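(* Let $N\ge 1$ be an integer and $N<p<\infty$. Let $a\in L^\infty(\mathbb{R}^N)$ with $a_-=\operatorname{ess\,inf}_{\mathbb{R}^N} a>0$, let $h\in L^1(\mathbb{R}^N)$ with $h\ge 0$, $h\not\equiv 0$, and let $g\in C(\mathbb{R})$ with $g\ge 0$ and $g\not\equiv 0$ in $[0,+\infty)$. Put $G(t)=\int_0^t g(\xi)\,d\xi$. Fix $x_0\in\mathbb{R}^N$ and $R>0$ such that $\int_{B(x_0,\frac R2)}h(x)\,dx>0$. Assume that there exist two constants $c,d$ such that: (i) $0<c<d$; (ii) $\displaystyle\frac{G(c)}{c^p}<\tilde K_R\,\frac{G(d)}{d^p}$; (iii) $\displaystyle\lim_{t\to+\infty}\frac{G(t)}{t^p}=0$. Then, for each $\lambda\in(\tilde\lambda_1,\tilde\lambda_2)$, where $$\tilde\lambda_1=\frac{1}{p\,k_a^p\,\|h\|_1\,\tilde K_R}\,\frac{d^p}{G(d)},\qquad \tilde\lambda_2=\frac{1}{p\,k_a^p\,\|h\|_1}\,\frac{c^p}{G(c)},$$ the problem $$-\Delta_p u+a(x)|u|^{p-2}u=\lambda h(x)g(u)\ \text{ in }\mathbb{R}^N,\qquad u\in W^{1,p}(\mathbb{R}^N),\ u\ge 0,$$ admits at least three (distinct) weak solutions.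
   Context: $\Delta_p u=\operatorname{div}(|\nabla u|^{p-2}\nabla u)$. $B(x_0,\rho)$ is the ball of $\mathbb{R}^N$ with centre $x_0$ and radius $\rho$; $\|h\|_1$ is the $L^1(\mathbb{R}^N)$ norm. A weak solution of the problem is a function $u\in W^{1,p}(\mathbb{R}^N)$, $u\ge 0$, such that $$\int_{\mathbb{R}^N}\left(|\nabla u|^{p-2}\nabla u\cdot\nabla v+a(x)|u|^{p-2}uv\right)dx=\lambda\int_{\mathbb{R}^N}h(x)g(u)\,v\,dx\quad\text{for all }v\in W^{1,p}(\mathbb{R}^N).$$ Constants: $$k_a=\left(\frac1{a_-}\right)^{\frac{p-N}{p^2}}2^{\frac{p-1}{p}}\left(\frac{\Gamma(1+\frac N2)}{\pi^{N/2}}\right)^{\frac1p}\frac{1}{N^{\frac{N}{p^2}}}\left(\frac{p-1}{p-N}\right)^{\frac{N(p-1)}{p^2}},$$ $$K_R=\frac{1}{k_a^p}\,\frac{\Gamma(1+\frac N2)}{\pi^{N/2}}\left(\frac{R^{p-N}}{2^p-2^{p-N}+R^p\|a\|_\infty}\right),\qquad \tilde K_R=K_R\,\frac{\int_{B(x_0,\frac R2)}h(x)\,dx}{\|h\|_1},$$ where $\Gamma$ is the Gamma function. The condition on $g$ is read as: $g(t)\ge 0$ for all $t\ge 0$, and $g$ is not identically zero on $[0,+\infty)$. Convention: if $G(c)=0$, then $\tilde\lambda_2=+\infty$. *)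

(* Defs.v *)
From HB Require Import structures.
From mathcomp Require Import all_boot all_order all_algebra.
From mathcomp Require Import all_classical all_reals all_analysis.
From mathcomp Require Import ess_sup_inf.
Set Implicit Arguments.
Unset Strict Implicit.
Unset Printing Implicit Defensive.
Import Order.TTheory GRing.Theory Num.Theory.
Import numFieldNormedType.Exports.
Local Open Scope classical_set_scope.
Local Open Scope ring_scope.

(* The space R^n is 'rV[R]_n, with the sigma-algebra generated by its n
   coordinate functions, that is, the Borel sigma-algebra. *)
Definition rV_display : measure_display -> measure_display.
Proof. exact. Qed.

Section measurable_rV.
Context {R : realType} {n : nat}.

Definition rV_coord (i : 'I_n) (x : 'rV[R]_n) : R := x 0 i.

Let rV_set0 : g_sigma_preimage rV_coord set0.
Proof. exact: sigma_algebra0. Qed.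

Let rV_setC A : g_sigma_preimage rV_coord A -> g_sigma_preimage rV_coord (~` A).
Proof. exact: sigma_algebraC. Qed.

Let rV_bigcup (F : (set 'rV[R]_n)^nat) :
  (forall i, g_sigma_preimage rV_coord (F i)) ->
  g_sigma_preimage rV_coord (\bigcup_i (F i)).
Proof. exact: sigma_algebra_bigcup. Qed.

HB.instance Definition _ :=
  @isMeasurable.Build (rV_display default_measure_display)
    'rV[R]_n (g_sigma_preimage rV_coord) rV_set0 rV_setC rV_bigcup.

End measurable_rV.

Lemma measurable_rV_coord (R : realType) n (i : 'I_n) :
  measurable_fun setT (rV_coord i : 'rV[R]_n -> R).
Proof.
move=> _ Y mY; rewrite setTI; apply: sub_sigma_algebra => /=.
rewrite -bigcup_seq/=; exists i => /=; first by rewrite mem_index_enum.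
by exists Y => //; rewrite setTI.
Qed.

Lemma measurable_fun_rV (R : realType) d (T : measurableType d) n
    (f : T -> 'rV[R]_n) :
  (forall i, measurable_fun setT (rV_coord i \o f)) -> measurable_fun setT f.
Proof.
move=> mf.
suff sub : g_sigma_preimage (@rV_coord R n) `<=`
    [set A | measurable (f @^-1` A)].
  by move=> _ A mA; rewrite setTI; exact: sub.
apply: smallest_sub => [|A].
  split => /=; first by rewrite preimage_set0.
    by move=> A mA; rewrite setTD preimage_setC; exact: measurableC.
  by move=> F mF; rewrite preimage_bigcup; exact: bigcup_measurable.
rewrite -bigcup_seq => -[i _ [B mB <-]]/=.
by rewrite setTI -comp_preimage -[X in measurable X]setTI; exact: mf.
Qed.

Section lebesgue_rV.
Context {R : realType}.

Definition rV_cons n (x : measurableTypeR R * 'rV[R]_n) : 'rV[R]_n.+1 :=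
  row_mx (x.1)%:M x.2.

Lemma rV_cons0 n (x : measurableTypeR R * 'rV[R]_n) : rV_cons x 0 0 = x.1.
Proof. by rewrite mxE; case: splitP => // j _; rewrite mxE ord1 eqxx. Qed.

Lemma rV_consS n (x : measurableTypeR R * 'rV[R]_n) i : rV_cons x 0 (lift 0 i) = x.2 0 i.
Proof.
by rewrite mxE; case: splitP => [j|j [] /val_inj->//]; rewrite ord1.
Qed.

Let rV_uncons n (x : 'rV[R]_n.+1) : measurableTypeR R * 'rV[R]_n :=
  (x 0 0, \row_i x 0 (lift 0 i)).

Let rV_consK n : cancel (@rV_cons n) (@rV_uncons n).
Proof.
move=> [a x]; rewrite /rV_uncons rV_cons0; congr pair.
by apply/rowP => i; rewrite mxE rV_consS.
Qed.

Let measurable_rV_cons n : measurable_fun setT (@rV_cons n).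
Proof.
apply: measurable_fun_rV => i; rewrite /comp /rV_coord.
case: (unliftP 0 i) => [j|] ->.
  under eq_fun do rewrite rV_consS.
  by apply: (measurableT_comp (measurable_rV_coord j)); exact: measurable_snd.
by under eq_fun do rewrite rV_cons0; exact: measurable_fst.
Qed.

Let measurable_rV_uncons n : measurable_fun setT (@rV_uncons n).
Proof.
apply/measurable_fun_pairP; split; first exact: measurable_rV_coord.
apply: measurable_fun_rV => i.
rewrite (_ : _ \o _ = rV_coord (lift 0 i)); first exact: measurable_rV_coord.
by apply/funext => x; rewrite /= /rV_coord mxE.
Qed.

Definition lebesgue_rV_step n (m : {sigma_finite_measure set 'rV[R]_n -> \bar R}) :
    set 'rV[R]_n.+1 -> \bar R :=
  pushforward (lebesgue_measure \x m)%E (@rV_cons n).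

Section lebesgue_rV_step.
Context n (m : {sigma_finite_measure set 'rV[R]_n -> \bar R}).

Let step_measure : exists mu : {measure set 'rV[R]_n.+1 -> \bar R},
  mu = lebesgue_rV_step m :> (set _ -> \bar R).
Proof.
unshelve eexists (pushforward (lebesgue_measure \x m)%E (@rV_cons n) :
  {measure set 'rV[R]_n.+1 -> \bar R}) => //.
exact: measurable_rV_cons.
Qed.

Let step0 : lebesgue_rV_step m set0 = 0%E.
Proof. by have [mu <-] := step_measure; rewrite measure0. Qed.

Let step_ge0 A : (0 <= lebesgue_rV_step m A)%E.
Proof. by have [mu <-] := step_measure; rewrite measure_ge0. Qed.

Let step_sigma_additive : semi_sigma_additive (lebesgue_rV_step m).
Proof.
by have [mu <-] := step_measure; exact: measure_semi_sigma_additive.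
Qed.

HB.instance Definition _ := isMeasure.Build _ _ _ (lebesgue_rV_step m)
  step0 step_ge0 step_sigma_additive.

Let step_sigma_finite : sigma_finite setT (lebesgue_rV_step m).
Proof.
have /sigma_finiteP[F [FT ndF Foo]] := sigma_finiteT (@lebesgue_measure R).
have /sigma_finiteP[G [GT ndG Goo]] := sigma_finiteT m.
exists (fun k => @rV_uncons n @^-1` (F k `*` G k)).
  apply/esym; rewrite -subTset => x _.
  have [i _ Fi] : (\bigcup_k F k) (rV_uncons x).1 by rewrite -FT.
  have [j _ Gj] : (\bigcup_k G k) (rV_uncons x).2 by rewrite -GT.
  exists (maxn i j) => //; split.
  - by move: Fi; apply/subsetPset/ndF/leq_maxl.
  - by move: Gj; apply/subsetPset/ndG/leq_maxr.
move=> k; have [mF Fk] := Foo k; have [mG Gk] := Goo k; split.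
  rewrite -[X in measurable X]setTI; apply: measurable_rV_uncons => //.
  exact: measurableX.
rewrite /lebesgue_rV_step /pushforward -comp_preimage (_ : _ \o _ = id).
  by rewrite preimage_id product_measure1E// lte_mul_pinfty// ge0_fin_numE.
by apply/funext => x; exact: rV_consK.
Qed.

HB.instance Definition _ := Measure_isSigmaFinite.Build _ _ _
  (lebesgue_rV_step m) step_sigma_finite.

End lebesgue_rV_step.

(* The n-dimensional Lebesgue measure, by iterated products: R^(n+1) is
   identified with R * R^n, and the measure on R^0 is the unit mass. *)
Fixpoint lebesgue_rV n : {sigma_finite_measure set 'rV[R]_n -> \bar R} :=
  match n with
  | 0 => dirac (0 : 'rV[R]_0)
  | m.+1 => lebesgue_rV_step (lebesgue_rV m)
  end.

End lebesgue_rV.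

Section sobolev.
Context {R : realType} {N : nat}.
Local Notation mu := (@lebesgue_rV R N).
Implicit Types (x y : 'rV[R]_N) (u v phi : 'rV[R]_N -> R).

(* The library's norm and balls on 'rV[R]_N are those of the sup norm. *)
Definition dotv x y : R := \sum_i x 0 i * y 0 i.
Definition enorm x : R := Num.sqrt (dotv x x).
Definition eball x (r : R) : set 'rV[R]_N := [set y | enorm (y - x) < r].

Definition partial (i : 'I_N) u : 'rV[R]_N -> R := 'D_(delta_mx 0 i) u.

Definition partials (s : seq 'I_N) u := foldr partial u s.

Definition smooth u := forall s : seq 'I_N,
  continuous (partials s u) /\
  forall i x, derivable (partials s u) x (delta_mx 0 i).

Definition test_function phi :=
  smooth phi /\ compact (closure [set x | phi x != 0]).

Definition weak_gradient u (Du : 'rV[R]_N -> 'rV[R]_N) :=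
  forall phi, test_function phi -> forall i,
    \int[mu]_x (u x * partial i phi x) = - \int[mu]_x (Du x 0 i * phi x).

(* u belongs to W^{1,p}(R^N) and Du is (a representative of) its gradient *)
Definition W1p (p : R) u (Du : 'rV[R]_N -> 'rV[R]_N) :=
  [/\ u \in Lfun mu p%:E,
      forall i, (fun x => Du x 0 i) \in Lfun mu p%:E &
      weak_gradient u Du].

(* As elements of W^{1,p} are defined up to null sets, so is u >= 0. Where
   p - 2 < 0 and the base vanishes, powR is 0, and so is the product, as usual.
   For N < p and h, a, g as in the theorem, both integrands are integrable. *)
Definition weak_solution (p : R) (a h : 'rV[R]_N -> R) (g : R -> R)
    (lambda : R) u :=
  {ae mu, forall x, 0 <= u x} /\
  exists2 Du, W1p p u Du &
    forall v Dv, W1p p v Dv ->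
      \int[mu]_x (enorm (Du x) `^ (p - 2) * dotv (Du x) (Dv x) +
                  a x * `|u x| `^ (p - 2) * u x * v x) =
      lambda * \int[mu]_x (h x * g (u x) * v x).

End sobolev.

Section constants.
Context {R : realType}.

Definition Gamma (s : R) : R :=
  \int[lebesgue_measure]_(t in `]0, +oo[) (t `^ (s - 1) * expR (- t)).

(* only used for t >= 0 *)
Definition primitive (g : R -> R) (t : R) : R :=
  \int[lebesgue_measure]_(xi in `[0, t]) g xi.

Context {N : nat}.
Local Notation mu := (@lebesgue_rV R N).
Local Notation n := (N%:R : R).
Implicit Types (p : R) (a h : 'rV[R]_N -> R) (r : R).

Definition infnorm a : R := fine 'N[mu]_+oo[EFin \o a].
Definition norm1 h : R := fine 'N[mu]_1[EFin \o h].
Definition ess_lower a : R := fine (ess_inf mu (EFin \o a)).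

Definition k_ p a : R :=
  (1 / ess_lower a) `^ ((p - n) / p ^+ 2) * 2 `^ ((p - 1) / p) *
  (Gamma (1 + n / 2) / pi `^ (n / 2)) `^ (1 / p) *
  (1 / n `^ (n / p ^+ 2)) *
  ((p - 1) / (p - n)) `^ (n * (p - 1) / p ^+ 2).

Definition K_ p a r : R :=
  1 / k_ p a `^ p * (Gamma (1 + n / 2) / pi `^ (n / 2)) *
  (r `^ (p - n) / (2 `^ p - 2 `^ (p - n) + r `^ p * infnorm a)).

Definition Ktilde p a h (x0 : 'rV[R]_N) r : R :=
  K_ p a r * (\int[mu]_(x in eball x0 (r / 2)) h x / norm1 h).

Definition lambda1 p a h (g : R -> R) (x0 : 'rV[R]_N) r (d : R) : R :=
  1 / (p * k_ p a `^ p * norm1 h * Ktilde p a h x0 r) *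
  (d `^ p / primitive g d).

Definition lambda2 p a h (g : R -> R) (c : R) : \bar R :=
  if primitive g c == 0 then +oo%E
  else (1 / (p * k_ p a `^ p * norm1 h) * (c `^ p / primitive g c))%:E.

End constants.

(* Main.v *)
Require Import Defs.
From mathcomp Require Import all_boot all_order all_algebra.
From mathcomp Require Import all_classical all_reals all_analysis.
From mathcomp Require Import ess_sup_inf.
From mathcomp Require Import measurable_realfun ring lra.
Set Implicit Arguments.
Unset Strict Implicit.
Unset Printing Implicit Defensive.
Import Order.TTheory GRing.Theory Num.Theory.
Import numFieldNormedType.Exports.
Local Open Scope classical_set_scope.
Local Open Scope ring_scope.

(* After redefining g on ]-oo, 0[ by the constant g 0 and truncating a, weak
   solutions are the u that minimize Phi - Psi'(u), where p Phi(u) is the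
   integral of |grad u|^p + a |u|^p and Psi(u) = lambda * \int h G(u).
   Morrey's inequality with the sharp use of Hoelder's inequality on balls gives
   sup |u|^p <= k_a^p p Phi(u). Hence on the sphere
   Phi = r := c^p / (p k_a^p) one has |u| <= c and
   Phi - Psi >= r - lambda ||h||_1 G(c) > 0 as lambda < lambda2, while Phi - Psi
   vanishes at 0 and, as lambda1 < lambda, is negative at a smoothing of the
   piecewise affine radial function equal to d on B(x0, R/2) and to 0 off
   B(x0, R). There is therefore a critical point inside the sphere, another one
   outside, and a mountain pass point at a higher level. Compactness comes from
   the equicontinuity of bounded sets (Morrey) and the integrability of h, and
   convergence in norm from the uniform convexity of Phi. Solutions are
   nonnegative because sqrt(f^2 + e^2) - e is almost minimizing whenever f is. *)

(** * An abstract three critical points theorem *)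

(** Reading criticality as minimality spares differentiating [Phi]: critical points are the fixed
    points of a map [T] sending [u] to a minimizer of [Phi - dPsi u], and moving from [u] towards
    [T u] lowers [J] at a rate [slope u] read off the tilted functional. Uniform convexity makes [T]
    continuous and turns vanishing slopes into strong convergence; one such step applied to a whole
    path does the work of a deformation flow, and no weak topology enters. Uniform convexity of the
    gradient term follows from the parallelogram identity when [p >= 2]; besides, [N < p] leaves
    only [N = 1], where gradients are scalars.

    The exact constants come from two choices. The radius of the ball in Morrey's estimate is the
    one that weighs gradient and potential as [Phi] does, and yields [k_a]. The radial profile has
    slope 2d/r on the annulus between the radii r/2 and r, whose volume yields the term 2^p -
    2^(p-N) of [K_R]; a C^1 profile keeps to this slope only up to a factor close to 1, absorbed by
    the strict inequality [lambda1 < lambda]. *)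

Section three_critical_points.
Context (R : realType) (V : lmodType R) (X : set V) (p : R).
Context (Phi Psi : V -> R) (dPsi : V -> V -> R).

(** No norm is put on [V]. [Phi] behaves like the p-th power of one, so its sublevel set
    [Phi v <= 1] serves as the unit ball and [C] as an operator norm up to a factor. Outside [X]
    nothing is asked. *)
Definition bounded_on_ball (C : R) (l : V -> R) :=
  forall v, X v -> Phi v <= 1 -> `|l v| <= C.

Definition bounded_linear (l : V -> R) :=
  (forall a u v, X u -> X v -> l (a *: u + v) = a * l u + l v) /\
  exists C, bounded_on_ball C l.

Definition minimizes (l : V -> R) (t : V) :=
  X t /\ forall v, X v -> Phi t - l t <= Phi v - l v.

Hypothesis p_gt1 : 1 < p.
Hypothesis X0 : X 0.
Hypothesis XP : forall a u v, X u -> X v -> X (a *: u + v).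
Hypothesis Phi_ge0 : forall u, 0 <= Phi u.
Hypothesis PhiZ : forall a u, X u -> Phi (a *: u) = `|a| `^ p * Phi u.
Hypothesis Phi_convex : forall (s : R) u v, X u -> X v -> 0 <= s <= 1 ->
  Phi ((1 - s) *: u + s *: v) <= (1 - s) * Phi u + s * Phi v.
Hypothesis Phi_uconvex : forall M e : R, 0 < e -> exists2 d : R, 0 < d &
  forall u v, X u -> X v -> Phi u <= M -> Phi v <= M ->
    Phi u + Phi v - 2 * Phi (2^-1 *: (u + v)) <= d -> Phi (u - v) <= e.
Hypothesis Phi_complete : forall w : nat -> V, (forall n, X (w n)) ->
  (forall e : R, 0 < e -> exists n0, forall m n, (n0 <= m)%N -> (n0 <= n)%N ->
     Phi (w m - w n) <= e) ->
  exists2 v, X v & forall e : R, 0 < e -> exists n0, forall n, (n0 <= n)%N ->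
    Phi (w n - v) <= e.

Local Notation J u := (Phi u - Psi u).

Hypothesis dPsi_linear : forall u a v w, X u -> X v -> X w ->
  dPsi u (a *: v + w) = a * dPsi u v + dPsi u w.
Hypothesis dPsi_bounded : forall M : R, exists C, forall u, X u -> Phi u <= M ->
  bounded_on_ball C (dPsi u).
Hypothesis dPsi_continuous : forall M e : R, 0 < e -> exists2 d : R, 0 < d &
  forall u v w, X u -> X v -> X w -> Phi u <= M -> Phi (u - v) <= d ->
    Phi w <= 1 -> `|dPsi u w - dPsi v w| <= e.
(** Complete continuity of the derivative: along a bounded sequence the functionals [dPsi (u n)]
    have a cluster point for the operator norm. This is the source of compactness in the abstract
    theorem. *)
Hypothesis dPsi_compact : forall M (u : nat -> V), (forall n, X (u n)) ->
  (forall n, Phi (u n) <= M) -> exists2 l, bounded_linear l &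
    forall e n0, 0 < e -> exists2 n, (n0 <= n)%N &
      forall w, X w -> Phi w <= 1 -> `|dPsi (u n) w - l w| <= e.
Hypothesis Psi_bounded : forall M : R, exists C, forall u, X u -> Phi u <= M ->
  `|Psi u| <= C.
Hypothesis Psi_continuous : forall M e : R, 0 < e -> exists2 d : R, 0 < d &
  forall u v, X u -> X v -> Phi u <= M -> Phi (u - v) <= d ->
    `|Psi u - Psi v| <= e.
(** One-sided, since only upper bounds on [J] along a step are drawn from it, but uniform on
    sublevel sets of [Phi], so that one step length serves all points of a path. *)
Hypothesis Psi_first_order : forall M e : R, 0 < e -> exists2 s0 : R, 0 < s0 <= 1 &
  forall u v (s : R), X u -> X v -> Phi u <= M -> Phi v <= M -> 0 <= s <= s0 ->
    Psi u + s * dPsi u v - s * e <= Psi (u + s *: v).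
Hypothesis J_coercive : forall M : R, exists M', forall u, X u -> J u <= M ->
  Phi u <= M'.

Let p_gt0 : 0 < p. Proof. exact: lt_trans p_gt1. Qed.

Let XZ a u : X u -> X (a *: u).
Proof. by move=> Xu; rewrite -[_ *: _]addr0; exact: XP. Qed.

Let XD u v : X u -> X v -> X (u + v).
Proof. by move=> Xu Xv; rewrite -[u]scale1r; exact: XP. Qed.

Let XB u v : X u -> X v -> X (u - v).
Proof. by move=> Xu Xv; rewrite addrC -scaleN1r; exact: XP. Qed.

Let segmentE (s : R) (u v : V) : u + s *: (v - u) = (1 - s) *: u + s *: v.
Proof. by rewrite scalerBr scalerBl scale1r addrA addrAC. Qed.

Let Phi0 : Phi 0 = 0.
Proof. by rewrite -(scale0r 0) PhiZ// normr0 powR0 ?mul0r// gt_eqF. Qed.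

Let PhiBC u v : X u -> X v -> Phi (u - v) = Phi (v - u).
Proof.
move=> Xu Xv; rewrite -[u - v]opprB -[- (v - u)]scaleN1r PhiZ; last exact: XB.
by rewrite normrN1 powR1 mul1r.
Qed.

(** Stands in for the triangle inequality: [u + v] is twice the midpoint of [u] and [v], so
    convexity and homogeneity bound it with the factor 2^p. *)
Lemma Phi_quasi_triangle u v : X u -> X v ->
  Phi (u + v) <= 2 `^ p * (Phi u + Phi v).
Proof.
move=> Xu Xv.
have -> : u + v = 2 *: ((1 - 2^-1) *: u + 2^-1 *: v).
  rewrite (_ : 1 - 2^-1 = 2^-1 :> R); last by lra.
  by rewrite -scalerDr scalerA divff ?scale1r.
rewrite PhiZ; last by apply: XP => //; exact: XZ.
rewrite ger0_norm// ler_wpM2l ?powR_ge0//.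
apply: le_trans (Phi_convex Xu Xv _) _; first by lra.
by have := Phi_ge0 u; have := Phi_ge0 v; lra.
Qed.


Lemma Phi_triangle_small (e : R) : 0 < e -> exists2 d : R, 0 < d &
  forall u v w, X u -> X v -> X w -> Phi (u - v) <= d -> Phi (v - w) <= d ->
    Phi (u - w) <= e.
Proof.
move=> e0; have K0 : 0 < (2 : R) `^ p by rewrite powR_gt0.
exists (e / 2 / 2 `^ p); first by rewrite !divr_gt0.
move=> u v w Xu Xv Xw uv vw.
rewrite -(subrKA v); apply: le_trans (Phi_quasi_triangle _ _) _; [exact: XB|exact: XB|].
rewrite -ler_pdivlMl//.
have -> : (2 `^ p)^-1 * e = e / 2 / 2 `^ p + e / 2 / 2 `^ p.
  by rewrite -mulrDl -splitr mulrC.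
exact: lerD.
Qed.

(** * Linear functionals and the minimizers of tilted convex functionals *)

Lemma bounded_linear0 l : bounded_linear l -> l 0 = 0.
Proof.
move=> [lin _]; have := lin 1 0 0 X0 X0; rewrite scaler0 addr0 mul1r => h.
lra.
Qed.

Lemma bounded_linearZ l a v : bounded_linear l -> X v -> l (a *: v) = a * l v.
Proof.
by move=> bl Xv; rewrite -[a *: v]addr0 bl.1// (bounded_linear0 bl) addr0.
Qed.

Lemma bounded_linearB l u v : bounded_linear l -> X u -> X v ->
  l (u - v) = l u - l v.
Proof.
by move=> bl Xu Xv; rewrite addrC -scaleN1r bl.1// mulN1r addrC.
Qed.

Lemma bounded_linear_sub l l' : bounded_linear l -> bounded_linear l' ->
  bounded_linear (fun v => l v - l' v).
Proof.
move=> [l1 [C lC]] [l2 [C' lC']]; split.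
  by move=> a u v Xu Xv; rewrite l1// l2//; lra.
exists (C + C') => v Xv v1; apply: le_trans (ler_normB _ _) _.
by rewrite lerD ?lC ?lC'.
Qed.

Lemma bounded_on_ballZ C l : bounded_linear l -> bounded_on_ball C l ->
  forall v (s : R), X v -> 0 < s -> Phi v <= s `^ p -> `|l v| <= C * s.
Proof.
move=> bl lC v s Xv s0 vs.
have : `|l (s^-1 *: v)| <= C.
  apply: lC; first exact: XZ.
  rewrite PhiZ// ger0_norm ?invr_ge0 ?(ltW s0)//.
  rewrite -ler_pdivlMl ?powR_gt0 ?invr_gt0// mulr1 -powR_inv1 ?(ltW s0)//.
  by rewrite -powRrM mulN1r powRN invrK.
by rewrite bounded_linearZ// normrM gtr0_norm ?invr_gt0// ler_pdivrMl// mulrC.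
Qed.

(** Supplies the radius for [bounded_on_ballZ]; the added 1 keeps it positive when [Phi v = 0]. *)
Lemma Phi_le_root v : Phi v <= (Phi v + 1) `^ p^-1 `^ p.
Proof.
rewrite -powRrM mulVf ?gt_eqF// powRr1; first by rewrite lerDl.
by rewrite addr_ge0.
Qed.

(** Where [Phi v = s^p], a functional bounded by [C] is at most [C s], and [p > 1]. The bound [B]
    depends on [C] and [K] alone, which makes minimizers uniformly bounded over families of
    functionals. *)
Lemma tilted_coercive (C K : R) : exists B, forall l v, bounded_linear l ->
  bounded_on_ball C l -> X v -> Phi v - l v <= K -> Phi v <= B.
Proof.
(* Chosen so that [s > s1] forces s^(p-1) >= |C| + |K| + 1; multiplied by [s > 1] this beats both
   the functional and [K]. *)
pose s1 := 1 + (`|C| + `|K| + 1) `^ (p - 1)^-1.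
have s1_ge1 : 1 <= s1 by rewrite lerDl powR_ge0.
exists (s1 `^ p) => l v bl lC Xv FK; rewrite leNgt; apply/negP => vs.
pose s := Phi v `^ p^-1.
have vE : Phi v = s `^ p by rewrite -powRrM mulVf ?gt_eqF// powRr1.
have ss1 : s1 < s.
  rewrite ltNge; apply/negP => ss1; move: vs; rewrite vE ltNge => /negP; apply.
  by rewrite ge0_ler_powR// ?ltW// ?nnegrE ?powR_ge0// ltW// (lt_le_trans _ s1_ge1).
have s_gt1 : 1 < s by exact: le_lt_trans ss1.
have s0 : 0 < s by exact: lt_trans s_gt1.
have lv : `|l v| <= C * s by apply: bounded_on_ballZ => //; rewrite vE.
have sp : `|C| + `|K| + 1 <= s `^ (p - 1).
  rewrite -[leLHS]powRr1 ?addr_ge0// -[X in _ `^ X <= _](@mulVf _ (p - 1)); last first.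
    by rewrite gt_eqF// subr_gt0.
  rewrite powRrM ge0_ler_powR ?subr_ge0 ?ltW// ?nnegrE ?powR_ge0 ?ltW//.
  by apply: le_lt_trans ss1; rewrite /s1 lerDr.
have : s * (`|C| + `|K| + 1) <= s `^ p.
  rewrite -[p in leRHS](subrKC 1) powRD; last by rewrite (gt_eqF s0) implybT.
  by rewrite powRr1 ?(ltW s0)// ler_pM2l.
have CC : C * s <= `|C| * s by rewrite ler_pM2r// ler_norm.
have KK : `|K| <= `|K| * s by rewrite ler_peMr// ltW.
have := ler_norm K; have := ler_norm (l v); rewrite -vE.
have -> : s * (`|C| + `|K| + 1) = `|C| * s + `|K| * s + s by lra.
by move: FK; lra.
Qed.

(** At the midpoint of [u] and [v] the tilted functional is still at least [m]. Its linear part is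
    affine, so the convexity defect of [Phi] is at most twice the allowed excess over [m], and
    uniform convexity applies. The number [m] is any lower bound, attained or not. *)
Lemma near_minimizers_close (C e : R) : 0 < e -> exists2 d : R, 0 < d &
  forall l m u v, bounded_linear l -> bounded_on_ball C l ->
    (forall w, X w -> m <= Phi w - l w) -> X u -> X v ->
    Phi u - l u <= m + d -> Phi v - l v <= m + d -> Phi (u - v) <= e.
Proof.
move=> e0; have [B HB] := tilted_coercive C 1.
have [d d0 Hd] := Phi_uconvex B e0.
exists (Num.min 1 (d / 2)); first by rewrite lt_min ltr01/= divr_gt0.
set d' := Num.min _ _ => l m u v bl lC hm Xu Xv Fu Fv.
have [d'1 d'd] : d' <= 1 /\ d' <= d / 2 by rewrite !ge_min !lexx orbT.
have m0 : m <= 0 by have := hm 0 X0; rewrite Phi0 (bounded_linear0 bl) subr0.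
have Bu : Phi u <= B by apply: (HB l) => //; lra.
have Bv : Phi v <= B by apply: (HB l) => //; lra.
apply: Hd => //.
have := hm (2^-1 *: (u + v)) (XZ _ (XD Xu Xv)).
rewrite (bounded_linearZ _ bl); last exact: XD.
have -> : l (u + v) = l u + l v by rewrite -[u in LHS]scale1r bl.1// mul1r.
by lra.
Qed.

(** Write [v] as the point at parameter [s] between [u] and [w = u + (v - u) / s]. Convexity bounds
    [Phi v] by [Phi u] plus [s * Phi w], and [Phi w] stays bounded as long as [Phi (u - v)] is small
    against s^p. *)
Lemma Phi_continuous_le (M e : R) : 0 < e -> exists2 d : R, 0 < d &
  forall u v, X u -> X v -> Phi u <= M -> Phi (u - v) <= d -> Phi v <= Phi u + e.
Proof.
move=> e0; set K : R := 2 `^ p; have K0 : 0 < K by rewrite powR_gt0.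
pose s := Num.min 1 (e / 2 / (K * (`|M| + 1))).
have M1 : 0 < `|M| + 1 by rewrite ltr_wpDl.
have s0 : 0 < s by rewrite lt_min ltr01/= !divr_gt0// mulr_gt0.
have [s1 s2] : s <= 1 /\ s <= e / 2 / (K * (`|M| + 1)) by rewrite !ge_min !lexx orbT.
exists (s `^ p * (e / 2) / K); first by rewrite divr_gt0// mulr_gt0// ?divr_gt0// powR_gt0.
move=> u v Xu Xv uM uv.
pose w := u + s^-1 *: (v - u).
have Xw : X w by rewrite /w addrC; apply: XP => //; exact: XB.
have -> : v = (1 - s) *: u + s *: w.
  rewrite /w scalerDr scalerA divff ?gt_eqF// scale1r addrA -scalerDl subrK scale1r.
  by rewrite addrC subrK.
apply: le_trans (Phi_convex Xu Xw _) _; first by rewrite ltW.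
have Phiw : Phi w <= K * (Phi u + (e / 2) / K).
  apply: le_trans (Phi_quasi_triangle _ _) _ => //; first by apply/XZ/XB.
  rewrite ler_pM2l// lerD2l PhiZ; last exact: XB.
  rewrite PhiBC// ger0_norm ?invr_ge0 ?(ltW s0)//.
  rewrite -[s^-1]powR_inv1 ?(ltW s0)// -powRrM mulN1r powRN.
  by rewrite ler_pdivrMl ?powR_gt0// mulrA.
have sK : s * (K * (`|M| + 1)) <= e / 2 by rewrite -ler_pdivlMr// mulr_gt0.
have : s * Phi w <= s * (K * (`|M| + 1)) + e / 2.
  apply: le_trans (_ : s * (K * (Phi u + e / 2 / K)) <= _).
    by rewrite ler_pM2l.
  rewrite mulrDr mulrCA mulfV ?gt_eqF// mulr1 mulrDr lerD//.
    by rewrite !ler_pM2l// (le_trans uM)// (le_trans (ler_norm M))// lerDl.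
  by rewrite ler_piMl// ltW// divr_gt0.
have : 0 <= s * Phi u by rewrite mulr_ge0// ltW.
by lra.
Qed.

Lemma Phi_continuous (M e : R) : 0 < e -> exists2 d : R, 0 < d &
  forall u v, X u -> X v -> Phi u <= M -> Phi (u - v) <= d ->
    `|Phi u - Phi v| <= e.
Proof.
move=> e0; have [d1 d10 H1] := Phi_continuous_le M e0.
have [d2 d20 H2] := Phi_continuous_le (M + e) e0.
exists (Num.min d1 d2); first by rewrite lt_min d10.
move=> u v Xu Xv uM; rewrite le_min => /andP[uv1 uv2].
have h1 := H1 _ _ Xu Xv uM uv1.
have h2 : Phi u <= Phi v + e.
  by apply: H2 => //; [lra|rewrite PhiBC].
by rewrite ler_norml; lra.
Qed.

Lemma bounded_linear_continuous (C e : R) : 0 < e -> exists2 d : R, 0 < d &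
  forall l u v, bounded_linear l -> bounded_on_ball C l -> X u -> X v ->
    Phi (u - v) <= d -> `|l u - l v| <= e.
Proof.
move=> e0; pose s := e / (`|C| + 1).
have C1 : 0 < `|C| + 1 by rewrite ltr_wpDl.
have s0 : 0 < s by rewrite divr_gt0.
exists (s `^ p); first by rewrite powR_gt0.
move=> l u v bl lC Xu Xv uv; rewrite -bounded_linearB//.
apply: le_trans (bounded_on_ballZ bl lC _ s0 uv) _; first exact: XB.
rewrite /s mulrCA (ler_piMr (ltW e0))// ler_pdivrMr// mul1r.
by rewrite (le_trans (ler_norm C))// lerDl.
Qed.

(** Direct method in norm: by uniform convexity a minimizing sequence is already Cauchy, so
    completeness takes the place of weak compactness. *)
Lemma exists_minimizer l : bounded_linear l -> exists t, minimizes l t.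
Proof.
move=> bl; have [lin [C lC]] := bl.
pose S := [set Phi v - l v | v in X].
have S0 : S !=set0 by exists (Phi 0 - l 0); exists 0.
have [B HB] := tilted_coercive C 0.
have infS : has_inf S.
  split => //; exists (- (`|C| * (`|B| + 1))) => _ [v Xv <-].
  have [|Fv] := leP 0 (Phi v - l v).
    by apply: le_trans; rewrite oppr_le0 mulr_ge0// addr_ge0.
  have vB := HB l v bl lC Xv (ltW Fv).
  have B1 : 0 < `|B| + 1 by rewrite ltr_wpDl.
  have : `|l v| <= C * (`|B| + 1).
    apply: bounded_on_ballZ => //; apply: le_trans vB _.
    apply: le_trans (ler_norm _) _; apply: le_trans (_ : `|B| + 1 <= _).
      by rewrite lerDl.
    by rewrite -[leLHS]powRr1 ?(ltW B1)// ler_powR ?lerDr// (ltW p_gt1).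
  have := ler_norm (l v); have := Phi_ge0 v.
  have := ler_norm C; rewrite -(ler_pM2r B1); lra.
pose m := inf S.
have mle w : X w -> m <= Phi w - l w.
  by move=> Xw; apply: ge_inf; [exact: infS.2|exists w].
have /choice[w Hw] (n : nat) : exists w, X w /\ Phi w - l w <= m + n.+1%:R^-1.
  have n0 : 0 < n.+1%:R^-1 :> R by rewrite invr_gt0.
  by have [_ [w Xw <-] wn] := inf_adherent n0 infS; exists w; split => //; apply: ltW.
have archi (e : R) : 0 < e -> exists n0, forall n, (n0 <= n)%N -> n.+1%:R^-1 <= e.
  move=> e0; have [n0 _ h] := near_infty_natSinv_lt (PosNum e0).
  by exists n0 => n /h/= /ltW.
have [v Xv wv] : exists2 v, X v & forall e : R, 0 < e -> exists n0, forall n,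
    (n0 <= n)%N -> Phi (w n - v) <= e.
  apply: Phi_complete => [n|e e0]; first by case: (Hw n).
  have [d d0 Hd] := near_minimizers_close C e0.
  have [n0 Hn0] := archi _ d0; exists n0 => i j ni nj.
  have [[Xi Fi] [Xj Fj]] := (Hw i, Hw j).
  apply: (Hd l m) => //.
    by apply: le_trans Fi _; rewrite lerD2l Hn0.
  by apply: le_trans Fj _; rewrite lerD2l Hn0.
exists v; split=> // u Xu; apply: le_trans (mle _ Xu).
apply/ler_addgt0Pr => e e0.
have [B' HB'] := tilted_coercive C (m + 1).
have e3 : 0 < e / 3 by rewrite divr_gt0.
have [d1 d10 Hd1] := Phi_continuous B' e3.
have [d2 d20 Hd2] := bounded_linear_continuous C e3.
have [n1 Hn1] := wv _ d10; have [n2 Hn2] := wv _ d20; have [n3 Hn3] := archi _ e3.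
pose n := maxn n1 (maxn n2 n3).
have [Xn Fn] := Hw n.
have := Hd1 (w n) v Xn Xv _ (Hn1 n _); rewrite leq_maxl => /(_ _ isT)/wrap[|].
  apply: (HB' l) => //; apply: le_trans Fn _; rewrite lerD2l.
  by rewrite invf_le1// ler1n.
have := Hd2 l (w n) v bl lC Xn Xv (Hn2 n _); rewrite leq_max leq_maxl orbT => /(_ isT).
have := Hn3 n; rewrite /n !leq_max leqnn !orbT => /(_ isT); rewrite -/n => h3.
by move=> h2 h1; move: Fn h3 h1 h2; rewrite !ler_norml; set k := n.+1%:R^-1; lra.
Qed.

Lemma minimizer_bounded (C : R) : exists B, forall l t, bounded_linear l ->
  bounded_on_ball C l -> minimizes l t -> Phi t <= B.
Proof.
have [B HB] := tilted_coercive C 0; exists B => l t bl lC [Xt mt].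
by apply: (HB l) => //; have := mt 0 X0; rewrite Phi0 (bounded_linear0 bl) subrr.
Qed.

(** The minimizer [t'] for [l'] almost minimizes [Phi - l], the excess being at most the value of
    [l' - l] at [t' - t]; two near minimizers for the same functional are close. *)
Lemma minimizer_stable (C e : R) : 0 < e -> exists2 d : R, 0 < d &
  forall l l' t t', bounded_linear l -> bounded_linear l' ->
    bounded_on_ball C l -> bounded_on_ball C l' ->
    minimizes l t -> minimizes l' t' ->
    bounded_on_ball d (fun v => l' v - l v) -> Phi (t - t') <= e.
Proof.
move=> e0; have [B HB] := minimizer_bounded C.
have [d d0 Hd] := near_minimizers_close C e0.
(* A radius whose ball contains [t' - t]; the added 1 gives [1 <= s], hence s <= s^p. *)
pose s : R := `|2 `^ p * (B + B)| + 1.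
have s0 : 0 < s by rewrite ltr_wpDl.
exists (d / s); first by rewrite divr_gt0.
move=> l l' t t' bl bl' lC lC' mt mt' ll'.
have [Xt ht] := mt; have [Xt' ht'] := mt'.
apply: (Hd l (Phi t - l t)) => //; first by rewrite lerDl ltW.
have : `|(l' (t' - t) - l (t' - t))| <= d / s * s.
  apply: (bounded_on_ballZ (bounded_linear_sub bl' bl)) => //; first exact: XB.
  apply: (@le_trans _ _ s).
    apply: le_trans (_ : 2 `^ p * (B + B) <= _); last first.
      by rewrite (le_trans (ler_norm _))// lerDl.
    rewrite -[- t]scaleN1r; apply: le_trans (Phi_quasi_triangle _ _) _ => //; first exact: XZ.
    rewrite ler_pM2l ?powR_gt0//; apply: lerD; first exact: (HB l').
    by rewrite PhiZ// normrN1 powR1 mul1r (HB l).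
  by rewrite -[leLHS]powRr1 ?(ltW s0)// ler_powR ?lerDr// (ltW p_gt1).
rewrite divfK ?gt_eqF// !bounded_linearB// ler_norml.
by have := ht' _ Xt; lra.
Qed.

(** * The descent map and the compactness of small slopes *)

Let dPsi_bl u : X u -> bounded_linear (dPsi u).
Proof.
move=> Xu; split; first by move=> a v w Xv Xw; exact: dPsi_linear.
by have [C HC] := dPsi_bounded (Phi u); exists C; exact: HC.
Qed.

Definition critical u := minimizes (dPsi u) u.

(** As [Phi (u - v) = 0] does not force [u = v], minimizers need not be unique. The second clause
    makes the choice fix critical points, which will keep the endpoints of paths in place. [X u]
    sits under the existential so that choice yields a total map. *)
Lemma descent_target_exists u : exists t, X u ->
  minimizes (dPsi u) t /\ (critical u -> t = u).
Proof.
have [cu|ncu] := pselect (critical u); first by exists u.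
have [Xu|nXu] := pselect (X u); last by exists u.
by have [t mt] := exists_minimizer (dPsi_bl Xu); exists t.
Qed.

Definition descent_target u := projT1 (cid (descent_target_exists u)).
Local Notation T := descent_target.

Let T_min u : X u -> minimizes (dPsi u) (T u).
Proof. by rewrite /T; case: cid => t /= h /h[]. Qed.

Let T_crit u : critical u -> T u = u.
Proof. by rewrite /T; case: cid => t /= h cu; case: (h cu.1) => _; exact. Qed.

Let XT u : X u -> X (T u). Proof. by move=> /T_min[]. Qed.

(** Plays the part of the norm of J'(u): on [X] it is nonnegative, and it vanishes exactly when [u]
    minimizes [Phi - dPsi u]. *)
Definition slope u := (Phi u - dPsi u u) - (Phi (T u) - dPsi u (T u)).

Let slope_ge0 u : X u -> 0 <= slope u.
Proof. by move=> Xu; rewrite subr_ge0; exact: (T_min Xu).2. Qed.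

Let T_bounded (M : R) : exists B, forall u, X u -> Phi u <= M -> Phi (T u) <= B.
Proof.
have [C HC] := dPsi_bounded M; have [B HB] := minimizer_bounded C.
by exists B => u Xu uM; apply: (HB (dPsi u)); [exact: dPsi_bl|exact: HC|exact: T_min].
Qed.

Let T_continuous (M e : R) : 0 < e -> exists2 d : R, 0 < d &
  forall u v, X u -> X v -> Phi u <= M -> Phi v <= M -> Phi (u - v) <= d ->
    Phi (T u - T v) <= e.
Proof.
move=> e0; have [C HC] := dPsi_bounded M.
have [d d0 Hd] := minimizer_stable C e0.
have [d' d'0 Hd'] := dPsi_continuous M d0.
exists d' => // u v Xu Xv uM vM uv.
apply: (Hd (dPsi u) (dPsi v)) => //;
  [exact: dPsi_bl|exact: dPsi_bl|exact: HC|exact: HC|exact: T_min|exact: T_min|].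
by move=> w Xw w1; rewrite distrC; exact: (Hd' u v).
Qed.

(** Convexity of [Phi] on the segment and the first-order bound on [Psi] add up: the terms linear in
    [s] are exactly [- s * slope u]. *)
Lemma descent (M e : R) : 0 < e -> exists2 s0 : R, 0 < s0 <= 1 &
  forall u (s : R), X u -> Phi u <= M -> 0 <= s <= s0 ->
    J (u + s *: (T u - u)) <= J u - s * slope u + s * e.
Proof.
move=> e0; have [B HB] := T_bounded M.
pose M' := `|M| + `|2 `^ p * (`|B| + `|M|)|.
have [s0 s01 Hs0] := Psi_first_order M' e0.
exists s0 => // u s Xu uM ss.
have uM' : Phi u <= M' by rewrite (le_trans uM)// (le_trans (ler_norm _))// lerDl.
have XTu := XT Xu.
have TM' : Phi (T u - u) <= M'.
  rewrite -[- u]scaleN1r; apply: le_trans (Phi_quasi_triangle _ _) _ => //; first exact: XZ.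
  apply: le_trans (_ : 2 `^ p * (`|B| + `|M|) <= _).
    rewrite ler_pM2l ?powR_gt0// lerD//; first exact: le_trans (HB _ Xu uM) (ler_norm _).
    by rewrite PhiZ// normrN1 powR1 mul1r (le_trans uM)// ler_norm.
  by rewrite (le_trans (ler_norm _))// lerDr.
have := Hs0 u (T u - u) s Xu (XB XTu Xu) uM' TM' ss.
rewrite bounded_linearB//; last exact: dPsi_bl.
have -> : u + s *: (T u - u) = (1 - s) *: u + s *: T u.
  exact: segmentE.
have : Phi ((1 - s) *: u + s *: T u) <= (1 - s) * Phi u + s * Phi (T u).
  by apply: Phi_convex => //; move: s01 ss => /andP[? ?] /andP[-> ?]/=; lra.
by rewrite /slope; lra.
Qed.

(** A Palais-Smale condition. A small slope makes [u n] nearly minimize its own tilted functional,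
    so it is close to [T (u n)]; compactness of [dPsi] and stability of minimizers bring [T (u n)]
    close to the minimizer [t] for a limit functional [l]. *)
Lemma small_slope_cluster (M : R) (u : nat -> V) : (forall n, X (u n)) ->
  (forall n, Phi (u n) <= M) ->
  (forall e : R, 0 < e -> exists n0, forall n, (n0 <= n)%N -> slope (u n) <= e) ->
  exists2 t, critical t & forall (e : R) n0, 0 < e -> exists2 n, (n0 <= n)%N &
    Phi (u n - t) <= e.
Proof.
move=> Xu uM su.
have [l bl Hl] := dPsi_compact Xu uM.
have [t mt] := exists_minimizer bl; have Xt := mt.1.
have [C1 HC1] := dPsi_bounded M; have [C2 HC2] := bl.2.
pose C := Num.max C1 C2.
have lC : bounded_on_ball C l.
  by move=> v Xv v1; rewrite (le_trans (HC2 _ Xv v1))// le_max lexx orbT.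
have uC n : bounded_on_ball C (dPsi (u n)).
  by move=> v Xv v1; rewrite (le_trans (HC1 _ (Xu n) (uM n) _ Xv v1))// le_max lexx.
have clus (e k : R) n0 : 0 < e -> 0 < k -> exists2 n, (n0 <= n)%N &
    Phi (u n - t) <= e /\ bounded_on_ball k (fun v => dPsi (u n) v - l v).
  move=> e0 k0; have [e' e'0 He'] := Phi_triangle_small e0.
  have [d1 d10 Hd1] := near_minimizers_close C e'0.
  have [d2 d20 Hd2] := minimizer_stable C e'0.
  have [n1 Hn1] := su _ d10.
  have dk0 : 0 < Num.min d2 k by rewrite lt_min d20.
  have [n] := Hl _ (maxn n0 n1) dk0.
  rewrite geq_max => /andP[n0n n1n] Hn; exists n => //; split; last first.
    by move=> v Xv v1; rewrite (le_trans (Hn _ Xv v1))// ge_min lexx orbT.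
  have XTn := XT (Xu n); have mTn := T_min (Xu n); have bln := dPsi_bl (Xu n).
  apply: (He' _ (T (u n))) => //.
    apply: (Hd1 (dPsi (u n)) (Phi (T (u n)) - dPsi (u n) (T (u n)))) => //.
    - exact: mTn.2.
    - by have := Hn1 _ n1n; rewrite /slope; lra.
    - by rewrite lerDl ltW.
  rewrite PhiBC//; apply: (Hd2 l (dPsi (u n))) => //.
  by move=> v Xv v1; rewrite (le_trans (Hn _ Xv v1))// ge_min lexx.
exists t; last by move=> e n0 e0; have [n n0n [h _]] := clus _ 1 n0 e0 ltr01; exists n.
(* So far [t] minimizes [Phi - l]. Some [u n] is close to [t] while [dPsi (u n)] is close to [l], so
   continuity of [dPsi] identifies [l] with [dPsi t], and [t] is critical. *)
have tl v : X v -> dPsi t v = l v.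
  move=> Xv; apply/eqP; rewrite -subr_eq0 -normr_le0; apply/ler_addgt0Pr => e e0; rewrite add0r.
  have vr : 0 < Phi v + 1 :> R by rewrite ltr_wpDl.
  have r0 : 0 < (Phi v + 1) `^ p^-1 by rewrite powR_gt0.
  have e2 : 0 < e / (Phi v + 1) `^ p^-1 / 2 by rewrite !divr_gt0.
  have [d d0 Hd] := dPsi_continuous M e2.
  have [n _ [un kn]] := clus _ _ 0%N d0 e2.
  have blt := bounded_linear_sub (dPsi_bl Xt) bl.
  have : bounded_on_ball (e / (Phi v + 1) `^ p^-1) (fun v => dPsi t v - l v).
    move=> w Xw w1; rewrite -(subrKA (dPsi (u n) w)).
    apply: le_trans (ler_normD _ _) _; rewrite [leRHS]splitr lerD//; last exact: kn.
    by rewrite distrC; apply: Hd.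
  move=> /(bounded_on_ballZ blt)/(_ _ _ Xv r0 (Phi_le_root v)).
  by rewrite divfK ?gt_eqF.
by split => // v Xv; rewrite !tl//; exact: mt.2.
Qed.

(** [P] records where the almost critical points lie. It need not be closed, so it reaches [t] only
    through approximation by points of [P], which the last clause keeps. *)
Lemma critical_of_small_slopes (c M : R) (P : set V) :
  (forall e : R, 0 < e -> exists u, [/\ X u, P u, Phi u <= M, slope u <= e &
    `|J u - c| <= e]) ->
  exists t, [/\ critical t, J t = c & forall e : R, 0 < e ->
    exists u, [/\ X u, P u, Phi u <= M & Phi (u - t) <= e]].
Proof.
move=> H.
have /choice[u Hu] (n : nat) : exists u, [/\ X u, P u, Phi u <= M,
    slope u <= n.+1%:R^-1 & `|J u - c| <= n.+1%:R^-1] by apply: H; rewrite invr_gt0.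
have archi (e : R) : 0 < e -> exists n0, forall n, (n0 <= n)%N -> n.+1%:R^-1 <= e.
  move=> e0; have [n0 _ h] := near_infty_natSinv_lt (PosNum e0).
  by exists n0 => n /h/= /ltW.
have Xu n : X (u n) by case: (Hu n).
have uM n : Phi (u n) <= M by case: (Hu n).
have [|t ct Ht] := small_slope_cluster Xu uM.
  move=> e /archi[n0 Hn0]; exists n0 => n /Hn0; apply: le_trans.
  by case: (Hu n).
exists t; split => //; last first.
  by move=> e e0; have [n _ un] := Ht e 0%N e0; exists (u n); case: (Hu n).
apply/eqP; rewrite -subr_eq0 -normr_le0; apply/ler_addgt0Pr => e e0; rewrite add0r.
have e3 : 0 < e / 3 by rewrite divr_gt0.
have [d1 d10 Hd1] := Phi_continuous M e3.
have [d2 d20 Hd2] := Psi_continuous M e3.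
have [n0 Hn0] := archi _ e3.
have d0 : 0 < Num.min d1 d2 by rewrite lt_min d10.
have [n n0n] := Ht _ n0 d0; rewrite le_min => /andP[un1 un2].
have h1 := Hd1 _ _ (Xu n) ct.1 (uM n) un1.
have h2 := Hd2 _ _ (Xu n) ct.1 (uM n) un2.
have h3 : `|J (u n) - c| <= e / 3 by case: (Hu n) => _ _ _ _ /le_trans; apply; exact: Hn0.
by move: h1 h2 h3; rewrite !ler_norml; lra.
Qed.


Let segment_continuous u v : X u -> X v ->
  continuous (fun s : R => Phi (u + s *: v)).
Proof.
move=> Xu Xv s; have Xs (t : R) : X (u + t *: v) by rewrite addrC; exact: XP.
apply/cvgrPdist_le => e e0.
have [d d0 Hd] := Phi_continuous (Phi (u + s *: v)) e0.
pose q : R := (d / (Phi v + 1)) `^ p^-1.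
have v1 : 0 < Phi v + 1 :> R by rewrite ltr_wpDl.
have q0 : 0 < q by rewrite powR_gt0// divr_gt0.
apply: filterS (nbhsx_ballx s q q0) => t; rewrite /ball/= => st; apply: Hd => //.
rewrite opprD addrACA subrr add0r -scalerBl PhiZ//.
apply: le_trans (_ : q `^ p * Phi v <= _).
  rewrite ler_wpM2r// ge0_ler_powR ?nnegrE ?(ltW p_gt0) ?(ltW q0)//.
  exact: ltW.
rewrite -powRrM mulVf ?gt_eqF// powRr1; last by rewrite divr_ge0 ?ltW.
by rewrite mulrAC ler_pdivrMr// ler_pM2l// lerDl.
Qed.

Let IVT_crossing (f : R -> R) (r a b : R) : a <= b -> continuous f ->
  (f a <= r <= f b) || (f b <= r <= f a) -> exists2 t, a <= t <= b & f t = r.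
Proof.
move=> ab cf h; have [|t] := @IVT _ f a b r ab (@continuous_subspaceT _ _ _ _ cf).
  by rewrite ge_min le_max; case/orP: h => /andP[-> ->]; rewrite ?orbT.
by rewrite in_itv/= => ? ?; exists t.
Qed.

(** * Local minimizers on both sides of the sphere, and the mountain pass *)

Variables (r delta : R).
Hypothesis J_sphere : forall u, X u -> Phi u = r -> delta <= J u.

(** [true] is the inside of the sphere and [false] the outside: one proof yields both local
    minimizers. *)
Let side (b : bool) (x : R) := if b then x < r else r < x.

Let J_lower_bound (M : R) : exists C : R, forall u, X u -> J u <= M -> C <= J u.
Proof.
have [B HB] := J_coercive M; have [C HC] := Psi_bounded B.
exists (- C) => u Xu uM; have := HC u Xu (HB u Xu uM).
by have := Phi_ge0 u; rewrite ler_norml; lra.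
Qed.

(* The step towards [T u] decreases [J], hence it cannot cross the sphere
   [Phi = r], where [J] is at least [delta]. *)
Lemma local_minimizer (b : bool) u0 : X u0 -> side b (Phi u0) -> J u0 < delta ->
  exists u, [/\ critical u, side b (Phi u) & J u < delta].
Proof.
move=> Xu0 su0 Ju0.
pose S := [set J u | u in [set u | X u /\ side b (Phi u)]].
have [C HC] := J_lower_bound (J u0).
have infS : has_inf S.
  split; first by exists (J u0); exists u0.
  exists (Num.min C (J u0)) => _ [u [Xu _] <-].
  have [uu0|uu0] := leP (J u) (J u0); first by rewrite ge_min HC.
  by rewrite ge_min (ltW uu0) orbT.
pose m := inf S.
have mle u : X u -> side b (Phi u) -> m <= J u.
  by move=> Xu su; apply: ge_inf; [exact: infS.2|exists u].
have m_delta : m < delta by exact: le_lt_trans (mle _ Xu0 su0) Ju0.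
have [M HM] := J_coercive delta.
have [|t [ct Jt Ht]] := @critical_of_small_slopes m M (fun u => side b (Phi u)).
  move=> e e0; apply: contrapT => /forallNP no.
  have [s0 /andP[s00 s01] Hs0] := @descent M (e / 2) (divr_gt0 e0 (ltr0n _ 2)).
  (* The three bounds keep [J u] below [delta], put it within [e] of [m], and make the excess over
     [m] smaller than the drop [s0 * e / 2] of a full step. *)
  pose k := Num.min (delta - m) (Num.min e (s0 * e / 4)).
  have k0 : 0 < k by rewrite !lt_min subr_gt0 m_delta e0 divr_gt0// mulr_gt0.
  have [k1 [k2 k3]] : k <= delta - m /\ k <= e /\ k <= s0 * e / 4.
    by rewrite !ge_min !lexx !orbT.
  have [_ [u [Xu su] <-] uk] := inf_adherent k0 infS.
  have mu := mle _ Xu su; rewrite -/m in uk.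
  have Ju : J u < delta by lra.
  have uM : Phi u <= M by apply: HM => //; lra.
  have su_big : e < slope u.
    by rewrite ltNge; apply/negP => ?; apply: (no u); split => //; rewrite ler_norml; lra.
  have XTu := XB (XT Xu) Xu.
  have Jdec (s : R) : 0 <= s <= s0 -> J (u + s *: (T u - u)) <= J u - s * e / 2.
    move=> ss; have := Hs0 u s Xu uM ss; have : s * e <= s * slope u.
      by case/andP: ss => s_ge0 _; rewrite (ler_wpM2l s_ge0)// ltW.
    by lra.
  have Xs (s : R) : X (u + s *: (T u - u)) by rewrite addrC; exact: XP.
  have Jdelta (s : R) : 0 <= s <= s0 -> Phi (u + s *: (T u - u)) <> r.
    move=> ss /(J_sphere (Xs s)); have := Jdec _ ss.
    have : 0 <= s * e by case/andP: ss => s_ge0 _; rewrite mulr_ge0// ltW.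
    by lra.
  have sv : side b (Phi (u + s0 *: (T u - u))).
    apply: contrapT => nsv.
    have [|s ss] := @IVT_crossing (fun s : R => Phi (u + s *: (T u - u))) r 0 s0
      (ltW s00) (segment_continuous Xu XTu).
      rewrite scale0r addr0; move: su nsv; case: (b) => /=.
        by move=> /ltW-> /negP; rewrite -leNgt => ->.
      by move=> /ltW-> /negP; rewrite -leNgt => ->; rewrite orbT.
    exact: Jdelta.
  have := mle _ (Xs s0) sv; have := Jdec s0; rewrite lexx (ltW s00) => /(_ isT).
  by lra.
exists t; split => //; last by rewrite Jt.
have tr : Phi t <> r by move=> /(J_sphere ct.1); rewrite Jt; lra.
(* [t] is a limit of points on side [b], so continuity of [Phi] excludes the other open side; the
   sphere itself is excluded because there [J] is at least [delta]. *)
have h : ~~ side (~~ b) (Phi t).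
  apply/negP => st.
  have e0 : 0 < `|Phi t - r| / 2 :> R by rewrite divr_gt0// normr_gt0 subr_eq0; apply/eqP.
  have [d d0 Hd] := Phi_continuous M e0.
  have [u [Xu su uM ut]] := Ht _ d0.
  have := Hd u t Xu ct.1 uM ut; rewrite ler_norml.
  move: st su; rewrite /side; case: (b) => /= st su.
    by rewrite gtr0_norm ?subr_gt0//; lra.
  by rewrite ltr0_norm ?subr_lt0//; lra.
by move: tr h; rewrite /side; case: (b) => /= /eqP tr;
  rewrite -leNgt lt_neqAle ?tr ?[r == _]eq_sym ?tr.
Qed.

Definition path_between u v (gamma : R -> V) :=
  [/\ forall t, X (gamma t),
      forall (t e : R), 0 < e -> exists2 d : R, 0 < d &
        forall s, `|t - s| < d -> Phi (gamma t - gamma s) <= e,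
      gamma 0 = u & gamma 1 = v].

Let path_Phi_continuous u v gamma : path_between u v gamma ->
  continuous (fun t => Phi (gamma t)).
Proof.
move=> [Xg cg _ _] t; apply/cvgrPdist_le => e e0.
have [d d0 Hd] := Phi_continuous (Phi (gamma t)) e0.
have [d' d'0 Hd'] := cg t _ d0.
near=> s; apply: Hd => //; apply: Hd'.
by near: s; exact: (nbhsx_ballx t d' d'0).
Unshelve. all: by end_near. Qed.

Let segment_path u v : X u -> X v -> path_between u v (fun t => u + t *: (v - u)).
Proof.
move=> Xu Xv; have Xs (t : R) : X (u + t *: (v - u)).
  by rewrite addrC; apply: XP => //; exact: XB.
split; [exact: Xs| |by rewrite scale0r addr0|by rewrite scale1r addrC subrK].
move=> t e e0; have vu1 : 0 < Phi (v - u) + 1 :> R by rewrite ltr_wpDl.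
have q0 : 0 < (e / (Phi (v - u) + 1)) `^ p^-1 by rewrite powR_gt0// divr_gt0.
exists ((e / (Phi (v - u) + 1)) `^ p^-1) => // s ts.
rewrite opprD addrACA subrr add0r -scalerBl PhiZ; last exact: XB.
apply: le_trans (_ : ((e / (Phi (v - u) + 1)) `^ p^-1) `^ p * Phi (v - u) <= _).
  by rewrite ler_wpM2r// ge0_ler_powR// ?nnegrE ?powR_ge0// ltW.
rewrite -powRrM mulVf ?gt_eqF// powRr1; last by rewrite divr_ge0 ?ltW.
by rewrite mulrAC ler_pdivrMr// ler_pM2l// lerDl.
Qed.

(** Continuity of [T] keeps the image a path, and the endpoints do not move because [T] fixes
    critical points. *)
Let descent_path u v gamma (s : R) : 0 <= s <= 1 -> critical u -> critical v ->
  path_between u v gamma ->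
  path_between u v (fun t => gamma t + s *: (T (gamma t) - gamma t)).
Proof.
move=> s01 cu cv [Xg cg g0 g1]; split.
- by move=> t; rewrite addrC; apply: XP => //; apply: XB => //; exact: XT.
- move=> t e e0; have [d1 d10 Hd1] := Phi_continuous (Phi (gamma t)) ltr01.
  have [d2 d20 Hd2] := T_continuous (Phi (gamma t) + 1) e0.
  have d0 : 0 < Num.min d1 (Num.min d2 e) by rewrite !lt_min d10 d20.
  have [d d'0 Hd] := cg t _ d0; exists d => // t' tt'.
  have := Hd _ tt'; rewrite !le_min => /and3P[h1 h2 h3].
  have Mt' : Phi (gamma t') <= Phi (gamma t) + 1.
    by have := Hd1 _ _ (Xg t) (Xg t') (lexx _) h1; rewrite ler_norml; lra.
  have -> : gamma t + s *: (T (gamma t) - gamma t) -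
      (gamma t' + s *: (T (gamma t') - gamma t')) =
      (1 - s) *: (gamma t - gamma t') + s *: (T (gamma t) - T (gamma t')).
    by rewrite !segmentE !scalerBr opprD addrACA.
  have XgB : X (gamma t - gamma t') by exact: XB.
  have XTB : X (T (gamma t) - T (gamma t')) by apply: XB; exact: XT.
  apply: le_trans (Phi_convex XgB XTB s01) _.
  have : Phi (T (gamma t) - T (gamma t')) <= e by apply: Hd2 => //; rewrite lerDl.
  case/andP: s01 => s0 s1 /(ler_wpM2l s0).
  have := ler_wpM2l (_ : 0 <= 1 - s) h3; rewrite subr_ge0 => /(_ s1).
  by lra.
- by rewrite g0 T_crit// subrr scaler0 addr0.
- by rewrite g1 T_crit// subrr scaler0 addr0.
Qed.

Lemma mountain_pass u v : critical u -> critical v -> Phi u < r -> r < Phi v ->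
  exists2 w, critical w & delta <= J w.
Proof.
move=> cu cv ur rv; have [Xu Xv] := (cu.1, cv.1).
(* Upper bounds of [J] along a path stand in for its maximum; their infimum [c] is the minimax
   level. *)
pose S := [set m | exists2 g, path_between u v g &
  forall t, 0 <= t <= 1 -> J (g t) <= m].
have S_delta m : S m -> delta <= m.
  move=> [g pg gm]; have [_ _ g0 g1] := pg.
  have [||t t01 gt] := @IVT_crossing (fun t => Phi (g t)) r 0 1 ler01.
  - exact: path_Phi_continuous pg.
  - by rewrite g0 g1 (ltW ur) (ltW rv).
  by apply: le_trans (gm _ t01); apply: J_sphere => //; case: pg.
have infS : has_inf S.
  split; last by exists delta.
  have [C HC] := Psi_bounded (Phi u + Phi v).
  exists (Phi u + Phi v + C); exists (fun t => u + t *: (v - u)); first exact: segment_path.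
  move=> t t01; have [Xg _ _ _] := segment_path Xu Xv.
  suff h : Phi (u + t *: (v - u)) <= Phi u + Phi v.
    by have := HC _ (Xg t) h; rewrite ler_norml; lra.
  have -> : u + t *: (v - u) = (1 - t) *: u + t *: v.
    exact: segmentE.
  apply: le_trans (Phi_convex Xu Xv t01) _; case/andP: t01 => t0 t1.
  by rewrite lerD// ler_piMl// lerBlDl lerDr.
pose c := inf S.
have c_delta : delta <= c by apply: lb_le_inf; [exact: infS.1|exact: S_delta].
have [M HM] := J_coercive (c + 1).
have [|t [ct Jt _]] := @critical_of_small_slopes c M setT; last by exists t; rewrite ?Jt.
move=> e0 e00; pose e := Num.min 1 e0.
have e_gt0 : 0 < e by rewrite lt_min ltr01.
have [e_le1 e_e0] : e <= 1 /\ e <= e0 by rewrite !ge_min !lexx orbT.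
apply: contrapT => /forallNP no.
have [s /andP[s0 s1] Hs] := @descent M (e / 4) (divr_gt0 e_gt0 (ltr0n _ 4)).
have se0 : 0 < s * e / 4 by rewrite divr_gt0// mulr_gt0.
have [m [g pg gm] mlt] := inf_adherent se0 infS; rewrite -/c in mlt.
have [Xg _ _ _] := pg.
have se1 : s * e <= e by rewrite ler_piMl// ltW.
(* Push an almost optimal path by one common step. Where [J >= c - e] the slope exceeds [e], so [J]
   drops by more than [3 s e / 4], against an initial excess below [s e / 4]; elsewhere [J] starts
   below [c - e] and rises by at most [s e / 4]. The new path contradicts the infimum. *)
have : S (c - s * e / 2).
  exists (fun t => g t + s *: (T (g t) - g t)).
    by apply: descent_path => //; rewrite s1 ltW.
  move=> t t01; have gt := gm t t01.
  have gM : Phi (g t) <= M by apply: HM => //; lra.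
  have := Hs _ s (Xg t) gM; rewrite lexx (ltW s0) => /(_ isT).
  have sl0 := mulr_ge0 (ltW s0) (slope_ge0 (Xg t)).
  have [gc|gc] := leP (c - e) (J (g t)); last by lra.
  have : e < slope (g t).
    rewrite ltNge; apply/negP => sle; apply: (no (g t)); split => //.
      exact: le_trans e_e0.
    by rewrite ler_norml; lra.
  by rewrite -(ltr_pM2l s0); lra.
move=> /(ge_inf infS.2); rewrite -/c.
have : 0 < s * e by rewrite mulr_gt0.
by lra.
Qed.

Theorem three_critical_points u0 v0 : X u0 -> X v0 ->
  Phi u0 < r -> r < Phi v0 -> J u0 < delta -> J v0 < delta ->
  exists u v w, [/\ critical u, critical v & critical w] /\
    [/\ Phi u < r, r < Phi v, J u < delta, J v < delta & delta <= J w].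
Proof.
move=> Xu Xv ur rv Ju Jv.
have [u [cu su Ju']] := @local_minimizer true u0 Xu ur Ju.
have [v [cv sv Jv']] := @local_minimizer false v0 Xv rv Jv.
by have [w cw Jw] := mountain_pass cu cv su sv; exists u, v, w.
Qed.

End three_critical_points.

(** * Lebesgue measure on row vectors *)

Section lebesgue_measure_rV.
Context {R : realType}.

Lemma measurable_rV_cons n :
  measurable_fun setT (@rV_cons R n).
Proof.
apply: measurable_fun_rV => i; rewrite /comp /rV_coord.
case: (unliftP 0 i) => [j|] ->.
  under eq_fun do rewrite rV_consS.
  by apply: (measurableT_comp (measurable_rV_coord j)); exact: measurable_snd.
by under eq_fun do rewrite rV_cons0; exact: measurable_fst.
Qed.

Lemma measurable_affine_rV n (a : R) (b : 'rV[R]_n) :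
  measurable_fun setT (fun x : 'rV[R]_n => a *: x + b).
Proof.
apply: measurable_fun_rV => i.
rewrite (_ : _ \o _ = fun x : 'rV[R]_n => a * rV_coord i x + b 0 i).
  apply: measurable_funD => //; apply: measurable_funM => //.
  exact: measurable_rV_coord.
by apply/funext => x; rewrite /= /rV_coord !mxE.
Qed.

Lemma measurable_mx_ball n (x : 'rV[R]_n) (e : R) : measurable (ball x e).
Proof.
have [e0|e0] := leP e 0.
  by rewrite (_ : ball x e = set0)// -subset0 => y [/lt_geF]; rewrite e0.
rewrite (_ : ball x e =
    \bigcap_(i in [set: 'I_n]) (rV_coord i @^-1` ball (x 0 i) e)).
  apply: fin_bigcap_measurable => // i _; rewrite -[X in measurable X]setTI.
  by apply: measurable_rV_coord => //; exact: measurable_ball.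
apply/seteqP; split => y /=.
  by move=> [_ xy] i _; exact: (xy 0 i).
by move=> xy; split => // i j; rewrite (ord1 i); exact: (xy j).
Qed.

(** An open set is the union of the balls it contains that have a rational centre and a radius
    1/(k+1), and these are countably many. *)
Lemma open_measurable_rV n (U : set 'rV[R]_n) : open U -> measurable U.
Proof.
move=> oU.
pose F (z : 'rV[rat]_n * nat) : set 'rV[R]_n :=
  let q := \row_i (ratr (z.1 0 i) : R) in
  if `[< ball q z.2.+1%:R^-1 `<=` U >] then ball q z.2.+1%:R^-1 else set0.
rewrite (_ : U = \bigcup_z F z).
  apply: countable_bigcupT_measurable; [exact: countableP|move=> z].
  by rewrite /F; case: asboolP => // _; exact: measurable_mx_ball.
apply/seteqP; split => x; last first.
  by move=> [z _]; rewrite /F; case: asboolP => // /(_ x).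
move=> Ux; have /nbhs_ballP[e /= e0 He] : nbhs x U by exact: open_nbhs_nbhs.
have [k _ /(_ k (leqnn _))/= ke] := near_infty_natSinv_lt (PosNum (divr_gt0 e0 (ltr0n _ 2))).
have k0 : 0 < k.+1%:R^-1 :> R by rewrite invr_gt0.
have /choice[q Hq] (i : 'I_n) : exists q : rat, ball (x 0 i) k.+1%:R^-1 (ratr q).
  set k' := k.+1%:R^-1 in k0 *.
  have [q] := @rat_in_itvoo R (x 0 i - k') (x 0 i + k') ltac:(lra).
  rewrite in_itv/= => /andP[q1 q2]; exists q; rewrite /ball/= ltr_norml; lra.
have Bx : ball (\row_i (ratr ((\row_i q i : 'rV[rat]_n) 0 i) : R)) k.+1%:R^-1 x.
  by split => // i j; rewrite (ord1 i) !mxE; apply: ball_sym; exact: Hq.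
exists (\row_i q i, k) => //; rewrite /F/=; case: asboolP => // -[] y yq.
apply: He; rewrite [e]splitr.
apply: (ball_triangle (y := \row_i (ratr ((\row_i q i : 'rV[rat]_n) 0 i) : R))).
  by apply: ball_sym; apply: le_ball Bx; exact: ltW.
by apply: le_ball yq; exact: ltW.
Qed.

Lemma continuous_measurable_rV n (f : 'rV[R]_n -> R) :
  continuous f -> measurable_fun setT f.
Proof.
move=> /continuousP cf; apply: (measurability _ (RGenOpens.measurableE R)) => //.
move=> _ [_ [x [y ->]] <-]; rewrite setTI.
by apply: open_measurable_rV; apply: cf; exact: itv_open.
Qed.

Lemma pushforward_measureP d1 d2 (X : measurableType d1) (Y : measurableType d2)
    (phi : X -> Y) (m : {measure set X -> \bar R}) : measurable_fun setT phi ->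
  exists nu : {measure set Y -> \bar R}, forall A, nu A = m (phi @^-1` A).
Proof.
by move=> mphi; unshelve eexists (pushforward m phi : {measure set Y -> \bar R}).
Qed.

Lemma ge0_integral_image d1 d2 (X : measurableType d1) (Y : measurableType d2)
    (phi : X -> Y) (m : {measure set X -> \bar R}) (m' : {measure set Y -> \bar R})
    (f : Y -> \bar R) : measurable_fun setT phi ->
  (forall A, measurable A -> m' A = m (phi @^-1` A)) ->
  measurable_fun setT f -> (forall y, 0 <= f y)%E ->
  (\int[m']_y f y = \int[m]_x f (phi x))%E.
Proof.
move=> mphi mm' mf f0; 
rewrite -[RHS](ge0_integral_pushforward mphi m (D := setT))//.
by apply: eq_measure_integral => A mA _; exact: mm'.
Qed.

Lemma ge0_integral_lebesgue_rVS n (f : 'rV[R]_n.+1 -> \bar R) :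
  measurable_fun setT f -> (forall x, 0 <= f x)%E ->
  (\int[lebesgue_rV n.+1]_x f x =
   \int[lebesgue_measure]_t \int[lebesgue_rV n]_x f (rV_cons (t, x)))%E.
Proof.
move=> mf f0.
rewrite (ge0_integral_image (m := (lebesgue_measure \x lebesgue_rV n)%E)
  (phi := @rV_cons R n))//; last exact: measurable_rV_cons.
rewrite fubini_tonelli1//.
by apply: measurableT_comp => //; exact: measurable_rV_cons.
Qed.

(** The image of Lebesgue measure under the affine map, scaled by |a|, gives half-open intervals
    their length, so it is Lebesgue measure by uniqueness. For [a < 0] the preimage of such an
    interval is closed on the other side, whence the two cases. *)
Lemma ge0_integral_affine (a b : R) (f : R -> \bar R) : a != 0 ->
  measurable_fun setT f -> (forall x, 0 <= f x)%E ->
  (\int[lebesgue_measure]_t f (a * t + b)%R =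
   `|a|^-1%:E * \int[lebesgue_measure]_t f t)%E.
Proof.
move=> a0 mf f0.
pose phi (t : measurableTypeR R) : measurableTypeR R := a * t + b.
have mphi : measurable_fun setT phi.
  by apply: measurable_funD => //; apply: measurable_funM.
have [nu nuE] := pushforward_measureP (@lebesgue_measure R) mphi.
pose nu' := mscale (NngNum (normr_ge0 a)) nu.
have lnu A : measurable A -> lebesgue_measure A = nu' A.
  apply: lebesgue_measure_unique => _ [[c d] _ <-].
  change (lebesgue_measure `]c, d]%classic = `|a|%:E * nu `]c, d]%classic)%E; rewrite nuE.
  have [cd|dc] := leP d c.
    by rewrite set_itv_ge ?bnd_simp -?leNgt// preimage_set0 !measure0 mule0.
  have [an|ap|/eqP] := ltgtP a 0; last by rewrite (negbTE a0).
  - have -> : phi @^-1` `]c, d] = `[(d - b) / a, (c - b) / a[%classic.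
      apply/seteqP; split => t; rewrite /phi/= !in_itv/= ler_ndivrMr// ltr_ndivlMr//.
        by move=> /andP[? ?]; apply/andP; split; lra.
      by move=> /andP[? ?]; apply/andP; split; lra.
    have h : (d - b) / a < (c - b) / a by rewrite ltr_nM2r ?invr_lt0// ltrD2r.
    transitivity (`|a|%:E * ((c - b) / a - (d - b) / a)%:E)%E; last first.
      by congr (_ * _)%E; apply/esym/(etrans (lebesgue_measure_itv _)); rewrite /= lte_fin h.
    rewrite lebesgue_measure_itv/= lte_fin dc -EFinB -EFinM; congr EFin.
    by rewrite ltr0_norm//; field.
  - have -> : phi @^-1` `]c, d] = `](c - b) / a, (d - b) / a]%classic.
      apply/seteqP; split => t; rewrite /phi/= !in_itv/= ltr_pdivrMr// ler_pdivlMr//.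
        by move=> /andP[? ?]; apply/andP; split; lra.
      by move=> /andP[? ?]; apply/andP; split; lra.
    have h : (c - b) / a < (d - b) / a by rewrite ltr_pM2r ?invr_gt0// ltrD2r.
    transitivity (`|a|%:E * ((d - b) / a - (c - b) / a)%:E)%E; last first.
      by congr (_ * _)%E; apply/esym/(etrans (lebesgue_measure_itv _)); rewrite /= lte_fin h.
    rewrite lebesgue_measure_itv/= lte_fin dc -EFinB -EFinM; congr EFin.
    by rewrite gtr0_norm//; field.
have -> : (\int[lebesgue_measure]_t f t = \int[nu']_t f t)%E.
  by apply: eq_measure_integral => A mA _; exact: lnu.
rewrite ge0_integral_mscale//=
  (ge0_integral_image (m := lebesgue_measure) mphi (fun A _ => nuE A) mf f0).
by rewrite muleA -EFinM mulVf ?mul1e// normr_eq0.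
Qed.

(** Induction on the dimension: the induction hypothesis rescales the inner integral over the last
    coordinates, and the one-dimensional rule the outer one. *)
Lemma ge0_integral_affine_rV n (a : R) (b : 'rV[R]_n) (f : 'rV[R]_n -> \bar R) :
  a != 0 -> measurable_fun setT f -> (forall x, 0 <= f x)%E ->
  (\int[lebesgue_rV n]_x f (a *: x + b)%R =
   (`|a|^-1 ^+ n)%:E * \int[lebesgue_rV n]_x f x)%E.
Proof.
move=> a0; elim: n b f => [|n IH] b f mf f0.
  rewrite expr0 mul1e; apply: eq_integral => x _; congr f.
  by apply/rowP => -[].
rewrite ge0_integral_lebesgue_rVS//; last first.
  by apply: measurableT_comp => //; exact: measurable_affine_rV.
rewrite [in RHS]ge0_integral_lebesgue_rVS//.
pose F (t : measurableTypeR R) := (\int[lebesgue_rV n]_x f (rV_cons (t, x)))%E.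
have mfc : measurable_fun setT (f \o @rV_cons R n).
  by apply: measurableT_comp => //; exact: measurable_rV_cons.
transitivity (\int[lebesgue_measure]_t ((`|a|^-1 ^+ n)%:E * F (a * t + b 0 0)%R))%E.
  apply: eq_integral => t _.
  rewrite -(IH (\row_i b 0 (lift 0 i)) (fun x => f (rV_cons (a * t + b 0 0, x)))) => [| |x]//.
    apply: eq_integral => x _; congr f; apply/rowP => i.
    rewrite [LHS]mxE [X in X + _]mxE.
    by case: (unliftP 0 i) => [j|] ->; rewrite ?rV_cons0// !rV_consS !mxE.
  by apply: measurableT_comp mfc _; exact: pair1_measurable.
have mF : measurable_fun setT F := measurable_fun_fubini_tonelli_F _ mfc (fun=> f0 _).
have F0 t : (0 <= F t)%E by apply: integral_ge0.
have mphi : measurable_fun setT (fun t : measurableTypeR R => a * t + b 0 0).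
  by apply: measurable_funD => //; apply: measurable_funM.
have k0 : (0 <= (`|a|^-1 ^+ n)%:E)%E by rewrite lee_fin exprn_ge0// invr_ge0.
have mFphi : measurable_fun setT (fun t : measurableTypeR R => F (a * t + b 0 0)).
  exact: (measurableT_comp mF mphi).
rewrite (ge0_integralZl (@lebesgue_measure R) measurableT mFphi (fun t _ => F0 _) k0).
rewrite (ge0_integral_affine (b 0 0) a0 mF F0).
by rewrite muleA -EFinM -exprSr.
Qed.

End lebesgue_measure_rV.

(** * Euclidean norm and uniform convexity *)

Section euclidean_norm.
Context {R : realType} {n : nat}.
Implicit Types (x y z : 'rV[R]_n) (a : R).

Lemma dotvC x y : dotv x y = dotv y x.
Proof. by apply: eq_bigr => i _; rewrite mulrC. Qed.

Lemma dotvDl x y z : dotv (x + y) z = dotv x z + dotv y z.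
Proof. by rewrite -big_split/=; apply: eq_bigr => i _; rewrite mxE mulrDl. Qed.

Lemma dotvDr x y z : dotv x (y + z) = dotv x y + dotv x z.
Proof. by rewrite dotvC dotvDl !(dotvC x). Qed.

Lemma dotvZl a x y : dotv (a *: x) y = a * dotv x y.
Proof. by rewrite mulr_sumr; apply: eq_bigr => i _; rewrite mxE mulrA. Qed.

Lemma dotvZr a x y : dotv x (a *: y) = a * dotv x y.
Proof. by rewrite dotvC dotvZl dotvC. Qed.

Lemma dotv0 x : dotv x 0 = 0.
Proof. by rewrite -(scale0r 0) dotvZr mul0r. Qed.

Lemma dotvv_ge0 x : 0 <= dotv x x.
Proof. by apply: sumr_ge0 => i _; rewrite -expr2 sqr_ge0. Qed.

Lemma enorm_ge0 x : 0 <= enorm x. Proof. exact: sqrtr_ge0. Qed.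

Lemma sqr_enorm x : enorm x ^+ 2 = dotv x x.
Proof. by rewrite sqr_sqrtr// dotvv_ge0. Qed.

Lemma enormZ a x : enorm (a *: x) = `|a| * enorm x.
Proof.
by rewrite /enorm dotvZl dotvZr mulrA -expr2 sqrtrM ?sqr_ge0// sqrtr_sqr.
Qed.

Lemma enorm0 : enorm (0 : 'rV[R]_n) = 0.
Proof. by rewrite -(scale0r 0) enormZ normr0 mul0r. Qed.

Lemma enormN x : enorm (- x) = enorm x.
Proof. by rewrite -scaleN1r enormZ normrN1 mul1r. Qed.

Lemma enorm_distC x y : enorm (x - y) = enorm (y - x).
Proof. by rewrite -opprB enormN. Qed.

Lemma ler_coord_enorm x i : `|x 0 i| <= enorm x.
Proof.
rewrite -sqrtr_sqr ler_wsqrtr// /dotv (bigD1 i)//= -expr2 lerDl.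
by apply: sumr_ge0 => j _; rewrite -expr2 sqr_ge0.
Qed.

Lemma enorm_eq0 x : enorm x = 0 -> x = 0.
Proof.
move=> x0; apply/rowP => i; rewrite mxE; apply/eqP; rewrite -normr_le0 -x0.
exact: ler_coord_enorm.
Qed.

Lemma ler_dotv_enorm x y : `|dotv x y| <= enorm x * enorm y.
Proof.
have [->|x0] := eqVneq x 0; first by rewrite dotvC dotv0 normr0 enorm0 mul0r.
have D0 : 0 < dotv x x.
  rewrite lt_neqAle dotvv_ge0 andbT eq_sym; apply: contraNneq x0 => D0.
  by rewrite (@enorm_eq0 x)// /enorm D0 sqrtr0.
rewrite -(@ler_pXn2r _ 2)// ?nnegrE ?mulr_ge0 ?enorm_ge0//.
rewrite exprMn !sqr_enorm real_normK ?num_real//.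
have := dotvv_ge0 (dotv x x *: y - dotv x y *: x).
rewrite -scaleNr !(dotvDl, dotvDr, dotvZl, dotvZr) (dotvC y x) => h.
suff : 0 <= dotv x x * (dotv x x * dotv y y - dotv x y ^+ 2).
  by rewrite pmulr_rge0// subr_ge0.
by apply: le_trans h _; rewrite le_eqVlt; apply/orP; left; apply/eqP; ring.
Qed.

Lemma ler_enormD x y : enorm (x + y) <= enorm x + enorm y.
Proof.
rewrite -(@ler_pXn2r _ 2)// ?nnegrE ?addr_ge0 ?enorm_ge0//.
rewrite sqr_enorm sqrrD !sqr_enorm !(dotvDl, dotvDr) (dotvC y x).
by have := le_trans (ler_norm _) (ler_dotv_enorm x y); lra.
Qed.

Lemma ler_dist_enorm x y : `|enorm x - enorm y| <= enorm (x - y).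
Proof.
have := ler_enormD (x - y) y; have := ler_enormD (y - x) x.
by rewrite !subrK ler_norml enorm_distC; lra.
Qed.

Lemma ler_enorm_sum x : enorm x <= \sum_i `|x 0 i|.
Proof.
have -> : enorm x = enorm (\sum_i x 0 i *: delta_mx 0 i) by rewrite -row_sum_delta.
elim/big_ind2 : _ => [|u s v t us vt|i _]; first by rewrite enorm0.
  by apply: le_trans (ler_enormD _ _) _; exact: lerD.
rewrite enormZ ler_piMr// /enorm /dotv (bigD1 i)//= !mxE !eqxx mulr1.
by rewrite big1 ?addr0 ?sqrtr1// => j /negPf ji; rewrite mxE ji andbF mul0r.
Qed.

Lemma parallelogram x y :
  enorm (x + y) ^+ 2 + enorm (x - y) ^+ 2 = 2 * (enorm x ^+ 2 + enorm y ^+ 2).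
Proof.
rewrite !sqr_enorm -scaleN1r !(dotvDl, dotvDr, dotvZl, dotvZr) (dotvC y x); ring.
Qed.

End euclidean_norm.

Lemma enorm_rV1 (R : realType) (x : 'rV[R]_1) : enorm x = `|x 0 0|.
Proof. by rewrite /enorm /dotv big_ord1 -expr2 sqrtr_sqr. Qed.

(** * Convexity and uniform convexity of p-th powers *)

Section powR_convexity.
Context {R : realType}.
Implicit Types (p s t x y : R).

Lemma powRZ_norm p (a x : R) : `|a * x| `^ p = `|a| `^ p * `|x| `^ p.
Proof. by rewrite normrM powRM. Qed.

Lemma continuous_powR_norm p : 0 < p -> continuous (fun x : R => `|x| `^ p).
Proof.
move=> p0 x; have [->|x0] := eqVneq x 0.
  apply/cvgrPdist_lt => e e0; have q0 : 0 < e `^ p^-1 by rewrite powR_gt0.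
  apply: filterS (nbhsx_ballx (0 : R) _ q0) => y; rewrite /ball/= sub0r normrN => yq.
  rewrite normr0 powR0 ?gt_eqF// sub0r normrN ger0_norm ?powR_ge0//.
  rewrite -[e]powRr1 ?(ltW e0)// -(mulVf (lt0r_neq0 p0)) powRrM.
  by rewrite gt0_ltr_powR ?nnegrE ?powR_ge0.
have h : {for `|x|, continuous (fun y : R => y `^ p)}.
  apply: differentiable_continuous; apply/derivable1_diffP.
  by have /derivable_powR : `|x| \in `]0, +oo[ by rewrite in_itv/= normr_gt0 x0.
exact: (cvg_comp _ _ (@norm_continuous _ R^o x) h).
Qed.

Lemma powR_conv p s x y : 1 <= p -> 0 <= x -> 0 <= y -> 0 <= s <= 1 ->
  ((1 - s) * x + s * y) `^ p <= (1 - s) * x `^ p + s * y `^ p.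
Proof.
move=> p1 x0 y0 /andP[s0 s1].
have h : 0 <= 1 - s <= 1 by lra.
have := @convex_powR R p p1
  (Itv01 (let: conj a _ := andP h in a) (let: conj _ b := andP h in b)) x y.
rewrite !inE/= !in_itv/= !andbT => /(_ x0 y0).
change (((1 - s) * x + (1 - (1 - s)) * y) `^ p <=
  (1 - s) * x `^ p + (1 - (1 - s)) * y `^ p -> ((1 - s) * x + s * y) `^ p <= (1 - s) * x `^
    p + s * y `^ p).
by rewrite subKr.
Qed.

(** The mean value theorem on each half of the interval gives two slopes, and the derivative p
    t^(p-1) is strictly increasing. *)
Lemma powR_midpoint_lt p x y : 1 < p -> 0 <= x -> x < y ->
  ((x + y) / 2) `^ p < (x `^ p + y `^ p) / 2.
Proof.
move=> p1 x0 xy; have p0 : 0 < p by lra.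
pose m := (x + y) / 2; have [xm my] : x < m /\ m < y by rewrite /m; lra.
have cont (a b : R) : 0 <= a -> {within `[a, b], continuous (fun t : R => t `^ p)}.
  move=> a0; apply: (@subspace_eq_continuous _ _ _ (fun t : R => `|t| `^ p)).
    by move=> t; rewrite inE/= in_itv/= => /andP[/(le_trans a0) t0 _];
      rewrite /from_subspace/= ger0_norm.
  by apply: continuous_subspaceT; exact: continuous_powR_norm.
have deriv (a b : R) : 0 <= a -> forall t, t \in `]a, b[ ->
    is_derive t 1 (fun t : R => t `^ p) (p * t `^ (p - 1)).
  move=> a0 t; rewrite in_itv/= => /andP[at_ _]; apply: is_derive1_powR.
  exact: le_lt_trans at_.
have m0 : 0 <= m by rewrite ltW// (le_lt_trans x0).
have [t] := MVT xm (deriv _ _ x0) (cont _ _ x0).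
rewrite in_itv/= => /andP[xt tm] E1.
have [t'] := MVT my (deriv _ _ m0) (cont _ _ m0).
rewrite in_itv/= => /andP[mt' t'y] E2.
have lt : t `^ (p - 1) < t' `^ (p - 1).
  by rewrite gt0_ltr_powR ?nnegrE ?subr_gt0//; lra.
have : p * t `^ (p - 1) * (m - x) < p * t' `^ (p - 1) * (y - m).
  have -> : y - m = m - x by rewrite /m; lra.
  by rewrite ltr_pM2r ?subr_gt0// ltr_pM2l.
by rewrite -E1 -E2 -/m; lra.
Qed.

Lemma half_itv01 : 0 <= (2^-1 : R) <= 1. Proof. lra. Qed.

Definition scalar_gap p x y := `|x| `^ p + `|y| `^ p - 2 * `|(x + y) / 2| `^ p.

Lemma scalar_gapC p x y : scalar_gap p x y = scalar_gap p y x.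
Proof. by rewrite /scalar_gap [_ `^ p + _]addrC [x + y]addrC. Qed.

Lemma scalar_gapZ p (a x y : R) :
  scalar_gap p (a * x) (a * y) = `|a| `^ p * scalar_gap p x y.
Proof. by rewrite /scalar_gap -mulrDr -mulrA !powRZ_norm; ring. Qed.

Lemma scalar_gap_ge0 p x y : 1 < p -> 0 <= scalar_gap p x y.
Proof.
move=> p1; rewrite /scalar_gap.
have h : `|(x + y) / 2| <= (1 - 2^-1) * `|x| + 2^-1 * `|y|.
  rewrite normrM [`|2^-1|]ger0_norm//; have := ler_normD x y; lra.
have hp : `|(x + y) / 2| `^ p <= ((1 - 2^-1) * `|x| + 2^-1 * `|y|) `^ p.
  by rewrite ge0_ler_powR// ?nnegrE//; have := normr_ge0 x; have := normr_ge0 y; lra.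
have := @powR_conv p 2^-1 `|x| `|y| (ltW p1) (normr_ge0 x) (normr_ge0 y) half_itv01.
by move: hp; lra.
Qed.

Lemma scalar_gap_gt0 p x y : 1 < p -> x != y -> 0 < scalar_gap p x y.
Proof.
move=> p1 xy; have p0 : 0 < p by lra.
wlog xley : x y xy / `|x| <= `|y|.
  have [h|/ltW h] := leP `|x| `|y|; first exact.
  by rewrite scalar_gapC; apply => //; rewrite eq_sym.
move: xley; rewrite le_eqVlt => /orP[/eqP E|xy'].
  have yx : x = - y.
    move/eqP: E; rewrite eqr_norm2 => /orP[/eqP h|/eqP//].
    by rewrite h eqxx in xy.
  have y0 : y != 0 by apply: contra_neq xy => y0; rewrite yx y0 oppr0.
  rewrite /scalar_gap yx addNr mul0r normr0 powR0 ?gt_eqF// normrN mulr0 subr0.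
  by rewrite addr_gt0// powR_gt0// normr_gt0.
have h : `|(x + y) / 2| <= (`|x| + `|y|) / 2.
  rewrite normrM [`|2^-1|]ger0_norm//; have := ler_normD x y; lra.
have hp : `|(x + y) / 2| `^ p <= ((`|x| + `|y|) / 2) `^ p.
  by rewrite ge0_ler_powR ?(ltW p0)// nnegrE// divr_ge0// addr_ge0.
have := powR_midpoint_lt p1 (normr_ge0 x) xy'.
by rewrite /scalar_gap; move: hp; lra.
Qed.

(* On the compact interval [-1, 1 - eta] the gap between 1 and t is bounded
   below by a positive constant; homogeneity reduces all pairs to this case. *)
Lemma scalar_uniform_convexity p (eta : R) : 1 < p -> 0 < eta ->
  exists2 C, 0 <= C & forall x y,
    `|x - y| `^ p <= C * scalar_gap p x y + eta * (`|x| `^ p + `|y| `^ p).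
Proof.
move=> p1 eta0; have p0 : 0 < p by lra.
(* As e^p <= eta, for [t] within [e] of 1 the error term alone suffices; for the other [t] the gap
   is at least [d] while |1 - t| <= 2, whence the constant 2^p / d. *)
pose e := Num.min 1 (eta `^ p^-1).
have e0 : 0 < e by rewrite lt_min ltr01 powR_gt0.
have e1 : e <= 1 by rewrite ge_min lexx.
have ep : e `^ p <= eta.
  rewrite -[leRHS]powRr1 ?(ltW eta0)// -(mulVf (lt0r_neq0 p0)) powRrM.
  by rewrite ge0_ler_powR ?nnegrE ?powR_ge0 ?(ltW e0) ?(ltW p0)// ge_min lexx orbT.
have cg : continuous (fun t : R => scalar_gap p 1 t).
  move=> t; apply: cvgB.
    by apply: cvgD; [exact: cvg_cst|exact: continuous_powR_norm].
  apply: cvgM; first exact: cvg_cst.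
  apply: (@continuous_comp _ _ _ (fun t : R => (1 + t) / 2) (fun x : R => `|x| `^ p)).
    by apply: cvgM; [apply: cvgD; [exact: cvg_cst|exact: cvg_id]|exact: cvg_cst].
  exact: continuous_powR_norm.
have [|c cin cmin] := @EVT_min R (fun t => scalar_gap p 1 t) (-1) (1 - e) _
  (continuous_subspaceT cg).
  by lra.
pose d := scalar_gap p 1 c.
have d0 : 0 < d.
  apply: scalar_gap_gt0 => //; move: cin; rewrite in_itv/= => /andP[_ ce].
  by apply/eqP; lra.
exists (2 `^ p / d); first by rewrite divr_ge0 ?powR_ge0 ?ltW.
have base (t : R) : `|t| <= 1 ->
    `|1 - t| `^ p <= 2 `^ p / d * scalar_gap p 1 t + eta.
  move=> t1; have [te|te] := leP t (1 - e).
    have : d <= scalar_gap p 1 t.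
      by apply: cmin; rewrite in_itv/= te andbT; move: t1; rewrite ler_norml => /andP[].
    move=> dt; apply: (@le_trans _ _ (2 `^ p)).
      rewrite ge0_ler_powR ?(ltW p0) ?nnegrE//.
      by apply: le_trans (ler_normB _ _) _; rewrite normr1; lra.
    apply: (@le_trans _ _ (2 `^ p / d * scalar_gap p 1 t)); last by rewrite lerDl ltW.
    by rewrite mulrAC ler_pdivlMr// ler_pM2l// powR_gt0.
  apply: (@le_trans _ _ eta).
    apply: le_trans ep; rewrite ge0_ler_powR ?nnegrE ?(ltW p0) ?(ltW e0)//.
    by move: t1; rewrite !ler_norml; lra.
  by rewrite lerDr mulr_ge0 ?scalar_gap_ge0// divr_ge0 ?powR_ge0 ?ltW.
have main x y : `|y| <= `|x| ->
    `|x - y| `^ p <= 2 `^ p / d * scalar_gap p x y + eta * (`|x| `^ p + `|y| `^ p).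
  move=> yx; have [x0|x0] := eqVneq x 0.
    move: yx; rewrite x0 normr0 normr_le0 => /eqP ->.
    rewrite subrr normr0 powR0 ?gt_eqF//.
    rewrite addr_ge0//.
      by rewrite mulr_ge0 ?scalar_gap_ge0// divr_ge0 ?powR_ge0// ltW.
    by rewrite mulr_ge0 ?(ltW eta0)// addr_ge0 ?powR_ge0.
  have t1 : `|y / x| <= 1 by rewrite normrM normfV ler_pdivrMr ?normr_gt0// mul1r.
  have /(ler_wpM2l (powR_ge0 `|x| p)) := base _ t1.
  rewrite -powRZ_norm mulrBr mulr1 [x * (y / x)]mulrC divfK// => h.
  apply: le_trans h _; rewrite mulrDr [X in X + _]mulrCA -scalar_gapZ mulr1.
  rewrite [x * (y / x)]mulrC divfK// lerD2l mulrC ler_pM2l//.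
  by rewrite lerDl powR_ge0.
move=> x y; have [xy|/ltW xy] := leP `|y| `|x|; first exact: main.
by rewrite distrC scalar_gapC [`|x| `^ p + _]addrC; exact: main.
Qed.

Context {n : nat}.
Implicit Types u v : 'rV[R]_n.

Definition gap p u v :=
  enorm u `^ p + enorm v `^ p - 2 * enorm (2^-1 *: (u + v)) `^ p.

Lemma enorm_conv p s u v : 1 <= p -> 0 <= s <= 1 ->
  enorm ((1 - s) *: u + s *: v) `^ p <= (1 - s) * enorm u `^ p + s * enorm v `^ p.
Proof.
move=> p1 s01; apply: le_trans (powR_conv p1 (enorm_ge0 u) (enorm_ge0 v) s01).
have p0 : 0 <= p by lra.
case/andP: s01 => s0 s1; rewrite ge0_ler_powR ?nnegrE ?enorm_ge0//.
  by rewrite addr_ge0// mulr_ge0 ?enorm_ge0// subr_ge0.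
apply: le_trans (ler_enormD _ _) _; rewrite !enormZ.
by rewrite !ger0_norm// subr_ge0.
Qed.

Lemma enorm_powRZ p (a : R) u : enorm (a *: u) `^ p = `|a| `^ p * enorm u `^ p.
Proof. by rewrite enormZ powRM ?enorm_ge0. Qed.

Lemma gap_ge0 p u v : 1 <= p -> 0 <= gap p u v.
Proof.
move=> p1; have := @enorm_conv p 2^-1 u v p1 half_itv01.
rewrite (_ : 1 - 2^-1 = 2^-1 :> R); last by lra.
by rewrite -scalerDr /gap; lra.
Qed.

(** Split each power as x * x^(p-1) and use that the second factor is monotone. *)
Lemma powR_superadditive p (a b : R) : 1 <= p -> 0 <= a -> 0 <= b ->
  a `^ p + b `^ p <= (a + b) `^ p.
Proof.
move=> p1 a0 b0; have [ab0|ab0] := eqVneq (a + b) 0.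
  have [-> ->] : a = 0 /\ b = 0 by lra.
  by rewrite addr0 powR0 ?addr0//; lra.
have split c : 0 <= c -> c `^ p = c * c `^ (p - 1).
  move=> c0; have [->|c1] := eqVneq c 0.
    by rewrite mul0r powR0//; lra.
  by rewrite -[c in c * _]powRr1// -powRD ?subrKC// c1 implybT.
have mono c d : 0 <= c -> c <= d -> c `^ (p - 1) <= d `^ (p - 1).
  by move=> c0 cd; rewrite ge0_ler_powR ?nnegrE ?subr_ge0//; lra.
rewrite !split ?addr_ge0// mulrDl lerD// ler_wpM2l// mono//; lra.
Qed.

(** Let A and B be the squared norms of half the sum and half the difference. By the parallelogram
    identity A + B is the mean of the squares of the norms of [u] and [v]. With q = p/2 >= 1,
    superadditivity bounds A^q + B^q by (A + B)^q, and convexity bounds this by the mean of the p-th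
    powers. *)
Lemma clarkson p u v : 2 <= p -> enorm (u - v) `^ p <= 2 `^ (p - 1) * gap p u v.
Proof.
move=> p2; pose q := p / 2; have q1 : 1 <= q by rewrite /q; lra.
have pE x : 0 <= x -> x `^ p = (x ^+ 2) `^ q.
  by move=> x0; rewrite -powR_mulrn// -powRrM /q mulrCA mulfV ?mulr1.
pose A := enorm (2^-1 *: (u + v)) ^+ 2; pose B := enorm (2^-1 *: (u - v)) ^+ 2.
have EA : A `^ q = enorm (2^-1 *: (u + v)) `^ p by rewrite (pE _ (enorm_ge0 _)).
have EB : B `^ q = 2^-1 `^ p * enorm (u - v) `^ p.
  by rewrite /B -(pE _ (enorm_ge0 _)) enorm_powRZ ger0_norm.
have AB : A + B = (1 - 2^-1) * enorm u ^+ 2 + 2^-1 * enorm v ^+ 2.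
  rewrite /A /B !enormZ !exprMn ger0_norm// -mulrDr parallelogram; clear; lra.
have h1 := @powR_superadditive q A B q1 (sqr_ge0 _) (sqr_ge0 _).
have h2 := @powR_conv q 2^-1 (enorm u ^+ 2) (enorm v ^+ 2) q1 (sqr_ge0 _) (sqr_ge0 _) half_itv01.
rewrite -AB -(pE _ (enorm_ge0 u)) -(pE _ (enorm_ge0 v)) in h2.
rewrite EA EB in h1.
have tr (a b c d x : R) : a + b <= x -> x <= (1 - 2^-1) * c + 2^-1 * d ->
  b <= 2^-1 * (c + d - 2 * a) by clear; lra.
have := tr _ _ _ _ _ h1 h2; rewrite -/(gap p u v).
rewrite -powR_inv1// -powRrM mulN1r powRN.
rewrite ler_pdivrMl ?powR_gt0// powR_inv1// => /le_trans; apply.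
rewrite mulrA -[2^-1]powR_inv1// -powRD ?implybT//.
by rewrite pnatr_eq0/= implybT.
Qed.

(** The two cases cover every [n < p] with [n] positive: for [n >= 2] this gives [p >= 2]. In
    dimension 1 the scalar estimate also treats [1 < p < 2], at the price of the term in [eta],
    which the integrated estimate absorbs on bounded sets. *)
Lemma uniform_convexity p (eta : R) : 1 < p -> (2 <= p \/ n = 1%N) -> 0 < eta ->
  exists2 C, 0 <= C & forall u v,
    enorm (u - v) `^ p <= C * gap p u v + eta * (enorm u `^ p + enorm v `^ p).
Proof.
move=> p1 [p2|n1] eta0.
  exists (2 `^ (p - 1)); first exact: powR_ge0.
  move=> u v; apply: le_trans (clarkson _ _ p2) _.
  by rewrite lerDl mulr_ge0 ?(ltW eta0)// addr_ge0 ?powR_ge0.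
have [C C0 HC] := scalar_uniform_convexity p1 eta0; exists C => //.
rewrite /gap; case: n / (esym n1) => u v; rewrite !enorm_rV1 !mxE.
by have := HC (u 0 0) (v 0 0); rewrite /scalar_gap [_ / 2]mulrC.
Qed.

End powR_convexity.

(** * Hoelder inequality and volume of balls *)

Section holder.
Context d (T : measurableType d) (R : realType) (m : {measure set T -> \bar R}).

Lemma Lnorm_le_powR (f : T -> R) (p A : R) : 0 < p -> 0 <= A ->
  (\int[m]_x (`|f x| `^ p)%:E <= A%:E)%E ->
  ('N[m]_p%:E[EFin \o f] <= (A `^ p^-1)%:E)%E.
Proof.
move=> p0 A0 fA.
have := @powR_Lnorm _ _ _ m (EFin \o f) p (lt0r_neq0 p0).
have /= -> : (\int[m]_x `|(EFin \o f) x| `^ p = \int[m]_x (`|f x| `^ p)%:E)%E.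
  by apply: eq_integral => x _; rewrite -poweR_EFin.
have := Lnorm_ge0 m p%:E (EFin \o f).
case: ('N[m]_p%:E[EFin \o f])%E => [r| |] //=; last first.
  by rewrite (gt_eqF p0) => _ h; move: fA; rewrite -h leye_eq.
rewrite lee_fin => r0 h; move: fA; rewrite -h lee_fin => rA.
rewrite lee_fin -[r]powRr1// -(mulfV (lt0r_neq0 p0)) powRrM.
by rewrite ge0_ler_powR ?nnegrE ?powR_ge0 ?invr_ge0 ?(ltW p0).
Qed.

Lemma ge0_holder_le (f g : T -> R) (p q A B : R) :
  measurable_fun setT f -> measurable_fun setT g ->
  (forall x, 0 <= f x) -> (forall x, 0 <= g x) ->
  0 < p -> 0 < q -> p^-1 + q^-1 = 1 -> 0 <= A -> 0 <= B ->
  (\int[m]_x (f x `^ p)%:E <= A%:E)%E -> (\int[m]_x (g x `^ q)%:E <= B%:E)%E ->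
  (\int[m]_x (f x * g x)%:E <= (A `^ p^-1 * B `^ q^-1)%:E)%E.
Proof.
move=> mf mg f0 g0 p0 q0 pq A0 B0 fA gB.
have := hoelder m mf mg p0 q0 pq; rewrite Lnorm1.
have -> : (\int[m]_x `|(EFin \o (f \* g)%R) x| = \int[m]_x (f x * g x)%:E)%E.
  by apply: eq_integral => x _ /=; rewrite ger0_norm// mulr_ge0.
have normE (k : T -> R) s : (forall x, 0 <= k x) ->
    (fun x => (k x `^ s)%:E) = (fun x => (`|k x| `^ s)%:E).
  by move=> k0; apply/funext => x; rewrite ger0_norm.
rewrite (normE f) // in fA; rewrite (normE g) // in gB.
move=> /le_trans; apply; rewrite EFinM; apply: lee_pmul; rewrite ?Lnorm_ge0//.
  exact: Lnorm_le_powR.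
exact: Lnorm_le_powR.
Qed.

End holder.

(** * The volume of Euclidean balls *)

Section ball_volume.
Context {R : realType}.

Lemma continuous_rV n (f : 'rV[R]_n -> R) :
  (forall (x : 'rV[R]_n) (e : R), 0 < e -> exists2 d : R, 0 < d & forall y : 'rV[R]_n,
    (forall i, `|x 0 i - y 0 i| < d) -> `|f x - f y| < e) -> continuous f.
Proof.
move=> H x A /nbhs_ballP[e /= e0 He]; apply/nbhs_ballP.
have [d d0 Hd] := H x e e0; exists d => //= y [_ xy]; apply: He.
by apply: Hd => i; exact: (xy 0 i).
Qed.

Lemma continuous_enorm n : continuous (@enorm R n).
Proof.
apply: continuous_rV => x e e0.
exists (e / n.+1%:R); first by rewrite divr_gt0.
move=> y xy; apply: le_lt_trans (ler_dist_enorm x y) _.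
apply: le_lt_trans (ler_enorm_sum _) _.
apply: (@le_lt_trans _ _ (\sum_(i < n) e / n.+1%:R)).
  by apply: ler_sum => i _; rewrite !mxE; apply/ltW/xy.
rewrite sumr_const card_ord -[ltLHS]mulr_natr -mulrA mulrC.
by rewrite gtr_pMl// mulrC ltr_pdivrMr// mul1r ltr_nat.
Qed.

Lemma measurable_enorm n : measurable_fun setT (@enorm R n).
Proof. by apply: continuous_measurable_rV; exact: continuous_enorm. Qed.

Lemma measurable_eball n (x : 'rV[R]_n) (r : R) : measurable (eball x r).
Proof.
rewrite (_ : eball x r = [set y | enorm (1 *: y + (- x)) < r]).
  rewrite -[X in measurable X]setTI; apply: measurable_fun_ltr => //.
  by apply: measurableT_comp; [exact: measurable_enorm|exact: measurable_affine_rV].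
by apply/seteqP; split => y /=; rewrite scale1r.
Qed.

Lemma enorm_rV_cons n (z : measurableTypeR R * 'rV[R]_n) :
  enorm (rV_cons z) ^+ 2 = z.1 ^+ 2 + enorm z.2 ^+ 2.
Proof.
rewrite !sqr_enorm /dotv big_ord_recl rV_cons0 -expr2; congr (_ + _).
by apply: eq_bigr => i _; rewrite rV_consS.
Qed.

Lemma integral_gauss_rV n :
  (\int[@lebesgue_rV R n]_x (expR (- enorm x ^+ 2))%:E =
   (Num.sqrt pi ^+ n)%:E)%E.
Proof.
elim: n => [|n IH].
  rewrite expr0 (_ : (\int[_]_x _ = \int[@lebesgue_rV R 0]_x (cst 1%E x))%E).
    by rewrite integral_cst// mul1e/= diracE in_setT.
  apply: eq_integral => x _; rewrite (_ : x = 0) ?enorm0 ?expr0n/= ?oppr0 ?expR0//.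
  by apply/rowP => -[].
have mg k : measurable_fun setT (fun x : 'rV[R]_k => (expR (- enorm x ^+ 2))%:E).
  apply/measurable_EFinP; apply: measurableT_comp => //.
  apply: measurableT_comp => //; apply: measurable_funX; exact: measurable_enorm.
rewrite ge0_integral_lebesgue_rVS//.
under eq_integral => t _.
  under eq_integral => x _ do rewrite enorm_rV_cons/= opprD expRD EFinM.
  rewrite ge0_integralZl//=; last by exact: mg.
  rewrite IH.
  over.
rewrite ge0_integralZr//=.
- by rewrite -/(gauss_fun) integralT_gauss -EFinM exprS.
- by apply/measurable_EFinP; exact: measurable_gauss_fun.

Qed.

Lemma sqrtr_exprn (t : R) n : 0 <= t -> Num.sqrt t ^+ n = t `^ (n%:R / 2).
Proof.
move=> t0; rewrite -powR_mulrn ?sqrtr_ge0//.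
by have <- := powR12_sqrt t0; rewrite -powRrM mulrC.
Qed.

(** A finite positive product forces both factors to be finite and positive. Applied to the Gaussian
    identity, this yields the convergence of the Gamma integral and the finiteness of the volume at
    once. *)
Lemma mule_eq_fin (G W : \bar R) (c : R) : (0 <= G)%E -> (0 <= W)%E -> 0 < c ->
  (G * W = c%:E)%E -> W = (c / fine G)%:E /\ 0 < c / fine G.
Proof.
case: G W => [G| |] [w| |]//=; rewrite ?lee_fin => G0 w0 c0.
- rewrite -EFinM => -[Gw].
  have Gn0 : G != 0 by apply: contra_ltN c0 => /eqP G0'; rewrite -Gw G0' mul0r.
  have Gp : 0 < G by rewrite lt_neqAle eq_sym Gn0.
  by rewrite divr_gt0//; split => //; rewrite -Gw mulrAC divff ?mul1r.
- have [->|Gn0] := eqVneq G 0; first by rewrite mul0e => -[h]; rewrite -h ltxx in c0.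
  by rewrite gt0_muley// lte_fin lt_neqAle eq_sym Gn0.
- have [->|wn0] := eqVneq w 0; first by rewrite mule0 => -[h]; rewrite -h ltxx in c0.
  by rewrite gt0_mulye// lte_fin lt_neqAle eq_sym wn0.
Qed.

Lemma lebesgue_eball_scale n (x : 'rV[R]_n) (r : R) : 0 < r ->
  (lebesgue_rV n (eball x r) = (r ^+ n)%:E * lebesgue_rV n (eball (0%R : 'rV[R]_n) 1))%E.
Proof.
move=> r0.
have mE y s : measurable (eball (y : 'rV[R]_n) s) by exact: measurable_eball.
have := @ge0_integral_affine_rV R n r x (fun y => (\1_(eball x r) y)%:E) (lt0r_neq0 r0).
have indE (y : 'rV[R]_n) s : (\int[lebesgue_rV n]_z (\1_(eball y s) z)%:E =
    lebesgue_rV n (eball y s))%E by rewrite integral_indic// setIT.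
rewrite indE ger0_norm ?(ltW r0)//.
have -> : (\int[lebesgue_rV n]_y (\1_(eball x r) (r *: y + x)%R)%:E =
    \int[lebesgue_rV n]_y (\1_(eball (0%R : 'rV[R]_n) 1) y)%:E)%E.
  apply: eq_integral => y _; congr EFin; rewrite !indicE; congr (nat_of_bool _)%:R.
  apply/idP/idP; rewrite !inE /eball/= addrK subr0 enormZ ger0_norm ?(ltW r0)//.
    by rewrite gtr_pMr.
  by rewrite gtr_pMr.
rewrite indE => ->; last 2 first.
- by apply/measurable_EFinP; exact: measurable_indic.
- by move=> y; rewrite lee_fin.
by rewrite muleA -EFinM -exprMn mulfV ?lt0r_neq0// expr1n mul1e.
Qed.

(** The volume of the unit ball; its inverse is the quotient of Gamma by a power of pi that occurs
    in [k_] and [K_]. *)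
Definition eball_volume n : R := pi `^ (n%:R / 2) / Gamma (1 + n%:R / 2).

Let gamma_integral n := (\int[@lebesgue_measure R]_(t in `]0%R, +oo[)
    (t `^ (n%:R / 2) * expR (- t))%:E)%E.

(** Write exp(-|x|^2) as the integral of exp(-t) over t > |x|^2 and exchange the integrals: for
    fixed [t] the set of [x] is the ball of radius sqrt t, whose volume is t^(n/2) times that of the
    unit ball. *)
Let integral_Gamma n : (gamma_integral n *
  lebesgue_rV n (eball (0%R : 'rV[R]_n) 1) = (Num.sqrt pi ^+ n)%:E)%E.
Proof.
rewrite -integral_gauss_rV.
pose k (z : measurableTypeR R * 'rV[R]_n) : R :=
  \1_[set z | enorm z.2 ^+ 2 < z.1] z * expR (- z.1).
have mA : measurable [set z : measurableTypeR R * 'rV[R]_n | enorm z.2 ^+ 2 < z.1].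
  rewrite -[X in measurable X]setTI; apply: measurable_fun_ltr => //.
  apply: measurable_funX; apply: measurableT_comp; [exact: measurable_enorm|exact: measurable_snd].
have mk : measurable_fun setT (EFin \o k).
  apply/measurable_EFinP; apply: measurable_funM; first exact: measurable_indic.
  by apply: measurableT_comp => //; apply: measurableT_comp.
have k0 z : (0 <= (EFin \o k) z)%E by rewrite lee_fin mulr_ge0// expR_ge0.
transitivity (\int[lebesgue_rV n]_x \int[lebesgue_measure]_t (EFin \o k) (t, x))%E; last first.
  apply: eq_integral => x _.
  pose s : R := enorm x ^+ 2.
  transitivity (\int[lebesgue_measure]_(t in `]s, +oo[) (expR (- t))%:E)%E.
    rewrite [RHS]integral_mkcond; apply: eq_integral => t _.
    rewrite epatch_indic/= -EFinM mulrC; congr (_ * _)%:E.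
    by rewrite !indicE; congr (nat_of_bool _)%:R; apply/idP/idP; rewrite !inE/= in_itv/= andbT.
  have me : continuous (fun t : R => expR (- t)).
    by move=> t; apply: (@continuous_comp R R R -%R expR);
      [exact: opp_continuous|exact: continuous_expR].
  rewrite integral_itv_obnd_cbnd; last first.
    by apply/measurable_EFinP; apply: measurable_funTS; exact: continuous_measurable_fun.
  have dF (t : R) : is_derive t 1 (fun t : R => - expR (- t)) (expR (- t)).
    have dN : is_derive t 1 (-%R : R -> R) (-1) by exact: (is_deriveN (is_derive_id t 1)).
    have := is_deriveN (is_derive1_comp (is_derive_expR (- t)) dN).
    by rewrite mulrN1 opprK.
  rewrite (@ge0_continuous_FTC2y _ _ (fun t => - expR (- t)) _ 0).
  - by rewrite sub0e -EFinN opprK.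
  - by move=> t _; exact: expR_ge0.
  - by apply: continuous_subspaceT.
  - by rewrite -oppr0; apply: cvgN; exact: cvgr_expR.
  - by move=> t _; apply: ex_derive.
  - by apply: cvg_at_right_filter; apply: cvgN; exact: me.
  - by move=> t _; rewrite derive1E; apply: derive_val.
rewrite -(fubini_tonelli _ mk k0) /gamma_integral.
rewrite -ge0_integralZr//=; last 2 first.
- apply/measurable_EFinP; apply: measurable_funTS; apply: measurable_funM.
    exact: measurable_powR.
  by apply: measurableT_comp => //; exact: measurableT_comp.
- by move=> t _; rewrite lee_fin mulr_ge0 ?powR_ge0 ?expR_ge0.
rewrite integral_mkcond; apply: eq_integral => t _.
rewrite epatch_indic/= indicE.
have [t0|t0] := leP t 0.
  rewrite memNset/=; last by rewrite in_itv/= andbT ltNge t0.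
  rewrite mule0; apply/esym; apply: integral0_eq => x _.
  rewrite /k indicE memNset ?mul0r//=.
  by rewrite ltNge (le_trans t0)// sqr_ge0.
rewrite mem_set/=; last by rewrite in_itv/= andbT.
rewrite mule1; apply/esym.
transitivity (\int[lebesgue_rV n]_x
  ((expR (- t))%:E * (\1_(eball (0%R : 'rV[R]_n) (Num.sqrt t)) x)%:E))%E.
  apply: eq_integral => x _; rewrite /k/= -EFinM mulrC !indicE; congr (_ * (nat_of_bool _)%:R)%:E.
  have tE : (enorm x < Num.sqrt t) = (enorm x ^+ 2 < t).
    by rewrite -[in RHS](sqr_sqrtr (ltW t0)) ltr_pXn2r ?nnegrE ?enorm_ge0 ?sqrtr_ge0.
  by apply/idP/idP; rewrite !inE/= /eball/= subr0 tE.
rewrite ge0_integralZl//=; last first.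
  by apply/measurable_EFinP; apply: measurable_indic; exact: measurable_eball.
rewrite integral_indic//; last exact: measurable_eball.
have st0 : 0 < Num.sqrt t by rewrite sqrtr_gt0.
rewrite setIT; apply: (etrans (congr1 _ (lebesgue_eball_scale _ st0))).
rewrite muleA -EFinM; congr (_%:E * _)%E.
by rewrite mulrC sqrtr_exprn ?(ltW t0).
Qed.

Lemma eball_volume_gt0 n : 0 < eball_volume n /\
  lebesgue_rV n (eball (0%R : 'rV[R]_n) 1) = (eball_volume n)%:E.
Proof.
have GE : Gamma (1 + n%:R / 2 : R) = fine (gamma_integral n).
  rewrite /Gamma /Rintegral; congr fine; apply: eq_integral => t _.
  by rewrite addrC addKr.
have := integral_Gamma n.
have pin : 0 < Num.sqrt pi ^+ n :> R by rewrite exprn_gt0// sqrtr_gt0 pi_gt0.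
have pinE : Num.sqrt pi ^+ n = pi `^ (n%:R / 2) :> R.
  by rewrite sqrtr_exprn ?pi_ge0.
have G0 : (0 <= gamma_integral n)%E.
  by apply: integral_ge0 => t _; rewrite lee_fin mulr_ge0 ?powR_ge0 ?expR_ge0.
have W0 : (0 <= lebesgue_rV n (eball (0%R : 'rV[R]_n) 1))%E by exact: measure_ge0.
by move=> /(mule_eq_fin G0 W0 pin)[-> gt0]; rewrite /eball_volume GE -pinE.
Qed.

Lemma lebesgue_eball n (x : 'rV[R]_n) (r : R) : 0 < r ->
  lebesgue_rV n (eball x r) = (r ^+ n * eball_volume n)%:E.
Proof.
by move=> r0; rewrite lebesgue_eball_scale// (eball_volume_gt0 n).2 EFinM.
Qed.

End ball_volume.

(** * Morrey's inequality *)

Section power_integrals.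
Context {R : realType}.

Lemma integral_powR (s a b : R) : 0 < a -> a < b -> s + 1 != 0 ->
  (\int[lebesgue_measure]_(t in `[a, b]) (t `^ s)%:E =
   ((b `^ (s + 1) - a `^ (s + 1)) / (s + 1))%:E)%E.
Proof.
move=> a0 ab s1.
have dF (t : R) : 0 < t -> is_derive t 1 (fun t => (s + 1)^-1 * t `^ (s + 1)) (t `^ s).
  move=> t0; have := is_deriveZ (s + 1)^-1 (is_derive1_powR (s + 1) t0).
  by rewrite addrK /GRing.scale/= mulKf.
have dc (f : R -> R) df (t : R) : is_derive t 1 f df -> {for t, continuous f}.
  by move=> h; apply: differentiable_continuous; apply/derivable1_diffP; exact: ex_derive.
have cF (t : R) (s' : R) : 0 < t -> {for t, continuous (fun t : R => t `^ s')}.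
  by move=> t0; apply: dc (is_derive1_powR s' t0).
rewrite (continuous_FTC2 (F := fun t => (s + 1)^-1 * t `^ (s + 1)))//.
- by rewrite -EFinB; congr EFin; rewrite -mulrBr mulrC.
- apply: continuous_in_subspaceT => t; rewrite inE/= in_itv/= => /andP[at_ _].
  by apply: cF; exact: lt_le_trans at_.
- split.
  + move=> t; rewrite in_itv/= => /andP[at_ _].
    by apply: ex_derive; apply: dF; exact: lt_trans at_.
  + by apply: cvg_at_right_filter; exact: dc (dF _ a0).
  + by apply: cvg_at_left_filter; exact: dc (dF _ (lt_trans a0 ab)).
- move=> t; rewrite in_itv/= => /andP[at_ _].
  by rewrite derive1E; apply: derive_val; apply: dF; exact: lt_trans at_.
Qed.

Lemma integral_powR_neg_le (p s : R) : 0 < p -> 0 < s ->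
  (\int[lebesgue_measure]_(t in `]s, 1%R[) (t `^ (- p - 1))%:E <= (s `^ (- p) / p)%:E)%E.
Proof.
move=> p0 s0; have [s1|s1] := leP 1 s.
  by rewrite set_itv_ge ?bnd_simp -?leNgt// integral_set0 lee_fin divr_ge0 ?powR_ge0// ltW.
have mpow A : measurable_fun A (fun t : R => (t `^ (- p - 1))%:E).
  by apply/measurable_EFinP; apply: measurable_funTS; exact: measurable_powR.
rewrite -(@integral_itv_bndoo _ _ _ _ true false)// integral_powR//; last first.
  by rewrite subrK oppr_eq0 gt_eqF.
rewrite subrK powR1 lee_fin invrN mulrN -mulNr opprB ler_pM2r ?invr_gt0//.
by rewrite gerBl.
Qed.

Lemma integral_powR_unit_le (th : R) : 0 <= th < 1 ->
  (\int[lebesgue_measure]_(t in `]0%R, 1%R[) (t `^ (- th))%:E <= ((1 - th)^-1)%:E)%E.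
Proof.
move=> /andP[th0 th1].
have mpow A : measurable_fun A (fun t : R => (t `^ (- th))%:E).
  by apply/measurable_EFinP; apply: measurable_funTS; exact: measurable_powR.
(* The power is singular at 0, so the interval is exhausted from inside; the index shift keeps the
   left endpoint strictly below 1, as [integral_powR] asks. *)
pose F (n : nat) : set R := `]n.+2%:R^-1, 1%R[%classic.
have FU : `]0%R, 1%R[%classic = \bigcup_n F n.
  apply/seteqP; split => t /=.
    rewrite in_itv/= => /andP[t0 t1].
    have [n _ /(_ n.+1 (leqnSn n))/= h] := near_infty_natSinv_lt (PosNum t0).
    by exists n => //; rewrite /F/= in_itv/= h.
  by move=> [n _]; rewrite /F/= !in_itv/= => /andP[h ->]; rewrite andbT (lt_trans _ h)// invr_gt0.
have ndF : {homo F : n m / (n <= m)%N >-> (n <= m)%O}.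
  move=> n m nm; apply/subsetPset => t; rewrite /F/= !in_itv/= => /andP[h ->].
  by rewrite andbT (le_lt_trans _ h)// lef_pV2 ?posrE// ler_nat !ltnS.
have cv : (\int[lebesgue_measure]_(t in F n) (t `^ (- th))%:E @[n --> \oo] -->
    \int[lebesgue_measure]_(t in \bigcup_n F n) (t `^ (- th))%:E)%E.
  apply: ge0_nondecreasing_set_cvg_integral => //.
  - by move=> n; exact: measurable_itv.
  - by move=> n; exact: mpow.
  - by move=> n t _; rewrite lee_fin powR_ge0.
rewrite FU; apply: cvge_to_le cv _; near=> n.
have n0 : 0 < n.+2%:R^-1 :> R by rewrite invr_gt0.
have n1 : n.+2%:R^-1 < 1 :> R by rewrite invf_lt1// ltr1n.
rewrite /F -(@integral_itv_bndoo _ _ _ _ true false)// integral_powR//; last first.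
  by rewrite addrC gt_eqF// subr_gt0.
rewrite powR1 lee_fin (addrC (- th)) ler_piMl ?invr_ge0 ?subr_ge0 ?(ltW th1)//.
Unshelve. all: by end_near. Qed.

End power_integrals.

Section morrey.
Context {R : realType} {N : nat}.
Local Notation mu := (@lebesgue_rV R N).

(** [G] is the gradient of [f], but only derivatives along lines are asked: this is what the
    fundamental theorem along segments and integration by parts consume. *)
Definition C1_pair (f : 'rV[R]_N -> R) (G : 'rV[R]_N -> 'rV[R]_N) :=
  [/\ continuous f, continuous G & forall x v : 'rV[R]_N,
    is_derive (0 : R) (1 : R) (fun t : R => f (x + t *: v)) (dotv (G x) v)].

Lemma C1_pair_derive f G x v (t : R) : C1_pair f G ->
  is_derive t 1 (fun t : R => f (x + t *: v)) (dotv (G (x + t *: v)) v).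
Proof.
move=> [_ _ d].
have sh : is_derive t 1 (fun s : R => s - t) 1.
  by rewrite -[X in is_derive _ _ _ X](subr0 1); apply: is_deriveB.
have := @is_derive1_comp _ (fun s : R => f (x + t *: v + s *: v)) _ t
  (dotv (G (x + t *: v)) v) 1 _ sh.
rewrite mulr1 subrr => /(_ (d _ _)).
congr (is_derive _ _ _ _); apply/funext => s /=.
by rewrite -addrA -scalerDl subrKC.
Qed.

Lemma continuous_line (x v : 'rV[R]_N) : continuous (fun t : R => x + t *: v).
Proof.
by move=> t; apply: cvgD; [exact: cvg_cst|apply: cvgZr_tmp; exact: cvg_id].
Qed.

Lemma continuous_dotv v : continuous (fun x : 'rV[R]_N => dotv x v).
Proof.
apply: continuous_rV => x e e0.
have k0 : 0 < enorm v + 1 by rewrite ltr_wpDl// enorm_ge0.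
exists (e / (enorm v + 1) / N.+1%:R); first by rewrite !divr_gt0.
move=> y xy; have -> : dotv x v - dotv y v = dotv (x - y) v.
  by rewrite dotvDl -[- y]scaleN1r dotvZl mulN1r.
apply: le_lt_trans (ler_dotv_enorm _ _) _.
apply: (@le_lt_trans _ _ (enorm (x - y) * (enorm v + 1))).
  by rewrite ler_wpM2l ?enorm_ge0// lerDl.
rewrite -ltr_pdivlMr//; apply: le_lt_trans (ler_enorm_sum _) _.
apply: (@le_lt_trans _ _ (\sum_(i < N) e / (enorm v + 1) / N.+1%:R)).
  by apply: ler_sum => i _; rewrite !mxE; apply/ltW/xy.
rewrite sumr_const card_ord -[ltLHS]mulr_natr -mulrA mulrC.
by rewrite gtr_pMl ?divr_gt0// mulrC ltr_pdivrMr// mul1r ltr_nat.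
Qed.

Lemma C1_pair_integral_le f G x y : C1_pair f G ->
  (`|f (x + y) - f x|%:E <=
   \int[lebesgue_measure]_(t in `]0%R, 1%R[) (enorm (G (x + t *: y)) * enorm y)%:E)%E.
Proof.
move=> fG; have [cf cG _] := fG.
have cl (h : 'rV[R]_N -> R) : continuous h -> continuous (fun t : R => h (G (x + t *: y))).
  move=> ch t; apply: (@cvg_comp _ _ _ (fun t : R => G (x + t *: y)) h).
    by apply: (@cvg_comp _ _ _ (fun t : R => x + t *: y) G); [exact: continuous_line|exact: cG].
  exact: ch.
have ce := cl _ (@continuous_enorm R N).
have cd : continuous (fun t : R => dotv (G (x + t *: y)) y).
  by apply: (cl (fun z => dotv z y)); exact: continuous_dotv.
have mE (f' : R -> R) A : continuous f' -> measurable_fun A (EFin \o f').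
  by move=> cf'; apply/measurable_EFinP; apply: measurable_funTS; exact: continuous_measurable_fun.
have := @continuous_FTC2 R (fun t => dotv (G (x + t *: y)) y) (fun t => f (x + t *: y)) 0 1 ltr01
  (continuous_subspaceT cd).
have dF t := @C1_pair_derive f G x y t fG.
have cF t : {for t, continuous (fun t : R => f (x + t *: y))}.
  by apply: differentiable_continuous; apply/derivable1_diffP; exact: ex_derive.
rewrite scale1r scale0r addr0 => FTC.
have -> : (`|f (x + y) - f x|%:E = `|\int[lebesgue_measure]_(t in `[0%R, 1%R])
    (dotv (G (x + t *: y)) y)%:E|)%E.
  rewrite FTC//.
    split; first by move=> t _; exact: ex_derive.
      by apply: cvg_at_right_filter; exact: cF.
    by apply: cvg_at_left_filter; exact: cF.
  by move=> t _; rewrite derive1E; exact: derive_val.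
apply: le_trans (le_abse_integral _ _ _) _ => //; first exact: mE.
have -> : (\int[lebesgue_measure]_(t in `]0%R, 1%R[) (enorm (G (x + t *: y)) * enorm y)%:E =
   \int[lebesgue_measure]_(t in `[0%R, 1%R]) (enorm (G (x + t *: y)) * enorm y)%:E)%E.
  rewrite -(@integral_itv_bndoo _ _ _ _ true false)//.
  by apply: mE => t; apply: cvgM; [exact: ce|exact: cvg_cst].
apply: ge0_le_integral => //.
- by apply: measurableT_comp => //; exact: mE.
- by apply: mE => t; apply: cvgM; [exact: ce|exact: cvg_cst].
- by move=> t _; rewrite lee_fin ler_dotv_enorm.
Qed.


Lemma measurable_dilation (x : 'rV[R]_N) :
  measurable_fun setT (fun z : measurableTypeR R * 'rV[R]_N => x + z.1 *: z.2).
Proof.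
apply: measurable_fun_rV => i.
rewrite (_ : _ \o _ = fun z : measurableTypeR R * 'rV[R]_N => x 0 i + z.1 * rV_coord i z.2).
  apply: measurable_funD => //; apply: measurable_funM; first exact: measurable_fst.
  by apply: measurableT_comp; [exact: measurable_rV_coord|exact: measurable_snd].
by apply/funext => z; rewrite /= /rV_coord !mxE.
Qed.

Lemma ge0_integral_translation (x : 'rV[R]_N) (f : 'rV[R]_N -> \bar R) :
  measurable_fun setT f -> (forall y, (0 <= f y)%E) ->
  (\int[mu]_y f (x + y)%R = \int[mu]_y f y)%E.
Proof.
move=> mf f0; have := ge0_integral_affine_rV x (oner_neq0 R) mf f0.
rewrite normr1 invr1 expr1n mul1e => <-.
by apply: eq_integral => y _; rewrite scale1r addrC.
Qed.

Section morrey_mean.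
Variables (p rho A : R) (x : 'rV[R]_N) (g : 'rV[R]_N -> R).
Hypotheses (N_ge1 : (1 <= N)%N) (N_lt_p : N%:R < p) (rho0 : 0 < rho) (A0 : 0 <= A).
Hypotheses (mg : measurable_fun setT g) (g0 : forall y, 0 <= g y).
Hypothesis gA : (\int[mu]_y (g y `^ p)%:E <= A%:E)%E.

Let p_gt1 : 1 < p.
Proof. by apply: le_lt_trans N_lt_p; rewrite ler1n. Qed.
Let p0 : 0 < p. Proof. exact: lt_trans p_gt1. Qed.

(** The weight that makes Hoelder's inequality on ]0,1[ times the ball efficient. In the p-th power
    of [F1] it puts t^(N-1) before the integrand, and the substitution z = t y turns this into
    t^(-p-1), integrable against |z|^p with total rho^p / p. In [F2] it leaves t to the power
    -(N-1)/(p-1), integrable at 0 precisely because N < p, with integral (p-1)/(p-N). *)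
Let al : R := (N%:R - 1) / p.
Let P := (@lebesgue_measure R \x mu)%E.
Let I01 : set (measurableTypeR R) := `]0%R, 1%R[%classic.
Let B : set 'rV[R]_N := eball 0 rho.
Let ind (z : measurableTypeR R * 'rV[R]_N) : R := \1_I01 z.1 * \1_B z.2.
Let F1 z : R := ind z * (g (x + z.1 *: z.2) * enorm z.2 * z.1 `^ al).
Let F2 z : R := ind z * z.1 `^ (- al).
Let H (z : measurableTypeR R * 'rV[R]_N) : R :=
  \1_I01 z.1 * \1_[set z : measurableTypeR R * 'rV[R]_N | enorm z.2 < z.1 * rho] z *
  (g (x + z.2) `^ p * enorm z.2 `^ p * z.1 `^ (- p - 1)).

Let menorm2 : measurable_fun setT (fun z : measurableTypeR R * 'rV[R]_N => enorm z.2).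
Proof. by apply: measurableT_comp; [exact: measurable_enorm|exact: measurable_snd]. Qed.

Let mpow1 s : measurable_fun setT (fun z : measurableTypeR R * 'rV[R]_N => z.1 `^ s).
Proof. by apply: (measurableT_comp (measurable_powR s)); exact: measurable_fst. Qed.

Let mI1 : measurable_fun setT (fun z : measurableTypeR R * 'rV[R]_N => \1_I01 z.1 : R).
Proof.
by apply: measurableT_comp; [apply: measurable_indic; exact: measurable_itv|exact: measurable_fst].
Qed.

Let mind : measurable_fun setT ind.
Proof.
apply: measurable_funM; first exact: mI1.
by apply: measurableT_comp;
  [apply: measurable_indic; exact: measurable_eball|exact: measurable_snd].
Qed.

Let mF1 : measurable_fun setT F1.
Proof.
apply: measurable_funM mind _; apply: measurable_funM (mpow1 _).
apply: measurable_funM menorm2; apply: measurableT_comp => //.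
exact: measurable_dilation.
Qed.

Let mF2 : measurable_fun setT F2.
Proof. exact: measurable_funM mind (mpow1 _). Qed.

Let mH : measurable_fun setT H.
Proof.
apply: measurable_funM.
  apply: measurable_funM; first exact: mI1.
  apply: measurable_indic; rewrite -[X in measurable X]setTI.
  apply: measurable_fun_ltr => //.
  by apply: measurable_funM => //; exact: measurable_fst.
apply: measurable_funM (mpow1 _); apply: measurable_funM; last first.
  by apply: (measurableT_comp (measurable_powR p)).
apply: (measurableT_comp (measurable_powR p)); apply: measurableT_comp => //.
rewrite (_ : (fun z => _) = (fun z : measurableTypeR R * 'rV[R]_N => 1 *: z.2 + x)).
  exact: (measurableT_comp (@measurable_affine_rV R N 1 x) measurable_snd).
by apply/funext => z; rewrite scale1r addrC.
Qed.

Let ind_ge0 z : 0 <= ind z. Proof. by rewrite mulr_ge0. Qed.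
Let F1_ge0 z : 0 <= F1 z.
Proof. by rewrite mulr_ge0// mulr_ge0 ?powR_ge0// mulr_ge0 ?enorm_ge0. Qed.
Let F2_ge0 z : 0 <= F2 z. Proof. by rewrite mulr_ge0// powR_ge0. Qed.
Let H_ge0 z : 0 <= H z. Proof. by rewrite !mulr_ge0 ?powR_ge0. Qed.

(* The substitution z = t y, which maps the ball of radius rho to the ball of
   radius t rho. *)
Let F1_H t : (\int[mu]_y (F1 (t, y) `^ p)%:E = \int[mu]_y (H (t, y))%:E)%E.
Proof.
have [t01|t01] := boolP (t \in I01); last first.
  have z k : (k : R) * 0 = 0 by rewrite mulr0.
  rewrite !integral0_eq// => y _; rewrite /H /F1 /ind/= indicE (negbTE t01) !mul0r//.
  by rewrite powR0// gt_eqF.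
have /andP[t0 t1] : 0 < t < 1 by move/set_mem : t01; rewrite /I01/= in_itv.
have mHt : measurable_fun setT (fun y => (t ^+ N * H (t, y))%:E).
  apply/measurable_EFinP; apply: measurable_funM => //.
  by apply: (measurableT_comp mH); exact: pair1_measurable.
have := @ge0_integral_affine_rV R N t 0 _ (lt0r_neq0 t0) mHt.
have tN : 0 < t ^+ N by rewrite exprn_gt0.
move=> /(_ (fun y => _))/wrap[y|]; first by rewrite lee_fin mulr_ge0// ltW.
under [X in _ = (_ * X)%E -> _]eq_integral do rewrite EFinM.
rewrite ge0_integralZl//=; last 3 first.
- by apply/measurable_EFinP; apply: (measurableT_comp mH); exact: pair1_measurable.
- by move=> y _; rewrite lee_fin.
- by rewrite lee_fin ltW.
rewrite muleA -EFinM gtr0_norm// -exprMn mulVf ?gt_eqF// expr1n mul1e => <-.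
apply: eq_integral => y _; congr EFin; rewrite addr0 /F1 /H /ind/= indicE t01 !mul1r.
have -> : \1_[set z : measurableTypeR R * 'rV[R]_N | enorm z.2 < z.1 * rho] (t, t *: y) =
  \1_B y :> R.
  rewrite !indicE; congr (nat_of_bool _)%:R; apply/idP/idP;
    rewrite !inE/= /B /eball/= subr0 enormZ gtr0_norm//.
    by rewrite ltr_pM2l.
  by rewrite ltr_pM2l.
rewrite !indicE; case: (y \in B); last by rewrite !mul0r mulr0 powR0// gt_eqF.
rewrite !mul1r enormZ (gtr0_norm t0) !powRM ?mulr_ge0 ?powR_ge0 ?enorm_ge0 ?(ltW t0)//.
rewrite mulrCA -!mulrA; congr (_ * _); rewrite [in RHS]mulrCA; congr (_ * _).
rewrite -powRrM /al divfK ?gt_eqF// mulrCA -powRD; last by rewrite (gt_eqF t0) implybT.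
rewrite -powR_mulrn ?(ltW t0)// -powRD; last by rewrite (gt_eqF t0) implybT.
by congr (_ `^ _); lra.
Qed.

(** For fixed [y] the parameter runs over |y|/rho < t < 1; the integral is at most (|y|/rho)^(-p) /
    p, and the power of |y| cancels. *)
Let H_le y : (\int[lebesgue_measure]_t (H (t, y))%:E <= (g (x + y) `^ p * (rho `^ p / p))%:E)%E.
Proof.
have [y0|y0] := eqVneq (enorm y) 0.
  rewrite integral0_eq; last first.
    by move=> t _; rewrite /H/= y0 powR0 ?gt_eqF// mulr0 mul0r mulr0.
  by rewrite lee_fin mulr_ge0 ?divr_ge0 ?powR_ge0 ?(ltW p0).
have yp : 0 < enorm y by rewrite lt_neqAle eq_sym y0 enorm_ge0.
pose s := enorm y / rho; have s0 : 0 < s by rewrite divr_gt0.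
pose k := g (x + y) `^ p * enorm y `^ p.
have k0 : 0 <= k by rewrite mulr_ge0 ?powR_ge0.
have -> : (\int[lebesgue_measure]_t (H (t, y))%:E =
    \int[lebesgue_measure]_(t in `]s, 1%R[) (k%:E * (t `^ (- p - 1))%:E))%E.
  rewrite [RHS]integral_mkcond; apply: eq_integral => t _; rewrite epatch_indic/= -!EFinM.
  congr EFin; rewrite /H/= [RHS]mulrC; congr (_ * _).
  rewrite -[LHS]/(\1_I01 t *
    \1_[set z : measurableTypeR R * 'rV[R]_N | enorm z.2 < z.1 * rho] (t, y)).
  rewrite !indicE -natrM mulnb; congr (nat_of_bool _)%:R.
  apply/andP/idP; rewrite !inE/= /I01/= !in_itv/= /s ltr_pdivrMr//.
    by move=> [/andP[_ ->] ->].
  by move=> /andP[h ->]; rewrite h andbT; split => //; rewrite -(pmulr_lgt0 _ rho0) (lt_trans yp).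
rewrite ge0_integralZl//=; last 2 first.
- by apply/measurable_EFinP; apply: measurable_funTS; exact: measurable_powR.
- by move=> t _; rewrite lee_fin powR_ge0.
apply: le_trans (lee_wpmul2l _ (integral_powR_neg_le p0 s0)) _; first by rewrite lee_fin.
rewrite -EFinM lee_fin /k -mulrA ler_wpM2l ?powR_ge0// mulrA ler_pM2r ?invr_gt0//.
rewrite powRN /s powRM ?invr_ge0 ?enorm_ge0 ?(ltW rho0)//.
rewrite -[rho^-1]powR_inv1 ?(ltW rho0)// -powRrM mulN1r powRN invfM invrK mulrA.
by rewrite mulfV ?mul1r// gt_eqF// powR_gt0.
Qed.

Let int_F1 : (\int[P]_z (F1 z `^ p)%:E <= (rho `^ p / p * A)%:E)%E.
Proof.
have mH' : measurable_fun setT (EFin \o H) by apply/measurable_EFinP; exact: mH.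
rewrite fubini_tonelli1; last 2 first.
- by apply/measurable_EFinP; apply: (measurableT_comp (measurable_powR p)).
- by move=> z; rewrite lee_fin powR_ge0.
rewrite /fubini_F; under eq_integral do rewrite F1_H.
rewrite (fubini_tonelli (EFin \o H) mH')//=.
have mgx : measurable_fun setT (fun y => (g (x + y) `^ p)%:E).
  apply/measurable_EFinP; apply: (measurableT_comp (measurable_powR p));
    apply: measurableT_comp => //.
  rewrite (_ : +%R x = (fun y : 'rV[R]_N => 1 *: y + x)); first exact: measurable_affine_rV.
  by apply/funext => z; rewrite scale1r addrC.
have rp0 : 0 <= rho `^ p / p by rewrite divr_ge0 ?powR_ge0// ltW.
apply: (@le_trans _ _ (\int[mu]_y ((rho `^ p / p)%:E * (g (x + y) `^ p)%:E))%E).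
  apply: ge0_le_integral => //.
  - by move=> y _; apply: integral_ge0 => t _; rewrite lee_fin.
  - exact: (measurable_fun_fubini_tonelli_G _ mH').
  - exact: measurable_funeM.
  - by move=> y _; rewrite -EFinM mulrC H_le.
rewrite ge0_integralZl//=; last by move=> y _; rewrite lee_fin powR_ge0.
rewrite [leRHS]EFinM; apply: lee_wpmul2l; first by rewrite lee_fin.
rewrite (ge0_integral_translation x (f := fun y => (g y `^ p)%:E))//.
- by apply/measurable_EFinP; apply: (measurableT_comp (measurable_powR p)).
- by move=> y; rewrite lee_fin powR_ge0.
Qed.

Let q := p / (p - 1).

Let q_gt0 : 0 < q. Proof. by rewrite divr_gt0// subr_gt0. Qed.

Let mu_B : (\int[mu]_y (\1_B y)%:E = (rho ^+ N * eball_volume N)%:E)%E.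
Proof.
rewrite integral_indic//; last exact: measurable_eball.
by rewrite setIT; exact: lebesgue_eball.
Qed.

Let int_F2 : (\int[P]_z (F2 z `^ q)%:E <=
  ((p - 1) / (p - N%:R) * (rho ^+ N * eball_volume N))%:E)%E.
Proof.
rewrite fubini_tonelli1; last 2 first.
- by apply/measurable_EFinP; apply: (measurableT_comp (measurable_powR q)).
- by move=> z; rewrite lee_fin powR_ge0.
have V0 : 0 <= rho ^+ N * eball_volume N.
  by rewrite mulr_ge0 ?exprn_ge0 ?(ltW rho0) ?(ltW (eball_volume_gt0 N).1).
pose th := al * q.
have thE : th = (N%:R - 1) / (p - 1).
  by rewrite /th /al /q mulrA divfK ?gt_eqF.
have th01 : 0 <= th < 1.
  rewrite thE divr_ge0 ?subr_ge0 ?ler1n ?(ltW p_gt1)//=.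
  by rewrite ltr_pdivrMr ?subr_gt0// mul1r ltrD2r.
have -> : (\int[lebesgue_measure]_t fubini_F mu (fun z => (F2 z `^ q)%:E) t =
    \int[lebesgue_measure]_(t in I01) ((rho ^+ N * eball_volume N)%:E * (t `^ (- th))%:E))%E.
  rewrite [RHS]integral_mkcond; apply: eq_integral => t _; rewrite epatch_indic/=.
  rewrite /fubini_F -!EFinM -mulrA EFinM -mu_B muleC -ge0_integralZl//=; last 2 first.
  - by apply/measurable_EFinP; apply: measurable_indic; exact: measurable_eball.
  - by rewrite lee_fin mulr_ge0 ?powR_ge0.
  apply: eq_integral => y _; rewrite -EFinM; congr EFin; rewrite /F2 /ind/=.
  rewrite !indicE; case: (t \in I01); last by rewrite !(mul0r, mulr0) powR0// gt_eqF.
  case: (y \in B); last by rewrite !(mul0r, mulr0) powR0// gt_eqF.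
  by rewrite !(mul1r, mulr1) -powRrM mulNr.
rewrite ge0_integralZl//=; last 3 first.
- exact: measurable_itv.
- by apply/measurable_EFinP; apply: measurable_funTS; exact: measurable_powR.
- by move=> t _; rewrite lee_fin powR_ge0.
apply: le_trans (lee_wpmul2l _ (integral_powR_unit_le th01)) _; first by rewrite lee_fin.
rewrite -EFinM lee_fin mulrC ler_wpM2r// thE.
have pN : p - N%:R != 0 by rewrite subr_eq0 gt_eqF.
have p1 : p - 1 != 0 by rewrite subr_eq0 gt_eqF.
rewrite le_eqVlt; apply/orP; left; apply/eqP.
have -> : 1 - (N%:R - 1) / (p - 1) = (p - N%:R) / (p - 1) by field.
by rewrite invfM invrK mulrC.
Qed.

Lemma morrey_mean :
  (\int[mu]_(y in eball 0%R rho) \int[lebesgue_measure]_(t in `]0%R, 1%R[)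
     (g (x + t *: y) * enorm y)%:E <=
   ((rho `^ p / p * A) `^ p^-1 *
    ((p - 1) / (p - N%:R) * (rho ^+ N * eball_volume N)) `^ (1 - p^-1))%:E)%E.
Proof.
have qE : q^-1 = 1 - p^-1 by rewrite /q invfM invrK mulrBr mulVf ?gt_eqF// mulr1.
have pq : p^-1 + q^-1 = 1 by rewrite qE subrKC.
have A'0 : 0 <= rho `^ p / p * A by rewrite mulr_ge0// divr_ge0 ?powR_ge0// ltW.
have B'0 : 0 <= (p - 1) / (p - N%:R) * (rho ^+ N * eball_volume N).
  by rewrite mulr_ge0 ?divr_ge0 ?subr_ge0 ?(ltW p_gt1) ?(ltW N_lt_p)// mulr_ge0 ?exprn_ge0
    ?(ltW rho0) ?(ltW (eball_volume_gt0 N).1).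
have := ge0_holder_le mF1 mF2 F1_ge0 F2_ge0 p0 q_gt0 pq A'0 B'0 int_F1 int_F2.
rewrite qE; apply: le_trans.
have mF12 : measurable_fun setT (fun z => (F1 z * F2 z)%:E).
  by apply/measurable_EFinP; exact: measurable_funM.
rewrite fubini_tonelli2//; last by move=> z; rewrite lee_fin mulr_ge0.
rewrite integral_mkcond le_eqVlt; apply/orP; left; apply/eqP; apply: eq_integral => y _.
rewrite /fubini_G epatch_indic/= muleC integral_mkcond.
have [yB|yB] := boolP (y \in B); last first.
  rewrite indicE (negbTE yB) mul0e; apply/esym/integral0_eq => t _.
  by rewrite /F1 /ind/= [\1_B y]indicE (negbTE yB) mulr0 !mul0r.
rewrite indicE yB mul1e; apply: eq_integral => t _; rewrite epatch_indic/= -EFinM.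
rewrite /F1 /F2 /ind/= [\1_B y]indicE yB mulr1 indicE; congr EFin.
have [tI|tI] := boolP (t \in I01); last by rewrite !(mulr0, mul0r).
have t0 : 0 < t by move/set_mem : tI; rewrite /I01/= in_itv/= => /andP[].
rewrite !(mulr1, mul1r) -!mulrA -powRD; last by rewrite (gt_eqF t0) implybT.
by rewrite subrr powRr0 !mulr1.
Qed.

End morrey_mean.

End morrey.

Lemma powR_expRE (R : realType) (l a : R) : expR l `^ a = expR (a * l).
Proof. by rewrite mulrC expRM. Qed.

(** All bases are positive, so in exponential form the identity reduces to one between exponents. *)
Lemma morrey_algebra (R : realType) (n p rho w b k : R) : 0 < p -> 0 < rho ->
  0 < w -> 0 < b -> 0 < k ->
  (rho `^ p * b^-1) `^ p^-1 * (k * (rho `^ n * w)) `^ (1 - p^-1) =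
  rho `^ n * w * (w^-1 `^ p^-1 * b^-1 `^ p^-1 * k `^ (1 - p^-1) * rho `^ (1 - n / p)).
Proof.
move=> p0 rho0 w0 b0 k0.
rewrite -(lnK rho0) -(lnK w0) -(lnK b0) -(lnK k0).
move: (ln rho) (ln w) (ln b) (ln k) => r lw lb lk {rho0 w0 b0 k0}.
rewrite -!expRN !powR_expRE -!expRD !powR_expRE -!expRD; congr expR.
by field; rewrite gt_eqF.
Qed.

(** [rho] is the radius for which the two coefficients in [morrey_sup] become E al^(1/p) and E with
    one and the same E. The bound is then E times the sum of the p-th roots of [al * B] and [A],
    which fits the energy; E is [k_a] without its power of 2. *)
Lemma morrey_radius (R : realType) (n p al w b m : R) : 0 < p ->
  0 < al -> 0 < w -> 0 < b -> 0 < m ->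
  let rho := al^-1 `^ p^-1 * b `^ p^-1 / m `^ (1 - p^-1) in
  let E := (1 / al) `^ ((p - n) / p ^+ 2) * w^-1 `^ p^-1 *
    (1 / b `^ (n / p ^+ 2)) * m `^ (n * (p - 1) / p ^+ 2) in
  (rho `^ n * w)^-1 `^ p^-1 = E * al `^ p^-1 /\
  w^-1 `^ p^-1 * b^-1 `^ p^-1 * m `^ (1 - p^-1) * rho `^ (1 - n / p) = E.
Proof.
move=> p0 al0 w0 b0 m0; rewrite !div1r.
rewrite -(lnK al0) -(lnK w0) -(lnK b0) -(lnK m0).
move: (ln al) (ln w) (ln b) (ln m) => ral rw rb rm {al0 w0 b0 m0} /=.
have pn : p != 0 by rewrite gt_eqF.
have eV (x : R) : (expR x)^-1 = expR (- x) by rewrite expRN.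
have eM (x y : R) : expR x * expR y = expR (x + y) by rewrite expRD.
by split; rewrite !(eV, powR_expRE, eM); congr expR; field.
Qed.

Section continuity_rV.
Context {R : realType} {N : nat}.

Lemma continuous_rV_dist (f : 'rV[R]_N -> R) : continuous f ->
  forall (x : 'rV[R]_N) (e : R), 0 < e -> exists2 d : R, 0 < d &
    forall y : 'rV[R]_N, (forall i, `|x 0 i - y 0 i| < d) -> `|f x - f y| < e.
Proof.
move=> cf x e e0; have /nbhs_ballP[d /= d0 Hd] := cf x _ (nbhsx_ballx (f x) e e0).
exists d => // y xy; have yb : ball x d y by split => // i j; rewrite (ord1 i); exact: xy.
exact: Hd yb.
Qed.

Lemma continuous_translation (h : 'rV[R]_N -> R) (x : 'rV[R]_N) :
  continuous h -> continuous (fun y : 'rV[R]_N => h (x + y)).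
Proof.
move=> ch; apply: continuous_rV => y e e0.
have [d d0 Hd] := continuous_rV_dist ch (x + y) e0; exists d => // z yz.
by apply: Hd => i; rewrite !mxE opprD addrACA subrr add0r.
Qed.

End continuity_rV.

(** * Pointwise Morrey estimates with explicit constants *)

Section morrey_inequality.
Context {R : realType} {N : nat} (p : R).
Local Notation mu := (@lebesgue_rV R N).
Local Notation w := (@eball_volume R N).
Hypotheses (N_ge1 : (1 <= N)%N) (N_lt_p : N%:R < p).
Context (f : 'rV[R]_N -> R) (G : 'rV[R]_N -> 'rV[R]_N) (A B : R).
Hypotheses (fG : C1_pair f G) (A0 : 0 <= A) (B0 : 0 <= B).
Hypothesis GA : (\int[mu]_y (enorm (G y) `^ p)%:E <= A%:E)%E.
Hypothesis fB : (\int[mu]_y (`|f y| `^ p)%:E <= B%:E)%E.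

Let N0 : 0 < N%:R :> R. Proof. by rewrite ltr0n. Qed.
Let p_gt1 : 1 < p. Proof. by apply: le_lt_trans N_lt_p; rewrite ler1n. Qed.
Let p0 : 0 < p. Proof. exact: lt_trans p_gt1. Qed.
Let w0 : 0 < w. Proof. exact: (eball_volume_gt0 N).1. Qed.

Definition morrey_cst : R :=
  w^-1 `^ p^-1 * N%:R^-1 `^ p^-1 * ((p - 1) / (p - N%:R)) `^ (1 - p^-1).

Let mf : measurable_fun setT f.
Proof. by apply: continuous_measurable_rV; case: fG. Qed.

Let cosc (x : 'rV[R]_N) (k : R) : continuous (fun y : 'rV[R]_N => `|f (x + y) - k|).
Proof.
have [cf _ _] := fG.
have ct := @continuous_translation _ _ f x cf.
apply: continuous_rV => y e e0; have [d d0 Hd] := continuous_rV_dist ct y e0.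
exists d => // z yz; apply: le_lt_trans (ler_dist_dist _ _) _.
by rewrite opprB addrA subrK; exact: Hd.
Qed.

Let mosc D (x : 'rV[R]_N) (k : R) :
  measurable_fun D (fun y : 'rV[R]_N => (`|f (x + y) - k|)%:E).
Proof.
apply/measurable_EFinP; apply: measurable_funTS.
by apply: continuous_measurable_rV; exact: cosc.
Qed.

Let mG : measurable_fun setT (fun y => enorm (G y)).
Proof.
apply: continuous_measurable_rV => y; apply: (@cvg_comp _ _ _ G (@enorm R N)).
  by case: fG => _ cG _; exact: cG.
exact: continuous_enorm.
Qed.

Let mline D (x : 'rV[R]_N) : measurable_fun D (fun y : 'rV[R]_N =>
  \int[lebesgue_measure]_(t in `]0%R, 1%R[) (enorm (G (x + t *: y)) * enorm y)%:E)%E.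
Proof.
apply: measurable_funTS.
pose k (z : measurableTypeR R * 'rV[R]_N) : R :=
  enorm (G (x + z.1 *: z.2)) * enorm z.2 * \1_(`]0%R, 1%R[%classic) z.1.
have mk : measurable_fun setT (EFin \o k).
  apply/measurable_EFinP; apply: measurable_funM.
    apply: measurable_funM.
      by apply: (measurableT_comp mG); exact: measurable_dilation.
    by apply: (measurableT_comp (@measurable_enorm R N)); exact: measurable_snd.
  by apply: measurableT_comp;
    [apply: measurable_indic; exact: measurable_itv|exact: measurable_fst].
have k0 z : (0 <= (EFin \o k) z)%E by rewrite lee_fin !mulr_ge0 ?enorm_ge0.
apply: eq_measurable_fun (measurable_fun_fubini_tonelli_G (m1 := lebesgue_measure) _ mk k0) => y _.
by rewrite /fubini_G [RHS]integral_mkcond; apply: eq_integral => t _; rewrite epatch_indic.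
Qed.

Lemma morrey_oscillation x (rho : R) : 0 < rho ->
  (\int[mu]_(y in eball 0%R rho) (`|f (x + y) - f x|)%:E <=
   (rho ^+ N * w * (morrey_cst * rho `^ (1 - N%:R / p) * A `^ p^-1))%:E)%E.
Proof.
move=> rho0.
have := morrey_mean x N_ge1 N_lt_p rho0 A0 mG (fun y => enorm_ge0 (G y)) GA.
set M := (X in (_ <= X%:E)%E) => h.
apply: (@le_trans _ _ M%:E).
  apply: le_trans h; apply: ge0_le_integral => //.
  - exact: measurable_eball.
  - by move=> y _; exact: C1_pair_integral_le.
rewrite lee_fin {h}/M -(powR_mulrn _ (ltW rho0)).
have k0 : 0 < (p - 1) / (p - N%:R) by rewrite divr_gt0// subr_gt0.
(* The factor 1/p of the mean estimate is enlarged to 1/N, which is the value that enters [k_a]. *)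
apply: (@le_trans _ _ (((rho `^ p) * N%:R^-1) `^ p^-1 * A `^ p^-1 *
    ((p - 1) / (p - N%:R) * (rho `^ N%:R * w)) `^ (1 - p^-1))).
  rewrite ler_wpM2r ?powR_ge0// -powRM ?mulr_ge0 ?powR_ge0 ?invr_ge0 ?(ltW N0)//.
  rewrite ge0_ler_powR ?nnegrE ?mulr_ge0 ?powR_ge0 ?invr_ge0 ?(ltW N0) ?(ltW p0)//.
  by rewrite ler_wpM2r// ler_wpM2l ?powR_ge0// lef_pV2 ?posrE// ltW.
rewrite mulrAC (morrey_algebra _ p0 rho0 w0 N0 k0) /morrey_cst !mulrA.
by rewrite le_eqVlt; apply/orP; left; apply/eqP; ring.
Qed.

Let ball_cst (k rho : R) : 0 < rho -> 0 <= k ->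
  (\int[mu]_(y in eball 0%R rho) k%:E = (rho ^+ N * w * k)%:E)%E.
Proof.
move=> rho0 k0; rewrite integral_cst//; last exact: measurable_eball.
by apply: (etrans (congr1 _ (lebesgue_eball _ rho0))); rewrite -EFinM mulrC.
Qed.

(** Average |f x| <= |f (x + y)| + |f (x + y) - f x| over the ball of radius [rho]; Hoelder's
    inequality bounds the mean of the first term and the oscillation estimate that of the second. *)
Lemma morrey_sup x (rho : R) : 0 < rho ->
  `|f x| <= (rho ^+ N * w)^-1 `^ p^-1 * B `^ p^-1 +
    morrey_cst * rho `^ (1 - N%:R / p) * A `^ p^-1.
Proof.
move=> rho0; set V := rho ^+ N * w.
have V0 : 0 < V by rewrite mulr_gt0// exprn_gt0.
have mball : measurable (eball (0%R : 'rV[R]_N) rho) by exact: measurable_eball.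
have mfx : measurable_fun setT (fun y => `|f (x + y)|).
  by apply: continuous_measurable_rV => y; have := @cosc x 0 y; under eq_fun do rewrite subr0.
have mfxD D : measurable_fun D (fun y => (`|f (x + y)|)%:E).
  by apply/measurable_EFinP; exact: measurable_funTS.
pose q := (1 - p^-1)^-1; have q0 : 0 < q by rewrite invr_gt0 subr_gt0 invf_lt1.
have pq : p^-1 + q^-1 = 1 by rewrite invrK subrKC.
have h1 : (\int[mu]_(y in eball 0%R rho) (`|f (x + y)|)%:E <= (B `^ p^-1 * V `^ (1 - p^-1))%:E)%E.
  have := @ge0_holder_le _ _ R mu (fun y => `|f (x + y)|) (\1_(eball 0%R rho)) p q B V mfx.
  rewrite invrK => H; apply: le_trans (H _ _ _ _ _ _ _ _ _ _) => //.
  - rewrite [leLHS]integral_mkcond le_eqVlt; apply/orP; left; apply/eqP; apply: eq_integral => y _.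
    by rewrite epatch_indic.
  - by rewrite subrKC.
  - exact: ltW.
  - rewrite (ge0_integral_translation x (f := fun y => (`|f y| `^ p)%:E))//.
    apply/measurable_EFinP; apply: (measurableT_comp (measurable_powR p)).
    exact: measurableT_comp.
  - rewrite le_eqVlt; apply/orP; left; apply/eqP.
    transitivity (\int[mu]_y (\1_(eball (0%R : 'rV[R]_N) rho) y)%:E)%E.
      apply: eq_integral => y _; rewrite indicE; case: (_ \in _); rewrite ?powR1//.
      by rewrite powR0// gt_eqF.
    by rewrite integral_indic// setIT; exact: lebesgue_eball.
have h2 := morrey_oscillation x rho0.
have h : ((V * `|f x|)%:E <= (B `^ p^-1 * V `^ (1 - p^-1))%:E +
    (V * (morrey_cst * rho `^ (1 - N%:R / p) * A `^ p^-1))%:E)%E.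
  apply: le_trans (leeD h1 h2); rewrite -ball_cst// -ge0_integralD//.
  apply: ge0_le_integral => //.
  - by apply: emeasurable_funD; [exact: mfxD|exact: mosc].
  move=> y _; rewrite -EFinD lee_fin.
  by have := ler_normB (f (x + y)) (f (x + y) - f x); rewrite subKr.
move: h; rewrite -EFinD lee_fin -ler_pdivlMl// mulrDr mulKf ?gt_eqF// => /le_trans; apply.
rewrite lerD2r mulrCA mulrC ler_wpM2r ?powR_ge0//.
by rewrite powRD ?(gt_eqF V0) ?implybT// powRr1 ?(ltW V0)// mulKf ?gt_eqF// powRN
  -[V^-1]powR_inv1 ?(ltW V0)// -powRrM mulN1r powRN.
Qed.

(** Both values are compared with [f] on the ball of radius [rho] about [x], which lies in the ball
    of radius [2 * rho] about [y]; the ratio of the volumes is the factor 2^N. *)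
Lemma morrey_modulus x y (rho : R) : 0 < rho -> enorm (x - y) <= rho ->
  `|f x - f y| <= morrey_cst * A `^ p^-1 *
    (rho `^ (1 - N%:R / p) + 2 ^+ N * (2 * rho) `^ (1 - N%:R / p)).
Proof.
move=> rho0 xy; set V := rho ^+ N * w.
have V0 : 0 < V by rewrite mulr_gt0// exprn_gt0.
have mball r : measurable (eball (0%R : 'rV[R]_N) r) by exact: measurable_eball.
have rho20 : 0 < 2 * rho by rewrite mulr_gt0.
have h1 := morrey_oscillation x rho0.
have h2 := morrey_oscillation y rho20.
have h3 : (\int[mu]_(z in eball 0%R rho) (`|f (x + z) - f y|)%:E <=
    \int[mu]_(z in eball 0%R (2 * rho)) (`|f (y + z) - f y|)%:E)%E.
  pose k (z : 'rV[R]_N) : \bar R := (`|f (y + z) - f y| * \1_(eball 0 (2 * rho)) z)%:E.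
  have mk : measurable_fun setT k.
    apply/measurable_EFinP; apply: measurable_funM; last exact: measurable_indic.
    by apply: continuous_measurable_rV; exact: cosc.
  have k0 z : (0 <= k z)%E by rewrite lee_fin mulr_ge0.
  rewrite [leRHS]integral_mkcond [leLHS]integral_mkcond.
  have -> : (\int[mu]_z ((fun z => (`|f (y + z) - f y|)%:E) \_ (eball 0%R (2 * rho))) z =
      \int[mu]_z k (x - y + z)%R)%E.
    rewrite (ge0_integral_translation (x - y) mk k0); apply: eq_integral => z _.
    by rewrite epatch_indic.
  apply: ge0_le_integral => //.
  - by move=> z _; rewrite epatch_indic/= -EFinM lee_fin mulr_ge0.
  - rewrite -measurable_restrictT//; exact: mosc.
  - apply: measurableT_comp => //.
    rewrite (_ : +%R (x - y) = (fun z : 'rV[R]_N => 1 *: z + (x - y)));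
      first exact: measurable_affine_rV.
    by apply/funext => z; rewrite scale1r addrC.
  - move=> z _; rewrite epatch_indic/= /k -EFinM lee_fin addrA [y + _]addrC subrK.
    rewrite !indicE; have [zr|] := boolP (z \in eball 0 rho); last by rewrite mulr0 mulr_ge0.
    have zr' : enorm z < rho by move/set_mem : zr; rewrite /eball/= subr0.
    have -> : (x - y + z \in eball 0 (2 * rho)) = true.
      apply/mem_set; rewrite /eball/= subr0; apply: le_lt_trans (ler_enormD _ _) _.
      have -> : 2 * rho = rho + rho by ring.
      exact: ler_ltD.
    by rewrite lexx.
have h : ((V * `|f x - f y|)%:E <=
    (V * (morrey_cst * rho `^ (1 - N%:R / p) * A `^ p^-1))%:E +
    ((2 * rho) ^+ N * w * (morrey_cst * (2 * rho) `^ (1 - N%:R / p) * A `^ p^-1))%:E)%E.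
  apply: le_trans (leeD h1 (le_trans h3 h2)); rewrite -ball_cst// -ge0_integralD//.
  apply: ge0_le_integral => //.
  - by apply: emeasurable_funD; exact: mosc.
  - move=> z _; rewrite -EFinD lee_fin.
    by have := ler_distD (f (x + z)) (f x) (f y); rewrite [`|f x - f (x + z)|]distrC.
move: h; rewrite -EFinD lee_fin -ler_pdivlMl// => /le_trans; apply.
rewrite exprMn -[2 ^+ N * rho ^+ N * w]mulrA -/V le_eqVlt; apply/orP; left; apply/eqP.
by field; rewrite gt_eqF.
Qed.

(** The radius of [morrey_radius] leaves a sum of two p-th roots, and its p-th power is at most
    2^(p-1) times the sum of the terms. This is the origin of 2^((p-1)/p) in [k_a]. *)
Lemma morrey_energy x (al : R) : 0 < al ->
  `|f x| `^ p <= ((1 / al) `^ ((p - N%:R) / p ^+ 2) * 2 `^ ((p - 1) / p) *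
     w^-1 `^ (1 / p) * (1 / N%:R `^ (N%:R / p ^+ 2)) *
     ((p - 1) / (p - N%:R)) `^ (N%:R * (p - 1) / p ^+ 2)) `^ p * (A + al * B).
Proof.
move=> al0; have m0 : 0 < (p - 1) / (p - N%:R) by rewrite divr_gt0// subr_gt0.
pose m := (p - 1) / (p - N%:R).
pose rho := al^-1 `^ p^-1 * N%:R `^ p^-1 / m `^ (1 - p^-1).
have rho0 : 0 < rho by rewrite /rho !(mulr_gt0, divr_gt0) ?invr_gt0 ?powR_gt0 ?invr_gt0.
have [] := @morrey_radius R N%:R p al w N%:R m p0 al0 w0 N0 m0.
rewrite -/rho => H1 H2.
have := morrey_sup x rho0.
rewrite -(powR_mulrn _ (ltW rho0)) H1 /morrey_cst H2 => {H1 H2}.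
set E := _ * m `^ _; set E' := (X in _ -> _ <= X `^ p * _).
have EE : E' `^ p = E `^ p * 2 `^ (p - 1).
  have -> : E' = E * 2 `^ ((p - 1) / p) by rewrite /E' /E [1 / p]div1r -/m; ring.
  by rewrite powRM ?powR_ge0 ?mulr_ge0 ?powR_ge0 ?divr_ge0// -powRrM divfK// gt_eqF.
have E0 : 0 <= E by rewrite !mulr_ge0 ?powR_ge0// divr_ge0 ?powR_ge0.
rewrite EE -mulrA -mulrDr -powRM ?(ltW al0)// => h.
apply: (@le_trans _ _ ((E * ((al * B) `^ p^-1 + A `^ p^-1)) `^ p)).
  by rewrite ge0_ler_powR ?nnegrE ?(ltW p0)// mulr_ge0// addr_ge0 ?powR_ge0.
rewrite powRM ?addr_ge0 ?powR_ge0// -mulrA ler_wpM2l ?powR_ge0//.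
have half : 0 <= (2^-1 : R) <= 1 by rewrite half_itv01.
have := @powR_conv R p 2^-1 ((al * B) `^ p^-1) (A `^ p^-1) (ltW p_gt1) (powR_ge0 _ _)
  (powR_ge0 _ _) half.
have h2 : (1 - 2^-1 = 2^-1 :> R) by lra.
have pn : p != 0 by rewrite gt_eqF.
have K (z : R) : 0 <= z -> (z `^ p^-1) `^ p = z.
  by move=> z0; rewrite -powRrM mulVf// powRr1.
rewrite h2 -!mulrDr [X in X <= _ -> _]powRM ?addr_ge0 ?powR_ge0 ?invr_ge0//.
rewrite !K// ?mulr_ge0 ?(ltW al0)// (addrC (al * B) A).
have -> : (2^-1 : R) `^ p = 2^-1 * (2 `^ (p - 1))^-1.
  rewrite -[2^-1 in LHS]powR_inv1// -powRrM mulN1r powRN -invfM; congr _^-1.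
  transitivity ((2 : R) `^ (1 + (p - 1))); first by rewrite subrKC.
  by rewrite [LHS]powRD ?powRr1// pnatr_eq0 implybT.
by rewrite -mulrA ler_pM2l ?invr_gt0// ler_pdivrMl ?powR_gt0.
Qed.

End morrey_inequality.

(** * Translations in L^p *)

Lemma cvg0_le (R : realType) (u : nat -> \bar R) (e : R) : u @ \oo --> 0%E -> 0 < e ->
  exists n0, forall n, (n0 <= n)%N -> (u n <= e%:E)%E.
Proof.
move=> /fine_cvgP[[n1 _ H1] H2] e0.
have /cvgrPdist_lt/(_ _ e0)[n2 _ {}H2] := H2.
exists (maxn n1 n2) => n; rewrite geq_max => /andP[/H1 h1 /H2/=].
by rewrite sub0r normrN -[in X in _ -> X](fineK h1) lee_fin => /ltW; apply: le_trans;
  exact: ler_norm.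
Qed.

Import HBNNSimple.

Section pint.
Context d (T : measurableType d) (R : realType) (mu : {measure set T -> \bar R}).
Implicit Types (f g : T -> R).

Lemma dominated_small (F : nat -> T -> R) g : (forall n, measurable_fun setT (F n)) ->
  mu.-integrable setT (EFin \o g) -> (forall n x, 0 <= F n x <= g x) ->
  (forall x, F ^~ x @ \oo --> (0 : R)) -> forall e, 0 < e ->
  exists n0, forall n, (n0 <= n)%N -> (\int[mu]_x (F n x)%:E <= e%:E)%E.
Proof.
move=> mF ig Fg F0 e e0; apply: cvg0_le => //.
have mF' n : measurable_fun setT (EFin \o F n) by apply/measurable_EFinP.
have F0' : {ae mu, forall x, setT x -> (EFin \o F n) x @[n --> \oo] --> (0 : \bar R)%E}.
  by apply: nearW => x _; apply: cvg_EFin; [exact: nearW|exact: F0].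
have Fg' : {ae mu, forall x n, setT x -> (`|(EFin \o F n) x| <= (EFin \o g) x)%E}.
  apply: nearW => x n _ /=; rewrite lee_fin.
  by have /andP[h0 h1] := Fg n x; rewrite ger0_norm.
have [_ _] := dominated_convergence measurableT mF' (measurable_cst 0%E) F0' ig Fg'.
by rewrite integral0.
Qed.

Variable p : R.

Definition pint f : \bar R := (\int[mu]_x (`|f x| `^ p)%:E)%E.

Lemma measurable_abs_powR f : measurable_fun setT f ->
  measurable_fun setT (fun x => (`|f x| `^ p)%:E).
Proof.
move=> mf; apply/measurable_EFinP; apply: (measurableT_comp (measurable_powR p)).
exact: measurableT_comp.
Qed.

Lemma pint_ge0 f : (0 <= pint f)%E.
Proof. by apply: integral_ge0 => x _; rewrite lee_fin powR_ge0. Qed.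

Lemma le_pint f g : 0 < p -> measurable_fun setT f -> measurable_fun setT g ->
  (forall x, `|f x| <= `|g x|) -> (pint f <= pint g)%E.
Proof.
move=> p0 mf mg fg; apply: ge0_le_integral => //.
- exact: measurable_abs_powR.
- exact: measurable_abs_powR.
- by move=> x _; rewrite lee_fin ge0_ler_powR ?nnegrE ?(ltW p0).
Qed.

Lemma pintZ a f : measurable_fun setT f ->
  pint (fun x => a * f x) = ((`|a| `^ p)%:E * pint f)%E.
Proof.
move=> mf; rewrite /pint; under eq_integral do rewrite normrM powRM// EFinM.
rewrite ge0_integralZl//=.
by apply: measurable_abs_powR.
Qed.

Lemma powR_absD (a b : R) : 0 < p -> `|a + b| `^ p <= 2 `^ p * (`|a| `^ p + `|b| `^ p).
Proof.
move=> p0; wlog ab : a b / `|a| <= `|b|.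
  by move=> H; have [/ltW|/H//] := ltP `|b| `|a|; rewrite addrC (addrC (_ `^ p)) => /H.
apply: (@le_trans _ _ ((2 * `|b|) `^ p)).
  rewrite ge0_ler_powR ?nnegrE ?(ltW p0)//; apply: le_trans (ler_normD _ _) _.
  by rewrite mulr_natl mulr2n lerD2r.
by rewrite powRM// ler_wpM2l ?powR_ge0// lerDr powR_ge0.
Qed.

Lemma pintD f g : 0 < p -> measurable_fun setT f -> measurable_fun setT g ->
  (pint (fun x => f x + g x)%R <= (2 `^ p)%:E * (pint f + pint g))%E.
Proof.
move=> p0 mf mg; have := measurable_abs_powR mf; have := measurable_abs_powR mg => mg' mf'.
rewrite /pint -ge0_integralD//.
rewrite -ge0_integralZl//=; last 2 first.
- exact: emeasurable_funD.
- by move=> x _; rewrite -EFinD lee_fin addr_ge0 ?powR_ge0.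
apply: ge0_le_integral => //.
- by apply: measurable_abs_powR; exact: measurable_funD.
- by apply: measurable_funeM; exact: emeasurable_funD.
- by move=> x _; rewrite -EFinD -EFinM lee_fin powR_absD.
Qed.

Lemma pintD_le f g (a b : R) : 0 < p -> measurable_fun setT f -> measurable_fun setT g ->
  (pint f <= a%:E)%E -> (pint g <= b%:E)%E ->
  (pint (fun x => f x + g x)%R <= (2 `^ p * (a + b))%:E)%E.
Proof.
move=> p0 mf mg fa gb; apply: le_trans (pintD p0 mf mg) _.
by rewrite EFinM EFinD lee_wpmul2l ?lee_fin ?powR_ge0// leeD.
Qed.

End pint.

Section translation_continuity.
Context {R : realType} {N : nat} (p : R).
Hypothesis p0 : 0 < p.
Local Notation mu := (@lebesgue_rV R N).
Implicit Types (f g : 'rV[R]_N -> R) (x y h : 'rV[R]_N).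

Definition translation_gap f h := pint mu p (fun x => f (h + x) - f x).

(** Every function in L^p will be shown to have this property. It is stable under linear
    combinations and L^p limits, so it spreads from open sets of finite measure to all measurable
    ones and then to all functions. *)
Definition translation_continuous f := [/\ measurable_fun setT f, (pint mu p f < +oo)%E &
  forall e : R, 0 < e -> exists2 d : R, 0 < d & forall h, enorm h < d ->
    (translation_gap f h <= e%:E)%E].

Lemma measurable_shift h : measurable_fun setT (fun x : 'rV[R]_N => h + x).
Proof.
rewrite (_ : (fun _ => _) = (fun x : 'rV[R]_N => 1 *: x + h)); first exact: measurable_affine_rV.
by apply/funext => x; rewrite scale1r addrC.
Qed.

Lemma measurable_translate f h : measurable_fun setT f -> measurable_fun setT (fun x => f (h + x)).
Proof. by move=> mf; apply: (measurableT_comp mf); exact: measurable_shift. Qed.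

Let mgap f h : measurable_fun setT f -> measurable_fun setT (fun x => f (h + x) - f x).
Proof. by move=> mf; apply: measurable_funB => //; exact: measurable_translate. Qed.

Lemma pint_translation f h : measurable_fun setT f -> pint mu p (fun x => f (h + x)) = pint mu p f.
Proof.
move=> mf; rewrite /pint (ge0_integral_translation h (f := fun y => (`|f y| `^ p)%:E))//.
exact: measurable_abs_powR.
Qed.

Lemma translation_continuousD f g : translation_continuous f -> translation_continuous g ->
  translation_continuous (fun x => f x + g x).
Proof.
move=> [mf foo cf] [mg goo cg]; split; first exact: measurable_funD.
  apply: le_lt_trans (pintD _ p0 mf mg) _.
  rewrite lte_mul_pinfty ?lee_fin ?powR_ge0//.
  by rewrite lte_add_pinfty; [|exact: foo|exact: goo].
move=> e e0; have k0 : 0 < (2 : R) `^ p by rewrite powR_gt0.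
have e'0 : 0 < e / 2 `^ p / 2 by rewrite !divr_gt0.
have [d1 d10 h1] := cf _ e'0; have [d2 d20 h2] := cg _ e'0.
exists (Num.min d1 d2); first by rewrite lt_min d10.
move=> h; rewrite lt_min => /andP[/h1 {}h1 /h2 {}h2].
rewrite /translation_gap.
rewrite (_ : (fun x => _) = (fun x => (f (h + x) - f x) + (g (h + x) - g x))); last first.
  by apply/funext => x; rewrite opprD addrACA.
have := pintD_le p0 (mgap h mf) (mgap h mg) h1 h2.
rewrite (_ : _ * _ = e)//; field; exact: lt0r_neq0.
Qed.

Lemma translation_continuousZ a f : translation_continuous f ->
  translation_continuous (fun x => a * f x).
Proof.
move=> [mf foo cf]; split; first exact: measurable_funM.
  rewrite pintZ// -(fineK (_ : pint mu p f \is a fin_num)) ?ge0_fin_numE ?pint_ge0//.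
  by rewrite -EFinM ltry.
move=> e e0; have k0 : 0 < `|a| `^ p + 1 by rewrite ltr_wpDl ?powR_ge0.
have [d d0 hd] := cf _ (divr_gt0 e0 k0); exists d => // h /hd {}hd.
rewrite /translation_gap (_ : (fun x => _) = (fun x => a * (f (h + x) - f x))); last first.
  by apply/funext => x; rewrite mulrBr.
rewrite pintZ; last exact: mgap.
apply: le_trans (lee_wpmul2l _ hd) _; first by rewrite lee_fin powR_ge0.
by rewrite -EFinM lee_fin mulrCA ger_pMr// ler_pdivrMr// mul1r lerDl.
Qed.

Lemma translation_continuous0 : translation_continuous (fun=> 0).
Proof.
have z : pint mu p (fun=> 0 : R) = 0%E.
  by apply: integral0_eq => x _; rewrite normr0 powR0// gt_eqF.
split; [exact: measurable_cst|by rewrite z|move=> e e0; exists 1 => // h _].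
by rewrite /translation_gap subrr z lee_fin ltW.
Qed.

Lemma translation_continuous_sum (I : Type) (s : seq I) (c : I -> R) (F : I -> 'rV[R]_N -> R) :
  (forall i, translation_continuous (F i)) ->
  translation_continuous (fun x => \sum_(i <- s) c i * F i x).
Proof.
move=> cF; elim: s => [|i s IH].
  rewrite (_ : (fun _ => _) = fun=> 0); first exact: translation_continuous0.
  by apply/funext => x; rewrite big_nil.
rewrite (_ : (fun _ => _) = fun x => c i * F i x + \sum_(i <- s) c i * F i x).
  exact: translation_continuousD (translation_continuousZ (c i) (cF i)) IH.
by apply/funext => x; rewrite big_cons.
Qed.

Lemma translation_continuous_approx f : measurable_fun setT f -> (pint mu p f < +oo)%E ->
  (forall e : R, 0 < e -> exists2 g, translation_continuous g &
     (pint mu p (fun x => f x - g x)%R <= e%:E)%E) -> translation_continuous f.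
Proof.
move=> mf foo H; split=> // e e0; have k0 : 0 < (2 : R) `^ p by rewrite powR_gt0.
pose e' := e / (2 `^ p * (2 `^ p * 2 + 1)).
have e'0 : 0 < e' by rewrite divr_gt0// mulr_gt0// addr_gt0// mulr_gt0.
have [g [mg goo cg] fg] := H _ e'0; have [d d0 hd] := cg _ e'0.
exists d => // h /hd {}hd; rewrite /translation_gap.
have mfg : measurable_fun setT (fun x => f x - g x) by exact: measurable_funB.
rewrite (_ : (fun x => _) = (fun x => ((f (h + x) - g (h + x)) + (g (h + x) - g x)) +
   -1 * (f x - g x))); last first.
  by apply/funext => x; ring.
have fgh : (pint mu p (fun x => f (h + x)%R - g (h + x)%R)%R <= e'%:E)%E.
  by apply: le_trans fg; rewrite (pint_translation h mfg) lexx.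
have gf : (pint mu p (fun x => -1 * (f x - g x))%R <= e'%:E)%E.
  by rewrite pintZ ?normrN1 ?powR1 ?mul1e; [exact: fg|exact: mfg].
have mfgh := measurable_translate h mfg.
have := pintD_le p0 mfgh (mgap h mg) fgh hd => H1.
have mH1 : measurable_fun setT (fun x => f (h + x) - g (h + x) + (g (h + x) - g x)).
  by apply: measurable_funD => //; exact: mgap.
have mH2 : measurable_fun setT (fun x => -1 * (f x - g x)) by exact: measurable_funM.
have := pintD_le p0 mH1 mH2 H1 gf.
rewrite (_ : _ * _ = e)//; rewrite /e'; field.
by rewrite !lt0r_neq0 ?addr_gt0 ?mulr_gt0.
Qed.

Lemma open_eball x (r : R) : open (eball x r).
Proof.
rewrite openE => y yr; pose e := r - enorm (y - x).
have e0 : 0 < e by rewrite subr_gt0.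
have c : continuous (fun z : 'rV[R]_N => enorm (z - x)).
  apply: continuous_rV => z e1 e10.
  have [d d0 Hd] := continuous_rV_dist (@continuous_enorm R N) (z - x) e10.
  by exists d => // w zw; apply: Hd => i; rewrite !mxE opprB addrA subrK.
have H : nbhs y [set z | ball (enorm (y - x)) e (enorm (z - x))] := c y _ (nbhsx_ballx _ _ e0).
apply: filterS H => z /=.
rewrite /ball/= => h;
  rewrite /eball/= -subr_gt0 (lt_le_trans _ (_ : e - `|enorm (y - x) - enorm (z - x)| <= _))//.
  by rewrite subr_gt0.
by rewrite /e -addrA -opprD lerD2l lerN2 -lerBlDl distrC ler_norm.
Qed.

(** If exactly one of [x] and [h + x] lies in [U], it is a point of [U] at distance at most |h| from
    the complement. The sets of points of [U] closer than 1/(n+1) to the complement decrease to the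
    empty set because [U] is open, and their measure tends to 0 because that of [U] is finite. *)
Lemma translation_continuous_open (U : set 'rV[R]_N) : open U -> (mu U < +oo)%E ->
  translation_continuous \1_U.
Proof.
move=> oU Uoo; have mU := open_measurable_rV oU.
have mI (A : set 'rV[R]_N) : measurable A -> measurable_fun setT (\1_A : 'rV[R]_N -> R).
  by move=> mA; exact: measurable_indic.
have pI (b : bool) : `|b%:R| `^ p = b%:R :> R.
  by case: b; rewrite ?normr1 ?powR1// normr0 powR0// gt_eqF.
split; first exact: mI.
  rewrite /pint; under eq_integral do rewrite indicE pI -indicE.
  by rewrite integral_indic// setIT.
pose C n : set 'rV[R]_N := \bigcup_(y in ~` U) eball y n.+1%:R^-1.
have mC n : measurable (C n).
  by apply: open_measurable_rV; apply: bigcup_open => y _; exact: open_eball.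
pose F n := U `&` C n.
have mF n : measurable (F n) by exact: measurableI.
have F0 : \bigcap_n F n = set0.
  apply/seteqP; split => // x Fx; have [Ux _] := Fx 0 I.
  have := oU; rewrite openE => /(_ x Ux) /nbhs_ballP[e/= e0 He].
  have [n _ /(_ n (leqnn n))/= hn] := near_infty_natSinv_lt (PosNum e0).
  have [_ [y yU /= xy]] := Fx n I; apply: yU; apply: He; split => // i j.
  rewrite (ord1 i) /ball/=; apply: le_lt_trans (lt_trans xy hn).
  by have := ler_coord_enorm (x - y) j; rewrite !mxE.
have ndF : {homo F : n m / (n <= m)%N >-> (m <= n)%O}.
  move=> n m nm; apply/subsetPset => x [Ux [y yU xy]]; split => //; exists y => //.
  by apply: lt_le_trans xy _; rewrite lef_pV2 ?posrE// ler_nat.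
have F0oo : (mu (F 0%N) < +oo)%E.
  by apply: le_lt_trans Uoo; rewrite le_measure ?inE//; apply: subIsetl.
have cF : mu \o F @ \oo --> 0%E.
  by have := nonincreasing_cvg_mu F0oo mF _ ndF; rewrite F0 measure0; apply.
move=> e e0; have [|n Hn] := cvg0_le cF (_ : 0 < e / 2); first exact: divr_gt0.
exists n.+1%:R^-1 => [|h hn]; first by rewrite invr_gt0.
have {}Hn := Hn n (leqnn n); rewrite /translation_gap /pint.
apply: (@le_trans _ _ (\int[mu]_x ((\1_(F n) (h + x)%R)%:E + (\1_(F n) x)%:E))%E).
  apply: ge0_le_integral => //.
  - by apply: measurable_abs_powR; apply: mgap; exact: mI.
  - by apply: emeasurable_funD; apply/measurable_EFinP; [apply: measurable_translate|]; exact: mI.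
  move=> x _; rewrite -EFinD lee_fin !indicE.
  have [xU|xU] := boolP (x \in U); have [hU|hU] := boolP (h + x \in U).
  - by rewrite subrr normr0 powR0 ?addr_ge0// gt_eqF.
  - rewrite (_ : x \in F n); first by rewrite sub0r normrN (pI true) lerDr.
    rewrite inE; split; first exact/set_mem.
    exists (h + x); first by move=> /mem_set; rewrite (negbTE hU).
    by rewrite /eball/= opprD addrCA subrr addr0 enormN.
  - rewrite (_ : h + x \in F n); first by rewrite subr0 (pI true) lerDl.
    rewrite inE; split; first exact/set_mem.
    exists x; first by move=> /mem_set; rewrite (negbTE xU).
    by rewrite /eball/= addrK.
  - by rewrite subrr normr0 powR0 ?addr_ge0// gt_eqF.
rewrite ge0_integralD//=; last 2 first.
- by apply/measurable_EFinP; apply: measurable_translate; exact: mI.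
- by apply/measurable_EFinP; exact: mI.
rewrite (ge0_integral_translation h (f := fun y => (\1_(F n) y)%:E))//; last first.
  by apply/measurable_EFinP; exact: mI.
rewrite integral_indic// setIT; apply: le_trans (leeD Hn Hn) _.
by rewrite -EFinD lee_fin -splitr.
Qed.

(** The product sigma-algebra is the Borel one; as open sets are stable under intersection,
    properties of measurable sets can be proved by Dynkin induction from open sets. *)
Lemma rV_measurable_open : @measurable _ 'rV[R]_N = <<s [set U : set 'rV[R]_N | open U] >>.
Proof.
apply/seteqP; split => A; last first.
  apply: smallest_sub; first exact: sigma_algebra_measurable.
  by move=> U oU; exact: open_measurable_rV.
apply: smallest_sub; first exact: smallest_sigma_algebra.
rewrite -bigcup_seq => B [i _ [C mC <-]]; rewrite setTI.
pose D := [set C : set R | <<s [set U : set 'rV[R]_N | open U] >> (rV_coord i @^-1` C)].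
suff : measurable `<=` D by apply.
have sD : sigma_algebra setT D.
  have [h0 hC hU] := smallest_sigma_algebra setT [set U : set 'rV[R]_N | open U].
  split.
  - by rewrite /D/= preimage_set0.
  - by move=> E; rewrite /D/= !setTD -preimage_setC => /hC; rewrite setTD.
  - by move=> E HE; rewrite /D/= preimage_bigcup; exact: hU.
have -> : @measurable _ R = <<s @RGenOInfty.G R >> := RGenOInfty.measurableE R.
apply: smallest_sub => // _ [x ->].
apply: sub_sigma_algebra => /=; apply: open_comp => //.
by move=> y _; exact: coord_continuous.
Qed.

(** Cutting with a fixed [U] of finite measure keeps all indicators in L^p throughout the Dynkin
    induction, in particular for complements. *)
Lemma translation_continuous_indic (A U : set 'rV[R]_N) : open U -> (mu U < +oo)%E ->
  measurable A -> translation_continuous \1_(A `&` U).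
Proof.
move=> oU Uoo; have mU := open_measurable_rV oU.
have mI (B : set 'rV[R]_N) : measurable B -> measurable_fun setT (\1_B : 'rV[R]_N -> R).
  by move=> mB; exact: measurable_indic.
have pI (b : bool) : `|b%:R| `^ p = b%:R :> R.
  by case: b; rewrite ?normr1 ?powR1// normr0 powR0// gt_eqF.
have pintI (B : set 'rV[R]_N) : measurable B -> pint mu p \1_B = mu B.
  move=> mB; rewrite /pint; under eq_integral do rewrite indicE pI -indicE.
  by rewrite integral_indic// setIT.
pose P B := translation_continuous \1_(B `&` U).
rewrite rV_measurable_open; move: A; apply: (dynkin_induction (P := P)).
- exact: rV_measurable_open.
- by move=> B C; exact: openI.
- by rewrite /P setTI; exact: translation_continuous_open.
- move=> B oB; rewrite /P; apply: translation_continuous_open; first exact: openI.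
  apply: le_lt_trans Uoo; apply: le_measure; rewrite ?inE//.
  by apply: measurableI => //; exact: open_measurable_rV.
- move=> B mB cB; rewrite /P.
  rewrite (_ : \1_(~` B `&` U) = fun x => \1_U x + -1 * \1_(B `&` U) x).
    exact: (translation_continuousD (translation_continuous_open oU Uoo)
      (translation_continuousZ (-1) cB)).
  apply/funext => x; rewrite !indicE !in_setI in_setC.
  by case: (x \in B); case: (x \in U); rewrite /= ?mulr0 ?mulN1r ?subrr ?addr0.
- move=> F mF tF cF; rewrite /P; pose G n := \big[setU/set0]_(i < n) F i.
  have mG n : measurable (G n) by exact: bigsetU_measurable.
  have mUF : measurable (\bigcup_k F k) by exact: bigcup_measurable.
  have cG n : translation_continuous \1_(G n `&` U).
    elim: n => [|n IH].
      rewrite /G big_ord0 set0I (_ : \1_set0 = fun=> 0); first exact: translation_continuous0.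
      by apply/funext => x; rewrite indicE in_set0.
    rewrite (_ : \1_(G n.+1 `&` U) = fun x => \1_(G n `&` U) x + \1_(F n `&` U) x).
      by apply: (translation_continuousD IH (cF n)).
    apply/funext => x; rewrite /G big_ord_recr/= !indicE !in_setI in_setU.
    have : ~ (x \in G n /\ x \in F n).
      move=> [/set_mem]; rewrite /G -bigcup_mkord => -[i/= ik Fi] /set_mem Fn.
      by move: (tF i n I I (ex_intro _ x (conj Fi Fn))) ik => ->; rewrite ltnn.
    by rewrite -/(G n); case: (x \in G n); case: (x \in F n); case: (x \in U) => //=;
      rewrite ?addr0 ?add0r// => H; case: H.
  apply: translation_continuous_approx.
  - by apply: mI; exact: measurableI.
  - rewrite pintI; last exact: measurableI.
    by apply: le_lt_trans Uoo; apply: le_measure; rewrite ?inE//; exact: measurableI.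
  move=> e e0; pose H n := (\bigcup_k F k `\` G n) `&` U.
  have mH n : measurable (H n) by apply: measurableI => //; exact: measurableD.
  have H0 : \bigcap_n H n = set0.
    apply/seteqP; split => // x Hx; have [[[k _ Fk] _] _] := Hx 0%N I.
    have [[_ +] _] := Hx k.+1 I; apply; rewrite /G -bigcup_mkord.
    by exists k => //=.
  have ndH : {homo H : n m / (n <= m)%N >-> (m <= n)%O}.
    move=> n m nm; apply/subsetPset => x [[Fx Gx] Ux]; split => //; split => // Gnx; apply: Gx.
    move: Gnx; rewrite /G -!bigcup_mkord => -[k /= kn Fk]; exists k => //=.
    exact: leq_trans nm.
  have H0oo : (mu (H 0%N) < +oo)%E.
    by apply: le_lt_trans Uoo; rewrite le_measure ?inE//; apply: subIsetr.
  have cH : mu \o H @ \oo --> 0%E.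
    by have := nonincreasing_cvg_mu H0oo mH _ ndH; rewrite H0 measure0; apply.
  have [n /(_ n (leqnn n)) Hn] := cvg0_le cH e0.
  exists \1_(G n `&` U); first exact: cG.
  rewrite (_ : (fun x => _) = \1_(H n)); first by rewrite pintI.
  apply/funext => x; rewrite !indicE /H setDE !in_setI in_setC.
  have : x \in G n -> x \in \bigcup_k F k.
    move=> /set_mem; rewrite /G -bigcup_mkord => -[k /= kn Fk]; apply/mem_set.
    by exists k.
  case: (x \in G n); case: (x \in \bigcup_k F k); case: (x \in U) => //=;
    rewrite ?subrr ?subr0// => H'; by have := H' isT.
Qed.

(** Simple functions increasing to [f], cut off to growing balls, converge to [f] in L^p by
    dominated convergence. *)
Lemma translation_continuous_ge0 f : measurable_fun setT f -> (forall x, 0 <= f x) ->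
  (pint mu p f < +oo)%E -> translation_continuous f.
Proof.
move=> mf f0 foo; have mf' : measurable_fun setT (EFin \o f) by apply/measurable_EFinP.
pose s := nnsfun_approx measurableT mf'.
pose Q n : set 'rV[R]_N := eball 0 n.+1%:R.
have oQ n : open (Q n) by exact: open_eball.
have Qoo n : (mu (Q n) < +oo)%E by rewrite lebesgue_eball// ltry.
have mQ n : measurable (Q n) by exact: measurable_eball.
pose g n x := s n x * \1_(Q n) x.
have mg n : measurable_fun setT (g n) by apply: measurable_funM => //; exact: measurable_indic.
have cvgs x : s ^~ x @ \oo --> f x.
  exact: fine_cvg (cvg_nnsfun_approx measurableT mf' (fun x _ => f0 x) (I : setT x)).
have sf n x : 0 <= s n x <= f x.
  rewrite fun_ge0/=; have := cvgs x; have nd := nd_nnsfun_approx measurableT mf'.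
  move=> /[dup] cs; move/(@cvg_lim _ _) <- => //.
  apply: nondecreasing_cvgn_le => [m k mk|]; last by apply/cvg_ex; exists (f x).
  by have /lefP := nd _ _ mk.
have gf n x : 0 <= g n x <= f x.
  have /andP[s0 s1] := sf n x; rewrite /g mulr_ge0//=; apply: le_trans s1.
  by rewrite ler_piMr// indicE; case: (_ \in _).
have cg n : translation_continuous (g n).
  pose sn : 'rV[R]_N -> R := s n.
  have [r rE] : exists r : seq R, forall x, sn x = \sum_(y <- r) y * \1_[set x | sn x = y] x.
    exists (finmap.enum_fset (fset_set (range (s n)))) => x.
    by rewrite /sn [LHS]fimfunE fsbig_finite.
  pose F (y : R) : 'rV[R]_N -> R := \1_([set x | sn x = y] `&` Q n).
  rewrite (_ : g n = fun x => \sum_(y <- r) y * F y x).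
    apply: translation_continuous_sum => y; apply: translation_continuous_indic.
    - exact: oQ.
    - exact: Qoo.
    - have := measurable_funP (s n) measurableT [set y] (measurable_set1 y); rewrite setTI; exact.
  apply/funext => x; rewrite /g -[s n x]/(sn x) rE mulr_suml; apply: eq_bigr => y _.
  by rewrite -mulrA /F indicI.
apply: translation_continuous_approx => // e e0.
have [||||n Hn] := @dominated_small _ _ _ mu (fun n x => `|f x - g n x| `^ p)
  (fun x => `|f x| `^ p) _ _ _ _ e e0.
- by move=> n; apply/measurable_EFinP; apply: measurable_abs_powR; exact: measurable_funB.
- apply/integrableP; split; first exact: measurable_abs_powR.
  by under eq_integral do rewrite gee0_abs ?lee_fin ?powR_ge0//.
- move=> n x; rewrite powR_ge0/= ge0_ler_powR ?nnegrE ?(ltW p0)//.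
  have /andP[g0 g1] := gf n x; rewrite !ger0_norm ?subr_ge0//.
  by rewrite gerBl.
- move=> x; have [n0 xn0] : exists n0 : nat, enorm x < n0%:R.
    by exists (Num.truncn (enorm x)).+1; exact: truncnS_gt.
  have cg0 : (fun n => f x - g n x) @ \oo --> (0 : R).
    rewrite -(subrr (f x)); apply: cvgB; first exact: cvg_cst.
    apply: cvg_trans (cvgs x); apply: near_eq_cvg; exists n0 => // n /= n0n.
    rewrite /g indicE mem_set ?mulr1// /Q /eball/= subr0; apply: lt_le_trans xn0 _.
    by rewrite ler_nat (leq_trans n0n).
  have := cvg_comp _ _ cg0 (@continuous_powR_norm R p p0 0).
  by rewrite normr0 powR0// gt_eqF.
by exists (g n); [exact: cg|exact: Hn].
Qed.

Lemma pint_translation_continuous f : measurable_fun setT f ->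
  (pint mu p f < +oo)%E -> translation_continuous f.
Proof.
move=> mf foo.
rewrite (_ : f = fun x => Num.max (f x) 0 + -1 * Num.max (- f x) 0); last first.
  apply/funext => x; rewrite mulN1r; case: (leP (f x) 0) => h.
    by rewrite max_l ?oppr_ge0// opprK add0r.
  by rewrite max_r ?oppr_le0 ?ltW// subr0.
have mm (g : 'rV[R]_N -> R) :
  measurable_fun setT g -> measurable_fun setT (fun x => Num.max (g x) 0).
  by move=> mg; exact: measurable_maxr.
apply: (@translation_continuousD (fun x => Num.max (f x) 0) (fun x => -1 * Num.max (- f x) 0));
  last apply: translation_continuousZ.
- apply: translation_continuous_ge0; first exact: mm.
    by move=> x; rewrite le_max lexx orbT.
  apply: le_lt_trans foo; apply: le_pint => //; first exact: mm.
  by move=> x; case: (leP (f x) 0) => _ //; rewrite normr0.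
- have mNf : measurable_fun setT (fun x => - f x) by exact: measurableT_comp.
  apply: translation_continuous_ge0; first exact: mm.
    by move=> x; rewrite le_max lexx orbT.
  apply: le_lt_trans foo; apply: le_pint => //; first exact: mm.
  by move=> x; case: (leP (- f x) 0) => _ //; rewrite ?normr0 ?normrN.
Qed.

End translation_continuity.

(** * Test functions and mollification *)

Section flat_function.
Context {R : realType}.

(** The powers of 1/t before exp(-1/t) make the family closed under differentiation up to linear
    combinations, so smoothness is proved for all [m] at once. *)
Definition flat (m : nat) (t : R) : R := if 0 < t then t^-1 ^+ m * expR (- t^-1) else 0.

Lemma flat_ge0 m t : 0 <= flat m t.
Proof.
by rewrite /flat; case: ltP => // t0; rewrite mulr_ge0 ?expR_ge0// exprn_ge0 ?invr_ge0 ?ltW.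
Qed.

Lemma flat_gt0 m t : 0 < t -> 0 < flat m t.
Proof. by move=> t0; rewrite /flat t0 mulr_gt0 ?expR_gt0// exprn_gt0 ?invr_gt0. Qed.

Lemma flat_le0 m t : t <= 0 -> flat m t = 0.
Proof. by rewrite /flat leNgt => /negbTE ->. Qed.

(** From y <= exp y at y = s/(n+1), raised to the power n+1. *)
Lemma exprn_expR_le (s : R) n : 0 <= s -> s ^+ n.+1 * expR (- s) <= n.+1%:R ^+ n.+1.
Proof.
move=> s0; rewrite expRN ler_pdivrMr ?expR_gt0//.
have -> : expR s = expR (s / n.+1%:R) ^+ n.+1.
  by rewrite -expRM_natl mulrC divfK// pnatr_eq0.
rewrite -exprMn; apply: lerXn2r; rewrite ?nnegrE ?mulr_ge0 ?expR_ge0//.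
rewrite -ler_pdivrMl// mulrC; apply: le_trans (expR_ge1Dx _).
by rewrite lerDr.
Qed.

Lemma flat_le m t : `|flat m t| <= m.+1%:R ^+ m.+1 * `|t|.
Proof.
rewrite (ger0_norm (flat_ge0 m t)) /flat; case: ltP => t0; last by rewrite mulr_ge0 ?exprn_ge0.
rewrite (gtr0_norm t0) -ler_pdivrMr// mulrC mulrA -exprS.
by apply: exprn_expR_le; rewrite invr_ge0 ltW.
Qed.

Lemma is_derive_flat m (t : R) :
  is_derive t 1 (flat m) (flat m.+2 t - m%:R * flat m.+1 t).
Proof.
have [t0|t0|t0] := ltgtP t 0.
- rewrite !flat_le0 ?(ltW t0)// mulr0 subrr.
  have H0 : is_derive t 1 (cst 0 : R -> R) 0 by apply: DeriveDef => //; rewrite derive_cst.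
  apply: near_eq_is_derive H0.
  have e0 : 0 < - t by rewrite oppr_gt0.
  apply: filterS (nbhsx_ballx t _ e0) => s; rewrite /ball/= ltr_distlC => /andP[_].
  by rewrite subrr => s0; rewrite flat_le0// ltW.
- apply: (@near_eq_is_derive _ _ _ (fun s : R => s^-1 ^+ m * expR (- s^-1))).
    apply: filterS (nbhsx_ballx t _ t0) => s; rewrite /ball/= ltr_distlC => /andP[].
    by rewrite subrr /flat => ->.
  have tn : t != 0 by rewrite gt_eqF.
  have dV : is_derive t 1 (fun s : R => s^-1) (- (t^-1 ^+ 2)).
    have := @is_deriveV R id t 1 1 tn (is_derive_id _ _).
    by rewrite [_ *: _]mulr1 exprVn.
  have dE : is_derive t 1 (fun s : R => expR (- s^-1)) (expR (- t^-1) * t^-1 ^+ 2).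
    have := @is_derive1_comp _ (@expR R) (fun s => - s^-1) t _ _ (is_derive_expR _) (is_deriveN dV).
    by rewrite opprK.
  have := is_deriveM (is_deriveX m dV) dE.
  have Em : ([eta GRing.inv] : R -> R) ^+ m = fun s => s^-1 ^+ m by rewrite exprfctE.
  rewrite Em; congr (is_derive _ _ _ _); rewrite /flat t0 /GRing.scale/=.
  case: m {dE Em} => [|m]; first by rewrite !expr0 mulr0n; ring.
  by rewrite succnK !exprS; ring.
- rewrite t0 !flat_le0// mulr0 subrr.
  (* At 0 the difference quotient of [flat m] is [flat m.+1], which is bounded by a multiple of
     |h|. *)
  have H : h^-1 *: (flat m (h *: 1 + 0) - flat m 0) @[h --> (0 : R)^'] --> (0 : R).
    have C0 : 0 < m.+2%:R ^+ m.+2 :> R by rewrite exprn_gt0.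
    apply/cvgrPdist_lt => e e0; near=> h; rewrite sub0r normrN.
    rewrite addr0 [h *: 1]mulr1 (flat_le0 m (lexx 0)) subr0.
    have -> : h^-1 *: flat m h = flat m.+1 h.
      by rewrite /flat; case: ifP; rewrite ?scaler0// /GRing.scale/= exprS mulrA.
    apply: le_lt_trans (flat_le _ _) _; rewrite -ltr_pdivlMl//.
    by near: h; apply: dnbhs0_lt; rewrite mulr_gt0// invr_gt0.
  by apply: DeriveDef; [apply/cvg_ex; exists 0|apply/cvg_lim].
Unshelve. all: by end_near. Qed.

End flat_function.

(** * Smooth functions and bumps *)

Section smoothn.
Context {R : realType} {N : nat}.
Implicit Types (u v : 'rV[R]_N -> R) (x y : 'rV[R]_N).

Lemma line_deriveE (f : 'rV[R]_N -> R) x (v : 'rV[R]_N) :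
  'D_v f x = 'D_1 (fun h : R => f (x + h *: v)) 0.
Proof.
rewrite /derive; set g1 := fun h => h^-1 *: _; set g2 := fun h => h^-1 *: _.
suff -> : g1 = g2 by [].
by apply/funext => h; rewrite /g1 /g2 /= [h%:A]mulr1 !addr0 scale0r addr0 [h *: v + x]addrC.
Qed.

Lemma line_derivable (f : 'rV[R]_N -> R) x (v : 'rV[R]_N) :
  derivable f x v <-> derivable (fun h : R => f (x + h *: v)) 0 1.
Proof.
rewrite derivable1P (_ : (fun h : R => f (h *: v + x)) = (fun h : R => f (x + h *: v)))//.
by apply/funext => h; rewrite addrC.
Qed.

Lemma line_is_derive (f : 'rV[R]_N -> R) x (v : 'rV[R]_N) d :
  is_derive x v f d <-> is_derive (0 : R) 1 (fun h : R => f (x + h *: v)) d.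
Proof.
split=> -[h1 h2]; apply: DeriveDef.
- exact/line_derivable.
- by rewrite -line_deriveE.
- exact/line_derivable.
- by rewrite line_deriveE.
Qed.

(** Differentiability to order [k], with induction from the first derivative on. Unlike [smooth],
    which speaks of iterated partial derivatives, it passes through sums and products by a direct
    induction on [k]. *)
Fixpoint smoothn (k : nat) u := if k is k'.+1 then
  (forall x, differentiable u x) /\ forall i, smoothn k' (partial i u) else True.

Lemma smoothnS k u : smoothn k.+1 u -> smoothn k u.
Proof.
by elim: k u => // k IH u [du pu]; split => // i; apply: IH; exact: pu.
Qed.

Lemma smoothnD k u v : smoothn k u -> smoothn k v -> smoothn k (fun x => u x + v x).
Proof.
elim: k u v => // k IH u v [du pu] [dv pv]; split.
  by move=> x; exact: differentiableD.
move=> i; rewrite (_ : partial i _ = fun x => partial i u x + partial i v x).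
  by apply: IH; [exact: pu|exact: pv].
by apply/funext => x; rewrite /partial deriveD//; exact: diff_derivable.
Qed.

Lemma smoothn_cst k (c : R) : smoothn k (fun=> c).
Proof.
elim: k c => // k IH c; split => // i.
by rewrite (_ : partial i _ = fun=> 0)//; apply/funext => x; rewrite /partial derive_cst.
Qed.

Lemma partialM i u v x : differentiable u x -> differentiable v x ->
  partial i (fun x => u x * v x) x = u x * partial i v x + v x * partial i u x.
Proof. by move=> du dv; rewrite /partial deriveM//; exact: diff_derivable. Qed.

Lemma smoothnM k u v : smoothn k u -> smoothn k v -> smoothn k (fun x => u x * v x).
Proof.
elim: k u v => // k IH u v [du pu] [dv pv]; split.
  by move=> x; exact: differentiableM.
move=> i; rewrite (_ : partial i _ = fun x => u x * partial i v x + v x * partial i u x).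
  apply: smoothnD; apply: IH; [|exact: pv| |exact: pu].
    by apply: (@smoothnS k).
  by apply: (@smoothnS k).
by apply/funext => x; exact: partialM.
Qed.

Lemma smoothn_prod k (I : Type) (s : seq I) (F : I -> 'rV[R]_N -> R) :
  (forall i, smoothn k (F i)) -> smoothn k (fun x => \prod_(i <- s) F i x).
Proof.
move=> sF; elim: s => [|i s IH].
  by rewrite (_ : (fun _ => _) = fun=> 1); [exact: smoothn_cst|apply/funext => x; rewrite big_nil].
rewrite (_ : (fun _ => _) = fun x => F i x * \prod_(i <- s) F i x); first exact: smoothnM.
by apply/funext => x; rewrite big_cons.
Qed.

Lemma smooth_smoothn u : (forall k, smoothn k u) -> smooth u.
Proof.
move=> su s; elim/last_ind: s u su => [|s i IH] u su.
  have [du _] := su 1%N; split => [x|i x]; first exact: differentiable_continuous.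
  exact: diff_derivable.
rewrite /partials foldr_rcons; apply: IH => k.
by have [_] := su k.+1; apply.
Qed.

Lemma is_diff_affine_coord (j : 'I_N) (a b : R) x :
  differentiable (fun y : 'rV[R]_N => b + a * y 0 j) x.
Proof.
apply: differentiableD => //; apply: differentiableM => //.
exact: differentiable_coord.
Qed.

Lemma is_derive_affine_coord (f : R -> R) (df : R) (j i : 'I_N) (a b : R) x :
  is_derive (b + a * x 0 j) 1 f df ->
  is_derive x (delta_mx 0 i) (fun y : 'rV[R]_N => f (b + a * y 0 j)) (a * (i == j)%:R * df).
Proof.
move=> d; apply/line_is_derive.
pose g (h : R) := b + a * x 0 j + h * (a * (i == j)%:R).
rewrite (_ : (fun h : R => _) = f \o g); last first.
  apply/funext => h /=; rewrite !mxE/= /g; congr (f _).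
  by rewrite eq_sym; ring.
have dg : is_derive (0 : R) 1 g (a * (i == j)%:R).
  have dM : is_derive (0 : R) 1 (fun h : R => h * (a * (i == j)%:R)) (a * (i == j)%:R).
    have := is_deriveM (is_derive_id (0 : R) 1) (is_derive_cst (a * (i == j)%:R) (0 : R) 1).
    by rewrite scaler0 add0r [_ *: _]mulr1.
  by have := is_deriveD (is_derive_cst (b + a * x 0 j) (0 : R) 1) dM; rewrite add0r.
have g0 : g 0 = b + a * x 0 j by rewrite /g mul0r addr0.
rewrite -g0 in d.
by have := @is_derive1_comp _ f g 0 _ _ d dg; rewrite mulrC.
Qed.

Lemma smoothn_flat k m (j : 'I_N) (a b : R) :
  smoothn k (fun y : 'rV[R]_N => flat m (b + a * y 0 j)).
Proof.
elim: k m => // k IH m; split => [x|i].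
  apply: (@differentiable_comp _ _ _ _ (fun y : 'rV[R]_N => b + a * y 0 j) (flat m)).
    exact: is_diff_affine_coord.
  by apply/derivable1_diffP; have [] := is_derive_flat m (b + a * x 0 j).
rewrite (_ : partial i _ = fun x => a * (i == j)%:R * flat m.+2 (b + a * x 0 j) +
    (- (a * (i == j)%:R * m%:R)) * flat m.+1 (b + a * x 0 j)).
  by apply: smoothnD; apply: smoothnM => //; exact: smoothn_cst.
apply/funext => x; have [_] := is_derive_affine_coord i (is_derive_flat m (b + a * x 0 j)).
by rewrite /partial => ->; ring.
Qed.

(** The two factors are functions of 1 + (y_j - x_j)/e and 1 - (y_j - x_j)/e, in the affine form
    that [smoothn_flat] expects; the product is positive exactly on the open cube of half-side [e]
    about [x]. *)
Definition bump (x : 'rV[R]_N) (e : R) (y : 'rV[R]_N) : R :=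
  \prod_(j < N) (flat 0 (1 - e^-1 * x 0 j + e^-1 * y 0 j) *
                 flat 0 (1 + e^-1 * x 0 j + (- e^-1) * y 0 j)).

Lemma smoothn_bump k x e : smoothn k (bump x e).
Proof. by apply: smoothn_prod => j; apply: smoothnM; exact: smoothn_flat. Qed.

Lemma bump_ge0 x e y : 0 <= bump x e y.
Proof. by apply: prodr_ge0 => j _; rewrite mulr_ge0 ?flat_ge0. Qed.

Lemma bump_eq0 x (e : R) y : 0 < e -> bump x e y != 0 -> forall j, `|y 0 j - x 0 j| < e.
Proof.
move=> e0 /prodf_neq0 H j; have := H j isT; rewrite mulf_eq0 negb_or => /andP[h1 h2].
have k (t : R) : flat 0 t != 0 -> 0 < t by move=> h; rewrite ltNge;
  apply: contraNN h => /(flat_le0 0) ->.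
move/k in h1; move/k in h2; rewrite -(ltr_pM2l (_ : 0 < e^-1)) ?invr_gt0// mulVf ?gt_eqF//.
rewrite -[X in X * _]gtr0_norm ?invr_gt0// -normrM ltr_norml mulrBr; apply/andP; split; lra.
Qed.

Lemma test_function_bump (c : R) x (e : R) : 0 < e -> test_function (fun y => c * bump x e y).
Proof.
move=> e0; split.
  by apply: smooth_smoothn => k; apply: smoothnM; [exact: smoothn_cst|exact: smoothn_bump].
pose K : set 'rV[R]_N := [set v : 'rV[R]_N | forall j, `[x 0 j - e, x 0 j + e]%classic (v 0 j)].
have cK : compact K := @rV_compact R N (fun j => `[x 0 j - e, x 0 j + e]%classic)
  (fun j => @segment_compact R _ _).
have clK : closed K by apply: compact_closed => //; exact: norm_hausdorff.
apply: (subclosed_compact _ cK); first exact: closed_closure.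
rewrite ((closure_id K).1 clK); apply: closureS => y /=.
rewrite mulf_eq0 negb_or => /andP[_ /(bump_eq0 e0) H] j.
by have := H j; rewrite ltr_distl /= in_itv/= => /andP[/ltW -> /ltW ->].
Qed.

End smoothn.

(** * Integration by parts against test functions *)

Section test_functions.
Context {R : realType} {N : nat}.
Local Notation mu := (@lebesgue_rV R N).
Implicit Types (f g u v : 'rV[R]_N -> R) (x y : 'rV[R]_N).

Lemma integral_translation x (f : 'rV[R]_N -> \bar R) : measurable_fun setT f ->
  (\int[mu]_y f (x + y)%R = \int[mu]_y f y)%E.
Proof.
move=> mf; rewrite integralE [RHS]integralE.
have h1 := ge0_integral_translation x (measurable_funepos mf) (fun y => funepos_ge0 f y).
have h2 := ge0_integral_translation x (measurable_funeneg mf) (fun y => funeneg_ge0 f y).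
by congr (_ - _)%E; [rewrite -h1|rewrite -h2]; apply: eq_integral => y _; rewrite !unlock.
Qed.

Lemma Rintegral_translation x f : measurable_fun setT f ->
  \int[mu]_y f (x + y) = \int[mu]_y f y.
Proof.
move=> mf; rewrite /Rintegral (integral_translation x (f := EFin \o f))//.
by apply/measurable_EFinP.
Qed.

Lemma continuous_bounded_on_ball f (r : R) : continuous f ->
  exists2 C : R, 0 <= C & forall y, enorm y < r -> `|f y| <= C.
Proof.
move=> cf; pose K : set 'rV[R]_N := [set v : 'rV[R]_N | forall j, `[- r, r]%classic (v 0 j)].
have cK : compact K := @rV_compact R N (fun j => `[- r, r]%classic)
  (fun j => @segment_compact R _ _).
have cfK : compact (f @` K) by apply: continuous_compact cK; exact: continuous_subspaceT.
have [M [_ HM]] := compact_bounded cfK.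
exists (`|M| + 1); first by rewrite addr_ge0.
have MM : M < `|M| + 1 by apply: le_lt_trans (ler_norm M) _; rewrite ltrDl.
move=> y yr; apply: (HM _ MM); exists y => // j /=.
by rewrite in_itv/= -ler_norml; apply: le_trans (ltW yr); exact: ler_coord_enorm.
Qed.

Lemma compact_enorm_bounded (K : set 'rV[R]_N) : compact K ->
  exists2 r : R, 0 < r & forall y, K y -> enorm y < r.
Proof.
move=> cK; have cfK : compact ((@enorm R N) @` K).
  by apply: continuous_compact cK; apply: continuous_subspaceT; exact: continuous_enorm.
have [M [_ HM]] := compact_bounded cfK.
have MM : M < `|M| + 1 by apply: le_lt_trans (ler_norm M) _; rewrite ltrDl.
exists (`|M| + 1 + 1); first by rewrite ltr_wpDl ?addr_ge0.
move=> y Ky; apply: (@le_lt_trans _ _ (`|M| + 1)); last by rewrite ltrDl.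
by apply: le_trans (ler_norm _) _; apply: (HM _ MM); exists y.
Qed.

Lemma test_function_support (phi : 'rV[R]_N -> R) : test_function phi -> exists2 r : R, 0 < r &
  forall y, r <= enorm y -> phi y = 0 /\ forall i, partial i phi y = 0.
Proof.
move=> [_ cK]; have [r r0 Hr] := compact_enorm_bounded cK.
exists r => // y ry; have yK : ~ closure [set x | phi x != 0] y.
  by move=> /Hr; rewrite ltNge ry.
have H : \forall z \near y, phi z = 0.
  have : nbhs y (~` closure [set x | phi x != 0]).
    by apply: open_nbhs_nbhs; split => //; apply: closed_openC; exact: closed_closure.
  apply: filterS => z zK; apply: contrapT => /eqP z0; apply: zK.
  exact: subset_closure.
split; first exact: nbhs_singleton H.
move=> i; rewrite /partial (near_eq_derive _ (_ : \near y, phi y = cst 0 y))//.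
by rewrite derive_cst.
Qed.

Lemma test_function_continuous (phi : 'rV[R]_N -> R) : test_function phi -> continuous phi.
Proof. by move=> [/(_ [::])[]]. Qed.

Lemma test_function_continuous_partial (phi : 'rV[R]_N -> R) i :
  test_function phi -> continuous (partial i phi).
Proof. by move=> [/(_ [:: i])[]]. Qed.

Lemma dotv_delta x (i : 'I_N) : dotv x (delta_mx 0 i) = x 0 i.
Proof.
rewrite /dotv (bigD1 i)//= mxE !eqxx mulr1 big1 ?addr0// => j ji.
by rewrite mxE (negbTE ji) andbF mulr0.
Qed.

Lemma bounded_support_integrable f (C r : R) : measurable_fun setT f -> 0 < r ->
  (forall y, `|f y| <= C) -> (forall y, r <= enorm y -> f y = 0) ->
  mu.-integrable setT (EFin \o f).
Proof.
move=> mf r0 fC f0;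
  apply: (@le_integrable _ _ _ mu _ measurableT _ (fun y => (C * \1_(eball 0 r) y)%:E)).
- by apply/measurable_EFinP.
- move=> y _; rewrite lee_fin indicE; have [yr|yr] := boolP (y \in eball 0 r).
    by rewrite mulr1; apply: le_trans (fC y) (ler_norm _).
  rewrite mulr0 normr0 f0 ?normr0// leNgt; apply: contra yr => yr.
  by apply/mem_set; rewrite /eball/= subr0.
- apply/integrableP; split.
    apply/measurable_EFinP; apply: measurable_funM => //; apply: measurable_indic.
    exact: measurable_eball.
  have C0 : 0 <= C by apply: le_trans (fC 0).
  under eq_integral => y _ do rewrite gee0_abs ?lee_fin ?mulr_ge0// EFinM.
  rewrite ge0_integralZl//=; last by apply/measurable_EFinP; apply: measurable_indic;
    exact: measurable_eball.
  rewrite integral_indic ?setIT//; last exact: measurable_eball.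
  rewrite lte_mul_pinfty ?lee_fin//.
  by apply: le_lt_trans (ltry _); rewrite (le_eqVlt (mu _)); apply/orP; left; apply/eqP;
    exact: lebesgue_eball.
Qed.

(** By translation invariance the integral of F(y + t e) does not depend on [t]; differentiating
    under the integral sign at [t = 0] gives the claim without iterated integrals. The radius
    [r + enorm e] covers the supports of all shifts with |t| < 1. *)
Lemma Rintegral_derive_eq0 (F dF : 'rV[R]_N -> R) (e : 'rV[R]_N) (C r : R) : 0 < r ->
  continuous F -> continuous dF ->
  (forall y t, is_derive (t : R) 1 (fun t : R => F (y + t *: e)) (dF (y + t *: e))) ->
  (forall y, `|F y| <= C) -> (forall y, r <= enorm y -> F y = 0) ->
  (forall y, `|dF y| <= C) -> (forall y, r <= enorm y -> dF y = 0) ->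
  \int[mu]_y dF y = 0.
Proof.
move=> r0 cF cdF FdF FC F0 dFC dF0.
have mF := continuous_measurable_rV cF; have mdF := continuous_measurable_rV cdF.
pose f (t : R) y := F (y + t *: e).
have d1 t y : partial1of2 f t y = dF (y + t *: e).
  by rewrite partial1of2E; exact: derive_val.
have r'0 : 0 < r + enorm e by rewrite ltr_wpDr// enorm_ge0.
have far y t : `]-1, 1[%classic t -> r + enorm e <= enorm y -> r <= enorm (y + t *: e).
  rewrite /= in_itv/= -ltr_norml => t1 ry; rewrite -(lerD2r (enorm e)); apply: le_trans ry _.
  rewrite -[y in leLHS](addrK (t *: e)); apply: le_trans (ler_enormD _ _) _.
  by rewrite enormN enormZ lerD2l ler_piMl ?enorm_ge0// ltW.
have I0 : `]-1, 1[%classic (0 : R) by rewrite /= in_itv/= ltrN10 ltr01.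
have fi t : `]-1, 1[%classic t -> mu.-integrable setT (EFin \o f t).
  move=> t1; apply: (bounded_support_integrable _ r'0 (fun y => FC _)).
    by rewrite /f; under eq_fun do rewrite addrC; exact: measurable_translate.
  by move=> y ry; rewrite /f F0//; exact: far.
have iG : mu.-integrable setT (EFin \o (fun y => C * \1_(eball 0 (r + enorm e)) y)).
  have C0 : 0 <= C by apply: le_trans (FC 0).
  apply: (@bounded_support_integrable _ C _ _ r'0).
  - by apply: measurable_funM => //; apply: measurable_indic; exact: measurable_eball.
  - by move=> y; rewrite ger0_norm ?mulr_ge0// ler_piMr// indicE; case: (_ \in _).
  - move=> y ry; rewrite indicE memNset ?mulr0// /eball/= subr0.
    by move=> h; rewrite ltNge ry in h.
have := @differentiation_under_integral R _ _ mu f setT measurableT 0 (-1) 1 I0 fi _ _ _ iG.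
under eq_Rintegral do rewrite d1 scale0r addr0.
move=> <-.
- have -> : (fun t : R => \int[mu]_y f t y) = cst (\int[mu]_y F y); last by rewrite derive1_cst.
  apply/funext => t /=; rewrite /f -[RHS](Rintegral_translation (t *: e) mF).
  by apply: eq_Rintegral => y _; rewrite addrC.
- by move=> t y _ _; have [] := FdF y t.
- by move=> y; rewrite mulr_ge0//; apply: le_trans (FC 0).
- move=> t y t1 _; rewrite d1 indicE; have [yr|yr] := boolP (y \in _); first by rewrite mulr1.
  rewrite mulr0 dF0 ?normr0//; apply: far => //; rewrite leNgt; apply: contra yr => yr.
  by apply/mem_set; rewrite /eball/= subr0.
Qed.

Lemma C1_pair_weak_gradient f G : C1_pair f G -> weak_gradient f G.
Proof.
move=> fG phi tphi i; have [cf cG _] := fG.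
have cphi := test_function_continuous tphi.
have cdphi := @test_function_continuous_partial _ i tphi.
have [r r0 supp] := test_function_support tphi.
have cGi : continuous (fun y => G y 0 i).
  move=> y; apply: (@cvg_comp _ _ _ G (fun z : 'rV[R]_N => z 0 i)); first exact: cG.
  exact: coord_continuous.
have cM (u v : 'rV[R]_N -> R) : continuous u -> continuous v -> continuous (fun y => u y * v y).
  by move=> cu cv y; exact: (@continuousM R _ u v y (cu y) (cv y)).
have bM u v : continuous u -> continuous v -> (forall y, r <= enorm y -> v y = 0) ->
    exists2 C : R, 0 <= C & forall y, `|u y * v y| <= C.
  move=> cu cv v0; have [C C0 HC] := continuous_bounded_on_ball r (cM _ _ cu cv).
  exists C => // y; have [/HC//|yr] := ltP (enorm y) r.
  by rewrite v0// mulr0 normr0.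
have phi0 y : r <= enorm y -> phi y = 0 by move=> /supp[].
have dphi0 y : r <= enorm y -> partial i phi y = 0 by move=> /supp[].
have [C1 C10 H1] := bM _ _ cf cphi phi0.
have [C2 C20 H2] := bM _ _ cf cdphi dphi0.
have [C3 C30 H3] := bM _ _ cGi cphi phi0.
have intg u v C : continuous u -> continuous v -> (forall y, r <= enorm y -> v y = 0) ->
    (forall y, `|u y * v y| <= C) -> mu.-integrable setT (EFin \o (fun y => u y * v y)).
  move=> cu cv v0 HC; apply: (bounded_support_integrable _ r0 HC).
    by apply: continuous_measurable_rV; exact: cM.
  by move=> y ry; rewrite v0// mulr0.
have i2 := intg _ _ _ cf cdphi dphi0 H2; have i3 := intg _ _ _ cGi cphi phi0 H3.
apply/eqP; rewrite -subr_eq0 opprK -RintegralD//; apply/eqP.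
apply: (@Rintegral_derive_eq0 (fun y => f y * phi y)
  (fun y => f y * partial i phi y + G y 0 i * phi y) (delta_mx 0 i) (C1 + (C2 + C3)) r r0).
- exact: cM.
- by move=> y; exact: (continuousD (cM _ _ cf cdphi y) (cM _ _ cGi cphi y)).
- move=> y t; have d1 := C1_pair_derive y (delta_mx 0 i) t fG.
  have d2 : is_derive t 1 (fun t : R => phi (y + t *: delta_mx 0 i))
    (partial i phi (y + t *: delta_mx 0 i)).
    have : is_derive (y + t *: delta_mx 0 i) (delta_mx 0 i) phi
      (partial i phi (y + t *: delta_mx 0 i)).
      by apply: DeriveDef => //; case: tphi => /(_ [::])[_ /(_ i (y + t *: delta_mx 0 i))].
    move=> /line_is_derive d2.
    have sh : is_derive t 1 (fun s : R => s - t) 1.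
      by rewrite -[X in is_derive _ _ _ X](subr0 1); apply: is_deriveB.
    have := @is_derive1_comp _ (fun s : R => phi (y + t *: delta_mx 0 i + s *: delta_mx 0 i)) _ t
      (partial i phi (y + t *: delta_mx 0 i)) 1 _ sh.
    rewrite mulr1 subrr => /(_ d2).
    congr (is_derive _ _ _ _); apply/funext => s /=.
    by rewrite -addrA -scalerDl subrKC.
  have := is_deriveM d1 d2; rewrite dotv_delta; congr (is_derive _ _ _ _).
  by rewrite /GRing.scale/= [_ * G _ _ _]mulrC.
- by move=> y; apply: le_trans (H1 y) _; rewrite lerDl addr_ge0.
- by move=> y ry; rewrite phi0// mulr0.
- by move=> y; apply: le_trans (ler_normD _ _) _; apply: le_trans (lerD (H2 y) (H3 y)) _;
  rewrite lerDr.
- by move=> y ry; rewrite phi0// dphi0// !mulr0 addr0.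
Qed.

End test_functions.

Section Lfun_pint.
Context d (T : measurableType d) (R : realType) (mu : {measure set T -> \bar R}).
Variable p : R.
Hypothesis p0 : 0 < p.

Lemma Lfun_pint (f : T -> R) : f \in Lfun mu p%:E <->
  measurable_fun setT f /\ (pint mu p f < +oo)%E.
Proof.
have E : ('N[mu]_p%:E[EFin \o f] `^ p = pint mu p f)%E.
  by rewrite powR_Lnorm ?gt_eqF.
split=> [/andP[]|[mf foo]].
  rewrite !inE /finite_norm => mf foo; split => //.
  by rewrite -E poweR_lty.
apply/andP; split; first by rewrite inE.
rewrite inE /finLfun/= /finite_norm.
have ff : pint mu p f \is a fin_num by rewrite ge0_fin_numE ?pint_ge0.
apply: le_lt_trans (ltry (fine (pint mu p f) `^ p^-1)).
by apply: Lnorm_le_powR => //; [rewrite fine_ge0 ?pint_ge0|rewrite fineK].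
Qed.

Lemma pint_integrable (f : T -> R) : measurable_fun setT f -> (pint mu p f < +oo)%E ->
  mu.-integrable setT (fun x => (`|f x| `^ p)%:E).
Proof.
move=> mf foo; apply/integrableP; split; first exact: measurable_abs_powR.
by under eq_integral do rewrite gee0_abs ?lee_fin ?powR_ge0//.
Qed.

Lemma Rintegral_sum (I : Type) (s : seq I) (c : I -> R) (F : I -> T -> R) :
  (forall i, mu.-integrable setT (EFin \o F i)) ->
  mu.-integrable setT (EFin \o (fun x => \sum_(i <- s) c i * F i x)) /\
  \int[mu]_x (\sum_(i <- s) c i * F i x) = \sum_(i <- s) c i * \int[mu]_x F i x.
Proof.
move=> iF; elim: s => [|i s [IH1 IH2]].
  split; first by under eq_fun do rewrite big_nil; exact: integrable0.
  by under eq_Rintegral do rewrite big_nil; rewrite big_nil Rintegral_cst// mul0r.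
have E : (fun x => \sum_(j <- i :: s) c j * F j x) =
  (fun x => c i * F i x + \sum_(j <- s) c j * F j x).
  by apply/funext => x; rewrite big_cons.
have ic : mu.-integrable setT (EFin \o (fun x => c i * F i x)).
  by have := integrableZl measurableT (c i) (iF i).
rewrite E; split; first by have := integrableD measurableT ic IH1.
by rewrite RintegralD// IH2 RintegralZl// big_cons.
Qed.

(** Hoelder's inequality for the factors D k^(1/p) and k^(1-1/p), the second having norm at most
    1. *)
Lemma jensen (D k : T -> R) (c : R) : 1 < p -> measurable_fun setT D -> measurable_fun setT k ->
  (forall x, 0 <= D x) -> (forall x, 0 <= k x) -> (\int[mu]_x (k x)%:E <= 1)%E -> 0 <= c ->
  (c%:E <= \int[mu]_x (D x * k x)%:E)%E ->
  ((c `^ p)%:E <= \int[mu]_x (D x `^ p * k x)%:E)%E.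
Proof.
move=> p1 mD mk D0 k0 k1 c0 cD.
have I0 : (0 <= \int[mu]_x (D x `^ p * k x)%:E)%E.
  by apply: integral_ge0 => x _; rewrite lee_fin mulr_ge0// powR_ge0.
have [Ioo|] := boolP ((\int[mu]_x (D x `^ p * k x)%:E) \is a fin_num)%E; last first.
  by rewrite ge0_fin_numE// -leNgt leye_eq => /eqP ->; rewrite leey.
pose A := fine (\int[mu]_x (D x `^ p * k x)%:E)%E.
have A0 : 0 <= A by rewrite fine_ge0.
have q0 : 0 < 1 - p^-1 by rewrite subr_gt0 invf_lt1.
have q'0 : 0 < (1 - p^-1)^-1 by rewrite invr_gt0.
have pq : p^-1 + (1 - p^-1)^-1^-1 = 1 by rewrite invrK subrKC.
have mkp s : measurable_fun setT (fun x => k x `^ s).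
  exact: (measurableT_comp (measurable_powR s)).
have h1 : (\int[mu]_x ((D x * k x `^ p^-1) `^ p)%:E <= A%:E)%E.
  rewrite /A fineK// le_eqVlt; apply/orP; left; apply/eqP; apply: eq_integral => x _.
  by rewrite powRM ?powR_ge0// -powRrM mulVf ?gt_eqF// powRr1.
have h2 : (\int[mu]_x ((k x `^ (1 - p^-1)) `^ (1 - p^-1)^-1)%:E <= 1%:E)%E.
  apply: le_trans k1; rewrite le_eqVlt; apply/orP; left; apply/eqP; apply: eq_integral => x _.
  by rewrite -powRrM mulfV ?gt_eqF// powRr1.
have := ge0_holder_le (measurable_funM mD (mkp p^-1)) (mkp (1 - p^-1))
  (fun x => mulr_ge0 (D0 x) (powR_ge0 _ _)) (fun x => powR_ge0 _ _) p0 q'0 pq A0 ler01 h1 h2.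
rewrite powR1 mulr1 => H.
have {}H : (\int[mu]_x (D x * k x)%:E <= (A `^ p^-1)%:E)%E.
  apply: le_trans H; rewrite le_eqVlt; apply/orP; left; apply/eqP; apply: eq_integral => x _.
  have [->|kn] := eqVneq (k x) 0; first by rewrite mulr0 powR0 ?gt_eqF// !mulr0.
  rewrite -mulrA -powRD; last by rewrite kn implybT.
  by rewrite subrKC powRr1.
have := le_trans cD H; rewrite lee_fin => {}H.
rewrite -(fineK Ioo) lee_fin -/A.
have -> : A = (A `^ p^-1) `^ p by rewrite -powRrM mulVf ?gt_eqF// powRr1.
by rewrite ge0_ler_powR ?nnegrE ?powR_ge0 ?(ltW p0).
Qed.

End Lfun_pint.

(** * Mollification and density of C^1 pairs *)

Section mollify.
Context {R : realType} {N : nat} (p : R).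
Hypothesis p1 : 1 < p.
Let p0 : 0 < p. Proof. exact: lt_trans p1. Qed.
Local Notation mu := (@lebesgue_rV R N).
Implicit Types (f g u : 'rV[R]_N -> R) (x y : 'rV[R]_N).

Definition mollifier (s : R) (k : 'rV[R]_N -> R) :=
  [/\ forall y, 0 <= k y, \int[mu]_y k y = 1, forall y, s <= enorm y -> k y = 0,
      forall y, differentiable k y & forall x, test_function (fun y => k (y - x))].

Lemma exists_mollifier (s : R) : 0 < s -> exists k, mollifier s k.
Proof.
(* The cube of half-side [e] lies in the Euclidean ball of radius [s], as the Euclidean norm is at
   most the sum of the coordinates in absolute value. *)
move=> s0; pose e := s / N.+1%:R; have e0 : 0 < e by rewrite divr_gt0.
pose b := @bump R N 0 e.
have bT x y : bump x e y = b (y - x).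
  rewrite /b /bump; apply: eq_bigr => j _; rewrite !mxE; congr (flat _ _ * flat _ _); ring.
have b_supp y : s <= enorm y -> b y = 0.
  move=> sy; apply: contraTeq sy => /(bump_eq0 e0) H; rewrite -ltNge.
  apply: le_lt_trans (ler_enorm_sum _) _; apply: (@le_lt_trans _ _ (\sum_(i < N) e)).
    by apply: ler_sum => j _; have := H j; rewrite mxE subr0 => /ltW.
  by rewrite sumr_const card_ord -mulr_natr /e mulrAC ltr_pdivrMr// ltr_pM2l// ltr_nat.
have sb : smoothn 1 b by exact: smoothn_bump.
have cb : continuous b by move=> y; apply: differentiable_continuous; exact: sb.1.
have mb := continuous_measurable_rV cb.
have [C C0 HC] := continuous_bounded_on_ball s cb.
have bC y : `|b y| <= C.
  by have [/HC//|/b_supp ->] := ltP (enorm y) s; rewrite normr0.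
have ib := bounded_support_integrable mb s0 bC b_supp.
(* A zero integral would make [b] vanish almost everywhere, while it is positive on a ball, which
   has positive volume. *)
have Z0 : 0 < \int[mu]_y b y.
  rewrite lt_neqAle eq_sym Rintegral_ge0 ?andbT; last by move=> y _; exact: bump_ge0.
  apply/negP => /eqP Z0.
  have : (\int[mu]_y (b y)%:E = 0)%E.
    by rewrite -(fineK (integrable_fin_num measurableT ib)) -[fine _]/(\int[mu]_y b y) Z0.
  have -> : (\int[mu]_y (b y)%:E = \int[mu]_y `|(b y)%:E|)%E.
    by apply: eq_integral => y _; rewrite gee0_abs// lee_fin bump_ge0.
  have mb' : measurable_fun setT (EFin \o b) by apply/measurable_EFinP.
  move/(ae_eq_integral_abs mu measurableT mb') => [A [mA A0 HA]].
  have : (mu (eball (0 : 'rV[R]_N) e) <= mu A)%E.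
    apply: le_measure; rewrite ?inE//; first exact: measurable_eball.
    move=> y; rewrite /eball/= subr0 => ye; apply: HA => /= /(_ I) /eqP.
    rewrite eqe /b /bump => /eqP.
    apply/eqP; apply/prodf_neq0 => j _; rewrite mxE !mulr0 subr0 addr0.
    have := le_lt_trans (ler_coord_enorm y j) ye; rewrite ltr_norml => /andP[h1 h2].
    have ei : 0 < e^-1 by rewrite invr_gt0.
    rewrite mulf_neq0// gt_eqF// flat_gt0//.
      by rewrite -(ltr_pM2l e0) mulr0 mulrDr mulr1 mulVKf ?gt_eqF//; lra.
    by rewrite -(ltr_pM2l e0) mulr0 mulrDr mulr1 mulNr mulrN mulVKf ?gt_eqF//; lra.
  rewrite A0 leNgt => /negP; apply.
  have E : mu (eball (0 : 'rV[R]_N) e) = (e ^+ N * eball_volume N)%:E := lebesgue_eball _ e0.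
  apply: (@lt_le_trans _ _ (e ^+ N * eball_volume N)%:E); last by rewrite -E.
  by rewrite lte_fin mulr_gt0 ?exprn_gt0 ?(eball_volume_gt0 N).1.
exists (fun y => (\int[mu]_y b y)^-1 * b y); split.
- by move=> y; rewrite mulr_ge0 ?bump_ge0// invr_ge0 ltW.
- by rewrite RintegralZl// mulVf// gt_eqF.
- by move=> y /b_supp ->; rewrite mulr0.
- by move=> y; apply: differentiableM => //; exact: sb.1.
- move=> x; rewrite (_ : (fun y => _) = (fun y => (\int[mu]_y b y)^-1 * bump x e y)).
    exact: test_function_bump.
  by apply/funext => y; rewrite bT.
Qed.

Lemma continuous_enorm_dist f :
  (forall x (e : R), 0 < e -> exists2 d : R, 0 < d & forall y,
    enorm (x - y) < d -> `|f x - f y| < e) ->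
  continuous f.
Proof.
move=> H; apply: continuous_rV => x e e0; have [d d0 Hd] := H x e e0.
exists (d / N.+1%:R) => [|y xy]; first by rewrite divr_gt0.
apply: Hd; apply: le_lt_trans (ler_enorm_sum _) _.
apply: (@le_lt_trans _ _ (\sum_(i < N) d / N.+1%:R)).
  by apply: ler_sum => i _; rewrite !mxE; apply/ltW/xy.
by rewrite sumr_const card_ord -[ltLHS]mulr_natr mulrAC ltr_pdivrMr// ltr_pM2l// ltr_nat.
Qed.

(** The product is dominated by C |f|^p + |g|: compare |f| with 1. *)
Lemma pint_bounded_integrable f g (C r : R) : measurable_fun setT f -> (pint mu p f < +oo)%E ->
  measurable_fun setT g -> 0 < r -> (forall y, `|g y| <= C) ->
    (forall y, r <= enorm y -> g y = 0) ->
  mu.-integrable setT (EFin \o (fun y => f y * g y)).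
Proof.
move=> mf foo mg r0 gC g0.
have i1 := integrableZl measurableT C (pint_integrable mf foo).
have ig : mu.-integrable setT (EFin \o (fun y => `|g y|)).
  apply: (bounded_support_integrable _ r0 (C := C)).
  - exact: measurableT_comp.
  - by move=> y; rewrite normr_id.
  - by move=> y /g0 ->; rewrite normr0.
apply: (le_integrable measurableT _ _ (integrableD measurableT i1 ig)).
  by apply/measurable_EFinP; exact: measurable_funM.
move=> y _; rewrite -[leRHS]/(`|(C * `|f y| `^ p + `|g y|)%:E|)%E lee_fin normrM
  [leRHS]ger0_norm; last first.
  by rewrite addr_ge0// mulr_ge0 ?powR_ge0// (le_trans _ (gC y)).
have [f1|f1] := leP `|f y| 1.
  apply: (@le_trans _ _ `|g y|); first by rewrite ler_piMl.
  by rewrite lerDr mulr_ge0 ?powR_ge0// (le_trans _ (gC y)).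
apply: (@le_trans _ _ (C * `|f y| `^ p)); last by rewrite lerDl.
rewrite mulrC ler_pM//; apply: le_trans (_ : `|f y| `^ 1 <= _); first by rewrite powRr1.
by rewrite ler_powR// ltW.
Qed.

Section convolution.
Variables (s : R) (k : 'rV[R]_N -> R).
Hypotheses (s0 : 0 < s) (km : mollifier s k).

Let k0 y : 0 <= k y. Proof. by case: km. Qed.
Let k1 : \int[mu]_y k y = 1. Proof. by case: km. Qed.
Let ks y : s <= enorm y -> k y = 0. Proof. by case: km => _ _ + _ _; apply. Qed.
Let dk y : differentiable k y. Proof. by case: km. Qed.
Let ck : continuous k. Proof. by move=> y; exact: differentiable_continuous. Qed.
Let mk : measurable_fun setT k. Proof. exact: continuous_measurable_rV. Qed.

Let k_bounded : exists2 C : R, 0 <= C & forall y, `|k y| <= C.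
Proof.
have [C C0 HC] := continuous_bounded_on_ball s ck; exists C => // y.
by have [/HC//|/ks ->] := ltP (enorm y) s; rewrite normr0.
Qed.

Let ik : mu.-integrable setT (EFin \o k).
Proof. by have [C C0 HC] := k_bounded; exact: bounded_support_integrable HC ks. Qed.

Let k1E : (\int[mu]_y (k y)%:E = 1)%E.
Proof. by rewrite -(fineK (integrable_fin_num measurableT ik)) -[fine _]/(\int[mu]_y k y) k1. Qed.

(** The convolution with the reflected kernel: after translation the kernel is [fun y => k (y - x)],
    which [mollifier] requires to be a test function. *)
Definition conv f x : R := \int[mu]_y (f (x + y) * k y).

Lemma conv_integrable f x : measurable_fun setT f -> (pint mu p f < +oo)%E ->
  mu.-integrable setT (EFin \o (fun y => f (x + y) * k y)).
Proof.
move=> mf foo; have [C C0 HC] := k_bounded.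
apply: (pint_bounded_integrable _ _ mk s0 HC ks); first exact: measurable_translate.
by rewrite pint_translation.
Qed.

Lemma conv_continuous f : measurable_fun setT f -> (pint mu p f < +oo)%E -> continuous (conv f).
Proof.
move=> mf foo; have [_ _ tc] := pint_translation_continuous p0 mf foo.
have [C C0 HC] := k_bounded.
pose B : R := 1 + fine (pint mu ((1 - p^-1)^-1) k).
have q0 : 0 < 1 - p^-1 by rewrite subr_gt0 invf_lt1.
have q'0 : 0 < (1 - p^-1)^-1 by rewrite invr_gt0.
have pq : p^-1 + (1 - p^-1)^-1^-1 = 1 by rewrite invrK subrKC.
have kq : (pint mu ((1 - p^-1)^-1) k < +oo)%E.
  have i1 : mu.-integrable setT (fun y => (`|k y| `^ (1 - p^-1)^-1)%:E).
    apply: (bounded_support_integrable _ s0 (C := C `^ (1 - p^-1)^-1)).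
    - by apply/measurable_EFinP; exact: measurable_abs_powR.
    - by move=> y; rewrite ger0_norm ?powR_ge0// ge0_ler_powR ?nnegrE ?(ltW q'0).
    - by move=> y /ks ->; rewrite normr0 powR0 ?gt_eqF.
  by have := integrable_fin_num measurableT i1; rewrite ge0_fin_numE ?pint_ge0.
have B0 : 0 < B by rewrite ltr_pwDl// fine_ge0 ?pint_ge0.
have kB : (\int[mu]_y (k y `^ (1 - p^-1)^-1)%:E <= B%:E)%E.
  rewrite /B EFinD fineK ?ge0_fin_numE ?pint_ge0//.
  have -> : (\int[mu]_y (k y `^ (1 - p^-1)^-1)%:E = pint mu (1 - p^-1)^-1 k)%E.
    by apply: eq_integral => y _; rewrite ger0_norm.
  by rewrite leeDr// lee_fin.
apply: continuous_enorm_dist => x e e0.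
pose e1 := (e / 2 / B `^ (1 - p^-1)) `^ p.
have Bq : 0 < B `^ (1 - p^-1) by rewrite powR_gt0.
have e10 : 0 < e1 by apply: powR_gt0; rewrite !divr_gt0.
have [d d0 Hd] := tc _ e10; exists d => // y xy.
have {}Hd := Hd (x - y) xy.
have mD : measurable_fun setT (fun z => `|f (x + z) - f (y + z)|).
  by apply: measurableT_comp => //; apply: measurable_funB; exact: measurable_translate.
have gap : (\int[mu]_z (`|f (x + z) - f (y + z)| `^ p)%:E <= e1%:E)%E.
  apply: le_trans Hd; rewrite /translation_gap.
  rewrite -(@pint_translation _ _ p (fun x0 => f (x - y + x0) - f x0) y).
    rewrite le_eqVlt; apply/orP; left; apply/eqP; apply: eq_integral => z _.
    by rewrite addrA subrK.
  by apply: measurable_funB => //; exact: measurable_translate.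
have := ge0_holder_le mD mk (fun z => normr_ge0 _) k0 p0 q'0 pq (ltW e10) (ltW B0) gap kB.
rewrite invrK /e1 -powRrM mulfV ?gt_eqF// powRr1 ?divr_ge0 ?(ltW e0)// ?divfK ?gt_eqF//; last first.
  exact: powR_ge0.
move=> H; rewrite /conv -RintegralB//; [|exact: conv_integrable|exact: conv_integrable].
have iB : mu.-integrable setT (EFin \o (fun z => f (x + z) * k z - f (y + z) * k z)).
  by have := integrableB measurableT (conv_integrable x mf foo) (conv_integrable y mf foo).
apply: (@le_lt_trans _ _ (e / 2)); last by rewrite ltr_pdivrMr// mulr_natr mulr2n ltrDl.
rewrite -lee_fin; apply: le_trans H; rewrite EFin_normr_Rintegral//.
apply: le_trans (le_abse_integral _ measurableT (measurable_int _ iB)) _.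
rewrite le_eqVlt; apply/orP; left; apply/eqP; apply: eq_integral => z _.
by rewrite /= -mulrBl normrM (ger0_norm (k0 z)).
Qed.

(** The difference at [x] is an average of f(x) - f(x + y) against the probability density [k].
    Jensen's inequality moves the p-th power inside; after exchanging the integrals only
    translations shorter than [s] occur. *)
Lemma pint_conv f (e : R) : measurable_fun setT f -> (pint mu p f < +oo)%E -> 0 < e ->
  (forall h, enorm h < s -> (translation_gap p f h <= e%:E)%E) ->
  (pint mu p (fun x => f x - conv f x)%R <= e%:E)%E.
Proof.
move=> mf foo e0 He.
have mT : measurable_fun setT (fun z : 'rV[R]_N * 'rV[R]_N => z.1 + z.2).
  apply: measurable_fun_rV => i.
  rewrite (_ : _ \o _ = fun z : 'rV[R]_N * 'rV[R]_N => rV_coord i z.1 + rV_coord i z.2).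
    apply: measurable_funD; first by apply: (measurableT_comp (measurable_rV_coord i));
      exact: measurable_fst.
    by apply: (measurableT_comp (measurable_rV_coord i)); exact: measurable_snd.
  by apply/funext => z; rewrite /= /rV_coord mxE.
pose F (z : 'rV[R]_N * 'rV[R]_N) : \bar R := (`|f (z.1 + z.2) - f z.1| `^ p * k z.2)%:E.
have mF : measurable_fun setT F.
  apply/measurable_EFinP; apply: measurable_funM; last first.
    by apply: measurableT_comp => //; exact: measurable_snd.
  apply: (measurableT_comp (measurable_powR p)); apply: measurableT_comp => //.
  apply: measurable_funB; first exact: measurableT_comp.
  by apply: measurableT_comp => //; exact: measurable_fst.
have F0 z : (0 <= F z)%E by rewrite lee_fin mulr_ge0 ?powR_ge0.
apply: (@le_trans _ _ (\int[mu]_x \int[mu]_y F (x, y))%E).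
  apply: ge0_le_integral => //.
  - apply: measurable_abs_powR; apply: measurable_funB => //.
    by apply: continuous_measurable_rV; exact: conv_continuous.
  - exact: (measurable_fun_fubini_tonelli_F _ mF).
  move=> x _.
  have mD : measurable_fun setT (fun y => f (x + y) - f x).
    by apply: measurable_funB => //; exact: measurable_translate.
  apply: (jensen p0 p1 _ mk) => //; [exact: measurableT_comp|by rewrite k1E|].
  have ifx : mu.-integrable setT (EFin \o (fun y => f x * k y)).
    by have := integrableZl measurableT (f x) ik.
  have ic := conv_integrable x mf foo.
  have -> : f x - conv f x = - \int[mu]_y (f (x + y) * k y - f x * k y).
    by rewrite RintegralB// RintegralZl// k1 mulr1 opprB.
  rewrite normrN EFin_normr_Rintegral//; last first.
    by have := integrableB measurableT ic ifx.
  have iB : mu.-integrable setT (EFin \o (fun z => f (x + z) * k z - f x * k z)).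
    by have := integrableB measurableT ic ifx.
  apply: le_trans (le_abse_integral _ measurableT (measurable_int _ iB)) _.
  rewrite le_eqVlt; apply/orP; left; apply/eqP; apply: eq_integral => z _.
  by rewrite /= -mulrBl normrM (ger0_norm (k0 z)).
rewrite (fubini_tonelli F mF F0)/=.
apply: (@le_trans _ _ (\int[mu]_y (e%:E * (k y)%:E))%E).
  apply: ge0_le_integral => //.
  - by move=> y _; apply: integral_ge0.
  - exact: (measurable_fun_fubini_tonelli_G _ mF).
  - by apply: measurable_funeM; apply/measurable_EFinP.
  move=> y _; rewrite /F/=.
  under eq_integral do rewrite mulrC EFinM.
  have mD : measurable_fun setT (fun x => f (x + y) - f x).
    apply: measurable_funB => //; under eq_fun do rewrite addrC.
    exact: measurable_translate.
  rewrite ge0_integralZl//=; last 2 first.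
  - exact: measurable_abs_powR.
  - by rewrite lee_fin.
  rewrite muleC; have [ys|/ks ->] := ltP (enorm y) s; last by rewrite !mule0.
  rewrite lee_wpmul2r ?lee_fin//; apply: le_trans (He y ys).
  rewrite le_eqVlt; apply/orP; left; apply/eqP; apply: eq_integral => x _.
  by rewrite [y + x]addrC.
rewrite ge0_integralZl//=.
- by rewrite k1E mule1.
- by apply/measurable_EFinP.
- by move=> y _; rewrite lee_fin.
- by rewrite lee_fin ltW.
Qed.

Lemma differentiable_derive_sum g x (w : 'rV[R]_N) : differentiable g x ->
  'D_w g x = \sum_i w 0 i * partial i g x.
Proof.
move=> dg; rewrite deriveE// {1}(row_sum_delta w) linear_sum; apply: eq_bigr => i _.
by rewrite linearZ/= /partial deriveE.
Qed.

Lemma continuous_rV_vec (f : 'rV[R]_N -> 'rV[R]_N) :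
  (forall i, continuous (fun x => f x 0 i)) -> continuous f.
Proof.
move=> cf x A [Q HQ QA].
have H : nbhs x [set y | forall j, Q 0 j (f y 0 j)].
  exact: (@filter_forall _ _ (fun j => [set y | Q 0 j (f y 0 j)]) (nbhs x) _
    (fun j => cf j x _ (HQ 0 j))).
by apply: filterS H => y Qy; apply: QA => i j; rewrite (ord1 i); exact: Qy.
Qed.

Lemma continuous_lincomb (I : Type) (l : seq I) (c : I -> R) (F : I -> 'rV[R]_N -> R) :
  (forall i, continuous (F i)) -> continuous (fun z => \sum_(i <- l) c i * F i z).
Proof.
move=> cF; elim: l => [|i l IH].
  rewrite (_ : (fun z => _) = fun=> 0); last first.
    by apply/funext => z; rewrite big_nil.
  by apply: continuous_rV => x e e0; exists 1 => // y _; rewrite subrr normr0.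
rewrite (_ : (fun z => _) = fun z => c i * F i z + \sum_(i <- l) c i * F i z); last first.
  by apply/funext => z; rewrite big_cons.
move=> z.
by apply: (continuousD (continuousM (cvg_cst _) (cF i z)) (IH z)).
Qed.

Lemma line_is_derive_at g x v (t : R) d : is_derive (x + t *: v) v g d ->
  is_derive t 1 (fun h : R => g (x + h *: v)) d.
Proof.
move=> /line_is_derive d2.
have sh : is_derive t 1 (fun h : R => h - t) 1.
  by rewrite -[X in is_derive _ _ _ X](subr0 1); apply: is_deriveB.
have := @is_derive1_comp _ (fun h : R => g (x + t *: v + h *: v)) _ t d 1 _ sh.
rewrite mulr1 subrr => /(_ d2).
congr (is_derive _ _ _ _); apply/funext => h /=.
by rewrite -addrA -scalerDl subrKC.
Qed.

(** Shifting the variable moves the point of evaluation from [u] into the kernel, where it can be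
    differentiated; the definition of the weak gradient, tested with the kernel, carries the
    derivative back to [u]. *)
Lemma W1p_conv u (Du : 'rV[R]_N -> 'rV[R]_N) : W1p p u Du ->
  C1_pair (conv u) (fun x => \row_i conv (fun y => Du y 0 i) x).
Proof.
move=> [/(Lfun_pint _ p0)[mu_ uoo] Duoo wg].
have mDu i : measurable_fun setT (fun y : 'rV[R]_N => Du y 0 i) by have /(Lfun_pint _ p0)[]
  := Duoo i.
have Dufin i : (pint mu p (fun y : 'rV[R]_N => Du y 0%R i) < +oo)%E by have
  /(Lfun_pint _ p0)[] := Duoo i.
split.
- exact: conv_continuous mu_ uoo.
- apply: continuous_rV_vec => i; under eq_fun do rewrite mxE.
  exact: conv_continuous (mDu i) (Dufin i).
move=> x v; have [_ _ _ _ tk] := km.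
have tk0 : test_function k by have := tk 0; under eq_fun do rewrite subr0.
have [r r0 supp] := test_function_support tk0.
pose D z := \sum_i (- v) 0 i * partial i k z.
have cpk i : continuous (partial i k) by exact: test_function_continuous_partial.
have cD : continuous D by exact: continuous_lincomb.
have D0 z : r <= enorm z -> D z = 0.
  by move=> /supp[_ H]; rewrite /D big1// => i _; rewrite H mulr0.
have [C C0 HC] := continuous_bounded_on_ball r cD.
have DC z : `|D z| <= C by have [/HC//|/D0 ->] := ltP (enorm z) r; rewrite normr0.
have [C' C'0 HC'] := k_bounded.
pose f (t : R) y := u y * k (y - x + t *: - v).
have df (t : R) y : is_derive t 1 (f ^~ y) (u y * D (y - x + t *: - v)).
  have dkz : is_derive (y - x + t *: - v) (- v) k (D (y - x + t *: - v)).
    apply: DeriveDef; first exact: diff_derivable.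
    exact: differentiable_derive_sum.
  have := is_deriveM (is_derive_cst (u y) t 1) (line_is_derive_at dkz).
  by rewrite scaler0 addr0.
have d1 (t : R) y : partial1of2 f t y = u y * D (y - x + t *: - v).
  by rewrite partial1of2E; apply: derive_val; exact: df.
have I0 : `]-1, 1[%classic (0 : R) by rewrite /= in_itv/= ltrN10 ltr01.
(* Beyond this radius both the kernel and its derivative vanish for every |t| < 1, so one indicator
   dominates the whole family. *)
pose r' := r + s + enorm x + enorm v.
have r'0 : 0 < r' by rewrite /r' -addrA ltr_wpDr ?addr_ge0 ?enorm_ge0// addr_gt0.
have far y (t : R) : `]-1, 1[%classic t -> r' <= enorm y -> r + s <= enorm (y - x + t *: - v).
  rewrite /= in_itv/= -ltr_norml => t1 ry; rewrite -(lerD2r (enorm x + enorm v)) addrA.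
  apply: le_trans ry _; rewrite -[y in leLHS](subrK x) -[y - x in leLHS](addrK (t *: - v)).
  rewrite -addrA; apply: le_trans (ler_enormD _ _) _; rewrite lerD2l addrC.
  apply: le_trans (ler_enormD _ _) _; rewrite lerD2l enormN enormZ enormN ler_piMl ?enorm_ge0//.
  exact: ltW.
have mkt (t : R) : measurable_fun setT (fun y => k (y - x + t *: - v)).
  rewrite (_ : (fun y => _) = (fun y => k (- x + t *: - v + y))); first exact: measurable_translate.
  by apply/funext => y; congr k; rewrite [RHS]addrC addrA.
have fi (t : R) : `]-1, 1[%classic t -> mu.-integrable setT (EFin \o f t).
  move=> t1; apply: (pint_bounded_integrable mu_ uoo (mkt t) r'0 (C := C')) => // y ry.
  by apply: ks; apply: le_trans (far y t t1 ry); rewrite lerDr ltW.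
have mI : measurable_fun setT (fun y => C * \1_(eball (0 : 'rV[R]_N) r') y : R).
  by apply: measurable_funM => //; apply: measurable_indic; exact: measurable_eball.
have iG : mu.-integrable setT (EFin \o (fun y => `|u y| * (C * \1_(eball (0 : 'rV[R]_N) r') y))).
  have mau : measurable_fun setT (fun y => `|u y|) by exact: measurableT_comp.
  apply: (pint_bounded_integrable mau _ mI r'0 (C := C)).
  - by rewrite /pint; under eq_integral do rewrite normr_id.
  - by move=> y; rewrite ger0_norm ?mulr_ge0// ler_piMr// indicE; case: (_ \in _).
  - move=> y ry; rewrite indicE memNset ?mulr0// /eball/= subr0.
    by move=> h; rewrite ltNge ry in h.
have fder (t : R) y : `]-1, 1[%classic t -> setT y -> derivable (f ^~ y) t 1.
  by move=> _ _; have [] := df t y.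
have G0 y : 0 <= `|u y| * (C * \1_(eball (0 : 'rV[R]_N) r') y) by rewrite !mulr_ge0.
have fG (t : R) y : `]-1, 1[%classic t -> setT y ->
    `|partial1of2 f t y| <= `|u y| * (C * \1_(eball (0 : 'rV[R]_N) r') y).
  move=> t1 _; rewrite d1 normrM ler_wpM2l// indicE.
  have [yr|yr] := boolP (y \in _); first by rewrite mulr1.
  rewrite mulr0 D0 ?normr0//; apply: le_trans (far y t t1 _); first by rewrite lerDl ltW.
  rewrite leNgt; apply: contra yr => yr.
  by apply/mem_set; rewrite /eball/= subr0.
have convE : (fun t : R => conv u (x + t *: v)) = (fun t => \int[mu]_y f t y).
  apply/funext => t; rewrite /conv -(Rintegral_translation (x + t *: v) (f := f t)); last first.
    by apply: measurable_funM.
  apply: eq_Rintegral => y _; rewrite /f; congr (_ * k _).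
  by rewrite scalerN [RHS]addrAC -[RHS]addrA -opprD [_ + x]addrC [x + _ + y]addrC addrK.
have D1 := @differentiation_under_integral R _ _ mu f setT measurableT 0 (-1) 1 I0 fi fder _
  G0 iG fG.
have D2 := @derivable_under_integral R _ _ mu f setT measurableT 0 (-1) 1 I0 fi fder _ G0 iG fG.
rewrite convE; apply: DeriveDef => //; rewrite -derive1E D1.
have tkx i : partial i (fun y => k (y - x)) = (fun y => partial i k (y - x)).
  apply/funext => y; rewrite /partial !line_deriveE.
  suff -> : (fun h : R => k (y + h *: delta_mx 0 i - x)) =
    (fun h => k (y - x + h *: delta_mx 0 i)) by [].
  by apply/funext => h; rewrite addrAC.
pose E i y := u y * partial i (fun y => k (y - x)) y.
have iE i : mu.-integrable setT (EFin \o E i).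
  have [r2 r20 supp2] := test_function_support (tk x).
  have cp := @test_function_continuous_partial _ _ _ i (tk x).
  have [C2 C20 HC2] := continuous_bounded_on_ball r2 cp.
  apply: (pint_bounded_integrable mu_ uoo (continuous_measurable_rV cp) r20 (C := C2)).
    by move=> y; have [/HC2//|/supp2[_ ->]] := ltP (enorm y) r2; rewrite normr0.
  by move=> y /supp2[_ ->].
transitivity (\int[mu]_y (\sum_(i <- index_enum 'I_N) (- v) 0 i * E i y)).
  apply: eq_Rintegral => y _; rewrite d1 scale0r addr0 /D mulr_sumr; apply: eq_bigr => i _.
  by rewrite /E tkx mulrCA.
rewrite (Rintegral_sum _ _ iE).2 /dotv; apply: eq_bigr => i _.
have -> : (- v) 0 i = - v 0 i by rewrite mxE.
have -> : \int[mu]_y E i y = - \int[mu]_y (Du y 0 i * k (y - x)) := wg _ (tk x) i.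
rewrite mulrNN [RHS]mulrC mxE; congr (_ * _).
rewrite /conv -(Rintegral_translation x (f := fun y => Du y 0 i * k (y - x))).
  by apply: eq_Rintegral => y _; rewrite [x + y]addrC addrK.
apply: measurable_funM; first exact: mDu.
by apply: continuous_measurable_rV; exact: test_function_continuous (tk x).
Qed.

End convolution.

Lemma enorm_powR_le (v : 'rV[R]_N) : enorm v `^ p <= N%:R `^ p * \sum_i `|v 0 i| `^ p.
Proof.
set S := \sum_i _; have S0 : 0 <= S by apply: sumr_ge0 => i _; exact: powR_ge0.
have K : (S `^ p^-1) `^ p = S by rewrite -powRrM mulVf ?gt_eqF// powRr1.
rewrite -[X in _ * X]K -powRM ?powR_ge0//.
rewrite ge0_ler_powR ?nnegrE ?(ltW p0) ?enorm_ge0 ?mulr_ge0 ?powR_ge0//.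
apply: le_trans (ler_enorm_sum _) _.
rewrite mulr_natl -[in leRHS](card_ord N) -sumr_const; apply: ler_sum => i _.
have -> : `|v 0 i| = (`|v 0 i| `^ p) `^ p^-1 by rewrite -powRrM mulfV ?gt_eqF// powRr1.
rewrite ge0_ler_powR ?nnegrE ?invr_ge0 ?(ltW p0) ?powR_ge0//.
by rewrite /S (bigD1 i)//= lerDl; apply: sumr_ge0 => j _; exact: powR_ge0.
Qed.

Lemma gradient_energy_le (V : 'rV[R]_N -> 'rV[R]_N) (e : R) :
  (forall i, measurable_fun setT (fun x : 'rV[R]_N => V x 0 i)) ->
  (forall i, (pint mu p (fun x : 'rV[R]_N => V x 0%R i) <= e%:E)%E) ->
  (\int[mu]_x (enorm (V x) `^ p)%:E <= (N%:R `^ p * (e *+ N))%:E)%E.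
Proof.
move=> mV Ve; have mV' i := measurable_abs_powR p (mV i).
have mVv : measurable_fun setT V by apply: measurable_fun_rV => i; exact: mV.
apply: (@le_trans _ _ (\int[mu]_x ((N%:R `^ p)%:E * \sum_(i < N) (`|V x 0 i| `^ p)%:E))%E).
  apply: ge0_le_integral => //.
  - by move=> x _; rewrite lee_fin powR_ge0.
  - apply/measurable_EFinP; apply: (measurableT_comp (measurable_powR p)).
    by apply: measurableT_comp => //; exact: measurable_enorm.
  - by apply: measurable_funeM; apply: emeasurable_sum => i; exact: mV'.
  - by move=> x _; rewrite sumEFin -EFinM lee_fin enorm_powR_le.
rewrite ge0_integralZl//=; last 2 first.
- by apply: emeasurable_sum => i; exact: mV'.
- by move=> x _; rewrite sumEFin lee_fin; apply: sumr_ge0 => i _; exact: powR_ge0.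
rewrite EFinM lee_wpmul2l ?lee_fin ?powR_ge0// ge0_integral_sum//.
apply: (@le_trans _ _ (\sum_(i < N) e%:E)%E); first by apply: lee_sum => i _; exact: Ve.
by rewrite sumEFin lee_fin sumr_const card_ord.
Qed.

Lemma W1p_approx u (Du : 'rV[R]_N -> 'rV[R]_N) (e : R) : W1p p u Du -> 0 < e ->
  exists f G, [/\ C1_pair f G, (pint mu p (fun x => u x - f x)%R <= e%:E)%E &
    (\int[mu]_x (enorm (Du x - G x)%R `^ p)%:E <= e%:E)%E].
Proof.
move=> uW e0; have [/(Lfun_pint _ p0)[mu_ uoo] Duoo _] := uW.
have mDu i : measurable_fun setT (fun y : 'rV[R]_N => Du y 0 i) by have /(Lfun_pint _ p0)[]
  := Duoo i.
have Dufin i : (pint mu p (fun y : 'rV[R]_N => Du y 0%R i) < +oo)%E by have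
  /(Lfun_pint _ p0)[] := Duoo i.
(* [gradient_energy_le] costs a factor N^p N in passing from the components to the gradient; N+1
   keeps the denominator positive without a hypothesis on [N]. *)
pose e1 := e / (N.+1%:R `^ p * N.+1%:R).
have e10 : 0 < e1 by rewrite divr_gt0// mulr_gt0// powR_gt0.
have [_ _ /(_ _ e0)[d d0 Hd]] := pint_translation_continuous p0 mu_ uoo.
have /choice[dd Hdd] : forall i, exists d : R, 0 < d /\ forall h, enorm h < d ->
    (translation_gap p (fun y : 'rV[R]_N => Du y 0%R i) h <= e1%:E)%E.
  move=> i; have [_ _ /(_ _ e10)[d' d'0 Hd']] := pint_translation_continuous p0 (mDu i) (Dufin i).
  by exists d'.
pose s := Num.min d (\big[Num.min/1]_i dd i).
have s0 : 0 < s by rewrite lt_min d0/=; apply: lt_bigmin => // i _; have [] := Hdd i.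
have [k km] := exists_mollifier s0.
exists (conv k u), (fun x => \row_i conv k (fun y => Du y 0 i) x); split.
- exact: W1p_conv km _ _ uW.
- apply: (pint_conv s0 km mu_ uoo e0) => h hs; apply: Hd; apply: lt_le_trans hs _.
  by rewrite /s ge_min lexx.
- have He1 i : (pint mu p
  (fun x : 'rV[R]_N => (Du x - \row_j conv k (fun y => Du y 0 j) x)%R 0%R i) <= e1%:E)%E.
    under eq_fun do rewrite !mxE.
    apply: (pint_conv s0 km (mDu i) (Dufin i) e10) => h hs; apply: (Hdd i).2;
      apply: lt_le_trans hs _.
    by rewrite /s ge_min; apply/orP; right; exact: bigmin_le.
  apply: le_trans (gradient_energy_le _ He1) _.
    move=> i; under eq_fun do rewrite !mxE; apply: measurable_funB; first exact: mDu.
    apply: continuous_measurable_rV; apply: (conv_continuous s0 km); [exact: mDu|exact: Dufin].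
  rewrite lee_fin -[e1 *+ N]mulr_natr mulrCA /e1 mulrAC ler_pdivrMr ?mulr_gt0 ?powR_gt0//.
  rewrite ler_wpM2l ?(ltW e0)// ler_pM ?powR_ge0// ?ler_nat//.
  by rewrite ge0_ler_powR ?nnegrE ?(ltW p0)// ler_nat.
Qed.
End mollify.

(** * The energy space *)

Section energy.
Context {R : realType} {N : nat} (p : R) (a : 'rV[R]_N -> R) (al A : R).
Local Notation mu := (@lebesgue_rV R N).
Hypotheses (p1 : 1 < p) (pN : 2 <= p \/ N = 1%N).
Hypotheses (ma : measurable_fun setT a) (al0 : 0 < al).
Hypotheses (a_ge : forall x, al <= a x) (a_le : forall x, a x <= A).

Let p0 : 0 < p. Proof. exact: lt_trans p1. Qed.
Let a0 x : 0 <= a x. Proof. by apply: le_trans (a_ge x); exact: ltW. Qed.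
Let A0 : 0 <= A. Proof. by apply: le_trans (a0 0) (a_le 0). Qed.

(* A gradient is carried along with its function, so that uniqueness of weak
   gradients is never needed. *)
Definition pairs : lmodType R := (('rV[R]_N -> R^o) * ('rV[R]_N -> 'rV[R]_N))%type.
Implicit Types (U V W : pairs).

Definition fct_of U : 'rV[R]_N -> R := U.1.
Definition grad_of U : 'rV[R]_N -> 'rV[R]_N := U.2.

Lemma fct_ofP (b : R) U V x : fct_of (b *: U + V) x = b * fct_of U x + fct_of V x.
Proof. by []. Qed.
Lemma grad_ofP (b : R) U V x : grad_of (b *: U + V) x = b *: grad_of U x + grad_of V x.
Proof. by []. Qed.
Lemma fct_ofB U V x : fct_of (U - V) x = fct_of U x - fct_of V x.
Proof. by []. Qed.
Lemma grad_ofB U V x : grad_of (U - V) x = grad_of U x - grad_of V x.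
Proof. by []. Qed.
Lemma fct_ofZ (b : R) U x : fct_of (b *: U) x = b * fct_of U x.
Proof. by []. Qed.
Lemma grad_ofZ (b : R) U x : grad_of (b *: U) x = b *: grad_of U x.
Proof. by []. Qed.
Lemma fct_ofD U V x : fct_of (U + V) x = fct_of U x + fct_of V x.
Proof. by []. Qed.
Lemma grad_ofD U V x : grad_of (U + V) x = grad_of U x + grad_of V x.
Proof. by []. Qed.

Lemma fct_of0 x : fct_of 0 x = 0. Proof. by []. Qed.
Lemma grad_of0 x : grad_of 0 x = 0. Proof. by []. Qed.

Definition gradient_pint (G : 'rV[R]_N -> 'rV[R]_N) := pint mu p (fun x => enorm (G x)).

Lemma gradient_pintE G : gradient_pint G = (\int[mu]_x (enorm (G x) `^ p)%:E)%E.
Proof. by apply: eq_integral => x _; rewrite ger0_norm ?enorm_ge0. Qed.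

Definition finite_energy : set pairs := [set U | [/\ measurable_fun setT (fct_of U),
  measurable_fun setT (grad_of U), (pint mu p (fct_of U) < +oo)%E &
  (gradient_pint (grad_of U) < +oo)%E]].

Definition energy_density U x : R := enorm (grad_of U x) `^ p + a x * `|fct_of U x| `^ p.

Definition energy U : R := p^-1 * \int[mu]_x energy_density U x.

Lemma energy_density_ge0 U x : 0 <= energy_density U x.
Proof. by rewrite addr_ge0 ?mulr_ge0 ?powR_ge0. Qed.

Let menorm G : measurable_fun setT G -> measurable_fun setT
  (fun x : 'rV[R]_N => enorm (G x : 'rV[R]_N)).
Proof. by move=> mG; apply: measurableT_comp => //; exact: measurable_enorm. Qed.

Lemma finite_energy_gradient U : finite_energy U ->
  mu.-integrable setT (fun x => (enorm (grad_of U x) `^ p)%:E).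
Proof.
move=> [_ mG _ Goo]; have := pint_integrable (menorm mG) Goo.
by under eq_fun do rewrite ger0_norm ?enorm_ge0//.
Qed.

Lemma finite_energy_potential U : finite_energy U ->
  mu.-integrable setT (fun x => (a x * `|fct_of U x| `^ p)%:E).
Proof.
move=> [mu_ _ uoo _].
apply: (le_integrable measurableT _ _ (integrableZl measurableT A (pint_integrable mu_ uoo))).
  apply/measurable_EFinP; apply: measurable_funM => //.
  by apply/measurable_EFinP; exact: measurable_abs_powR.
move=> x _; rewrite -[leRHS]/(`|(A * `|fct_of U x| `^ p)%:E|)%E lee_fin.
rewrite [leLHS]ger0_norm ?mulr_ge0 ?powR_ge0// [leRHS]ger0_norm ?mulr_ge0 ?powR_ge0//.
by rewrite ler_wpM2r ?powR_ge0.
Qed.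

Lemma energy_density_integrable U : finite_energy U ->
  mu.-integrable setT (EFin \o energy_density U).
Proof.
move=> fU.
by have := integrableD measurableT (finite_energy_gradient fU) (finite_energy_potential fU).
Qed.

Lemma finite_energyP (b : R) U V : finite_energy U -> finite_energy V -> finite_energy (b *: U + V).
Proof.
move=> [mU1 mU2 U1oo U2oo] [mV1 mV2 V1oo V2oo].
have mbU1 : measurable_fun setT (fun x => b * fct_of U x) by exact: measurable_funM.
have mG : measurable_fun setT (grad_of (b *: U + V)).
  apply: measurable_fun_rV => i; rewrite (_ : _ \o _ =
    fun x => b * rV_coord i (grad_of U x) + rV_coord i (grad_of V x)).
    apply: measurable_funD; last by apply: measurableT_comp => //; exact: measurable_rV_coord.
    apply: measurable_funM => //; apply: measurableT_comp => //; exact: measurable_rV_coord.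
  apply/funext => x; rewrite -[LHS]/(grad_of (b *: U + V) x 0 i) grad_ofP.
  by rewrite /rV_coord !mxE.
have le_mul (k : R) (u v : \bar R) :
  0 <= k -> (u < +oo)%E -> (v < +oo)%E -> (0 <= u)%E -> (0 <= v)%E ->
    (k%:E * (u + v) < +oo)%E.
  by move=> k0 uoo voo u0 v0; rewrite lte_mul_pinfty ?lee_fin// lte_add_pinfty.
have bpoo (u : \bar R) : (0 <= u)%E -> (u < +oo)%E -> ((`|b| `^ p)%:E * u < +oo)%E.
  by move=> u0 uoo; rewrite lte_mul_pinfty ?lee_fin ?powR_ge0.
split; [| exact: mG | |].
- exact: measurable_funD mbU1 mV1.
- apply: le_lt_trans (pintD mu p0 mbU1 mV1) _; rewrite pintZ//.
  by apply: le_mul; rewrite ?powR_ge0 ?pint_ge0 ?mule_ge0 ?lee_fin ?powR_ge0 ?bpoo ?pint_ge0.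
- have mb : measurable_fun setT (fun x => `|b| * enorm (grad_of U x)).
    by apply: measurable_funM => //; exact: menorm.
  apply: (@le_lt_trans _ _ (pint mu p (fun x => `|b| * enorm (grad_of U x) + enorm (grad_of V x)))).
    apply: le_pint => //; [exact: menorm|by apply: measurable_funD => //; exact: menorm|].
    move=> x; rewrite [leLHS]ger0_norm ?enorm_ge0// [leRHS]ger0_norm ?addr_ge0 ?mulr_ge0
      ?enorm_ge0//.
    rewrite grad_ofP.
    by apply: le_trans (ler_enormD _ _) _; rewrite enormZ.
  apply: le_lt_trans (pintD mu p0 mb (menorm mV2)) _; rewrite pintZ ?normr_id; last exact: menorm.
  apply: le_mul.
  + exact: powR_ge0.
  + by apply: bpoo; [exact: pint_ge0|exact: U2oo].
  + exact: V2oo.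
  + by apply: mule_ge0; [rewrite lee_fin powR_ge0|exact: pint_ge0].
  + exact: pint_ge0.
Qed.

Lemma finite_energy0 : finite_energy 0.
Proof.
have z : pint mu p (fun=> 0 : R) = 0%E.
  by apply: integral0_eq => x _; rewrite normr0 powR0// gt_eqF.
split; [exact: measurable_cst|exact: measurable_cst|by rewrite /fct_of/= z|].
rewrite /gradient_pint (_ : (fun x => _) = fun=> 0) ?z//.
by apply/funext => x; rewrite grad_of0 enorm0.
Qed.

Lemma finite_energyZ b U : finite_energy U -> finite_energy (b *: U).
Proof. by move=> fU; rewrite -[b *: U]addr0; exact: finite_energyP fU finite_energy0. Qed.

Lemma finite_energyD U V : finite_energy U -> finite_energy V -> finite_energy (U + V).
Proof. by move=> fU; rewrite -[U]scale1r; exact: finite_energyP. Qed.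

Lemma finite_energyB U V : finite_energy U -> finite_energy V -> finite_energy (U - V).
Proof. by move=> fU fV; rewrite addrC -scaleN1r; exact: finite_energyP. Qed.

Lemma energy_ge0 U : 0 <= energy U.
Proof.
by rewrite mulr_ge0 ?invr_ge0 ?(ltW p0)// Rintegral_ge0// => x _; exact: energy_density_ge0.
Qed.

Lemma energyZ b U : finite_energy U -> energy (b *: U) = `|b| `^ p * energy U.
Proof.
move=> fU; rewrite /energy mulrCA; congr (_ * _).
rewrite -RintegralZl//; last exact: energy_density_integrable.
apply: eq_Rintegral => x _; rewrite /energy_density grad_ofZ fct_ofZ enormZ normrM.
by rewrite !powRM ?enorm_ge0// mulrDr; congr (_ + _); rewrite mulrCA.
Qed.

Lemma energy_le_density W (f : 'rV[R]_N -> R) :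
  finite_energy W -> mu.-integrable setT (EFin \o f) ->
  (forall x, energy_density W x <= f x) -> energy W <= p^-1 * \int[mu]_x f x.
Proof.
move=> fW intf Wf; rewrite /energy ler_wpM2l ?invr_ge0 ?(ltW p0)//.
by apply: le_Rintegral => //; exact: energy_density_integrable.
Qed.

Lemma Rintegral_lin2 (f g : 'rV[R]_N -> R) (b c : R) :
  mu.-integrable setT (EFin \o f) -> mu.-integrable setT (EFin \o g) ->
  mu.-integrable setT (EFin \o (fun x => b * f x + c * g x)) /\
  \int[mu]_x (b * f x + c * g x) = b * \int[mu]_x f x + c * \int[mu]_x g x.
Proof.
move=> i1 i2.
have j1 : mu.-integrable setT (EFin \o (fun x => b * f x)) by have := integrableZl measurableT b i1.
have j2 : mu.-integrable setT (EFin \o (fun x => c * g x)) by have := integrableZl measurableT c i2.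
split; first by have := integrableD measurableT j1 j2.
by rewrite RintegralD// !RintegralZl.
Qed.

Lemma energy_density_convex (s : R) U V x : 0 <= s <= 1 ->
  energy_density ((1 - s) *: U + s *: V) x <= (1 - s) * energy_density U x + s * energy_density V x.
Proof.
move=> s01; rewrite /energy_density grad_ofP fct_ofP grad_ofZ fct_ofZ.
have h1 := enorm_conv (grad_of U x) (grad_of V x) (ltW p1) s01.
have := powR_conv (ltW p1) (normr_ge0 (fct_of U x)) (normr_ge0 (fct_of V x)) s01.
have h2 : `|(1 - s) * fct_of U x + s * fct_of V x| `^ p <=
    ((1 - s) * `|fct_of U x| + s * `|fct_of V x|) `^ p.
  have /andP[s0 s1] := s01; have s1' : 0 <= 1 - s by rewrite subr_ge0.
  rewrite ge0_ler_powR ?nnegrE ?(ltW p0)// ?addr_ge0 ?mulr_ge0//.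
  by apply: le_trans (ler_normD _ _) _; rewrite !normrM (ger0_norm s0) (ger0_norm s1').
move=> /(le_trans h2)/(ler_wpM2l (a0 x)) h3; apply: le_trans (lerD h1 h3) _.
by rewrite le_eqVlt; apply/orP; left; apply/eqP; ring.
Qed.

Lemma energy_convex (s : R) U V : finite_energy U -> finite_energy V -> 0 <= s <= 1 ->
  energy ((1 - s) *: U + s *: V) <= (1 - s) * energy U + s * energy V.
Proof.
move=> fU fV s01.
have fUV := finite_energyP (1 - s) fU (finite_energyZ s fV).
have iU := energy_density_integrable fU; have iV := energy_density_integrable fV.
have [iUV E] := Rintegral_lin2 (1 - s) s iU iV.
apply: le_trans (energy_le_density fUV iUV (fun x => energy_density_convex U V x s01)) _.
rewrite E /energy; move: (Rintegral _ _ _) (Rintegral _ _ _) => x y; rewrite le_eqVlt;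
  apply/orP; left; apply/eqP; ring.
Qed.

Lemma energy_uconvex (M e : R) : 0 < e -> exists2 d : R, 0 < d &
  forall U V, finite_energy U -> finite_energy V -> energy U <= M -> energy V <= M ->
    energy U + energy V - 2 * energy (2^-1 *: (U + V)) <= d -> energy (U - V) <= e.
Proof.
move=> e0; pose eta := e / 4 / (`|M| + 1).
have M0 : 0 < `|M| + 1 by rewrite ltr_wpDl.
have eta0 : 0 < eta by rewrite !divr_gt0.
have [C C0 HC] := @uniform_convexity R N p eta p1 pN eta0.
have [C' C'0 HC'] := scalar_uniform_convexity p1 eta0.
(* One constant above those of the gradient and of the function, made positive by the 1. The
   convexity defect and the error term in [eta] then contribute [e / 2] each. *)
pose K := C + C' + 1; have K0 : 0 < K by rewrite ltr_pwDr// addr_ge0.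
exists (e / 2 / K); first by rewrite !divr_gt0.
move=> U V fU fV UM VM gapUV.
have fUV := finite_energyZ 2^-1 (finite_energyD fU fV).
have iU := energy_density_integrable fU; have iV := energy_density_integrable fV.
have iUV := energy_density_integrable fUV.
have [i1 E1] := Rintegral_lin2 1 1 iU iV.
have [i2 E2] := Rintegral_lin2 (K + eta) (- (2 * K)) i1 iUV.
have fD := finite_energyB fU fV.
apply: le_trans (energy_le_density fD i2 _) _.
  move=> x; rewrite /energy_density grad_ofB fct_ofB grad_ofZ fct_ofZ grad_ofD fct_ofD.
  have h1 := HC (grad_of U x) (grad_of V x).
  have h2 := ler_wpM2l (a0 x) (HC' (fct_of U x) (fct_of V x)).
  have g1 := gap_ge0 (grad_of U x) (grad_of V x) (ltW p1).
  have g2 := mulr_ge0 (a0 x) (scalar_gap_ge0 (fct_of U x) (fct_of V x) p1).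
  apply: le_trans (lerD h1 h2) _.
  have k1 : C * gap p (grad_of U x) (grad_of V x) <= K * gap p (grad_of U x) (grad_of V x).
    by rewrite ler_wpM2r// /K -addrA lerDl addr_ge0.
  have k2 : C' * (a x * scalar_gap p (fct_of U x) (fct_of V x)) <=
      K * (a x * scalar_gap p (fct_of U x) (fct_of V x)).
    by rewrite ler_wpM2r// /K (addrC C) -addrA lerDl addr_ge0.
  apply: (@le_trans _ _ (K * gap p (grad_of U x) (grad_of V x) +
     eta * (enorm (grad_of U x) `^ p + enorm (grad_of V x) `^ p) +
     (K * (a x * scalar_gap p (fct_of U x) (fct_of V x)) +
     eta * (a x * (`|fct_of U x| `^ p + `|fct_of V x| `^ p))))).
    apply: lerD; first by rewrite lerD2r.
    apply: le_trans (_ : C' * (a x * scalar_gap p (fct_of U x) (fct_of V x)) +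
      eta * (a x * (`|fct_of U x| `^ p + `|fct_of V x| `^ p)) <= _).
      by rewrite le_eqVlt; apply/orP; left; apply/eqP; ring.
    by rewrite lerD2r.
  rewrite /gap /scalar_gap [_ / 2]mulrC;
    move: (_ `^ _) (_ `^ _) (_ `^ _) (_ `^ _) (_ `^ _) (_ `^ _) (a x) => ? ? ? ? ? ? ?;
    rewrite le_eqVlt; apply/orP; left; apply/eqP; ring.
rewrite E2 E1.
have -> : p^-1 *
  ((K + eta) * (1 * \int[mu]_x energy_density U x + 1 * \int[mu]_x energy_density V x) +
    - (2 * K) * \int[mu]_x energy_density (2^-1 *: (U + V)) x) =
    K * (energy U + energy V - 2 * energy (2^-1 *: (U + V))) + eta * (energy U + energy V).
  by rewrite /energy; move: (Rintegral _ _ _) (Rintegral _ _ _) (Rintegral _ _ _) => x y z; ring.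
have -> : e = K * (e / 2 / K) + eta * ((`|M| + 1) + (`|M| + 1)).
  by rewrite /eta; field; rewrite !gt_eqF.
have MM : M <= `|M| + 1 by apply: le_trans (ler_norm M) _; rewrite lerDl.
apply: lerD; first by rewrite ler_wpM2l// ltW.
by rewrite ler_wpM2l ?(ltW eta0)// lerD// (le_trans _ MM).
Qed.

Lemma energy_continuous (M e : R) : 0 < e -> exists2 d : R, 0 < d &
  forall U V, finite_energy U -> finite_energy V -> energy U <= M -> energy (U - V) <= d ->
    `|energy U - energy V| <= e.
Proof.
move=> e0; exact: (@Phi_continuous R pairs finite_energy p energy finite_energy0 finite_energyP
  energy_ge0 energyZ energy_convex M e e0).
Qed.

Lemma energy_quasi_triangle U V : finite_energy U -> finite_energy V ->
  energy (U + V) <= 2 `^ p * (energy U + energy V).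
Proof.
move=> fU fV; exact:
  (@Phi_quasi_triangle R pairs finite_energy p energy finite_energy0 finite_energyP
  energy_ge0 energyZ energy_convex U V fU fV).
Qed.

Lemma energy_le U (b c : R) : finite_energy U -> (pint mu p (fct_of U) <= b%:E)%E ->
  (gradient_pint (grad_of U) <= c%:E)%E -> p * energy U <= c + A * b.
Proof.
move=> fU ub uc; have [mU1 mU2 U1oo U2oo] := fU.
rewrite /energy mulrA divff ?gt_eqF// mul1r /energy_density RintegralD//; last 2 first.
- exact: finite_energy_gradient.
- exact: finite_energy_potential.
apply: lerD.
  by rewrite -lee_fin /Rintegral fineK ?integrable_fin_num -?gradient_pintE//;
    exact: finite_energy_gradient.
apply: (@le_trans _ _ (\int[mu]_x (A * `|fct_of U x| `^ p))).
  apply: le_Rintegral => //; first exact: finite_energy_potential.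
    by have := integrableZl measurableT A (pint_integrable mU1 U1oo).
  by move=> x _; rewrite ler_wpM2r ?powR_ge0.
rewrite RintegralZl//; last exact: pint_integrable.
rewrite ler_wpM2l// -lee_fin /Rintegral fineK ?integrable_fin_num//.
exact: pint_integrable.
Qed.

Lemma energy_ge U : finite_energy U ->
  (gradient_pint (grad_of U) + al%:E * pint mu p (fct_of U) <= (p * energy U)%:E)%E.
Proof.
move=> fU; have [mU1 mU2 U1oo U2oo] := fU.
rewrite /energy mulrA divff ?gt_eqF// mul1r /energy_density.
rewrite /Rintegral fineK; last first.
  by apply: integrable_fin_num => //; exact: energy_density_integrable.
under eq_integral do rewrite EFinD.
rewrite ge0_integralD//=; last 4 first.
- by move=> x _; rewrite lee_fin powR_ge0.
- exact: measurable_int (finite_energy_gradient fU).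
- by move=> x _; rewrite lee_fin mulr_ge0 ?powR_ge0.
- exact: measurable_int (finite_energy_potential fU).
have mp := measurable_abs_powR p mU1.
rewrite gradient_pintE leeD2l// /pint -ge0_integralZl//=; last by rewrite lee_fin ltW.
apply: ge0_le_integral => //.
- by move=> x _; rewrite -EFinM lee_fin mulr_ge0 ?powR_ge0 ?(ltW al0).
- exact: measurable_funeM.
- exact: measurable_int (finite_energy_potential fU).
- by move=> x _; rewrite -EFinM lee_fin ler_wpM2r ?powR_ge0.
Qed.

End energy.

(** * Limits in L^p *)

Section Lp_limits.
Context d (T : measurableType d) (R : realType) (mu : {measure set T -> \bar R}).
Variable p : R.
Hypothesis p1 : 1 < p.
Let p0 : 0 < p. Proof. exact: lt_trans p1. Qed.
Implicit Types (f g : T -> R).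

Lemma pint_fatou (F : nat -> T -> R) f (e : R) : (forall n, measurable_fun setT (F n)) ->
  measurable_fun setT f -> {ae mu, forall x, F ^~ x @ \oo --> f x} ->
  (forall n, (pint mu p (F n) <= e%:E)%E) -> (pint mu p f <= e%:E)%E.
Proof.
move=> mF mf Ff Fe.
have mFp n := measurable_abs_powR p (mF n).
apply: (@le_trans _ _ (\int[mu]_x limn_einf (fun n => (`|F n x| `^ p)%:E))%E).
  apply: ae_ge0_le_integral => //.
  - exact: measurable_abs_powR.
  - move=> x _; rewrite limn_einf_lim; apply: lime_ge; first exact: is_cvg_einfs.
    apply: nearW => n; apply: le_ereal_inf_tmp => _ [k _ <-].
    by rewrite lee_fin powR_ge0.
  - rewrite (_ : (fun x => _) = fun x => (- limn_esup (fun n => - (`|F n x| `^ p)%:E))%E).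
      apply: measurableT_comp => //; apply: measurable_fun_limn_esup => n.
      exact: measurableT_comp.
    apply/funext => x; rewrite -limn_einfN; congr limn_einf; apply/funext => n.
    by rewrite /= opprK.
  - apply: filterS Ff => x Fx _.
    have : (fun n => (`|F n x| `^ p)%:E) @ \oo --> (`|f x| `^ p)%:E.
      apply: cvg_EFin; first exact: nearW.
      exact: cvg_comp _ _ Fx (@continuous_powR_norm R p p0 (f x)).
    by move=> /cvg_limn_einf_sup[-> _].
apply: le_trans (fatou mu measurableT mFp _) _.
  by move=> n x _; rewrite lee_fin powR_ge0.
rewrite limn_einf_lim; apply: lime_le; first exact: is_cvg_einfs.
apply: nearW => n; apply: le_trans (Fe n).
by apply: ereal_inf_lbound; exists n => //=.
Qed.

Lemma geometric_cauchy_cvg (u : nat -> R) (C : R) : 0 <= C ->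
  (forall k, `|u k.+1 - u k| <= C * 2^-1 ^+ k) -> cvgn u.
Proof.
move=> C0 uC.
have c1 : cvgn (series (fun k => `|u k.+1 - u k|)).
  apply: (series_le_cvg (v_ := fun k => C * 2^-1 ^+ k)) => //.
  - by move=> k; rewrite mulr_ge0// exprn_ge0// invr_ge0.
  - have := @is_cvg_geometric_series R C 2^-1.
    by apply; rewrite ger0_norm ?invr_ge0// invf_lt1// ltr1n.
have c2 := normed_cvg c1.
have E : u = (fun n => u 0%N + series (fun k => u k.+1 - u k) n).
  by apply/funext => n; rewrite /series/= telescope_sumr// subrKC.
by rewrite E; apply: is_cvgD => //; exact: is_cvg_cst.
Qed.

Lemma riesz_fischer (F : nat -> T -> R) : (forall n, measurable_fun setT (F n)) ->
  (forall e : R, 0 < e -> exists n0, forall m n, (n0 <= m)%N -> (n0 <= n)%N ->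
     (pint mu p (fun x => F m x - F n x)%R <= e%:E)%E) ->
  exists2 f : T -> R, measurable_fun setT f & forall e : R, 0 < e -> exists n0, forall n,
    (n0 <= n)%N ->
     (pint mu p (fun x => F n x - f x)%R <= e%:E)%E.
Proof.
move=> mF cF.
pose ep (k : nat) : R := (2^-1 `^ p) ^+ k * 2^-1 ^+ k.
have h0 : 0 < (2^-1 : R) by rewrite invr_gt0.
have ep0 k : 0 < ep k by rewrite mulr_gt0 ?exprn_gt0 ?powR_gt0.
have /choice[n0 Hn0] := fun k => cF _ (ep0 k).
(* The running maximum makes the subsequence monotone, and including [i] makes it tend to
   infinity. *)
pose n k := (\max_(i < k.+1) maxn (n0 i) i)%N.
have kn k : (maxn (n0 k) k <= n k)%N.
  exact: (@leq_bigmax _ (fun i : 'I_k.+1 => maxn (n0 i) i) (Ordinal (ltnSn k))).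
have n0n k : (n0 k <= n k)%N by apply: leq_trans (kn k); exact: leq_maxl.
have nn k : (n k <= n k.+1)%N.
  by apply/bigmax_leqP => i _;
    exact: (@leq_bigmax _ (fun i : 'I_k.+2 => maxn (n0 i) i) (widen_ord (leqnSn _) i)).
pose D k x := F (n k.+1) x - F (n k) x.
have mD k : measurable_fun setT (D k) by exact: measurable_funB.
have De k : (pint mu p (D k) <= (ep k)%:E)%E.
  by apply: Hn0; [exact: leq_trans (nn k)|].
(* Since [c k * ep k] is 2^-k, the weighted sum [S] of the |D_k|^p is integrable, hence finite
   almost everywhere; there |D_k| <= S^(1/p) 2^-k and the subsequence converges geometrically. *)
pose c (k : nat) : R := (2 `^ p) ^+ k.
have c0 k : 0 < c k by rewrite exprn_gt0// powR_gt0.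
have cep k : c k * ep k = 2^-1 ^+ k.
  rewrite /c /ep mulrA -exprMn -powRM ?(ltW h0)//.
  by rewrite divff ?pnatr_eq0// powR1 expr1n mul1r.
pose S x : \bar R := (\sum_(k <oo) (c k * `|D k x| `^ p)%:E)%E.
have mS k : measurable_fun setT (fun x => (c k * `|D k x| `^ p)%:E).
  apply/measurable_EFinP; apply: measurable_funM => //.
  by apply/measurable_EFinP; exact: measurable_abs_powR.
have S0 k x : (0 <= (c k * `|D k x| `^ p)%:E)%E by rewrite lee_fin mulr_ge0 ?powR_ge0 ?(ltW (c0 k)).
have mSS : measurable_fun setT S by apply: ge0_emeasurable_sum => //.
have intS : (\int[mu]_x S x < +oo)%E.
  rewrite /S integral_nneseries//.
  apply: (@le_lt_trans _ _ (\sum_(k <oo) (2^-1 ^+ k)%:E)%E).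
    apply: lee_nneseries => // [k _ _|k _]; first by apply: integral_ge0.
    under eq_integral do rewrite EFinM.
    rewrite ge0_integralZl//=.
    - by rewrite -cep EFinM lee_wpmul2l ?lee_fin ?(ltW (c0 k))// De.
    - exact: measurable_abs_powR.
    - by rewrite lee_fin (ltW (c0 k)).
  have cg : (series (fun k => (2^-1 : R) ^+ k)) @ \oo --> (1 - 2^-1 : R)^-1.
    have := @cvg_geometric_series R 1 2^-1; rewrite /geometric/=.
    rewrite div1r; under [X in series X]eq_fun do rewrite mul1r.
    by apply; rewrite ger0_norm ?invr_ge0// invf_lt1// ltr1n.
  have -> : (\sum_(k <oo) (2^-1 ^+ k)%:E)%E = ((1 - 2^-1 : R)^-1)%:E.
    apply/cvg_lim => //; under eq_fun do rewrite sumEFin.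
    by apply: cvg_EFin; first exact: nearW.
  exact: ltry.
have Sint : mu.-integrable setT S.
  apply/integrableP; split => //.
  by under eq_integral do rewrite gee0_abs ?nneseries_ge0//.
have good : {ae mu, forall x, cvgn (fun k => F (n k) x)}.
  apply: filterS (integrable_ae measurableT Sint) => x /(_ I) Sfin.
  pose s := fine (S x).
  have s0 : 0 <= s by rewrite fine_ge0// nneseries_ge0.
  apply: (geometric_cauchy_cvg (powR_ge0 s p^-1)) => k.
  have : c k * `|D k x| `^ p <= s.
    rewrite -lee_fin fineK// /S; apply: le_trans (nneseries_lim_ge k.+1 _); last first.
      by move=> ? _ _; exact: S0.
    by rewrite big_mkord big_ord_recr/= leeDr//; apply: sume_ge0 => i _; exact: S0.
  move=> H.
  have -> : `|F (n k.+1) x - F (n k) x| = (`|D k x| `^ p) `^ p^-1.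
    by rewrite -powRrM mulfV ?gt_eqF// powRr1.
  have -> : s `^ p^-1 * 2^-1 ^+ k = (s / c k) `^ p^-1.
    have E : (c k)^-1 = (2^-1 ^+ k) `^ p.
      rewrite /c -[(2 `^ p) ^+ k]powR_mulrn ?powR_ge0// -[2^-1 ^+ k]powR_mulrn//.
      rewrite -[2^-1]powR_inv1// -!powRrM -powRN; congr (_ `^ _); ring.
    rewrite E powRM ?powR_ge0//; congr (_ * _).
    by rewrite -powRrM mulfV ?gt_eqF// powRr1// exprn_ge0.
  rewrite ge0_ler_powR ?nnegrE ?invr_ge0 ?(ltW p0) ?powR_ge0 ?divr_ge0 ?(ltW (c0 k))//.
  by rewrite ler_pdivlMr// mulrC.
(* The upper limit is defined and measurable everywhere, and it agrees with the limit wherever the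
   subsequence converges. *)
pose f x := fine (limn_esup (fun k => (F (n k) x)%:E)).
have mf : measurable_fun setT f.
  apply: (measurableT_comp (fine_measurable measurableT)).
  by apply: measurable_fun_limn_esup => k; apply/measurable_EFinP.
have Ff : {ae mu, forall x, (fun k => F (n k) x) @ \oo --> f x}.
  apply: filterS good => x /cvg_ex[l Fl].
  have /cvg_limn_einf_sup[_ El] : (fun k => (F (n k) x)%:E) @ \oo --> l%:E.
    by apply: cvg_EFin => //; exact: nearW.
  by rewrite /f El.
exists f => // e e0; have [m0 Hm0] := cF e e0; exists m0 => m mm0.
have Hk0 k : (m0 <= n (k + m0))%N.
  by apply: leq_trans (kn _); rewrite leq_max; apply/orP; right; exact: leq_addl.
apply: (@pint_fatou (fun k x => F m x - F (n (k + m0)%N) x)).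
- by move=> k; exact: measurable_funB.
- exact: measurable_funB.
- apply: filterS Ff => x Fx; apply: cvgB; first exact: cvg_cst.
  by rewrite (cvg_shiftn m0 (fun k => F (n k) x)).
- by move=> k; apply: Hm0.
Qed.

End Lp_limits.

Section pairing.
Context {R : realType} {N : nat} (p : R).
Local Notation mu := (@lebesgue_rV R N).
Hypothesis p1 : 1 < p.
Let p0 : 0 < p. Proof. exact: lt_trans p1. Qed.

Lemma bounded_support_pairing (g : 'rV[R]_N -> R) (C r : R) : measurable_fun setT g -> 0 < r ->
  (forall y, `|g y| <= C) -> (forall y, r <= enorm y -> g y = 0) ->
  exists2 K : R, 0 <= K & forall (f : 'rV[R]_N -> R) (b : R), measurable_fun setT f ->
    0 <= b -> (pint mu p f <= b%:E)%E -> `|\int[mu]_y (f y * g y)| <= b `^ p^-1 * K.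
Proof.
move=> mg r0 gC g0.
have q0 : 0 < 1 - p^-1 by rewrite subr_gt0 invf_lt1.
have q'0 : 0 < (1 - p^-1)^-1 by rewrite invr_gt0.
have pq : p^-1 + (1 - p^-1)^-1^-1 = 1 by rewrite invrK subrKC.
have C0 : 0 <= C by apply: le_trans (gC 0).
have i1 : mu.-integrable setT (fun y => (`|g y| `^ (1 - p^-1)^-1)%:E).
  apply: (bounded_support_integrable _ r0 (C := C `^ (1 - p^-1)^-1)).
  - by apply/measurable_EFinP; exact: measurable_abs_powR.
  - by move=> y; rewrite ger0_norm ?powR_ge0// ge0_ler_powR ?nnegrE ?(ltW q'0).
  - by move=> y /g0 ->; rewrite normr0 powR0 ?gt_eqF.
pose B := \int[mu]_y (`|g y| `^ (1 - p^-1)^-1).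
have B0 : 0 <= B by apply: Rintegral_ge0 => y _; exact: powR_ge0.
have gB : (\int[mu]_y (`|g y| `^ (1 - p^-1)^-1)%:E <= B%:E)%E.
  by rewrite /B /Rintegral fineK// integrable_fin_num.
exists (B `^ (1 - p^-1)); first exact: powR_ge0.
move=> f b mf b0 fb.
have maf : measurable_fun setT (fun y => `|f y|) by exact: measurableT_comp.
have mag : measurable_fun setT (fun y => `|g y|) by exact: measurableT_comp.
have := ge0_holder_le maf mag (fun y => normr_ge0 _) (fun y => normr_ge0 _) p0 q'0 pq b0 B0 fb gB.
rewrite invrK => H.
have ifg : mu.-integrable setT (EFin \o (fun y => f y * g y)).
  apply: (pint_bounded_integrable p1 mf _ mg r0 gC g0).
  by apply: le_lt_trans fb _; exact: ltry.
rewrite -lee_fin EFin_normr_Rintegral//; apply: le_trans H.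
apply: le_trans (le_abse_integral _ measurableT (measurable_int _ ifg)) _.
rewrite le_eqVlt; apply/orP; left; apply/eqP; apply: eq_integral => y _.
by rewrite /= normrM.
Qed.

End pairing.

(** * The Sobolev space as a set of pairs *)

Section sobolev_space.
Context {R : realType} {N : nat} (p : R).
Local Notation mu := (@lebesgue_rV R N).
Hypotheses (p1 : 1 < p).
Let p0 : 0 < p. Proof. exact: lt_trans p1. Qed.
Implicit Types (U V W : @pairs R N).

Lemma bounded_of_support (h : 'rV[R]_N -> R) (r : R) : continuous h ->
  (forall y, r <= enorm y -> h y = 0) -> exists C : R, forall y, `|h y| <= C.
Proof.
move=> ch h0; have [C C0 HC] := continuous_bounded_on_ball r ch; exists C => y.
by have [/HC//|/h0 ->] := ltP (enorm y) r; rewrite normr0.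
Qed.

Definition W1p_pair : set (@pairs R N) := [set U | W1p p (fct_of U) (grad_of U)].

Lemma W1p_pairE U : W1p_pair U <-> finite_energy p U /\ weak_gradient (fct_of U) (grad_of U).
Proof.
split=> [[/(Lfun_pint _ p0)[mu_ uoo] Duoo wg]|[[mu_ mG uoo Goo] wg]].
  have mDu i : measurable_fun setT (fun y : 'rV[R]_N => grad_of U y 0 i).
    by have /(Lfun_pint _ p0)[] := Duoo i.
  have Dufin i : (pint mu p (fun y : 'rV[R]_N => grad_of U y 0%R i) < +oo)%E.
    by have /(Lfun_pint _ p0)[] := Duoo i.
  split; last exact: wg.
  split; [exact: mu_|by apply: measurable_fun_rV => i; exact: mDu|exact: uoo|].
  rewrite gradient_pintE.
  pose e := \sum_i fine (pint mu p (fun y : 'rV[R]_N => grad_of U y 0%R i)).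
  apply: le_lt_trans (@gradient_energy_le R N p p1 _ e mDu _) (ltry _).
  move=> i.
  have fi : pint mu p (fun y : 'rV[R]_N => grad_of U y 0%R i) \is a fin_num.
    by rewrite ge0_fin_numE; [exact: Dufin|exact: pint_ge0].
  rewrite -(fineK fi) lee_fin /e (bigD1 i)//= lerDl; apply: sumr_ge0 => j _.
  by apply: fine_ge0; exact: pint_ge0.
have mGi i : measurable_fun setT (fun x : 'rV[R]_N => grad_of U x 0 i).
  by apply: (measurableT_comp (measurable_rV_coord i)); exact: mG.
split; [by apply/(Lfun_pint _ p0); split; [exact: mu_|exact: uoo]| |exact: wg].
move=> i; apply/(Lfun_pint _ p0); split; first exact: mGi.
apply: le_lt_trans Goo; apply: le_pint => //.
  by apply: measurableT_comp => //; exact: measurable_enorm.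
by move=> x; rewrite [leRHS]ger0_norm ?enorm_ge0//; exact: ler_coord_enorm.
Qed.

Let coord_finite U i : finite_energy p U ->
  measurable_fun setT (fun x : 'rV[R]_N => grad_of U x 0 i) /\
  (pint mu p (fun x : 'rV[R]_N => grad_of U x 0%R i) < +oo)%E.
Proof.
move=> [_ mG _ Goo].
have mGi : measurable_fun setT (fun x : 'rV[R]_N => grad_of U x 0 i).
  by apply: (measurableT_comp (measurable_rV_coord i)); exact: mG.
split; first exact: mGi.
apply: le_lt_trans Goo; apply: le_pint => //.
  by apply: measurableT_comp => //; exact: measurable_enorm.
by move=> x; rewrite [leRHS]ger0_norm ?enorm_ge0//; exact: ler_coord_enorm.
Qed.

Lemma test_pairing_integrable U (phi : 'rV[R]_N -> R) i : finite_energy p U -> test_function phi ->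
  mu.-integrable setT (EFin \o (fun x => fct_of U x * partial i phi x)) /\
  mu.-integrable setT (EFin \o (fun x => grad_of U x 0 i * phi x)).
Proof.
move=> fU tphi; have [r r0 supp] := test_function_support tphi.
have cphi := test_function_continuous tphi.
have cdphi := @test_function_continuous_partial _ _ _ i tphi.
have [C HC] := bounded_of_support cphi (fun y ry => (supp y ry).1).
have [C' HC'] := bounded_of_support cdphi (fun y ry => (supp y ry).2 i).
have [mGi Gi] := coord_finite i fU; have [mU _ Uoo _] := fU.
split.
  exact: (pint_bounded_integrable p1 mU Uoo (continuous_measurable_rV cdphi) r0 HC'
    (fun y ry => (supp y ry).2 i)).
exact: (pint_bounded_integrable p1 mGi Gi (continuous_measurable_rV cphi) r0 HC
  (fun y ry => (supp y ry).1)).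
Qed.

Lemma W1p_pairP (b : R) U V : W1p_pair U -> W1p_pair V -> W1p_pair (b *: U + V).
Proof.
move=> /W1p_pairE[fU wU] /W1p_pairE[fV wV]; apply/W1p_pairE; split.
  exact: finite_energyP p1 b U V fU fV.
move=> phi tphi i.
have [iU1 iU2] := test_pairing_integrable i fU tphi.
have [iV1 iV2] := test_pairing_integrable i fV tphi.
transitivity (\int[mu]_x (b * (fct_of U x * partial i phi x) + 1 * (fct_of V x * partial i phi x))).
  by apply: eq_Rintegral => x _; rewrite fct_ofP mul1r mulrDl mulrA.
rewrite (Rintegral_lin2 b 1 iU1 iV1).2 (wU _ tphi i) (wV _ tphi i) mul1r mulrN -opprD; congr (- _).
rewrite -[X in _ + X]mul1r -(Rintegral_lin2 b 1 iU2 iV2).2.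
by apply: eq_Rintegral => x _; rewrite grad_ofP !mxE mul1r mulrDl mulrA.
Qed.

(** Both sides of the weak gradient identity are continuous in L^p, because the test function and
    its derivatives are bounded with bounded support. *)
Lemma W1p_pair_closed U : finite_energy p U ->
  (forall e : R, 0 < e -> exists2 V, W1p_pair V &
    (pint mu p (fun x => fct_of U x - fct_of V x)%R <= e%:E)%E /\
    (gradient_pint p (fun x => grad_of U x - grad_of V x)%R <= e%:E)%E) -> W1p_pair U.
Proof.
move=> fU H; apply/W1p_pairE; split; first exact: fU.
move=> phi tphi i; apply/eqP; rewrite -subr_eq0 opprK -normr_eq0.
have [iU1 iU2] := test_pairing_integrable i fU tphi.
have [r r0 supp] := test_function_support tphi.
have cphi := test_function_continuous tphi.
have cdphi := @test_function_continuous_partial _ _ _ i tphi.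
have [C HC] := bounded_of_support cphi (fun y ry => (supp y ry).1).
have [C' HC'] := bounded_of_support cdphi (fun y ry => (supp y ry).2 i).
have [K K0 HK] := bounded_support_pairing p1 (continuous_measurable_rV cdphi) r0 HC'
  (fun y ry => (supp y ry).2 i).
have [K' K'0 HK'] := bounded_support_pairing p1 (continuous_measurable_rV cphi) r0 HC
  (fun y ry => (supp y ry).1).
rewrite eq_le normr_ge0 andbT; apply/ler_addgt0Pr => e e0; rewrite add0r.
have KK0 : 0 < K + K' + 1 by rewrite ltr_pwDr// addr_ge0.
pose d := (e / (K + K' + 1)) `^ p.
have d0 : 0 < d by apply: powR_gt0; exact: divr_gt0.
have [V /W1p_pairE[fV wV] [h1 h2]] := H _ d0.
have [iV1 iV2] := test_pairing_integrable i fV tphi.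
have mUV := finite_energyB p1 fU fV.
have [mGi Gi] := coord_finite i mUV; have [mD _ _ _] := mUV.
have h2i : (pint mu p (fun x : 'rV[R]_N => grad_of (U - V) x 0%R i) <= d%:E)%E.
  apply: le_trans h2; apply: le_pint => //.
    by apply: measurableT_comp; [exact: measurable_enorm|have [] := mUV].
  by move=> x; rewrite [leRHS]ger0_norm ?enorm_ge0//; exact: ler_coord_enorm.
have b1 := HK _ _ mD (ltW d0) h1; have b2 := HK' _ _ mGi (ltW d0) h2i.
have dp : d `^ p^-1 = e / (K + K' + 1).
  by rewrite /d -powRrM mulfV ?gt_eqF// powRr1// ltW// divr_gt0.
have -> : \int[mu]_x (fct_of U x * partial i phi x) + \int[mu]_x (grad_of U x 0 i * phi x) =
    \int[mu]_x (fct_of (U - V) x * partial i phi x) + \int[mu]_x (grad_of (U - V) x 0 i * phi x).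
  have -> : \int[mu]_x (fct_of (U - V) x * partial i phi x) =
      1 * \int[mu]_x (fct_of U x * partial i phi x) + (-1) * \int[mu]_x
        (fct_of V x * partial i phi x).
    rewrite -(Rintegral_lin2 1 (-1) iU1 iV1).2; apply: eq_Rintegral => x _.
    by rewrite fct_ofB mulN1r mul1r mulrBl.
  have -> : \int[mu]_x (grad_of (U - V) x 0 i * phi x) =
      1 * \int[mu]_x (grad_of U x 0 i * phi x) + (-1) * \int[mu]_x (grad_of V x 0 i * phi x).
    rewrite -(Rintegral_lin2 1 (-1) iU2 iV2).2; apply: eq_Rintegral => x _.
    by rewrite grad_ofB !mxE mulN1r mul1r mulrBl.
  by rewrite (wV _ tphi i); ring.
apply: le_trans (ler_normD _ _) _; apply: le_trans (lerD b1 b2) _.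
rewrite dp -mulrDr mulrAC ler_pdivrMr// ler_wpM2l ?(ltW e0)//.
by rewrite lerDl.
Qed.

(** The bound uniform in [x] selects the continuous representative: pointwise estimates for C^1
    pairs then pass to the limit at every point, not just almost everywhere. *)
Definition approximable U := forall e : R, 0 < e -> exists f G,
  [/\ C1_pair f G, (pint mu p (fun x => fct_of U x - f x)%R <= e%:E)%E,
      (gradient_pint p (fun x => grad_of U x - G x)%R <= e%:E)%E &
      forall x, `|fct_of U x - f x| <= e].

Definition sobolev : set (@pairs R N) := [set U | W1p_pair U /\ approximable U].

Lemma sobolev_finite U : sobolev U -> finite_energy p U.
Proof. by move=> [/W1p_pairE[]]. Qed.

Definition mkpair (f : 'rV[R]_N -> R) (G : 'rV[R]_N -> 'rV[R]_N) : @pairs R N := (f, G).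

Lemma pint0 : pint mu p (fun=> 0 : R) = 0%E.
Proof. by apply: integral0_eq => x _; rewrite normr0 powR0// gt_eqF. Qed.

Lemma sobolev_C1_pair f G : C1_pair f G -> finite_energy p (mkpair f G) -> sobolev (mkpair f G).
Proof.
move=> fG fe; split.
  by apply/W1p_pairE; split; [exact: fe|exact: C1_pair_weak_gradient].
move=> e e0; exists f, G; split; first exact: fG.
- rewrite (_ : (fun x => _) = fun=> 0); first by rewrite pint0 lee_fin ltW.
  by apply/funext => x; rewrite /fct_of subrr.
- rewrite /gradient_pint (_ : (fun x => _) = fun=> 0); first by rewrite pint0 lee_fin ltW.
  by apply/funext => x; rewrite /grad_of subrr enorm0.
- by move=> x; rewrite /fct_of subrr normr0 ltW.
Qed.

Lemma C1_pair_lincomb (b : R) f G f' G' : C1_pair f G -> C1_pair f' G' ->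
  C1_pair (fun x : 'rV[R]_N => b * f x + f' x) (fun x => b *: G x + G' x).
Proof.
move=> [cf cG df] [cf' cG' df']; split.
- by move=> x; apply: (continuousD (continuousM (cvg_cst _) (cf x)) (cf' x)).
- have ci (H : 'rV[R]_N -> 'rV[R]_N) i : continuous H -> continuous (fun x => H x 0 i).
    move=> cH y; apply: (@cvg_comp _ _ _ H (fun z : 'rV[R]_N => z 0 i)); first exact: cH.
    exact: coord_continuous.
  apply: continuous_rV_vec => i; under eq_fun do rewrite !mxE.
  by move=> x; apply: (continuousD (continuousM (cvg_cst _) (ci _ i cG x)) (ci _ i cG' x)).
- move=> x v; have := is_deriveD (is_deriveZ b (df x v)) (df' x v).
  by rewrite dotvDl dotvZl.
Qed.

Lemma sobolevP (b : R) U V : sobolev U -> sobolev V -> sobolev (b *: U + V).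
Proof.
move=> [wU aU] [wV aV]; split; first exact: W1p_pairP.
have fU := sobolev_finite (conj wU aU); have fV := sobolev_finite (conj wV aV).
move=> e e0; pose k := 2 `^ p * ((`|b| `^ p + 1)).
have k0 : 0 < k by rewrite mulr_gt0 ?powR_gt0// ltr_wpDl ?powR_ge0.
have b0 : 0 < `|b| + 1 by rewrite ltr_wpDl.
pose d := Num.min (e / k) (e / (`|b| + 1)).
have d0 : 0 < d by rewrite lt_min !divr_gt0.
have dk : k * d <= e by rewrite mulrC -ler_pdivlMr// /d ge_min lexx.
have db : (`|b| + 1) * d <= e by rewrite mulrC -ler_pdivlMr// /d ge_min lexx orbT.
have [f [G [fG f1 f2 f3]]] := aU _ d0; have [f' [G' [fG' g1 g2 g3]]] := aV _ d0.
have [mU mGU _ _] := fU; have [mV mGV _ _] := fV.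
have mC (h : 'rV[R]_N -> R) : continuous h -> measurable_fun setT h.
  by move=> ch; exact: continuous_measurable_rV.
have mf : measurable_fun setT f by apply: mC; case: fG.
have mf' : measurable_fun setT f' by apply: mC; case: fG'.
have mfD : measurable_fun setT (fun x => fct_of U x - f x) by exact: measurable_funB.
have mfD' : measurable_fun setT (fun x => fct_of V x - f' x) by exact: measurable_funB.
have mvB (H K : 'rV[R]_N -> 'rV[R]_N) : measurable_fun setT H -> continuous K ->
    measurable_fun setT (fun x => enorm (H x - K x)).
  move=> mH cK; apply: measurableT_comp; first exact: measurable_enorm.
  apply: measurable_fun_rV => i; rewrite (_ : _ \o _ = fun x => rV_coord i (H x) - K x 0 i).
    apply: measurable_funB; first by apply: (measurableT_comp (measurable_rV_coord i)).
    apply: mC => x; apply: (@cvg_comp _ _ _ K (fun z : 'rV[R]_N => z 0 i)); first exact: cK.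
    exact: coord_continuous.
  by apply/funext => x; rewrite /= /rV_coord !mxE.
have mG1 : measurable_fun setT (fun x => enorm (grad_of U x - G x)) by apply: mvB => //; case: fG.
have mG2 : measurable_fun setT (fun x => enorm (grad_of V x - G' x)) by apply: mvB => //; case: fG'.
have bd (u v : 'rV[R]_N -> R) (w : 'rV[R]_N -> R) :
  measurable_fun setT u -> measurable_fun setT v ->
    measurable_fun setT w -> (pint mu p u <= d%:E)%E -> (pint mu p v <= d%:E)%E ->
    (forall x, `|w x| <= `|b| * `|u x| + `|v x|) -> (pint mu p w <= e%:E)%E.
  move=> mu1 mv mw ud vd wle.
  have mbu : measurable_fun setT (fun x => b * u x) by exact: measurable_funM.
  have mau : measurable_fun setT (fun x => `|b * u x|) by exact: measurableT_comp.
  have mav : measurable_fun setT (fun x => `|v x|) by exact: measurableT_comp.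
  apply: (@le_trans _ _ (pint mu p (fun x => `|b * u x| + `|v x|))).
    apply: (le_pint _ p0 mw); first exact: measurable_funD.
    by move=> x; rewrite [leRHS]ger0_norm ?addr_ge0// normrM; exact: wle.
  have pn (h : 'rV[R]_N -> R) : pint mu p (fun x => `|h x|) = pint mu p h.
    by apply: eq_integral => x _; rewrite normr_id.
  have ub : (pint mu p (fun x => `|b * u x|)%R <= (`|b| `^ p * d)%:E)%E.
    by rewrite pn pintZ// EFinM lee_wpmul2l ?lee_fin ?powR_ge0.
  have vb : (pint mu p (fun x => `|v x|)%R <= d%:E)%E by rewrite pn.
  apply: le_trans (pintD_le p0 mau mav ub vb) _; rewrite lee_fin; apply: le_trans dk.
  by rewrite /k le_eqVlt; apply/orP; left; apply/eqP; ring.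
exists (fun x => b * f x + f' x), (fun x => b *: G x + G' x); split.
- exact: C1_pair_lincomb.
- apply: (bd _ _ _ mfD mfD' _ f1 g1).
    have [mUV _ _ _] := finite_energyP p1 b fU fV.
    by apply: measurable_funB => //; apply: measurable_funD => //; exact: measurable_funM.
  move=> x; rewrite fct_ofP opprD addrACA -mulrBr.
  by apply: le_trans (ler_normD _ _) _; rewrite normrM.
- apply: (bd _ _ _ mG1 mG2 _ f2 g2).
    have [_ mUV _ _] := finite_energyP p1 b fU fV; apply: mvB => //.
    by case: (C1_pair_lincomb b fG fG').
  move=> x; rewrite [leLHS]ger0_norm ?enorm_ge0//.
  rewrite [`|enorm (grad_of U x - _)|]ger0_norm ?enorm_ge0//
    [`|enorm (grad_of V x - _)|]ger0_norm ?enorm_ge0//.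
  rewrite grad_ofP opprD addrACA -scalerBr.
  by apply: le_trans (ler_enormD _ _) _; rewrite enormZ.
- move=> x; rewrite fct_ofP opprD addrACA -mulrBr.
  apply: le_trans (ler_normD _ _) _; rewrite normrM; apply: le_trans db.
  by rewrite mulrDl mul1r lerD// ler_wpM2l.
Qed.

End sobolev_space.

(** * Sobolev embedding and completeness *)

Section sobolev_embedding.
Context {R : realType} {N : nat} (p : R) (a : 'rV[R]_N -> R) (al A : R).
Local Notation mu := (@lebesgue_rV R N).
Hypotheses (N_ge1 : (0 < N)%N) (N_lt_p : N%:R < p).
Hypotheses (ma : measurable_fun setT a) (al0 : 0 < al).
Hypotheses (a_ge : forall x, al <= a x) (a_le : forall x, a x <= A).
Implicit Types (U V W : @pairs R N).

Lemma embedding_p_gt1 : 1 < p.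
Proof. by apply: le_lt_trans N_lt_p; rewrite ler1n. Qed.
Let p1 := embedding_p_gt1.
Let p0 : 0 < p. Proof. exact: lt_trans p1. Qed.

Lemma embedding_exponent : 2 <= p \/ N = 1%N.
Proof.
case: N N_ge1 N_lt_p => [|[|n]] // _ np; [by right|left].
by apply: le_trans (ltW np); rewrite ler_nat.
Qed.

Let A0 : 0 <= A.
Proof. by apply: le_trans (ltW al0) _; apply: le_trans (a_ge 0) (a_le 0). Qed.

(** This is [k_a] with [al] for the essential infimum of the potential and the unit ball volume for
    the Gamma quotient. *)
Definition sup_cst : R :=
  ((1 / al) `^ ((p - N%:R) / p ^+ 2) * 2 `^ ((p - 1) / p) *
        (eball_volume N)^-1 `^ (1 / p) * (1 / N%:R `^ (N%:R / p ^+ 2)) *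
        ((p - 1) / (p - N%:R)) `^ (N%:R * (p - 1) / p ^+ 2)).

Local Notation E := (energy p a).
Local Notation fin := (finite_energy p).

Let K := sup_cst `^ p * p.
Let K0 : 0 <= K. Proof. by rewrite mulr_ge0 ?powR_ge0 ?(ltW p0). Qed.

Lemma small_energy U (d : R) : fin U -> E U <= d ->
  (pint mu p (fct_of U) <= (p * d / al)%:E)%E /\ (gradient_pint p (grad_of U) <= (p * d)%:E)%E.
Proof.
move=> fU Ud; have [mU mG Uoo Goo] := fU.
have h := energy_ge p1 ma al0 a_ge a_le fU.
have {}h : (gradient_pint p (grad_of U) + al%:E * pint mu p (fct_of U) <= (p * d)%:E)%E.
  by apply: le_trans h _; rewrite lee_fin ler_wpM2l// ltW.
have g0 : (0 <= gradient_pint p (grad_of U))%E by exact: pint_ge0.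
have f0 : (0 <= al%:E * pint mu p (fct_of U))%E.
  by apply: mule_ge0; [rewrite lee_fin ltW|exact: pint_ge0].
split; last by apply: le_trans h; exact: leeDl.
have fi : pint mu p (fct_of U) \is a fin_num by rewrite ge0_fin_numE; [exact: Uoo|exact: pint_ge0].
have : (al%:E * pint mu p (fct_of U) <= (p * d)%:E)%E by apply: le_trans h; exact: leeDr.
by rewrite -(fineK fi) -EFinM !lee_fin ler_pdivlMr// mulrC.
Qed.

Lemma pint_energy U (d : R) : fin U -> 0 <= d -> (pint mu p (fct_of U) <= d%:E)%E ->
  (gradient_pint p (grad_of U) <= d%:E)%E -> E U <= (1 + A) / p * d.
Proof.
move=> fU d0 h1 h2; have := energy_le p1 ma al0 a_ge a_le fU h1 h2.
by rewrite mulrAC ler_pdivlMr// mulrDl mul1r mulrC.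
Qed.

Lemma energyBC U V : fin U -> fin V -> E (U - V) = E (V - U).
Proof.
move=> fU fV; have fD := finite_energyB p1 fV fU.
have -> : U - V = (-1) *: (V - U) by rewrite scaleN1r opprB.
rewrite (@energyZ R N p a al A ma al0 a_ge a_le (-1) (V - U) fD).
by rewrite normrN normr1 powR1 mul1r.
Qed.

Lemma C1_sup f (G : 'rV[R]_N -> 'rV[R]_N) : C1_pair f G -> fin (mkpair f G) ->
  forall x, `|f x| `^ p <= K * E (mkpair f G).
Proof.
move=> fG fF x; have [_ _ foo Goo] := fF.
have ge := energy_ge p1 ma al0 a_ge a_le fF.
have ff : pint mu p f \is a fin_num by rewrite ge0_fin_numE; [exact: foo|exact: pint_ge0].
have gf : gradient_pint p G \is a fin_num by rewrite ge0_fin_numE; [exact: Goo|exact: pint_ge0].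
have B0 : 0 <= fine (pint mu p f) by apply: fine_ge0; exact: pint_ge0.
have C0 : 0 <= fine (gradient_pint p G) by apply: fine_ge0; exact: pint_ge0.
have GA : (\int[mu]_y (enorm (G y) `^ p)%:E <= (fine (gradient_pint p G))%:E)%E.
  by rewrite (fineK gf) gradient_pintE.
have fB : (\int[mu]_y (`|f y| `^ p)%:E <= (fine (pint mu p f))%:E)%E by rewrite (fineK ff).
apply: le_trans (morrey_energy N_ge1 N_lt_p fG C0 B0 GA fB x al0) _.
have -> : K * E (mkpair f G) = sup_cst `^ p * (p * E (mkpair f G)) by rewrite mulrA.
rewrite ler_wpM2l ?powR_ge0//.
by move: ge; rewrite /fct_of/grad_of/= -(fineK ff) -(fineK gf) -EFinM -EFinD lee_fin.
Qed.

Lemma sobolev_approx U (e : R) : sobolev p U -> 0 < e -> exists f G,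
  [/\ C1_pair f G, fin (mkpair f G), E (U - mkpair f G) <= e &
      forall x, `|fct_of U x - f x| <= e].
Proof.
move=> sU e0; have fU := sobolev_finite p1 sU; have [mU mGU Uoo Goo] := fU.
pose d := Num.min e (e / ((1 + A) / p)).
have k0 : 0 < (1 + A) / p by rewrite divr_gt0// ltr_wpDr.
have d0 : 0 < d by rewrite lt_min e0 divr_gt0.
have [f [G [fG f1 f2 f3]]] := sU.2 _ d0.
have [cf cG _] := fG.
have mG : measurable_fun setT G.
  apply: measurable_fun_rV => i; apply: continuous_measurable_rV => x.
  by apply: (@cvg_comp _ _ _ G (fun z : 'rV[R]_N => z 0 i)); [exact: cG|exact: coord_continuous].
have fD : fin (U - mkpair f G).
  split.
  - by apply: measurable_funB; [exact: mU|exact: continuous_measurable_rV].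
  - apply: measurable_fun_rV => i; rewrite (_ : _ \o _ =
      fun x => rV_coord i (grad_of U x) - rV_coord i (G x)).
      by apply: measurable_funB; apply: (measurableT_comp (measurable_rV_coord i)).
    by apply/funext => x;
      rewrite -[LHS]/(rV_coord i (grad_of (U - mkpair f G) x)) grad_ofB /rV_coord !mxE.
  - by apply: le_lt_trans f1 _; exact: ltry.
  - by apply: le_lt_trans f2 _; exact: ltry.
exists f, G; split; [exact: fG| | |].
- have := finite_energyB p1 fU fD; by rewrite opprB addrC subrK.
- apply: le_trans (pint_energy fD (ltW d0) f1 f2) _.
  by rewrite mulrC -ler_pdivlMr// /d ge_min lexx orbT.
- by move=> x; apply: le_trans (f3 x) _; rewrite /d ge_min lexx.
Qed.

Lemma approximable_energy U : fin U -> (forall e : R, 0 < e -> exists f G,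
  [/\ C1_pair f G, fin (mkpair f G), E (U - mkpair f G) <= e &
      forall x, `|fct_of U x - f x| <= e]) -> approximable p U.
Proof.
move=> fU H e e0.
pose d := Num.min e (Num.min (e / (p / al)) (e / p)).
have d0 : 0 < d by rewrite !lt_min e0 !divr_gt0.
have de : d <= e by rewrite /d ge_min lexx.
have d1 : p * d / al <= e by rewrite mulrAC mulrC -ler_pdivlMr ?divr_gt0// /d !ge_min lexx orbT.
have d2 : p * d <= e by rewrite mulrC -ler_pdivlMr// /d !ge_min lexx !orbT.
have [f [G [fG fF EF sF]]] := H _ d0.
have fD := finite_energyB p1 fU fF.
have [h1 h2] := small_energy fD EF.
exists f, G; split; [exact: fG| | |].
- by apply: le_trans h1 _; rewrite lee_fin.
- by apply: le_trans h2 _; rewrite lee_fin.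
- by move=> x; apply: le_trans (sF x) _.
Qed.

(** Limit of the estimate for C^1 pairs along an approximation that converges both in energy and at
    the point [x]. *)
Theorem sobolev_sup U x : sobolev p U -> `|fct_of U x| `^ p <= sup_cst `^ p * (p * E U).
Proof.
have gen (e x1 y z t : R) : y <= t -> t - z <= e / 2 -> x1 - y < e / 2 -> x1 <= z + e.
  by move=> *; lra.
move=> sU; have fU := sobolev_finite p1 sU.
apply/ler_addgt0Pr => e e0.
have e20 : 0 < e / 2 by rewrite divr_gt0.
have [d1 /= d10 Hd1] := (@cvgrPdist_lt _ _ _ _ _ _ _).1
  (@continuous_powR_norm R p p0 (fct_of U x)) _ e20.
have k0 : 0 < e / 2 / (K + 1) by rewrite divr_gt0// ltr_wpDl.
have [d2 d20 Hd2] := energy_continuous p1 ma al0 a_ge a_le (E U) k0.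
pose d := Num.min (d1 / 2) d2.
have d0 : 0 < d by rewrite lt_min d20 divr_gt0.
have [f [G [fG fF EF sF]]] := sobolev_approx sU d0.
have h1 : `| (`|fct_of U x| `^ p) - `|f x| `^ p| < e / 2.
  apply: Hd1; rewrite /ball/=; apply: le_lt_trans (sF x) _.
  by apply: (@le_lt_trans _ _ (d1 / 2));
    [rewrite /d ge_min lexx|rewrite ltr_pdivrMr// ltr_pMr// ltr1n].
have h2 : `|E U - E (mkpair f G)| <= e / 2 / (K + 1).
  apply: Hd2 => //; apply: le_trans EF _; by rewrite /d ge_min lexx orbT.
have h3 := C1_sup fG fF x.
have h4 : K * (E (mkpair f G) - E U) <= e / 2.
  apply: (@le_trans _ _ (K * (e / 2 / (K + 1)))).
    by rewrite ler_wpM2l//; apply: le_trans h2; rewrite distrC ler_norm.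
  by rewrite mulrA ler_pdivrMr ?ltr_wpDl// mulrC ler_wpM2l ?(ltW e20)// lerDl.
have h5 : `|fct_of U x| `^ p - `|f x| `^ p < e / 2 by apply: le_lt_trans h1; exact: ler_norm.
rewrite mulrA -/K.

by rewrite mulrBr in h4; exact: gen h3 h4 h5.
Qed.

Lemma sobolev_sup_le U (M : R) x : sobolev p U -> E U <= M ->
  `|fct_of U x| <= (K * M) `^ p^-1.
Proof.
move=> sU UM; have := sobolev_sup x sU => h.
have h' : `|fct_of U x| `^ p <= K * M.
  by apply: le_trans h _; rewrite mulrA ler_wpM2l.
have -> : `|fct_of U x| = (`|fct_of U x| `^ p) `^ p^-1.
  by rewrite -powRrM mulfV ?gt_eqF// powRr1.
by rewrite ge0_ler_powR ?invr_ge0 ?(ltW p0)// nnegrE ?powR_ge0//; apply: le_trans h';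
  exact: powR_ge0.
Qed.

Lemma sobolev_sup_bounded (M : R) : exists2 C : R, 0 <= C & forall U x, sobolev p U -> E U <= M ->
  `|fct_of U x| <= C.
Proof.
by exists ((K * M) `^ p^-1); [exact: powR_ge0|move=> U x sU UM; exact: sobolev_sup_le].
Qed.

Lemma sobolev_sup_small (e : R) : 0 < e -> exists2 d : R, 0 < d & forall U x, sobolev p U ->
  E U <= d -> `|fct_of U x| <= e.
Proof.
move=> e0; exists (e `^ p / (K + 1)); first by rewrite divr_gt0 ?powR_gt0// ltr_wpDl.
move=> U x sU UM; apply: le_trans (sobolev_sup_le x sU UM) _.
have e1 : (e `^ p) `^ p^-1 = e by rewrite -powRrM mulfV ?gt_eqF// powRr1// ltW.
have K1 : 0 < K + 1 by rewrite ltr_wpDl.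
have h : K * (e `^ p / (K + 1)) <= e `^ p.
  by rewrite mulrA ler_pdivrMr// mulrC ler_wpM2l ?powR_ge0// lerDl.
rewrite -[leRHS]e1 ge0_ler_powR ?invr_ge0 ?(ltW p0)// nnegrE ?powR_ge0//.
by rewrite mulr_ge0// divr_ge0 ?powR_ge0// ltW.
Qed.

Theorem sobolev_modulus (M e : R) : 0 < e -> exists2 rho : R, 0 < rho & forall U, sobolev p U ->
  E U <= M -> forall x y, enorm (x - y) <= rho -> `|fct_of U x - fct_of U y| <= e.
Proof.
have gen (x y z t : R) : x - y <= 1 -> y <= z -> z <= t -> x <= t + 1 by move=> *; lra.
have gen2 (q x y z l : R) : l = q * (1 + x * y) + 1 -> l != 0 ->
  q * (z / l + x * (y * (z / l))) = z * ((l - 1) / l) by move=> -> h; field.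
have gen3 (x y z t : R) : x <= t / 4 -> y <= t / 2 -> z <= t / 4 -> x + y + z <= t by move=> *; lra.
move=> e0; pose B := p * (`|M| + 1).
have B0 : 0 <= B by rewrite mulr_ge0 ?(ltW p0) ?addr_ge0.
pose kap := 1 - N%:R / p.
have kap0 : 0 < kap by rewrite subr_gt0 ltr_pdivrMr// mul1r.
pose L := @morrey_cst R N p * B `^ p^-1 * (1 + 2 ^+ N * 2 `^ kap) + 1 : R.
have L0 : 0 < L.
  by rewrite ltr_wpDl// mulr_ge0 ?addr_ge0 ?mulr_ge0 ?powR_ge0 ?exprn_ge0.
have eL : 0 < e / 2 / L by rewrite !divr_gt0.
(* With [kap] the Hoelder exponent 1 - N/p, Morrey's modulus at scale [rho] is at most (L - 1) / L
   times [e / 2]; the other half of [e] pays for the C^1 approximation at the two points. *)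
pose rho := (e / 2 / L) `^ kap^-1.
have rho0 : 0 < rho by exact: powR_gt0.
have rhok : rho `^ kap = e / 2 / L by rewrite -powRrM mulVf ?gt_eqF// powRr1// ltW.
have [d1 d10 Hd1] := energy_continuous p1 ma al0 a_ge a_le M ltr01.
exists rho => // U sU UM x y xy; have fU := sobolev_finite p1 sU.
pose d := Num.min (e / 4) d1.
have d0 : 0 < d by rewrite lt_min d10 divr_gt0.
have [f [G [fG fF EF sF]]] := sobolev_approx sU d0.
have h2 : `|E U - E (mkpair f G)| <= 1.
  by apply: (Hd1 _ _ fU fF UM); apply: le_trans EF _; rewrite /d ge_min lexx orbT.
have h3 : E (mkpair f G) <= `|M| + 1.
  have := le_trans (ler_norm _) (eq_ind_r (fun z => z <= 1) h2 (distrC _ _)) => h4.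
  exact: gen h4 UM (ler_norm M).
have [_ h4] := small_energy fF h3.
rewrite gradient_pintE in h4.
have h5 := morrey_modulus N_ge1 N_lt_p fG B0 h4 rho0 xy.
have h6 : `|f x - f y| <= e / 2.
  apply: le_trans h5 _; rewrite -/kap powRM ?(ltW rho0)// rhok.
  have -> : @morrey_cst R N p * B `^ p^-1 * (e / 2 / L + 2 ^+ N * (2 `^ kap * (e / 2 / L))) =
    (e / 2) * ((L - 1) / L) by exact: gen2 erefl (lt0r_neq0 L0).
  by rewrite ler_piMr ?divr_ge0 ?(ltW e0)// ler_pdivrMr// mul1r gerBl.
have d4 : d <= e / 4 by rewrite /d ge_min lexx.
have h7 := le_trans (sF x) d4; have h8 := le_trans (sF y) d4.
have -> : fct_of U x - fct_of U y = (fct_of U x - f x) + (f x - f y) - (fct_of U y - f y) by ring.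
apply: le_trans (ler_normB _ _) _; apply: le_trans (lerD (ler_normD _ _) (lexx _)) _.
exact: gen3 h7 h6 h8.
Qed.

(** The functions converge uniformly, by the sup bound applied to differences, which gives a limit
    defined at every point; the gradients converge componentwise by Riesz-Fischer. Fatou's lemma
    turns the Cauchy bound on the functions into convergence in L^p. *)
Theorem sobolev_complete (w : nat -> @pairs R N) : (forall n, sobolev p (w n)) ->
  (forall e : R, 0 < e -> exists n0, forall m n, (n0 <= m)%N -> (n0 <= n)%N ->
     E (w m - w n) <= e) ->
  exists2 v, sobolev p v & forall e : R, 0 < e -> exists n0, forall n, (n0 <= n)%N ->
    E (w n - v) <= e.
Proof.
move=> sw cw; have fw n := sobolev_finite p1 (sw n).
have fD m n := finite_energyB p1 (fw m) (fw n).
have sD m n : sobolev p (w m - w n) by rewrite -scaleN1r addrC; exact: (sobolevP p1).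
have ucau e : 0 < e -> exists n0, forall m n, (n0 <= m)%N -> (n0 <= n)%N ->
    forall x, `|fct_of (w m) x - fct_of (w n) x| <= e.
  move=> e0; have [d d0 Hd] := sobolev_sup_small e0; have [n0 Hn0] := cw _ d0.
  by exists n0 => m n mn nn x; rewrite -fct_ofB; apply: Hd; [exact: sD|exact: Hn0].
have cvx x : cvgn (fun n => fct_of (w n) x).
  apply/cauchy_cvgP/cauchy_ballP => e e0.
  have e20 : 0 < e / 2 by rewrite divr_gt0.
  have [n0 Hn0] := ucau _ e20.
  pose S : set R := [set z | exists2 n, (n0 <= n)%N & z = fct_of (w n) x].
  exists (S, S) => /=; first by split; exists n0 => // n nn; exists n.
  move=> [_ _] [/= [m mm ->] [n nn ->]]; rewrite /ball/=; apply: le_lt_trans (Hn0 m n mm nn x) _.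
  by rewrite ltr_pdivrMr// ltr_pMr// ltr1n.
pose f x := limn (fun n => fct_of (w n) x).
have unif e : 0 < e -> exists n0, forall n, (n0 <= n)%N -> forall x, `|fct_of (w n) x - f x| <= e.
  move=> e0; have [n0 Hn0] := ucau e e0; exists n0 => n nn x.
  have h : (fun m => `|fct_of (w n) x - fct_of (w m) x|) @ \oo --> `|fct_of (w n) x - f x|.
    by apply: cvg_norm; apply: cvgB; [exact: cvg_cst|exact: cvx].
  apply: (@closed_cvg _ _ \oo _ (fun m => `|fct_of (w n) x - fct_of (w m) x|)
    [set z | z <= e] (@closed_le _ e) _ _ h).
  by exists n0 => // m /= mm; exact: Hn0.
have mf : measurable_fun setT f.
  apply: (measurable_fun_cvg (h := fun n => fct_of (w n))); first by move=> n; case: (fw n).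
  by move=> x _; exact: cvx.
have small e : 0 < e -> exists n0, forall m n, (n0 <= m)%N -> (n0 <= n)%N ->
    (pint mu p (fct_of (w m - w n)) <= e%:E)%E /\ (gradient_pint p (grad_of (w m - w n)) <= e%:E)%E.
  move=> e0; pose d := Num.min (e / (p / al)) (e / p).
  have d0 : 0 < d by rewrite !lt_min !divr_gt0.
  have d1 : p * d / al <= e by rewrite mulrAC mulrC -ler_pdivlMr ?divr_gt0// /d !ge_min lexx.
  have d2 : p * d <= e by rewrite mulrC -ler_pdivlMr// /d !ge_min lexx !orbT.
  have [n0 Hn0] := cw _ d0; exists n0 => m n mm nn.
  have [h1 h2] := small_energy (fD m n) (Hn0 _ _ mm nn).
  by split; [apply: le_trans h1 _|apply: le_trans h2 _]; rewrite lee_fin.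
have mgi n i : measurable_fun setT (fun x : 'rV[R]_N => grad_of (w n) x 0 i).
  by apply: (measurableT_comp (measurable_rV_coord i)); case: (fw n).
have RF i : exists2 g : 'rV[R]_N -> R, measurable_fun setT g & forall e : R, 0 < e ->
    exists n0, forall n,
      (n0 <= n)%N -> (pint mu p (fun x => grad_of (w n) x 0%R i - g x)%R <= e%:E)%E.
  apply: (@riesz_fischer _ _ _ mu p p1 (fun n x => grad_of (w n) x 0 i) (fun n => mgi n i)).
  move=> e e0; have [n0 Hn0] := small e e0; exists n0 => m n mm nn.
  apply: le_trans (Hn0 m n mm nn).2; apply: (le_pint _ p0).
  - by apply: measurable_funB; exact: mgi.
  - by apply: measurableT_comp; [exact: measurable_enorm|case: (fD m n)].
  - move=> x; rewrite [leRHS]ger0_norm ?enorm_ge0// grad_ofB.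
    by apply: le_trans (ler_coord_enorm _ i); rewrite !mxE.
have /choice[g Hg] : forall i, exists g : 'rV[R]_N -> R, measurable_fun setT g /\ forall e :
  R, 0 < e ->
    exists n0, forall n,
      (n0 <= n)%N -> (pint mu p (fun x => grad_of (w n) x 0%R i - g x)%R <= e%:E)%E.
  by move=> i; have [g0 h1 h2] := RF i; exists g0.
pose G (x : 'rV[R]_N) : 'rV[R]_N := \row_i g i x.
have mG : measurable_fun setT G.
  apply: measurable_fun_rV => i; rewrite (_ : _ \o _ = g i); first by case: (Hg i).
  by apply/funext => x; rewrite /= /rV_coord mxE.
pose v := mkpair f G.
have conv e : 0 < e -> exists n0, forall n, (n0 <= n)%N ->
    (pint mu p (fct_of (w n - v)) <= e%:E)%E /\ (gradient_pint p (grad_of (w n - v)) <= e%:E)%E.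
  move=> e0; have [n0 Hn0] := small e e0.
  pose d := e / (N%:R `^ p * N%:R).
  have N0 : 0 < N%:R :> R by rewrite ltr0n.
  have d0 : 0 < d by rewrite divr_gt0// mulr_gt0// powR_gt0.
  have /choice[m Hm] : forall i, exists n1, forall n, (n1 <= n)%N ->
      (pint mu p (fun x => grad_of (w n) x 0%R i - g i x)%R <= d%:E)%E.
    by move=> i; exact: (Hg i).2.
  exists (maxn n0 (\max_i m i)) => n; rewrite geq_max => /andP[nn0 nm]; split.
    apply: (@pint_fatou _ _ _ mu p p1 (fun k x => fct_of (w n) x - fct_of (w (k + n0)%N) x)).
    - by move=> k; case: (fD n (k + n0)%N).
    - by apply: measurable_funB; [case: (fw n)|exact: mf].
    - apply: aeW => x; apply: cvgB; first exact: cvg_cst.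
      by rewrite (cvg_shiftn n0 (fun k => fct_of (w k) x)); exact: cvx.
    - by move=> k; apply: (Hn0 _ _ nn0 _).1; exact: leq_addl.
  rewrite gradient_pintE.
  apply: le_trans (@gradient_energy_le R N p p1 (fun x => grad_of (w n - v) x) d _ _) _.
  - move=> i; under eq_fun do rewrite grad_ofB !mxE.
    by apply: measurable_funB; [exact: mgi|case: (Hg i)].
  - move=> i; have := Hm i n (leq_trans (leq_bigmax i) nm).
    rewrite /pint; apply: le_trans; rewrite le_eqVlt; apply/orP; left; apply/eqP.
    by apply: eq_integral => x _; rewrite grad_ofB !mxE.
  - have -> : d *+ N = d * N%:R by rewrite mulr_natr.
    have Np : 0 < N%:R `^ p :> R by exact: powR_gt0.
    rewrite lee_fin le_eqVlt; apply/orP; left; apply/eqP; rewrite /d.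
    by field; rewrite !gt_eqF.
have fwv n : measurable_fun setT (fct_of (w n - v)) /\ measurable_fun setT (grad_of (w n - v)).
  have [m1 m2 _ _] := fw n; split; first by apply: measurable_funB; [exact: m1|exact: mf].
  apply: measurable_fun_rV => i; rewrite (_ : _ \o _ =
      fun x => rV_coord i (grad_of (w n) x) - rV_coord i (G x)).
    by apply: measurable_funB; apply: (measurableT_comp (measurable_rV_coord i)).
  by apply/funext => x; rewrite -[LHS]/(rV_coord i (grad_of (w n - v) x)) grad_ofB /rV_coord !mxE.
have [n1 Hn1] := conv _ ltr01.
have fv : fin v.
  have fd : fin (w n1 - v).
    have [h1 h2] := Hn1 n1 (leqnn _); have [m1 m2] := fwv n1.
    split; [exact: m1|exact: m2|by apply: le_lt_trans h1 _;
      exact: ltry|by apply: le_lt_trans h2 _; exact: ltry].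
  by have := finite_energyB p1 (fw n1) fd; rewrite opprB addrC subrK.
have fwv' n := finite_energyB p1 (fw n) fv.
have cE e : 0 < e -> exists n0, forall n, (n0 <= n)%N -> E (w n - v) <= e.
  move=> e0; have k0 : 0 < (1 + A) / p by rewrite divr_gt0// ltr_wpDr.
  have d0 : 0 < e / ((1 + A) / p) by rewrite divr_gt0.
  have [n0 Hn0] := conv _ d0; exists n0 => n /Hn0[h1 h2].
  by apply: le_trans (pint_energy (fwv' n) (ltW d0) h1 h2) _; rewrite mulrC divfK// gt_eqF.
exists v; last exact: cE.
have Eopp n : E (v - w n) = E (w n - v) by exact: energyBC fv (fw n).
split.
  apply: (W1p_pair_closed p1 fv) => e e0; have [n0 Hn0] := conv _ e0.
  have := Hn0 n0 (leqnn _) => -[h1 h2].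
  exists (w n0); first by case: (sw n0).
  split.
  - apply: le_trans h1; rewrite le_eqVlt; apply/orP; left; apply/eqP.
    by apply: eq_integral => x _; rewrite fct_ofB distrC.
  - apply: le_trans h2; rewrite le_eqVlt; apply/orP; left; apply/eqP.
    by apply: eq_integral => x _; rewrite grad_ofB -enormN opprB.
apply: (approximable_energy fv) => e e0.
pose d := Num.min (e / 2) (e / 2 / 2 `^ p).
have d0 : 0 < d by rewrite lt_min !divr_gt0 ?powR_gt0.
have [n0 Hn0] := cE _ d0; have [n2 Hn2] := unif _ d0.
pose n := maxn n0 n2.
have h1 := Hn0 n (leq_maxl _ _); have h2 := Hn2 n (leq_maxr _ _).
have [f' [G' [fG' fF' EF' sF']]] := sobolev_approx (sw n) d0.
exists f', G'; split; [exact: fG'|exact: fF'| |].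
- have f1 := finite_energyB p1 fv (fw n); have f2 := finite_energyB p1 (fw n) fF'.
  rewrite -(subrKA (w n)); apply: le_trans (energy_quasi_triangle p1 ma al0 a_ge a_le f1 f2) _.
  have h3 : E (v - w n) + E (w n - mkpair f' G') <= d + d by rewrite Eopp; exact: lerD h1 EF'.
  apply: le_trans (ler_wpM2l (powR_ge0 _ _) h3) _.
  have h4 : d * 2 `^ p <= e / 2 by rewrite -ler_pdivlMr ?powR_gt0// /d ge_min lexx orbT.
  by rewrite mulrDr mulrC [leRHS]splitr; exact: lerD.
- move=> x; rewrite -(subrKA (fct_of (w n) x)); apply: le_trans (ler_normD _ _) _.
  rewrite [`|fct_of v x - _|]distrC.
  have d2 : d <= e / 2 by rewrite /d ge_min lexx.
  by rewrite [leRHS]splitr; exact: lerD (le_trans (h2 x) d2) (le_trans (sF' x) d2).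
Qed.

Lemma pint_eq0_ae (u : 'rV[R]_N -> R) : measurable_fun setT u ->
  (forall e : R, 0 < e -> (pint mu p u <= e%:E)%E) -> {ae mu, forall x, u x = 0}.
Proof.
move=> mu_ H; have h0 : pint mu p u = 0%E.
  apply/eqP; rewrite eq_le pint_ge0 andbT; apply/lee_addgt0Pr => e e0; rewrite add0e; exact: H.
have mm := measurable_abs_powR p mu_.
have h1 : (\int[mu]_x `|(`|u x| `^ p)%:E| = 0)%E.
  by rewrite -h0; apply: eq_integral => x _; rewrite gee0_abs// lee_fin powR_ge0.
have := (ae_eq_integral_abs mu measurableT mm).1 h1; apply: filterS => x /(_ I) [] /eqP;
  rewrite powR_eq0 normr_eq0 (gt_eqF p0) andbT.
by move=> /eqP.
Qed.

(** Weak solutions are tested against all of W^{1,p}, while the variational argument lives on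
    approximable pairs. Mollified pairs converge in energy to the given pair and, by completeness,
    also to an element of [sobolev]; the two limits agree almost everywhere. *)
Theorem W1p_representative v Dv : W1p p v Dv -> exists U, [/\ sobolev p U,
  {ae mu, forall x, v x = fct_of U x} & {ae mu, forall x, Dv x = grad_of U x}].
Proof.
move=> vW; pose V := mkpair v Dv.
have /(W1p_pairE p1)[fV _] : W1p_pair p V by [].
have [mV mDV Voo DVoo] := fV.
have k0 : 0 < (1 + A) / p by rewrite divr_gt0// ltr_wpDr.
have ap e : 0 < e -> exists F, [/\ sobolev p F, E (V - F) <= e & E (F - V) <= e].
  move=> e0; have d0 : 0 < e / ((1 + A) / p) by rewrite divr_gt0.
  have [f [G [fG h1 h2]]] := W1p_approx p1 vW d0; have [cf cG _] := fG.
  rewrite -gradient_pintE in h2.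
  have mG : measurable_fun setT G.
    apply: measurable_fun_rV => i; apply: continuous_measurable_rV => x.
    by apply: (@cvg_comp _ _ _ G (fun z : 'rV[R]_N => z 0 i)); [exact: cG|exact: coord_continuous].
  have fD : fin (V - mkpair f G).
    split.
    - by apply: measurable_funB; [exact: mV|exact: continuous_measurable_rV].
    - apply: measurable_fun_rV => i; rewrite (_ : _ \o _ =
        fun x => rV_coord i (grad_of V x) - rV_coord i (G x)).
        by apply: measurable_funB; apply: (measurableT_comp (measurable_rV_coord i)).
      by apply/funext => x;
        rewrite -[LHS]/(rV_coord i (grad_of (V - mkpair f G) x)) grad_ofB /rV_coord !mxE.
    - by apply: le_lt_trans h1 _; exact: ltry.
    - by apply: le_lt_trans h2 _; exact: ltry.
  have fF : fin (mkpair f G) by have := finite_energyB p1 fV fD; rewrite opprB addrC subrK.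
  have EV : E (V - mkpair f G) <= e.
    by apply: le_trans (pint_energy fD (ltW d0) h1 h2) _; rewrite mulrC divfK// gt_eqF.
  exists (mkpair f G); split; [exact: sobolev_C1_pair p1 _ _ fG fF|exact: EV|].
  by rewrite (energyBC fF fV).
have /choice[F HF] := fun n : nat => ap (n.+1%:R^-1) (ltac:(by rewrite invr_gt0)).
have fF n : fin (F n) by apply: (sobolev_finite p1); case: (HF n).
have fVF n := finite_energyB p1 fV (fF n).
have fFV n := finite_energyB p1 (fF n) fV.
have two0 : 0 < 2 `^ p :> R by rewrite powR_gt0.
have smalln e : 0 < e -> exists n0, forall n, (n0 <= n)%N -> n.+1%:R^-1 <= e :> R.
  move=> e0; exists (Num.truncn e^-1) => n nn; rewrite invf_ple ?posrE//.
  by apply: ltW; apply: lt_le_trans (truncnS_gt _) _; rewrite ler_nat ltnS.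
have [U sU HU] : exists2 U, sobolev p U & forall e : R, 0 < e -> exists n0, forall n,
  (n0 <= n)%N -> E (F n - U) <= e.
  apply: sobolev_complete; first by move=> n; case: (HF n).
  move=> e e0; have d0 : 0 < e / 2 / 2 `^ p by rewrite !divr_gt0.
  have [n0 Hn0] := smalln _ d0; exists n0 => m n mm nn.
  rewrite -(subrKA V);
    apply: le_trans (energy_quasi_triangle p1 ma al0 a_ge a_le (fFV m) (fVF n)) _.
  have [_ h1 _] := HF n; have [_ _ h2] := HF m.
  rewrite mulrC -ler_pdivlMr//;
    apply: le_trans (lerD (le_trans h2 (Hn0 _ mm)) (le_trans h1 (Hn0 _ nn))) _.
  by rewrite le_eqVlt; apply/orP; left; apply/eqP; field; rewrite gt_eqF.
have fU := sobolev_finite p1 sU.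
have fVU := finite_energyB p1 fV fU.
have VU e : 0 < e -> E (V - U) <= e.
  move=> e0; have d0 : 0 < e / 2 / 2 `^ p by rewrite !divr_gt0.
  have [n0 Hn0] := smalln _ d0; have [n1 Hn1] := HU _ d0; pose n := maxn n0 n1.
  rewrite -(subrKA (F n));
    apply: le_trans
    (energy_quasi_triangle p1 ma al0 a_ge a_le (fVF n) (finite_energyB p1 (fF n) fU)) _.
  have [_ h1 _] := HF n.
  rewrite mulrC -ler_pdivlMr//;
    apply: le_trans (lerD (le_trans h1 (Hn0 _ (leq_maxl _ _))) (Hn1 _ (leq_maxr _ _))) _.
  by rewrite le_eqVlt; apply/orP; left; apply/eqP; field; rewrite gt_eqF.
have sm e : 0 < e -> (pint mu p (fct_of (V - U)) <= e%:E)%E /\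
  (gradient_pint p (grad_of (V - U)) <= e%:E)%E.
  move=> e0; pose d := Num.min (e / (p / al)) (e / p).
  have d0 : 0 < d by rewrite !lt_min !divr_gt0.
  have d1 : p * d / al <= e by rewrite mulrAC mulrC -ler_pdivlMr ?divr_gt0// /d !ge_min lexx.
  have d2 : p * d <= e by rewrite mulrC -ler_pdivlMr// /d !ge_min lexx !orbT.
  have [h1 h2] := small_energy fVU (VU _ d0).
  by split; [apply: le_trans h1 _|apply: le_trans h2 _]; rewrite lee_fin.
have [m1 m2 _ _] := fVU.
exists U; split; [exact: sU| |].
- have := pint_eq0_ae m1 (fun e e0 => (sm e e0).1); apply: filterS => x.
  by rewrite fct_ofB => /eqP; rewrite subr_eq0 => /eqP.
- have m2' : measurable_fun setT (fun x => enorm (grad_of (V - U) x)).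
    by apply: measurableT_comp; [exact: measurable_enorm|exact: m2].
  have := pint_eq0_ae m2' (fun e e0 => (sm e e0).2); apply: filterS => x.
  by move=> /enorm_eq0; rewrite grad_ofB => /eqP; rewrite subr_eq0 => /eqP.
Qed.

End sobolev_embedding.

(** * The nonlinearity *)

Section real_functions.
Context {R : realType}.
Implicit Types (g : R -> R).

(** Only [s] is confined to the segment, so that [t] may leave it; each point of the segment has a
    neighbourhood with its own admissible radius, and compactness makes the radius common. *)
Lemma uniform_on_segment g (C e : R) : continuous g -> 0 < e ->
  exists2 d : R, 0 < d & forall s t, `|s| <= C -> `|s - t| <= d -> `|g s - g t| <= e.
Proof.
move=> cg e0.
have e20 : 0 < e / 2 by rewrite divr_gt0.
have /compact_near_coveringP near_cov := @segment_compact R (- C) C.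
have H := near_cov R (0 : R)^'+ (fun d s => forall t, `|s - t| <= d -> `|g s - g t| <= e) _.
have key : (forall x, `[- C, C]%classic x -> \forall x' \near x & i \near 0^'+,
   forall t, `|x' - t| <= i -> `|g x' - g t| <= e).
  move=> x _.
  have [r /= r0 Hr] := (@cvgrPdist_lt _ _ _ _ _ _ _).1 (cg x) _ e20.
  have r20 : 0 < r / 2 by rewrite divr_gt0.
  exists (ball x (r / 2), [set d | d < r / 2]) => /=.
    split; first exact: nbhsx_ballx.
    exact: nbhs_right_lt.
  move=> [x' d] /= [xx' dr] t x't.
  rewrite -(subrKA (g x)); apply: le_trans (ler_normD _ _) _.
  rewrite [leRHS]splitr; apply: lerD; apply: ltW.
    rewrite distrC; apply: Hr; rewrite /ball/=; apply: lt_trans xx' _.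
    by rewrite ltr_pdivrMr// ltr_pMr// ltr1n.
  apply: Hr; rewrite /ball/= -(subrKA x'); apply: le_lt_trans (ler_normD _ _) _.
  by rewrite [ltRHS]splitr; apply: ltrD; [exact: xx'|apply: le_lt_trans x't dr].
have {key}H := H _ key; near (0 : R)^'+ => d.
exists d; first by near: d; exact: nbhs_right_gt.
move=> s t; rewrite ler_norml => sC.
suff : `[- C, C]%classic `<=` (fun s => forall t, `|s - t| <= d -> `|g s - g t| <= e).
  by apply; rewrite /= in_itv.
by near: d; exact: H.
Unshelve. all: by end_near.
Qed.

Lemma bounded_on_segment g (C : R) : continuous g ->
  exists2 B : R, 0 <= B & forall t, `|t| <= C -> `|g t| <= B.
Proof.
move=> cg; have [C0|C0] := leP 0 C; last first.
  by exists 0 => // t tC; have := le_lt_trans (le_trans (normr_ge0 t) tC) C0; rewrite ltxx.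
have [|c _ Hc] := @EVT_max R (fun t => `|g t|) (- C) C (le_trans (ge0_cp C0).1 C0).
  apply: continuous_subspaceT => t; apply: cvg_norm; exact: cg.
exists `|g c| => // t; rewrite ler_norml => tC; apply: Hc; by rewrite in_itv.
Qed.

(** * The extended primitive of the nonlinearity *)

Section antiderivative.
Variable g : R -> R.
Hypotheses (cg : continuous g) (g_const : forall t, t <= 0 -> g t = g 0).

(** [primitive] integrates over [0, t] and so is meaningful for [t >= 0]. On the negative side [g]
    is constant, and the linear function is its primitive there. *)
Definition antideriv (t : R) : R := if 0 <= t then primitive g t else g 0 * t.

Lemma antideriv_bounds (s t m M : R) : s <= t -> (forall x, s <= x <= t -> m <= g x <= M) ->
  m * (t - s) <= antideriv t - antideriv s <= M * (t - s).
Proof.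
have pos (s' t' : R) : 0 <= s' -> s' <= t' -> (forall x, s' <= x <= t' -> m <= g x <= M) ->
    m * (t' - s') <= antideriv t' - antideriv s' <= M * (t' - s').
  move=> s0 st mM; have t0 := le_trans s0 st.
  rewrite /antideriv s0 t0 /primitive.
  have ig (v : R) : lebesgue_measure.-integrable `[0, v] (EFin \o g).
    apply: continuous_compact_integrable; first exact: segment_compact.
    exact: continuous_subspaceT.
  rewrite (@Rintegral_itvB R g (BLeft 0) (BRight t') s' (ig t')) ?bnd_simp//.
  have ist : lebesgue_measure.-integrable `]s', t'] (EFin \o g).
    apply: integrableS (ig t') => //; apply: subset_itvr; by rewrite bnd_simp.
  have ic (k : R) : lebesgue_measure.-integrable `]s', t'] (EFin \o (fun=> k)).
    apply: (@integrableS _ _ _ lebesgue_measure `[s', t'] `]s', t']) => //.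
      by apply: subset_itvr; rewrite bnd_simp.
    apply: continuous_compact_integrable; first exact: segment_compact.
    by apply: continuous_subspaceT => x; exact: cvg_cst.
  have vol (k : R) : \int[lebesgue_measure]_(x in `]s', t']) k = k * (t' - s').
    apply: (etrans (Rintegral_cst _ _ _)) => //; congr (_ * _).
    apply: (etrans (congr1 fine (lebesgue_measure_itv _))); rewrite /= lte_fin; case: ltP => //= h.
    by have -> : t' = s'; [apply/eqP; rewrite eq_le st h|rewrite subrr].
  rewrite -!vol; apply/andP; split.
    apply: le_Rintegral => //.
    move=> x; rewrite /= in_itv/= => /andP[sx xt].
    by have /andP[] : m <= g x <= M by apply: mM; rewrite (ltW sx) xt.
  apply: le_Rintegral => //.
  move=> x; rewrite /= in_itv/= => /andP[sx xt].
  by have /andP[] : m <= g x <= M by apply: mM; rewrite (ltW sx) xt.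
have z0 : antideriv 0 = 0.
  by rewrite /antideriv lexx /primitive set_itv1 Rintegral_set1.
have neg (s' t' : R) : t' <= 0 -> s' <= t' -> (forall x, s' <= x <= t' -> m <= g x <= M) ->
    m * (t' - s') <= antideriv t' - antideriv s' <= M * (t' - s').
  move=> t0 st mM; have s0 := le_trans st t0.
  have E v : v <= 0 -> antideriv v = g 0 * v.
    move=> v0; rewrite /antideriv; case: leP => // v0'.
    have -> : v = 0 by apply/eqP; rewrite eq_le v0 v0'.
    by move: z0; rewrite /antideriv lexx mulr0.
  rewrite !E// -mulrBr -(g_const t0).
  have /andP[h1 h2] : m <= g t' <= M by apply: mM; rewrite st lexx.
  by rewrite !ler_wpM2r ?subr_ge0.
move=> st mM.
have [s0|s0] := leP 0 s; first exact: pos.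
have [t0|t0] := leP t 0; first exact: neg.
have /andP[h1 h2] := pos 0 t (lexx _) (ltW t0)
  (fun x xt => mM x
  (match andP xt with conj a b => introT andP (conj (le_trans (ltW s0) a) b) end)).
have /andP[h3 h4] := neg s 0 (lexx _) (ltW s0)
  (fun x xt => mM x
  (match andP xt with conj a b => introT andP (conj a (le_trans b (ltW t0))) end)).
move: h1 h2 h3 h4; rewrite z0; clear; move: (antideriv t) (antideriv s) => *; apply/andP;
  split; lra.
Qed.

Lemma antideriv_lipschitz (C : R) : exists2 B : R, 0 <= B & forall s t, `|s| <= C -> `|t| <= C ->
  `|antideriv t - antideriv s| <= B * `|t - s|.
Proof.
have [B B0 HB] := bounded_on_segment C cg; exists B => // s t.
have main (s' t' : R) :
  s' <= t' -> `|s'| <= C -> `|t'| <= C -> `|antideriv t' - antideriv s'| <= B * `|t' - s'|.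
  move=> st; rewrite !ler_norml => /andP[s1 s2] /andP[t1 t2].
  have /andP[h1 h2] : - B * (t' - s') <= antideriv t' - antideriv s' <= B * (t' - s').
    apply: antideriv_bounds => // x /andP[sx xt]; rewrite -ler_norml; apply: HB.
    by rewrite ler_norml (le_trans s1 sx) (le_trans xt t2).
  by rewrite (@ger0_norm _ (t' - s')) ?subr_ge0// -mulNr h1.
move=> sC tC; have [st|/ltW ts] := leP s t; first exact: main.
by rewrite distrC (distrC t); exact: main.
Qed.

Lemma antideriv0 : antideriv 0 = 0.
Proof. by rewrite /antideriv lexx /primitive set_itv1 Rintegral_set1. Qed.

Lemma continuous_antideriv : continuous antideriv.
Proof.
move=> t; have [B B0 HB] := antideriv_lipschitz (`|t| + 1).
apply/cvgrPdist_le => e e0; near=> s.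
have st : `|t - s| <= Num.min 1 (e / (B + 1)).
  near: s; apply: cvgr_dist_le; first exact: cvg_id.
  by rewrite lt_min ltr01 divr_gt0// ltr_wpDl.
move: st; rewrite le_min => /andP[st1 st2].
have sC : `|s| <= `|t| + 1.
  have -> : s = t - (t - s) by ring.
  by apply: le_trans (ler_normB _ _) _; rewrite lerD2l.
apply: le_trans (HB s t sC _) _; first by rewrite lerDl.
apply: (@le_trans _ _ (B * (e / (B + 1)))); first by rewrite ler_wpM2l.
by rewrite mulrA ler_pdivrMr ?ltr_wpDl// mulrC ler_wpM2l ?(ltW e0)// lerDl.
Unshelve. all: by end_near.
Qed.

Lemma antideriv_first_order (C e : R) : 0 < e -> exists2 d : R, 0 < d &
  forall s t, `|s| <= C -> `|t - s| <= d ->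
    g s * (t - s) - e * `|t - s| <= antideriv t - antideriv s.
Proof.
move=> e0; have [d d0 Hd] := uniform_on_segment C cg e0; exists d => // s t sC std.
have main (s' t' : R) : s' <= t' -> (forall x, s' <= x <= t' -> `|g s - g x| <= e) ->
   (g s - e) * (t' - s') <= antideriv t' - antideriv s' <= (g s + e) * (t' - s').
  move=> st H; apply: antideriv_bounds => // x /H; rewrite ler_distlC => /andP[h1 h2].
  by rewrite h1 h2.
have [st|/ltW ts] := leP s t.
  have : forall x, s <= x <= t -> `|g s - g x| <= e.
    move=> x /andP[sx xt]; apply: Hd => //; apply: le_trans std.
    by rewrite distrC !ger0_norm ?subr_ge0// lerD2r.
  move=> /(main s t st)/andP[h _]; apply: le_trans h.
  by rewrite (@ger0_norm _ (t - s)) ?subr_ge0// mulrBl.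
have : forall x, t <= x <= s -> `|g s - g x| <= e.
  move=> x /andP[tx xs]; apply: Hd => //; apply: le_trans std.
  by rewrite (distrC t) !ger0_norm ?subr_ge0// lerD2l lerN2.
move=> /(main t s ts)/andP[_ h]; rewrite (distrC t) (@ger0_norm _ (s - t)) ?subr_ge0//.
rewrite -[leRHS]opprB lerNr; apply: le_trans h _.
by rewrite le_eqVlt; apply/orP; left; apply/eqP; ring.
Qed.

(** Far to the right the limit hypothesis applies, a bounded interval is absorbed in [C], and for
    [t < 0] the linear branch is nonpositive as [0 <= g 0]. *)
Lemma antideriv_growth (p e : R) :
  0 < p -> 0 <= g 0 -> primitive g t / t `^ p @[t --> +oo] --> (0 : R) -> 0 < e ->
  exists2 C : R, 0 <= C & forall t, antideriv t <= e * `|t| `^ p + C.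
Proof.
move=> p0 g0 lim e0.
have [T [_ HT]] := (@cvgrPdist_le _ _ _ _ _ _ _).1 lim _ e0.
have [B B0 HB] := bounded_on_segment (`|T| + 1) continuous_antideriv.
exists B => // t; have [t0|t0] := leP 0 t; last first.
  rewrite /antideriv ifF; last by apply/negbTE; rewrite -ltNge.
  apply: (@le_trans _ _ 0); first by rewrite mulr_ge0_le0// ltW.
  by rewrite addr_ge0// mulr_ge0 ?powR_ge0// ltW.
have [tT|tT] := leP t (`|T| + 1).
  apply: (@le_trans _ _ B); last by rewrite lerDr mulr_ge0 ?powR_ge0// ltW.
  by apply: le_trans (ler_norm _) _; apply: HB; rewrite ger0_norm.
have tp : 0 < t by apply: le_lt_trans tT; rewrite addr_ge0.
have := HT t (lt_trans (le_lt_trans (ler_norm T) (ltr_pwDr ltr01 (lexx _))) tT).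
rewrite sub0r normrN => /(le_trans (ler_norm _)).
rewrite ler_pdivrMr ?powR_gt0// /antideriv t0 ger0_norm// => h.
by apply: le_trans h _; rewrite lerDl.
Qed.

End antiderivative.
End real_functions.

(** * Compactness of equibounded families, in the manner of Arzela-Ascoli *)

Lemma pointwise_cluster {R : realType} (T : eqType) (u : nat -> T -> R) (C : R) :
  (forall n x, `|u n x| <= C) -> exists w : T -> R, forall (s : seq T) (e : R) n0, 0 < e ->
    exists2 n, (n0 <= n)%N & forall x, x \in s -> `|u n x - w x| <= e.
Proof.
move=> uC.
have cK : compact (`[- C, C]%classic : set R) by exact: segment_compact.
have uK : (u @ \oo) [set f : T -> R | forall i, `[- C, C]%classic (f i)].
  by exists 0%N => // n _ i; rewrite /= in_itv/= -ler_norml; exact: uC.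
have [w [_ clw]] := @tychonoff T (fun=> R) (fun=> `[- C, C]%classic) (fun=> cK) (u @ \oo) _ uK.
exists w => s e n0 e0.
have nw : @nbhs _ (prod_topology (fun=> R)) w [set f | forall x, x \in s -> `|f x - w x| <= e].
  have FF : Filter (@nbhs _ (prod_topology (fun=> R)) w) by exact:
    (@nbhs_filter (prod_topology (fun=> R)) w).
  clear clw uK; elim: s => [|x s IH].
    by apply: (@filterS _ _ FF setT); [|exact: (@filterT _ _ FF)].
  have nx : @nbhs _ (prod_topology (fun=> R)) w [set f | `|f x - w x| <= e].
    have := @proj_continuous T (fun=> R) x w; rewrite /continuous_at.
    move=> /cvgrPdist_le/(_ e e0); apply: filterS => f; by rewrite distrC.
  apply: (@filterS _ _ FF _ _ _ (@filterI _ _ FF _ _ nx IH)) => f [/= h1 h2] y;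
    rewrite in_cons => /orP[/eqP->//|]; exact: h2.
have [f [[n nn fn] Hf]] := clw [set f | exists2 n, (n0 <= n)%N & u n = f] _
  (ltac:(by exists n0 => // n nn; exists n)) nw.
by exists n => // x xs; rewrite fn; exact: Hf.
Qed.

(** Turns the control on finitely many points that [pointwise_cluster] provides into control on a
    ball, once a common modulus of continuity is known. *)
Lemma finite_net {R : realType} (N : nat) (r d : R) : 0 < d -> exists s : seq 'rV[R]_N,
  forall x, enorm x <= r -> exists2 y, y \in s & enorm (x - y) < d.
Proof.
move=> d0.
have cK : compact [set v : 'rV[R]_N | forall i, `[- r, r]%classic (v ord0 i)].
  by apply: (@rV_compact _ _ (fun=> `[- r, r]%classic)) => i; exact: segment_compact.
move: cK; rewrite compact_cover => /(_ 'rV[R]_N setT (fun y => eball y d)) [].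
- by move=> y _; exact: open_eball.
- by move=> x _; exists x => //; rewrite /eball/= subrr enorm0.
move=> D _ HD; exists (finmap.enum_fset D) => x xr.
have [i|y yD xy] := HD x.
  rewrite /= in_itv/= -ler_norml; exact: le_trans (ler_coord_enorm _ _) xr.
by exists y.
Qed.

(** * Integrals with the weight [h] *)

Section weighted_integral.
Context {R : realType} {N : nat} (h : 'rV[R]_N -> R).
Local Notation mu := (@lebesgue_rV R N).
Hypotheses (mh : measurable_fun setT h) (ih : mu.-integrable setT (EFin \o h)).
Hypothesis h0 : forall x, 0 <= h x.
Implicit Types (f : 'rV[R]_N -> R).

Definition mass := \int[mu]_x h x.

Lemma mass_ge0 : 0 <= mass.
Proof. by apply: Rintegral_ge0 => x _. Qed.

Definition bounded_measurable f := measurable_fun setT f /\ exists C : R, forall x, `|f x| <= C.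

Lemma bounded_measurableM f1 f2 : bounded_measurable f1 -> bounded_measurable f2 ->
  bounded_measurable (fun x => f1 x * f2 x).
Proof.
move=> [m1 [C1 H1]] [m2 [C2 H2]]; split; first exact: measurable_funM.
by exists (C1 * C2) => x; rewrite normrM ler_pM.
Qed.

Lemma bounded_measurableD f1 f2 : bounded_measurable f1 -> bounded_measurable f2 ->
  bounded_measurable (fun x => f1 x + f2 x).
Proof.
move=> [m1 [C1 H1]] [m2 [C2 H2]]; split; first exact: measurable_funD.
by exists (C1 + C2) => x; apply: le_trans (ler_normD _ _) _; exact: lerD.
Qed.

Lemma bounded_measurable_cst (c : R) : bounded_measurable (fun=> c).
Proof. by split; [exact: measurable_cst|exists `|c| => x]. Qed.

Lemma bounded_measurableZ (c : R) f : bounded_measurable f -> bounded_measurable (fun x => c * f x).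
Proof. by move=> bf; exact: bounded_measurableM (bounded_measurable_cst c) bf. Qed.

Lemma bounded_measurable_comp (k : R -> R) f : continuous k -> bounded_measurable f ->
  bounded_measurable (fun x => k (f x)).
Proof.
move=> ck [mf [C HC]]; split.
  by apply: measurableT_comp mf; exact: continuous_measurable_fun.
by have [B _ HB] := bounded_on_segment C ck; exists B => x; exact: HB.
Qed.

Lemma weighted_integrable f : bounded_measurable f ->
  mu.-integrable setT (EFin \o (fun x => h x * f x)).
Proof.
move=> [mf [C HC]]; apply: (le_integrable measurableT _ _ (integrableZl measurableT C ih)).
  by apply/measurable_EFinP; exact: measurable_funM.
move=> x _; rewrite -[leRHS]/(`|(C * h x)%:E|)%E lee_fin normrM mulrC.
apply: le_trans (ler_norm _); rewrite (ger0_norm (h0 x)); exact: ler_wpM2r.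
Qed.

Lemma weighted_lin2 (b c : R) f1 f2 : bounded_measurable f1 -> bounded_measurable f2 ->
  \int[mu]_x (h x * (b * f1 x + c * f2 x)) = b * \int[mu]_x (h x * f1 x) + c * \int[mu]_x
    (h x * f2 x).
Proof.
move=> b1 b2; rewrite -(Rintegral_lin2 b c (weighted_integrable b1) (weighted_integrable b2)).2.
by apply: eq_Rintegral => x _; rewrite mulrDr !mulrA (mulrC (h x) b) (mulrC (h x) c).
Qed.

Lemma weighted_cst (c : R) : \int[mu]_x (h x * c) = c * mass.
Proof.
by rewrite /mass -RintegralZl//; apply: eq_Rintegral => x _; rewrite mulrC.
Qed.

Lemma weighted_le f1 f2 : bounded_measurable f1 -> bounded_measurable f2 ->
  (forall x, f1 x <= f2 x) -> \int[mu]_x (h x * f1 x) <= \int[mu]_x (h x * f2 x).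
Proof.
move=> b1 b2 H; apply: le_Rintegral => //; [exact: weighted_integrable|exact: weighted_integrable|].
by move=> x _; apply: ler_wpM2l.
Qed.

Lemma weighted_norm_le_fun f b : bounded_measurable f -> bounded_measurable b ->
  (forall x, `|f x| <= b x) -> `|\int[mu]_x (h x * f x)| <= \int[mu]_x (h x * b x).
Proof.
move=> bf bb H; have bNb := bounded_measurableZ (-1) bb.
have EN : \int[mu]_x (h x * (-1 * b x)) = - \int[mu]_x (h x * b x).
  transitivity (\int[mu]_x (-1 * (h x * b x))).
    by apply: eq_Rintegral => x _; rewrite !mulN1r mulrN.
  by rewrite RintegralZl//; [rewrite mulN1r|exact: weighted_integrable].
rewrite ler_norml -EN; apply/andP; split.
  by apply: (weighted_le bNb bf) => x; rewrite mulN1r; have := H x; rewrite ler_norml => /andP[].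
by apply: (weighted_le bf bb) => x; have := H x; rewrite ler_norml => /andP[].
Qed.

Lemma weighted_norm_le f (C : R) : bounded_measurable f -> (forall x, `|f x| <= C) ->
  `|\int[mu]_x (h x * f x)| <= C * mass.
Proof.
by move=> bf HC; rewrite -weighted_cst;
  exact: weighted_norm_le_fun bf (bounded_measurable_cst C) HC.
Qed.

Lemma weighted_dist_le f1 f2 (e : R) : bounded_measurable f1 -> bounded_measurable f2 ->
  (forall x, `|f1 x - f2 x| <= e) ->
  `|\int[mu]_x (h x * f1 x) - \int[mu]_x (h x * f2 x)| <= e * mass.
Proof.
move=> b1 b2 H.
have -> : \int[mu]_x (h x * f1 x) - \int[mu]_x (h x * f2 x) = \int[mu]_x
  (h x * (1 * f1 x + (-1) * f2 x)).
  by rewrite weighted_lin2// mul1r mulN1r.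
apply: weighted_norm_le; last by move=> x; rewrite mul1r mulN1r.
exact: bounded_measurableD (bounded_measurableZ 1 b1) (bounded_measurableZ (-1) b2).
Qed.

Lemma weight_tail (e : R) : 0 < e -> exists r : R,
  \int[mu]_x (h x * ((r < enorm x)%R)%:R) <= e.
Proof.
move=> e0; pose F (n : nat) (x : 'rV[R]_N) := h x * (n%:R < enorm x :> R)%:R.
have mF n : measurable_fun setT (F n).
  apply: measurable_funM => //.
  have mb : measurable_fun setT (fun x : 'rV[R]_N => n%:R < enorm x).
    by apply: measurable_fun_ltr => //; exact: measurable_enorm.
  by apply: (measurableT_comp (f := fun b : bool => b%:R : R) _ mb).
have F0 n x : 0 <= F n x <= h x.
  by rewrite /F mulr_ge0//=; case: (_ < _); rewrite ?mulr1// mulr0.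
have Fl x : F n x @[n --> \oo] --> 0.
  apply: cvg_near_cst; exists (Num.truncn (enorm x)).+1 => // n /= nx.
  rewrite /F ltNge (_ : _ <= _) ?mulr0//; apply/ltW.
  by apply: lt_le_trans (truncnS_gt _) _; rewrite ler_nat.
have [n0 Hn0] := @dominated_small _ _ _ mu F h mF ih F0 Fl e e0.
exists n0%:R; rewrite -lee_fin /Rintegral fineK; first exact: Hn0.
apply: integrable_fin_num => //; apply: (le_integrable measurableT _ _ ih).
  by apply/measurable_EFinP; exact: mF.
move=> x _; rewrite /= lee_fin; have /andP[h1 h2] := F0 n0 x.
by rewrite (ger0_norm h1) (ger0_norm (h0 x)).
Qed.

(** Outside a large ball the weight has little mass, so there a mere bound [D] on the difference is
    enough. This makes locally uniform closeness sufficient on an unbounded domain. *)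
Lemma weighted_dist_local_le (D e : R) : 0 < e -> 0 <= D -> exists r : R, forall f1 f2,
  bounded_measurable f1 -> bounded_measurable f2 -> (forall x, `|f1 x - f2 x| <= D) ->
  (forall x, enorm x <= r -> `|f1 x - f2 x| <= e) ->
  `|\int[mu]_x (h x * f1 x) - \int[mu]_x (h x * f2 x)| <= e * mass + e.
Proof.
move=> e0 D0; have D1 : 0 < D + 1 by rewrite ltr_wpDl.
have [r Hr] := weight_tail (divr_gt0 e0 D1); exists r => f1 f2 b1 b2 HD He.
pose chi (x : 'rV[R]_N) : R := ((r < enorm x)%R)%:R.
have bchi : bounded_measurable chi.
  split; last by exists 1 => x; rewrite /chi; case: (_ < _); rewrite ?normr1 ?normr0.
  have mb : measurable_fun setT (fun x : 'rV[R]_N => r < enorm x).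
    by apply: measurable_fun_ltr => //; exact: measurable_enorm.
  by apply: (measurableT_comp (f := fun b : bool => b%:R : R) _ mb).
have be := bounded_measurable_cst e.
have bound x : `|f1 x - f2 x| <= D * chi x + 1 * e.
  rewrite /chi mul1r; case: ltP => [_|/He h1]; last by rewrite mulr0 add0r.
  by rewrite mulr1; apply: le_trans (HD x) _; rewrite lerDl ltW.
have b12 : bounded_measurable (fun x => 1 * f1 x + (-1) * f2 x).
  exact: bounded_measurableD (bounded_measurableZ 1 b1) (bounded_measurableZ (-1) b2).
have bb : bounded_measurable (fun x => D * chi x + 1 * e).
  exact: bounded_measurableD (bounded_measurableZ D bchi) (bounded_measurableZ 1 be).
have -> : \int[mu]_x (h x * f1 x) - \int[mu]_x (h x * f2 x) = \int[mu]_x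
  (h x * (1 * f1 x + (-1) * f2 x)).
  by rewrite weighted_lin2// mul1r mulN1r.
have lim : D * \int[mu]_x (h x * chi x) <= e.
  apply: (@le_trans _ _ (D * (e / (D + 1)))); first by rewrite ler_wpM2l.
  by rewrite mulrA ler_pdivrMr// mulrC ler_wpM2l ?(ltW e0)// lerDl.
have E1 : \int[mu]_x (h x * (D * chi x + 1 * e)) <= e * mass + e.
  by rewrite (weighted_lin2 D 1 bchi be) weighted_cst mul1r addrC lerD2l.
apply: le_trans E1; apply: weighted_norm_le_fun => // x.
by rewrite mul1r mulN1r; exact: bound.
Qed.

End weighted_integral.

(** * The nonlinear term: continuity, compactness, coercivity *)

Section nonlinearity.
Context {R : realType} {N : nat} (p : R) (a h : 'rV[R]_N -> R) (al A : R) (g : R -> R) (lam : R).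
Local Notation mu := (@lebesgue_rV R N).
Hypotheses (N_ge1 : (0 < N)%N) (N_lt_p : N%:R < p).
Hypotheses (ma : measurable_fun setT a) (al0 : 0 < al).
Hypotheses (a_ge : forall x, al <= a x) (a_le : forall x, a x <= A).
Hypotheses (mh : measurable_fun setT h) (ih : mu.-integrable setT (EFin \o h)).
Hypothesis h0 : forall x, 0 <= h x.
Hypotheses (cg : continuous g) (g_const : forall t, t <= 0 -> g t = g 0).
Hypothesis lam0 : 0 <= lam.
Implicit Types (U V W : @pairs R N).

Let p1 : 1 < p. Proof. exact: embedding_p_gt1 N_ge1 N_lt_p. Qed.
Let p0 : 0 < p. Proof. exact: lt_trans p1. Qed.

Local Notation E := (energy p a).
Local Notation X := (sobolev p).
Local Notation sup_bounded := (sobolev_sup_bounded N_ge1 N_lt_p ma al0 a_ge a_le).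
Local Notation sup_small := (sobolev_sup_small N_ge1 N_lt_p ma al0 a_ge a_le).
Local Notation Gt := (antideriv g).
Local Notation H := (mass h).

Let H0 : 0 <= H. Proof. exact: mass_ge0 h0. Qed.
Let XB U V : X U -> X V -> X (U - V).
Proof. by move=> sU sV; rewrite -scaleN1r addrC; exact: sobolevP p1 _ _ _ sV sU. Qed.

Lemma sobolev_bounded_measurable U : X U -> bounded_measurable (fct_of U).
Proof.
move=> sU; split; first by have [] := sobolev_finite p1 sU.
by have [C _ HC] := sup_bounded (E U); exists C => x; exact: HC.
Qed.

Definition Psi U : R := lam * \int[mu]_x (h x * Gt (fct_of U x)).
Definition pairing (k : 'rV[R]_N -> R) V : R := lam * \int[mu]_x (h x * (k x * fct_of V x)).
Definition dPsi U V : R := pairing (fun x => g (fct_of U x)) V.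

Let bg U : X U -> bounded_measurable (fun x => g (fct_of U x)).
Proof. by move=> sU; apply: (bounded_measurable_comp cg); exact: sobolev_bounded_measurable. Qed.

Let bG U : X U -> bounded_measurable (fun x => Gt (fct_of U x)).
Proof.
move=> sU; apply: (bounded_measurable_comp (continuous_antideriv cg g_const)).
exact: sobolev_bounded_measurable.
Qed.

Lemma pairing_linear k b U V : bounded_measurable k -> X U -> X V ->
  pairing k (b *: U + V) = b * pairing k U + pairing k V.
Proof.
move=> bk sU sV; have bU := bounded_measurableM bk (sobolev_bounded_measurable sU).
have bV := bounded_measurableM bk (sobolev_bounded_measurable sV).
rewrite /pairing mulrCA -mulrDr; congr (_ * _).
have := weighted_lin2 mh ih h0 b 1 bU bV; rewrite mul1r => <-.
by apply: eq_Rintegral => x _; rewrite fct_ofP mul1r; congr (_ * _); ring.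
Qed.

Lemma pairing_le k V (B C : R) : bounded_measurable k -> X V -> 0 <= B -> (forall x, `|k x| <= B) ->
  (forall x, `|fct_of V x| <= C) -> `|pairing k V| <= lam * (B * C * H).
Proof.
move=> bk sV B0 kB VC; rewrite /pairing normrM (ger0_norm lam0) ler_wpM2l//.
apply: (weighted_norm_le mh ih h0).
  exact: bounded_measurableM bk (sobolev_bounded_measurable sV).
by move=> x; rewrite normrM ler_pM.
Qed.

Lemma pairing_bounded k : bounded_measurable k -> bounded_linear X E (pairing k).
Proof.
move=> bk; split; first by move=> b U V; exact: pairing_linear.
have [mk [B HB]] := bk; have [C C0 HC] := sup_bounded 1.
exists (lam * (B * C * H)) => V sV EV; apply: pairing_le => //.
  by apply: le_trans (HB 0).
by move=> x; exact: HC.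
Qed.

Lemma dPsi_linear U b V W : X U -> X V -> X W -> dPsi U (b *: V + W) = b * dPsi U V + dPsi U W.
Proof. by move=> /bg; exact: pairing_linear. Qed.

Lemma dPsi_bounded M : exists C, forall U, X U -> E U <= M -> bounded_on_ball X E C (dPsi U).
Proof.
have [C C0 HC] := sup_bounded 1; have [D D0 HD] := sup_bounded M.
have [B B0 HB] := bounded_on_segment D cg.
exists (lam * (B * C * H)) => U sU EU V sV EV; apply: (pairing_le (bg sU) sV B0).
  by move=> x; apply: HB; exact: HD.
by move=> x; exact: HC.
Qed.

Lemma dPsi_continuous M e : 0 < e -> exists2 d : R, 0 < d & forall U V W, X U -> X V -> X W ->
  E U <= M -> E (U - V) <= d -> E W <= 1 -> `|dPsi U W - dPsi V W| <= e.
Proof.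
move=> e0; have [C C0 HC] := sup_bounded 1; have [D D0 HD] := sup_bounded M.
have K1 : 0 < lam * (C * H) + 1 by rewrite ltr_wpDl// !mulr_ge0.
have e'0 : 0 < e / (lam * (C * H) + 1) by rewrite divr_gt0.
have [d' d'0 Hd'] := uniform_on_segment D cg e'0.
have [d d0 Hd] := sup_small d'0.
exists d => // U V W sU sV sW EU EUV EW.
have bW := sobolev_bounded_measurable sW.
rewrite /dPsi /pairing -mulrBr normrM (ger0_norm lam0).
apply: (@le_trans _ _ (lam * (e / (lam * (C * H) + 1) * C * H))).
  rewrite ler_wpM2l//; apply: (weighted_dist_le mh ih h0).
  - exact: bounded_measurableM (bg sU) bW.
  - exact: bounded_measurableM (bg sV) bW.
  move=> x; rewrite -mulrBl normrM ler_pM//; last exact: HC.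
  by apply: Hd'; [exact: HD|rewrite -fct_ofB; apply: Hd => //; exact: XB].
have -> : lam * (e / (lam * (C * H) + 1) * C * H) = (lam * (C * H)) * e /
  (lam * (C * H) + 1) by ring.
by rewrite ler_pdivrMr// mulrC ler_wpM2l ?(ltW e0)// lerDl.
Qed.

(** A bounded sequence is equibounded and equicontinuous, so some pointwise cluster point [w] is
    approached uniformly on every ball; the tail of [h] takes care of infinity. The limit functional
    is the pairing with [g] of [w], where [w] need not be known to lie in the Sobolev space. *)
Lemma dPsi_compact M (u : nat -> @pairs R N) : (forall n, X (u n)) -> (forall n, E (u n) <= M) ->
  exists2 l, bounded_linear X E l & forall e n0, 0 < e -> exists2 n, (n0 <= n)%N &
      forall W, X W -> E W <= 1 -> `|dPsi (u n) W - l W| <= e.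
Proof.
move=> su Eu; have [C C0 HC] := sup_bounded 1; have [D D0 HD] := sup_bounded M.
have [w Hw] := pointwise_cluster (fun n x => HD (u n) x (su n) (Eu n)).
have wD x : `|w x| <= D + 1.
  have [n _ Hn] := Hw [:: x] 1 0%N ltr01.
  have -> : w x = fct_of (u n) x - (fct_of (u n) x - w x) by ring.
  apply: le_trans (ler_normB _ _) _; apply: lerD; first exact: HD.
  by apply: Hn; rewrite inE.
(* [w] inherits the common modulus of the sequence: compare its values at [x] and [y] through one
   index [n] that is good at both points. *)
have wmod e : 0 < e -> exists2 rho : R, 0 < rho & forall x y, enorm (x - y) <= rho ->
    `|w x - w y| <= e /\ forall n, `|fct_of (u n) x - fct_of (u n) y| <= e.
  move=> e0; have e30 : 0 < e / 3 by rewrite divr_gt0.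
  have [rho rho0 Hr] := sobolev_modulus N_ge1 N_lt_p ma al0 a_ge a_le M e30.
  exists rho => // x y xy; split; last first.
    move=> n; apply: le_trans (Hr _ (su n) (Eu n) x y xy) _.
    by rewrite ler_pdivrMr// ler_peMr ?(ltW e0)// ler1n.
  have [n _ Hn] := Hw [:: x; y] _ 0%N e30.
  have h1 := Hn x (mem_head _ _).
  have h2 : `|fct_of (u n) y - w y| <= e / 3 by apply: Hn; rewrite !inE eqxx orbT.
  have h3 := Hr _ (su n) (Eu n) x y xy.
  have -> : w x - w y = (fct_of (u n) x - fct_of (u n) y) - (fct_of (u n) x - w x) +
    (fct_of (u n) y - w y) by ring.
  apply: le_trans (ler_normD _ _) _;
    apply: le_trans (lerD (le_trans (ler_normB _ _) (lerD h3 h1)) h2) _.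
  by rewrite le_eqVlt; apply/orP; left; apply/eqP; field.
have cw : continuous w.
  apply: continuous_rV => x e e0.
  have e20 : 0 < e / 2 by rewrite divr_gt0.
  have [rho rho0 Hr] := wmod _ e20.
  exists (rho / N.+1%:R); first by rewrite divr_gt0.
  move=> y xy; apply: (@le_lt_trans _ _ (e / 2)); last by rewrite ltr_pdivrMr// ltr_pMr// ltr1n.
  apply: (Hr x y _).1; apply: le_trans (ler_enorm_sum _) _.
  apply: (@le_trans _ _ (\sum_(i < N) rho / N.+1%:R)).
    by apply: ler_sum => i _; rewrite !mxE; apply/ltW/xy.
  rewrite sumr_const card_ord -[leLHS]mulr_natr mulrAC ler_pdivrMr//.
  by rewrite ler_wpM2l ?(ltW rho0)// ler_nat.
have bw : bounded_measurable w.
  by split; [exact: continuous_measurable_rV|exists (D + 1)].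
have bgw := bounded_measurable_comp cg bw.
exists (pairing (fun x => g (w x))); first exact: pairing_bounded.
move=> e n0 e0.
have [B B0 HB] := bounded_on_segment (D + 1) cg.
have K1 : 0 < lam * (H + 1) + 1 by rewrite ltr_wpDl// mulr_ge0 ?addr_ge0.
have C10 : 0 < C + 1 by rewrite ltr_wpDl.
pose e2 := e / (lam * (H + 1) + 1).
have e20 : 0 < e2 by rewrite divr_gt0.
have e30 : 0 < e2 / (C + 1) by rewrite divr_gt0.
have BC0 : 0 <= (B + B) * C by rewrite mulr_ge0 ?addr_ge0.
have [r Hr] := weighted_dist_local_le mh ih h0 e20 BC0.
have [d d0 Hd] := uniform_on_segment D cg e30.
have d30 : 0 < d / 3 by rewrite divr_gt0.
have [rho rho0 Hrho] := wmod _ d30.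
(* Closeness to [w] at the points of the net, together with the two moduli, gives closeness on the
   whole ball of radius [r]. *)
have [s Hs] := @finite_net R N r rho rho0.
have [n nn Hn] := Hw s _ n0 d30.
exists n => // W sW EW; have bW := sobolev_bounded_measurable sW.
have gu x : `|g (fct_of (u n) x)| <= B.
  by apply: HB; apply: le_trans (HD _ x (su n) (Eu n)) _; rewrite lerDl.
have gw x : `|g (w x)| <= B by apply: HB; exact: wD.
have loc x : enorm x <= r -> `|fct_of (u n) x - w x| <= d.
  move=> /Hs[y ys xy]; have [h1 h2] := Hrho _ _ (ltW xy).
  have -> : fct_of (u n) x - w x = (fct_of (u n) x - fct_of (u n) y) +
    (fct_of (u n) y - w y) - (w x - w y) by ring.
  apply: le_trans (ler_normB _ _) _;
    apply: le_trans (lerD (le_trans (ler_normD _ _) (lerD (h2 n) (Hn y ys))) h1) _.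
  by rewrite le_eqVlt; apply/orP; left; apply/eqP; field.
have := Hr _ _ (bounded_measurableM (bg (su n)) bW) (bounded_measurableM bgw bW).
rewrite /dPsi /pairing -mulrBr normrM (ger0_norm lam0) => main.
apply: le_trans (ler_wpM2l lam0 (main _ _)) _.
- move=> x; rewrite -mulrBl normrM ler_pM//; last exact: HC.
  by apply: le_trans (ler_normB _ _) _; apply: lerD; [exact: gu|exact: gw].
- move=> x xr; rewrite -mulrBl normrM; apply: (@le_trans _ _ (e2 / (C + 1) * C)).
    rewrite ler_pM//; last exact: HC.
    by apply: Hd; [exact: HD|exact: loc].
  by rewrite mulrAC ler_pdivrMr// ler_wpM2l ?(ltW e20)// lerDl.
have -> : lam * (e2 * H + e2) = lam * (H + 1) * e / (lam * (H + 1) + 1) by rewrite /e2; ring.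
by rewrite ler_pdivrMr// mulrC ler_wpM2l ?(ltW e0)// lerDl.
Qed.

Lemma Psi_bounded M : exists C, forall U, X U -> E U <= M -> `|Psi U| <= C.
Proof.
have [D D0 HD] := sup_bounded M.
have [B B0 HB] := bounded_on_segment D (continuous_antideriv cg g_const).
exists (lam * (B * H)) => U sU EU; rewrite /Psi normrM (ger0_norm lam0) ler_wpM2l//.
by apply: (weighted_norm_le mh ih h0 (bG sU)) => x; apply: HB; exact: HD.
Qed.

Lemma Psi_continuous M e : 0 < e -> exists2 d : R, 0 < d & forall U V, X U -> X V ->
  E U <= M -> E (U - V) <= d -> `|Psi U - Psi V| <= e.
Proof.
move=> e0; have [D D0 HD] := sup_bounded M.
have [B B0 HB] := antideriv_lipschitz cg g_const (D + 1).
have K1 : 0 < lam * (B * H) + 1 by rewrite ltr_wpDl// !mulr_ge0.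
pose d' := Num.min 1 (e / (lam * (B * H) + 1)).
have d'0 : 0 < d' by rewrite lt_min ltr01 divr_gt0.
have [d d0 Hd] := sup_small d'0.
exists d => // U V sU sV EU EUV; rewrite /Psi -mulrBr normrM (ger0_norm lam0).
have dist x : `|fct_of U x - fct_of V x| <= d'.
  by rewrite -fct_ofB; apply: Hd => //; exact: XB.
have VD x : `|fct_of V x| <= D + 1.
  have -> : fct_of V x = fct_of U x - (fct_of U x - fct_of V x) by ring.
  apply: le_trans (ler_normB _ _) _; apply: lerD; first exact: HD.
  by apply: le_trans (dist x) _; rewrite /d' ge_min lexx.
apply: (@le_trans _ _ (lam * (B * (e / (lam * (B * H) + 1)) * H))).
  rewrite ler_wpM2l//; apply: (weighted_dist_le mh ih h0 (bG sU) (bG sV)) => x.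
  apply: le_trans (HB _ _ (VD x) _) _.
    by apply: le_trans (HD _ x sU EU) _; rewrite lerDl.
  by rewrite ler_wpM2l//; apply: le_trans (dist x) _; rewrite /d' ge_min lexx orbT.
have -> : lam * (B * (e / (lam * (B * H) + 1)) * H) = (lam * (B * H)) * e /
  (lam * (B * H) + 1) by ring.
by rewrite ler_pdivrMr// mulrC ler_wpM2l ?(ltW e0)// lerDl.
Qed.

Lemma Psi_first_order M e : 0 < e -> exists2 s0 : R, 0 < s0 <= 1 & forall U V (s : R),
  X U -> X V -> E U <= M -> E V <= M -> 0 <= s <= s0 ->
  Psi U + s * dPsi U V - s * e <= Psi (U + s *: V).
Proof.
have gen (z1 z2 z3 z4 z5 : R) :
  z2 - z3 <= z4 - z1 -> z3 <= z5 -> z1 + z2 - z5 <= z4 by move=> *; lra.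
move=> e0; have [D D0 HD] := sup_bounded M.
have K1 : 0 < lam * (D * H) + 1 by rewrite ltr_wpDl// !mulr_ge0.
pose e1 := e / (lam * (D * H) + 1).
have e10 : 0 < e1 by rewrite divr_gt0.
have [d d0 Hd] := antideriv_first_order cg g_const D e10.
have D1 : 0 < D + 1 by rewrite ltr_wpDl.
exists (Num.min 1 (d / (D + 1))).
  by rewrite lt_min ltr01 divr_gt0//= ge_min lexx.
move=> U V s sU sV EU EV /andP[s_ge0]; rewrite le_min => /andP[s1 sd].
have sUV : X (U + s *: V) by rewrite addrC; exact: sobolevP p1 _ _ _ sV sU.
have bV := sobolev_bounded_measurable sV.
have bgV := bounded_measurableM (bg sU) bV.
have bc := bounded_measurable_cst (N := N) (- (s * (e1 * D))).
have b1 := bounded_measurableD (bounded_measurableZ 1 (bG sU)) (bounded_measurableZ s bgV).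
have pw x : 1 * (1 * Gt (fct_of U x) + s * (g (fct_of U x) * fct_of V x)) + 1 *
  (- (s * (e1 * D))) <=
    Gt (fct_of (U + s *: V) x).
  have sv : `|s * fct_of V x| <= s * D by rewrite normrM (ger0_norm s_ge0) ler_wpM2l//; exact: HD.
  have svd : `|fct_of U x + s * fct_of V x - fct_of U x| <= d.
    rewrite addrAC subrr add0r; apply: le_trans sv _.
    apply: (@le_trans _ _ (d / (D + 1) * D)); first by rewrite ler_wpM2r.
    by rewrite mulrAC ler_pdivrMr// ler_wpM2l ?(ltW d0)// lerDl.
  have := Hd _ _ (HD _ x sU EU) svd; rewrite addrAC subrr add0r => h1.
  rewrite fct_ofD fct_ofZ !mul1r.
  have h2 : e1 * `|s * fct_of V x| <= s * (e1 * D) by rewrite mulrCA ler_wpM2l ?(ltW e10).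

  by apply: gen h2; rewrite mulrCA.
have bb := bounded_measurableD (bounded_measurableZ 1 b1) (bounded_measurableZ 1 bc).
have := weighted_le mh ih h0 bb (bG sUV) pw.
rewrite (weighted_lin2 mh ih h0 1 1 b1 bc) (weighted_lin2 mh ih h0 1 s (bG sU) bgV)
  weighted_cst// !mul1r.
move=> /(ler_wpM2l lam0); apply: le_trans; rewrite /Psi /dPsi /pairing.
have h3 : lam * (s * (e1 * D) * H) <= s * e.
  have -> : lam * (s * (e1 * D) * H) = s * ((lam * (D * H)) * e / (lam * (D * H) + 1)) by
    rewrite /e1; ring.
  by rewrite ler_wpM2l// ler_pdivrMr// mulrC ler_wpM2l ?(ltW e0)// lerDl.
have {}gen (z1 z2 z3 z4 : R) :
  lam * z3 <= s * z4 -> lam * z1 + s * (lam * z2) - s * z4 <= lam * (z1 + s * z2 + - z3).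
  move=> z; rewrite !mulrDr mulrN mulrCA; exact: lerB.
by rewrite mulNr; exact: gen h3.
Qed.

(** The primitive of [g] is below e1 |t|^p + C, and the sup bound turns |u|^p into a multiple of the
    energy; [e1] is so small that at most half of the energy is lost. *)
Lemma J_coercive : 0 <= g 0 -> primitive g t / t `^ p @[t --> +oo] --> (0 : R) ->
  forall M, exists M', forall U, X U -> E U - Psi U <= M -> E U <= M'.
Proof.
move=> g0 lim M; pose S := sup_cst (N := N) p al `^ p * p.
have S0 : 0 <= S by rewrite mulr_ge0 ?powR_ge0 ?(ltW p0).
have SH0 : 0 <= lam * (S * H) by apply: mulr_ge0 => //; exact: mulr_ge0.
have K2 : 0 < lam * (S * H) + 1 by rewrite ltr_wpDl.
have K1 : 0 < 2 * (lam * (S * H) + 1) by rewrite mulr_gt0.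
pose e1 := (2 * (lam * (S * H) + 1))^-1.
have e10 : 0 < e1 by rewrite invr_gt0.
have [C C0 HC] := antideriv_growth cg g_const p0 g0 lim e10.
exists (2 * (M + lam * (C * H))) => U sU JU.
have E0 : 0 <= E U by exact: energy_ge0 p1 al0 a_ge U.
have bE := bounded_measurable_cst (N := N) (e1 * (S * E U) + C).
have pw x : Gt (fct_of U x) <= e1 * (S * E U) + C.
  apply: le_trans (HC _) _; rewrite lerD2r ler_wpM2l ?(ltW e10)//.
  by have := sobolev_sup N_ge1 N_lt_p ma al0 a_ge a_le x sU; rewrite mulrA.
have := weighted_le mh ih h0 (bG sU) bE pw; rewrite weighted_cst//.
move=> /(ler_wpM2l lam0); rewrite -/(Psi U) => h1.
have h2 : lam * (e1 * (S * E U) * H) <= E U / 2.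
  have -> : lam * (e1 * (S * E U) * H) = (lam * (S * H)) * e1 * E U by ring.
  rewrite mulrC ler_wpM2l// /e1 invfM mulrCA ler_piMr ?invr_ge0// ler_pdivrMr//.
  by rewrite mul1r lerDl.
have gen (z1 z2 z3 z4 : R) :
  z1 - z2 <= M -> z2 <= z3 + z4 -> z3 <= z1 / 2 -> z1 <= 2 * (M + z4) by move=> *; lra.
by rewrite mulrDl mulrDr in h1; exact: gen JU h1 h2.
Qed.

End nonlinearity.

(** * Euler-Lagrange equation *)

Lemma cvg_slope {R : realType} (f : R -> R) (df : R) : is_derive (0 : R) (1 : R) f df ->
  (fun k : nat => (f k.+1%:R^-1 - f 0) * k.+1%:R) @ \oo --> df.
Proof.
move=> [dv <-].
have h : (fun k : nat => k.+1%:R^-1 : R) @ \oo --> (0 : R)^'.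
  move=> B; rewrite /dnbhs/= => /(@cvg_harmonic R) HB.
  have {}HB : \forall k \near \oo, (k.+1%:R^-1 != 0 :> R -> B k.+1%:R^-1) by exact: HB.
  by apply: (filterS _ HB) => k; apply; rewrite invr_eq0 pnatr_eq0.
have := cvg_comp _ _ h dv; rewrite /comp.
apply: cvg_trans; apply: near_eq_cvg; apply: nearW => k /=.
by rewrite invrK addr0 /GRing.scale/= mulr1 mulrC.
Qed.

Lemma is_derive_dotv_line {R : realType} n (W V : 'rV[R]_n) :
  is_derive (0 : R) (1 : R) (fun s : R => dotv (W + s *: V) (W + s *: V)) (2 * dotv W V).
Proof.
have lin (c : R) : is_derive (0 : R) (1 : R) (fun s : R => s * c) c.
  have := is_deriveM (is_derive_id (0 : R) 1) (is_derive_cst c (0 : R) 1).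
  by rewrite /GRing.scale/= mulr0 add0r mulr1.
have quad : is_derive (0 : R) (1 : R) (fun s : R => s * (s * dotv V V)) 0.
  have := is_deriveM (is_derive_id (0 : R) 1) (lin (dotv V V)).
  by rewrite /GRing.scale/= !mul0r addr0.
have := is_deriveD (is_deriveD (is_derive_cst (dotv W W) (0 : R) 1) (lin (2 * dotv W V))) quad.
rewrite add0r addr0; congr (is_derive _ _ _ _); apply/funext => s.
rewrite -[LHS]/(dotv W W + s * (2 * dotv W V) + s * (s * dotv V V)).
by rewrite dotvDl !dotvDr !dotvZl !dotvZr (dotvC V W); ring.
Qed.

(** At [W = 0] the quotient tends to 0 because [p > 1], and the right side is 0 whatever value the
    power takes there. Elsewhere the square of the norm is a positive polynomial in the parameter,
    and its power p/2 is differentiated. *)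
Lemma enorm_powR_slope {R : realType} n (p : R) (W V : 'rV[R]_n) : 1 < p ->
  (fun k : nat => (enorm (W + k.+1%:R^-1 *: V) `^ p - enorm W `^ p) * k.+1%:R) @ \oo -->
    p * (enorm W `^ (p - 2) * dotv W V).
Proof.
move=> p1; have p0 : 0 < p by exact: lt_trans p1.
have [->|W0] := eqVneq W 0.
  rewrite dotvC dotv0 !mulr0.
  have -> : (fun k : nat =>
    (enorm (0 + k.+1%:R^-1 *: V) `^ p - enorm (0 : 'rV[R]_n) `^ p) * k.+1%:R) =
      fun k : nat => `|k.+1%:R^-1| `^ (p - 1) * enorm V `^ p.
    apply/funext => k; rewrite add0r enormZ enorm0 powR0 ?gt_eqF// subr0 powRM ?enorm_ge0//.
    rewrite mulrAC; congr (_ * _); have k0 : 0 < (k.+1%:R^-1 : R) by rewrite invr_gt0.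
    rewrite (ger0_norm (ltW k0)).
    have -> : k.+1%:R^-1 `^ p = k.+1%:R^-1 `^ (p - 1) * k.+1%:R^-1 :> R.
      transitivity (k.+1%:R^-1 `^ (p - 1 + 1) : R); first by rewrite subrK.
      rewrite [LHS]powRD; last by rewrite (gt_eqF k0) implybT.
      by rewrite powRr1// ltW.
    by rewrite -mulrA mulVf ?mulr1// pnatr_eq0.
  rewrite -[X in _ --> X](mul0r (enorm V `^ p)); apply: cvgM; last exact: cvg_cst.
  have -> : 0 = `|0 : R| `^ (p - 1) by rewrite normr0 powR0// subr_eq0 gt_eqF.
  apply: (@cvg_comp _ _ _ (fun k : nat => k.+1%:R^-1 : R) (fun t : R => `|t| `^ (p - 1)) _ _
    _ (@cvg_harmonic R)).
  by apply: continuous_powR_norm; rewrite subr_gt0.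
have b0 : 0 < dotv W W.
  rewrite lt0r dotvv_ge0 andbT; apply: contra_neq W0 => h.
  by apply: enorm_eq0; rewrite /enorm h sqrtr0.
have enp (z : 'rV[R]_n) q : enorm z `^ q = dotv z z `^ (q / 2).
  by rewrite /enorm -powR12_sqrt ?dotvv_ge0// -powRrM mulrC.
pose P (s : R) := dotv (W + s *: V) (W + s *: V).
have dP := is_derive_dotv_line W V.
have P0 : P 0 = dotv W W by rewrite /P scale0r addr0.
have dPp : is_derive (0 : R) (1 : R) (fun s => P s `^ (p / 2))
  (p * (enorm W `^ (p - 2) * dotv W V)).
  have d1 : is_derive (P 0) 1 (fun t => t `^ (p / 2)) (p / 2 * dotv W W `^ (p / 2 - 1)).
    by rewrite P0; exact: is_derive1_powR.
  have := @is_derive1_comp _ _ _ _ _ _ d1 dP.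
  rewrite enp mulrBl divff ?pnatr_eq0//.
  by congr (is_derive _ _ _ _); field.
have := cvg_slope dPp; apply: cvg_trans; apply: near_eq_cvg; apply: nearW => k.
by rewrite !enp P0.
Qed.

Lemma normr_powR_slope {R : realType} (p u v : R) : 1 < p ->
  (fun k : nat => (`|u + k.+1%:R^-1 * v| `^ p - `|u| `^ p) * k.+1%:R) @ \oo --> p *
    (`|u| `^ (p - 2) * u * v).
Proof.
move=> p1; have := @enorm_powR_slope R 1 p (const_mx u) (const_mx v) p1.
have -> : p * (enorm (const_mx u : 'rV[R]_1) `^ (p - 2) * dotv (const_mx u : 'rV[R]_1)
  (const_mx v)) =
    p * (`|u| `^ (p - 2) * u * v) by rewrite /dotv big_ord1 !mxE enorm_rV1 mxE !mulrA.
apply: cvg_trans; apply: near_eq_cvg; apply: nearW => k.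
by rewrite !enorm_rV1 !mxE.
Qed.

Section euler_lagrange.
Context {R : realType} {N : nat} (p : R) (a : 'rV[R]_N -> R) (al A : R).
Local Notation mu := (@lebesgue_rV R N).
Hypotheses (p1 : 1 < p).
Hypotheses (ma : measurable_fun setT a) (al0 : 0 < al).
Hypotheses (a_ge : forall x, al <= a x) (a_le : forall x, a x <= A).
Implicit Types (U V W : @pairs R N).
Let p0 : 0 < p. Proof. exact: lt_trans p1. Qed.
Local Notation E := (energy p a).
Local Notation X := (@sobolev R N p).
Local Notation dens := (energy_density p a).

Lemma sobolev0 : X 0.
Proof.
have f0 := @finite_energy0 R N p p1.
apply: (sobolev_C1_pair p1 (f := fun=> 0) (G := fun=> 0) _ f0); split.
- by move=> x; exact: cst_continuous.
- by move=> x; exact: cst_continuous.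
- by move=> x v; rewrite dotvC dotv0; exact: is_derive_cst.
Qed.

(** The left-hand integrand of [weak_solution], obtained as the derivative of the energy density,
    divided by p, in the direction [V]. *)
Definition first_variation U V (x : 'rV[R]_N) : R :=
  enorm (grad_of U x) `^ (p - 2) * dotv (grad_of U x) (grad_of V x) +
  a x * `|fct_of U x| `^ (p - 2) * fct_of U x * fct_of V x.

Let quotient U V (k : nat) x : R := p^-1 * (dens (U + k.+1%:R^-1 *: V) x - dens U x) * k.+1%:R.

Let quotient_cvg U V x : quotient U V k x @[k --> \oo] --> first_variation U V x.
Proof.
have c1 := @enorm_powR_slope R N p (grad_of U x) (grad_of V x) p1.
have c2 := @normr_powR_slope R p (fct_of U x) (fct_of V x) p1.
have lin (q1 q2 : nat -> R) (l1 l2 b c : R) :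
  q1 k @[k --> \oo] --> l1 -> q2 k @[k --> \oo] --> l2 ->
    b * (q1 k + c * q2 k) @[k --> \oo] --> b * (l1 + c * l2).
  move=> h1 h2; apply: cvgM; first exact: cvg_cst.
  by apply: cvgD; [exact: h1|apply: cvgM; [exact: cvg_cst|exact: h2]].
have := lin _ _ _ _ p^-1 (a x) c1 c2;
  have -> : p^-1 * (p * (enorm (grad_of U x) `^ (p - 2) * dotv (grad_of U x) (grad_of V x)) +
  a x * (p * (`|fct_of U x| `^ (p - 2) * fct_of U x * fct_of V x))) = first_variation U V x.
  by rewrite /first_variation; field; rewrite gt_eqF.
apply: cvg_trans; apply: near_eq_cvg; apply: nearW => k.
rewrite /quotient /energy_density grad_ofD grad_ofZ fct_ofD fct_ofZ /=.
by move: (_ `^ _) (_ `^ _) (_ `^ _) (_ `^ _) => *; ring.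
Qed.

Let bound U V x : R := p^-1 * (dens (U + V) x + dens (U - V) x + 2 * dens U x).

(** Difference quotients of a convex function are monotone: those for steps in ]0,1] lie between the
    differences for the steps -1 and 1. The resulting bound is integrable and lets dominated
    convergence differentiate the energy. *)
Let quotient_le U V k x : `|quotient U V k x| <= bound U V x.
Proof.
pose s : R := k.+1%:R^-1.
have s0 : 0 < s by rewrite invr_gt0.
have s1 : s <= 1 by rewrite invf_le1// ler1n.
have D0 W : 0 <= dens W x by exact: energy_density_ge0 al0 a_ge W x.
have pi0 : 0 <= p^-1 by rewrite invr_ge0 ltW.
have up : dens (U + s *: V) x - dens U x <= s * (dens (U + V) x - dens U x).
  have -> : U + s *: V = (1 - s) *: U + s *:
    (U + V) by rewrite scalerDr addrA -scalerDl subrK scale1r.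
  have h := @energy_density_convex R N p a al p1 al0 a_ge s U (U + V) x.
  have {}h := h (introT andP (conj (ltW s0) s1)).
  have gen (z1 z2 z3 : R) : z1 <= (1 - s) * z2 + s * z3 -> z1 - z2 <= s * (z3 - z2).
    by rewrite -subr_ge0 => z; rewrite -subr_ge0; apply: le_trans z _; rewrite le_eqVlt;
      apply/orP; left; apply/eqP; ring.
  exact: gen h.
have lo : s * (dens U x - dens (U - V) x) <= dens (U + s *: V) x - dens U x.
  have s10 : 0 < 1 + s by rewrite ltr_wpDl// ltW.
  (* The weight for which [U] is the convex combination of [U + s *: V] and [U - V]. *)
  pose t := s / (1 + s).
  have t0 : 0 <= t by rewrite divr_ge0 ?ltW.
  have t1 : t <= 1 by rewrite ler_pdivrMr// mul1r lerDr.
  have EU : U = (1 - t) *: (U + s *: V) + t *: (U - V).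
    rewrite !scalerDr scalerN scalerA addrACA -scalerDl subrK scale1r -scalerBl.
    rewrite (_ : (1 - t) * s - t = 0) ?scale0r ?addr0//.
    by rewrite /t; field; rewrite gt_eqF.
  have h := @energy_density_convex R N p a al p1 al0 a_ge t (U + s *: V) (U - V) x.
  have {}h := h (introT andP (conj t0 t1)); rewrite -EU in h.
  have gen (z1 z2 z3 : R) : z2 <= (1 - t) * z1 + t * z3 -> s * (z2 - z3) <= z1 - z2.
    move=> /(ler_wpM2l (ltW s10)).
    have -> : (1 + s) * ((1 - t) * z1 + t * z3) = z1 + s * z3 by rewrite /t; field; rewrite gt_eqF.
    rewrite -subr_ge0 => z; rewrite -subr_ge0; apply: le_trans z _.
    by rewrite le_eqVlt; apply/orP; left; apply/eqP; ring.
  exact: gen h.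
have sk : s * k.+1%:R = 1 by rewrite /s mulVf// pnatr_eq0.
have k0 : 0 <= k.+1%:R :> R by [].
rewrite /quotient /bound -mulrA normrM (ger0_norm pi0) ler_wpM2l//.
have {}up := ler_wpM2r k0 up; have {}lo := ler_wpM2r k0 lo.
rewrite mulrAC sk mul1r in up; rewrite mulrAC sk mul1r in lo.
have gen (q z1 z2 z3 : R) :
  0 <= z1 -> 0 <= z2 -> 0 <= z3 -> z3 - z2 <= q -> q <= z1 - z3 -> `|q| <= z1 + z2 + 2 * z3.
  by move=> *; rewrite ler_norml; apply/andP; split; lra.
exact: gen (D0 _) (D0 _) (D0 _) lo up.
Qed.

Let bound_integrable U V :
  finite_energy p U -> finite_energy p V -> mu.-integrable setT (EFin \o bound U V).
Proof.
move=> fU fV; have i1 := energy_density_integrable ma al0 a_ge a_le (finite_energyD p1 fU fV).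
have i2 := energy_density_integrable ma al0 a_ge a_le (finite_energyB p1 fU fV).
have i3 := energy_density_integrable ma al0 a_ge a_le fU.
have [i12 _] := Rintegral_lin2 p^-1 p^-1 i1 i2.
have [i123 _] := Rintegral_lin2 1 (p^-1 * 2) i12 i3.
apply: eq_integrable i123 => // x _; rewrite /= /bound; congr EFin.
by move: (dens _ _) (dens _ _) (dens _ _) => *; ring.
Qed.

Let quotient_integral U V k : finite_energy p U -> finite_energy p V ->
  mu.-integrable setT (EFin \o quotient U V k) /\
  \int[mu]_x quotient U V k x = (E (U + k.+1%:R^-1 *: V) - E U) * k.+1%:R.
Proof.
move=> fU fV; have fW := finite_energyD p1 fU (finite_energyZ p1 k.+1%:R^-1 fV).
have i1 := energy_density_integrable ma al0 a_ge a_le fW.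
have i2 := energy_density_integrable ma al0 a_ge a_le fU.
have [i12 E12] := Rintegral_lin2 (p^-1 * k.+1%:R) (- (p^-1 * k.+1%:R)) i1 i2.
have EQ x : quotient U V k x = p^-1 * k.+1%:R * dens (U + k.+1%:R^-1 *: V) x + -
  (p^-1 * k.+1%:R) * dens U x.
  by rewrite /quotient; move: (dens (U + _) x) (dens U x) => *; ring.
split; first by apply: eq_integrable i12 => // x _; rewrite /= EQ.
transitivity (\int[mu]_x
  (p^-1 * k.+1%:R * dens (U + k.+1%:R^-1 *: V) x + - (p^-1 * k.+1%:R) * dens U x)).
  by apply: eq_Rintegral => x _.
rewrite E12 /energy; move: (Rintegral _ _ _) (Rintegral _ _ _) => *; ring.
Qed.

Lemma first_variation_cvg U V : finite_energy p U -> finite_energy p V ->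
  mu.-integrable setT (EFin \o first_variation U V) /\
  (fun k : nat => (E (U + k.+1%:R^-1 *: V) - E U) * k.+1%:R) @ \oo --> \int[mu]_x
    first_variation U V x.
Proof.
move=> fU fV.
have mq k := measurable_int _ (quotient_integral k fU fV).1.
have mf : measurable_fun setT (EFin \o first_variation U V).
  apply/measurable_EFinP; apply: (measurable_fun_cvg (h := quotient U V)).
    by move=> k; apply/measurable_EFinP; exact: mq.
  by move=> x _; exact: quotient_cvg.
have Fc (x : 'rV[R]_N) :
  (fun k => (EFin \o quotient U V k) x) @ \oo --> (EFin \o first_variation U V) x.
  by apply: cvg_EFin; [exact: nearW|exact: quotient_cvg].
have [i _ c] := dominated_convergence measurableT mq mf (aeW mu (fun x _ => Fc x))
  (bound_integrable fU fV) (aeW mu (fun x k _ => quotient_le U V k x)).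
split; first exact: i.
have -> : (fun k : nat => (E (U + k.+1%:R^-1 *: V) - E U) * k.+1%:R) =
  (fun k => \int[mu]_x quotient U V k x).
  by apply/funext => k; rewrite (quotient_integral k fU fV).2.
apply: fine_cvg; rewrite /Rintegral fineK; first exact: c.
exact: integrable_fin_num.
Qed.

Lemma first_variationN U V x : first_variation U (- V) x = - first_variation U V x.
Proof.
rewrite /first_variation -[- V]scaleN1r grad_ofZ fct_ofZ dotvZr !mulN1r.
by move: (dotv _ _) (_ `^ _) (_ `^ _) => *; ring.
Qed.

(** Minimality along [U] plus multiples of [V] gives one inequality in the limit; the same for [- V]
    gives the reverse one. *)
Theorem euler_lagrange l U V : bounded_linear X E l -> minimizes X E l U -> X V ->
  \int[mu]_x first_variation U V x = l V.
Proof.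
have gen (n z1 z2 z3 z4 : R) : 0 < n -> z1 - z3 <= z2 - (n^-1 * z4 + z3) -> z4 <= (z2 - z1) * n.
  move=> n0 z; rewrite -ler_pdivrMr// mulrC; move: z; move: (n^-1 * z4) => ? ?; lra.
move=> [ll _] [sU minU] sV.
have half W : X W -> l W <= \int[mu]_x first_variation U W x.
  move=> sW; have [_ c] := first_variation_cvg (sobolev_finite p1 sU) (sobolev_finite p1 sW).
  apply: (@closed_cvg _ _ \oo _ (fun k : nat => (E (U + k.+1%:R^-1 *: W) - E U) * k.+1%:R)
    [set z | l W <= z] (@closed_ge _ (l W)) _ _ c).
  apply: nearW => k /=.
  have sUW : X (k.+1%:R^-1 *: W + U) by exact: sobolevP.
  have := minU _ sUW; rewrite ll// [_ + U]addrC => h.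
  have k0 : 0 < (k.+1%:R : R) by [].
  exact: gen k0 h.
apply/eqP; rewrite eq_le half// andbT.
have sNV : X (- V) by rewrite -scaleN1r -[_ *: V]addr0; exact: sobolevP p1 _ _ _ sV sobolev0.
have := half _ sNV.
have -> : l (- V) = - l V.
  have l0 : l 0 = 0 by have := ll (-1) V V sV sV; rewrite scaleN1r addNr mulN1r addNr.
  by have := ll (-1) V 0 sV sobolev0; rewrite scaleN1r addr0 l0 addr0 mulN1r.
have -> : \int[mu]_x first_variation U (- V) x = - \int[mu]_x first_variation U V x.
  rewrite -[RHS]mulN1r -RintegralZl//; last first.
    exact: (first_variation_cvg (sobolev_finite p1 sU) (sobolev_finite p1 sV)).1.
  by apply: eq_Rintegral => x _; rewrite first_variationN mulN1r.
by rewrite lerN2.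
Qed.

End euler_lagrange.

(** * Cutoff functions *)

Section is_derive_antideriv.
Context {R : realType} (g : R -> R).
Hypotheses (cg : continuous g) (g_const : forall t, t <= 0 -> g t = g 0).

Lemma is_derive_antideriv (s : R) : is_derive s 1 (antideriv g) (g s).
Proof.
have c : (fun h : R => h^-1 *: (antideriv g (h *: 1 + s) - antideriv g s)) @ (0 : R)^' --> g s.
  apply/cvgrPdist_le => e e0; have e20 : 0 < e / 2 by rewrite divr_gt0.
  have [d1 d10 H1] := antideriv_first_order cg g_const (`|s| + 1) e20.
  have [d2 d20 H2] := uniform_on_segment (`|s| + 1) cg e20.
  near=> h.
  have h0 : h != 0 by near: h; exact: nbhs_dnbhs_neq.
  have hd : `|h| <= Num.min 1 (Num.min d1 d2).
    near: h; apply: nbhs_dnbhs; apply: filterS (nbhsx_ballx (0 : R) (Num.min 1 (Num.min d1 d2)) _).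
      by move=> y; rewrite /ball/= sub0r normrN => /ltW.
    by rewrite !lt_min ltr01 d10 d20.
  move: hd; rewrite !le_min => /andP[h1 /andP[hd1 hd2]].
  have sC : `|s| <= `|s| + 1 by rewrite lerDl.
  have shC : `|h + s| <= `|s| + 1.
    by rewrite addrC; apply: le_trans (ler_normD _ _) _; rewrite lerD2l.
  have sh : h + s - s = h by rewrite addrK.
  have hs : s - (h + s) = - h by rewrite opprD addrCA subrr addr0.
  have := H1 s (h + s) sC; rewrite sh => /(_ hd1) l1.
  have := H1 (h + s) s shC; rewrite hs normrN => /(_ hd1) l2.
  have := H2 s (h + s) sC; rewrite hs normrN => /(_ hd2) l3.
  rewrite /GRing.scale/= mulr1.
  have -> : g s - h^-1 * (antideriv g (h + s) - antideriv g s) =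
      h^-1 * (g s * h - (antideriv g (h + s) - antideriv g s)) by field.
  rewrite normrM normfV mulrC ler_pdivrMr ?normr_gt0//.
  have l4 : `|(g s - g (h + s)) * h| <= e / 2 * `|h| by rewrite normrM ler_wpM2r.
  move: l1 l2 l4; rewrite mulrBl !ler_norml mulrN.
  move: (antideriv g (h + s)) (antideriv g s) (g s * h) (g (h + s) * h) (`|h|) => z1 z2 z3 z4 z5.
  have -> : e * z5 = e / 2 * z5 + e / 2 * z5 by rewrite -mulrDl -splitr.
  move: (e / 2 * z5) => z6 l1 l2 /andP[l3' l4].
  by apply/andP; split; lra.
split; first by apply/cvg_ex; exists (g s).
exact: cvg_lim c.
Unshelve. all: by end_near.
Qed.

End is_derive_antideriv.

Section cutoff.
Context {R : realType}.

Definition trapezoid (d s : R) : R := Num.max 0 (Num.min 1 (Num.min (s / d) ((1 - s) / d))).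

Lemma continuous_trapezoid d : continuous (trapezoid d).
Proof.
move=> s; apply:
  (@continuous_max R R (fun=> 0) (fun s => Num.min 1 (Num.min (s / d) ((1 - s) / d)))).
  exact: cst_continuous.
apply: (@continuous_min R R (fun=> 1) (fun s => Num.min (s / d) ((1 - s) / d))).
  exact: cst_continuous.
apply: (@continuous_min R R (fun s => s / d) (fun s => (1 - s) / d)).
  by rewrite /continuous_at; apply: cvgM; [exact: cvg_id|exact: cvg_cst].
rewrite /continuous_at; apply: cvgM; last exact: cvg_cst.
by apply: cvgB; [exact: cvg_cst|exact: cvg_id].
Qed.

(** The step is the normalized primitive of a trapezoid of height 1 on [0, 1]. Its plateau [d, 1-d]
    has length exactly 1/k, so its area is at least 1/k and the normalized slope at most [k]. As [k]
    tends to 1 the profile approaches the affine one. *)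
Lemma smooth_step (k : R) : 1 < k -> exists eta deta : R -> R,
  [/\ (forall s : R, is_derive s (1 : R) eta (deta s)), continuous deta,
      (forall s, 0 <= eta s <= 1), (forall s, 1 <= s -> eta s = 1) &
      (forall s, 0 <= deta s <= k /\ (s <= 0 \/ 1 <= s -> deta s = 0 /\ (s <= 0 -> eta s = 0)))].
Proof.
move=> k1; have k0 : 0 < k by exact: lt_trans k1.
pose d := (1 - k^-1) / 2.
have ki : k^-1 < 1 by rewrite invf_lt1.
have ki0 : 0 < k^-1 by rewrite invr_gt0.
have d0 : 0 < d by rewrite divr_gt0// subr_gt0.
have d12 : d < 1 / 2 by rewrite ltr_pM2r ?invr_gt0//; lra.
pose t := trapezoid d.
have ct : continuous t by exact: continuous_trapezoid.
have t01 s : 0 <= t s <= 1.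
  by rewrite /t /trapezoid le_max lexx/= ge_max ler01/= ge_min lexx.
have tneg s : s <= 0 -> t s = 0.
  move=> s0; rewrite /t /trapezoid max_l// !ge_min; apply/orP; right; apply/orP; left.
  by rewrite pmulr_lle0 ?invr_gt0.
have tbig s : 1 <= s -> t s = 0.
  move=> s1; rewrite /t /trapezoid max_l// !ge_min; apply/orP; right; apply/orP; right.
  by rewrite pmulr_lle0 ?invr_gt0// subr_le0.
have tone s : d <= s <= 1 - d -> t s = 1.
  move=> /andP[s1 s2]; rewrite /t /trapezoid [Num.min 1 _]min_l ?max_r//.
  by rewrite le_min !ler_pdivlMr// !mul1r s1 lerBrDr -lerBrDl.
have tc s : s <= 0 -> t s = t 0 by move=> s0; rewrite !tneg.
pose T := antideriv t.
have mono u v : u <= v -> T u <= T v.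
  move=> uv; have /andP[h _] := antideriv_bounds ct tc uv (fun x _ => t01 x).
  by rewrite -subr_ge0; apply: le_trans h; rewrite mul0r.
have T0 s : s <= 0 -> T s = 0.
  move=> s0; have h x : s <= x <= 0 -> 0 <= t x <= 0 by move=> /andP[_ /tneg ->]; rewrite lexx.
  have := antideriv_bounds ct tc s0 h; rewrite !mul0r => h2.
  have : T 0 - T s = 0 by apply/eqP; rewrite eq_le andbC.
  by rewrite /T antideriv0 sub0r => /eqP; rewrite oppr_eq0 => /eqP.
have T1 s : 1 <= s -> T s = T 1.
  move=> s1; have h x : 1 <= x <= s -> 0 <= t x <= 0 by move=> /andP[/tbig -> _]; rewrite lexx.
  have := antideriv_bounds ct tc s1 h; rewrite !mul0r => h2.
  by apply/eqP; rewrite -subr_eq0 eq_le andbC.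
have Tk : k^-1 <= T 1.
  have dd : d <= 1 - d by lra.
  have h x : d <= x <= 1 - d -> 1 <= t x <= 1 by move=> /tone ->; rewrite lexx.
  have /andP[h1 _] := antideriv_bounds ct tc dd h.
  have h2 : T (1 - d) <= T 1 by apply: mono; lra.
  have h3 : 0 <= T d by rewrite -(T0 0 (lexx _)); exact: mono (ltW d0).
  have h4 : 1 - d - d = k^-1 by rewrite /d; field; rewrite gt_eqF.
  by rewrite mul1r h4 in h1; rewrite /T in h2 h3 *; lra.
have T10 : 0 < T 1 by exact: lt_le_trans ki0 Tk.
have iT : (T 1)^-1 <= k by rewrite -[k]invrK lef_pV2 ?posrE.
exists (fun s => (T 1)^-1 * T s), (fun s => (T 1)^-1 * t s); split.
- by move=> s; have := is_deriveZ (T 1)^-1 (is_derive_antideriv ct tc s).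
- by move=> s; apply: cvgM; [exact: cvg_cst|exact: ct].
- move=> s; rewrite mulr_ge0 ?invr_ge0 ?(ltW T10)//=; last first.
    by have [/T0 ->|/ltW s0] := leP s 0; rewrite // -(T0 0 (lexx _)); exact: mono.
  rewrite mulrC ler_pdivrMr// mul1r.
  by have [/mono//|/ltW/T1 ->] := leP s 1.
- by move=> s /T1 ->; rewrite mulVf// gt_eqF.
- move=> s; have /andP[h1 h2] := t01 s; split.
    rewrite mulr_ge0 ?invr_ge0 ?(ltW T10)//=; apply: le_trans iT.
    by rewrite ler_piMr// invr_ge0 ltW.
  move=> s01; split; last by move=> /T0 ->; rewrite mulr0.
  by case: s01 => [/tneg|/tbig] ->; rewrite mulr0.
Qed.

End cutoff.

Section radial_functions.
Context {R : realType} {N : nat}.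
Local Notation mu := (@lebesgue_rV R N).

(** Profiles are taken as functions of the squared distance, which is differentiable at the centre
    too. *)
Lemma radial_C1_pair (x0 : 'rV[R]_N) (z dz : R -> R) :
  (forall q : R, is_derive q (1 : R) z (dz q)) -> continuous dz ->
  C1_pair (fun x => z (dotv (x - x0) (x - x0)))
    (fun x => (2 * dz (dotv (x - x0) (x - x0))) *: (x - x0)).
Proof.
move=> hz cdz.
have cz : continuous z.
  by move=> q; apply: differentiable_continuous; apply/derivable1_diffP; have [] := hz q.
have cd : continuous (fun x : 'rV[R]_N => dotv (x - x0) (x - x0)).
  have -> : (fun x : 'rV[R]_N => dotv (x - x0) (x - x0)) =
    (fun x => enorm (x - x0) * enorm (x - x0)).
    by apply/funext => x; rewrite -expr2 sqr_enorm.
  have ce : continuous (fun x : 'rV[R]_N => enorm (x - x0)).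
    apply: continuous_enorm_dist => x e e0; exists e => // y xy.
    apply: le_lt_trans (ler_dist_enorm _ _) _; by rewrite opprB addrA subrK.
  by move=> x; exact: (continuousM (ce x) (ce x)).
split.
- by move=> x; apply: (@cvg_comp _ _ _ (fun x => dotv (x - x0) (x - x0)) z); [exact: cd|exact: cz].
- apply: continuous_rV_vec => i; under eq_fun do rewrite !mxE.
  have c1 : continuous (fun x : 'rV[R]_N => dz (dotv (x - x0) (x - x0))).
    by move=> x; apply: (@cvg_comp _ _ _ (fun x => dotv (x - x0) (x - x0)) dz);
      [exact: cd|exact: cdz].
  have c2 : continuous (fun x : 'rV[R]_N => x 0 i : R) by move=> x; exact: coord_continuous.
  have c3 : continuous (fun x : 'rV[R]_N => 2 * dz (dotv (x - x0) (x - x0))).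
    by move=> x; apply: (continuousM (cvg_cst _) (c1 x)).
  have c4 : continuous (fun x : 'rV[R]_N => x 0 i - x0 0 i).
    apply: continuous_rV => x e e0; exists e => // y xy.
    by rewrite (_ : _ - _ = x 0 i - y 0 i) ?xy//; ring.
  by move=> x; apply: (continuousM (c3 x) (c4 x)).
- move=> x v; have d1 := is_derive_dotv_line (x - x0) v.
  pose P (s : R) := dotv (x - x0 + s *: v) (x - x0 + s *: v).
  have P0 : P 0 = dotv (x - x0) (x - x0) by rewrite /P scale0r addr0.
  have := @is_derive1_comp R z P 0 _ _ (hz (P 0)) d1.
  have -> : z \o P = (fun t : R => z (dotv (x + t *: v - x0) (x + t *: v - x0))).
    by apply/funext => t; rewrite /P /= addrAC.
  by rewrite P0 dotvZl mulrA (mulrC 2).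
Qed.

(* On a neighborhood of the centre the profile is constant, so the square root is harmless there. *)
Lemma cutoff_C1_pair (x0 : 'rV[R]_N) (r k : R) : 0 < r -> 1 < k -> exists f G,
  [/\ C1_pair f G, (forall x : 'rV[R]_N, 0 <= f x <= 1 /\ (r <= enorm (x - x0) -> f x = 0)),
      (forall x, enorm (x - x0) <= r / 2 -> f x = 1) &
      (forall x, enorm (G x) <= k * (2 / r) /\
        (enorm (x - x0) < r / 2 \/ r <= enorm (x - x0) -> G x = 0))].
Proof.
move=> r0 k1; have [eta [deta [he cde eta01 eta1 hde]]] := smooth_step k1.
(* Maps the squared radius to the parameter of the step: 1 at distance r/2 and 0 at distance [r],
   with slope -2/r in the distance. *)
pose arg (q : R) := 2 * (r - Num.sqrt q) / r.
pose z q := eta (arg q).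
pose dz q := deta (arg q) * (- (2 / r) * (2 * Num.sqrt q)^-1).
have deta0 s : s <= 0 \/ 1 <= s -> deta s = 0 by move=> h; have [_ /(_ h)[]] := hde s.
have eta0 s : s <= 0 -> eta s = 0.
  by move=> h; have [_ /(_ (or_introl h))[_ /(_ h)]] := hde s.
have r2 : 0 < r / 2 by rewrite divr_gt0.
have q0 : 0 < (r / 2) ^+ 2 by rewrite exprn_gt0.
have arg1 q : q < (r / 2) ^+ 2 -> 1 < arg q.
  move=> h; rewrite /arg ltr_pdivlMr// mul1r mulrBr.
  have : Num.sqrt q < r / 2 by rewrite -[ltRHS]ger0_norm ?(ltW r2)// -sqrtr_sqr ltr_sqrt.
  by rewrite ltr_pdivlMr// => ?; lra.
have near_small (q : R) : q <= 0 -> \forall t \near q, (t : R) < (r / 2) ^+ 2.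
  by move=> h; apply: lt_nbhsl; exact: le_lt_trans q0.
have zd q : is_derive q (1 : R) z (dz q).
  have [h|h] := leP q 0.
    have -> : dz q = 0.
      rewrite /dz deta0 ?mul0r//; right; apply: ltW; apply: arg1; exact: le_lt_trans q0.
    apply: (near_eq_is_derive _ (is_derive_cst (1 : R) q (1 : R))).
    apply: filterS (near_small q h) => t /arg1/ltW/eta1 h1.
    by rewrite /z h1.
  have da : is_derive q (1 : R) arg (- (2 / r) * (2 * Num.sqrt q)^-1).
    have := is_deriveZ (- (2 / r)) (is_derive1_sqrt h).
    move=> /(is_deriveD (is_derive_cst (2 : R) q (1 : R))); rewrite add0r.
    congr (is_derive _ _ _ _); apply/funext => t.
    rewrite -[LHS]/(2 + - (2 / r) * Num.sqrt t) /arg; field; by rewrite gt_eqF.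
  exact: (@is_derive1_comp R eta arg q _ _ (he (arg q)) da).
have cdz : continuous dz.
  move=> q; have [h|h] := leP q 0.
    have dz0 t : t < (r / 2) ^+ 2 -> dz t = 0.
      by move=> /arg1/ltW h1; rewrite /dz deta0 ?mul0r//; right.
    rewrite /continuous_at dz0; last exact: le_lt_trans q0.
    by apply: cvg_near_cst; apply: filterS (near_small q h) => t; exact: dz0.
  have cs : {for q, continuous (Num.sqrt : R -> R)} by exact: sqrt_continuous.
  rewrite /continuous_at; apply: cvgM.
    apply: (@cvg_comp _ _ _ arg deta); last exact: cde.
    rewrite /arg; apply: cvgM; last exact: cvg_cst.
    apply: cvgM; first exact: cvg_cst.
    by apply: cvgB; [exact: cvg_cst|exact: cs].
  apply: cvgM; first exact: cvg_cst.
  apply: cvgV; first by rewrite mulf_neq0// gt_eqF// sqrtr_gt0.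
  by apply: cvgM; [exact: cvg_cst|exact: cs].
have argE (x : 'rV[R]_N) : arg (dotv (x - x0) (x - x0)) = 2 * (r - enorm (x - x0)) / r by [].
have arg_neg (x : 'rV[R]_N) : r <= enorm (x - x0) -> 2 * (r - enorm (x - x0)) / r <= 0.
  by move=> h; rewrite pmulr_lle0 ?invr_gt0// pmulr_rle0// subr_le0.
have arg_big (x : 'rV[R]_N) : enorm (x - x0) <= r / 2 -> 1 <= 2 * (r - enorm (x - x0)) / r.
  by rewrite ler_pdivlMr// => h; rewrite ler_pdivlMr// mul1r; lra.
exists (fun x => z (dotv (x - x0) (x - x0))),
  (fun x => (2 * dz (dotv (x - x0) (x - x0))) *: (x - x0)).
split; first exact: radial_C1_pair.
- move=> x; rewrite /z argE; split; first exact: eta01.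
  by move=> /arg_neg/eta0.
- by move=> x; rewrite /z argE => /arg_big/eta1.
- move=> x; rewrite /dz argE -/(enorm (x - x0)); split; last first.
    move=> h; rewrite deta0 ?mul0r ?mulr0 ?scale0r//.
    by case: h => [/ltW/arg_big|/arg_neg]; [right|left].
  have [/andP[d0 dk] _] := hde (2 * (r - enorm (x - x0)) / r).
  rewrite enormZ; have [->|en0] := eqVneq (enorm (x - x0)) 0.
    by rewrite mulr0 mulr_ge0 ?divr_ge0 ?ltW// (lt_trans _ k1).
  have en : 0 < enorm (x - x0) by rewrite lt0r en0 enorm_ge0.
  rewrite !normrM (ger0_norm d0) normrN (@ger0_norm _ (2 / r)) ?divr_ge0 ?(ltW r0)//.
  rewrite normfV (@ger0_norm _ (2 * enorm _)) ?mulr_ge0 ?(ltW en)// (@ger0_norm _ 2)//.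
  move: (2 * (r - enorm (x - x0)) / r) d0 dk => s d0 dk.
  have -> : 2 * (deta s * (2 / r * (2 * enorm (x - x0))^-1)) * enorm (x - x0) = deta s * (2 / r).
    by field; rewrite en0 gt_eqF.
  by rewrite ler_wpM2r// divr_ge0// ltW.
Qed.

Lemma measure_annulus (x0 : 'rV[R]_N) (r : R) : 0 < r ->
  mu (eball x0 r `\` eball x0 (r / 2)) = ((r ^+ N - (r / 2) ^+ N) * eball_volume N)%:E.
Proof.
move=> r0; have r2 : 0 < r / 2 by rewrite divr_gt0.
have b1 : mu (eball x0 r) = (r ^+ N * eball_volume N)%:E := lebesgue_eball _ r0.
have b2 : mu (eball x0 (r / 2)) = ((r / 2) ^+ N * eball_volume N)%:E := lebesgue_eball _ r2.
have fin1 : (mu (eball x0 r) < +oo)%E by rewrite b1 ltry.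
have sub : eball x0 r `&` eball x0 (r / 2) = eball x0 (r / 2).
  apply: setIidr => y /= h; apply: lt_trans h _; by rewrite ltr_pdivrMr// ltr_pMr// ltr1n.
apply: (etrans (measureD (measurable_eball _ _) (measurable_eball _ _) fin1)); rewrite sub.
by apply: (etrans (congr2 (fun u v => (u - v)%E) b1 b2)); rewrite mulrBl.
Qed.

End radial_functions.

(** * The element of low energy behind the constant [K_R] *)

Section test_element.
Context {R : realType} {N : nat} (p : R) (a : 'rV[R]_N -> R) (al A : R).
Local Notation mu := (@lebesgue_rV R N).
Hypotheses (N_ge1 : (0 < N)%N) (N_lt_p : N%:R < p).
Hypotheses (ma : measurable_fun setT a) (al0 : 0 < al).
Hypotheses (a_ge : forall x, al <= a x) (a_le : forall x, a x <= A).
Let p1 : 1 < p. Proof. exact: embedding_p_gt1 N_ge1 N_lt_p. Qed.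
Let p0 : 0 < p. Proof. exact: lt_trans p1. Qed.

Lemma pint_le_bounded (f : 'rV[R]_N -> R) (S : set 'rV[R]_N) (C v : R) :
  measurable_fun setT f -> measurable S -> 0 <= C ->
  (forall x, `|f x| <= C) -> (forall x, ~ S x -> f x = 0) -> mu S = v%:E ->
  (pint mu p f <= (C `^ p * v)%:E)%E.
Proof.
move=> mf mS C0 fC fS muS.
apply: (@le_trans _ _ (\int[mu]_x (C `^ p * \1_S x)%:E)%E).
  apply: ge0_le_integral => //.
  - exact: measurable_abs_powR.
  - by apply/measurable_EFinP; apply: measurable_funM => //.
  move=> x _; rewrite lee_fin indicE; have [xS|xS] := boolP (x \in S).
    by rewrite mulr1 ge0_ler_powR ?nnegrE ?(ltW p0).
  rewrite mulr0 fS ?normr0 ?powR0 ?gt_eqF//.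
  by move=> xS'; move/negP: xS; apply; exact: mem_set.
under eq_integral do rewrite EFinM.
have i1 : (\int[mu]_x (\1_S x)%:E = v%:E)%E.
  by apply: (etrans (integral_indic _ _ _)) => //; rewrite setIT; exact: muS.
rewrite ge0_integralZl//=;
  [by rewrite i1 EFinM|by apply/measurable_EFinP|by rewrite lee_fin powR_ge0].
Qed.

(** The gradient is at most 2dk/r, with k^p = 1 + eps, and lives on the annulus, of volume (r^N -
    (r/2)^N) times the unit one; together they give r^(N-p) (2^p - 2^(p-N)). The potential term is
    bounded by A d^p on the whole ball. This is the denominator of [K_R]. *)
Lemma test_element (x0 : 'rV[R]_N) (r d eps : R) : 0 < r -> 0 <= d -> 0 < eps -> exists U,
  [/\ sobolev p U, (forall x, 0 <= fct_of U x <= d),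
    (forall x, enorm (x - x0) <= r / 2 -> fct_of U x = d) &
   p * energy p a U <= (1 + eps) * (d `^ p * eball_volume N * r `^ (N%:R - p) *
      (2 `^ p - 2 `^ (p - N%:R) + r `^ p * A))].
Proof.
move=> r0 d0 e0; pose k := (1 + eps) `^ p^-1.
have k1 : 1 < k.
  have : 1 `^ p^-1 < (1 + eps) `^ p^-1.
    by rewrite gt0_ltr_powR ?invr_gt0 ?nnegrE ?ltrDl ?addr_ge0 ?(ltW e0).
  by rewrite powR1.
have k0 : 0 < k by exact: lt_trans k1.
have kp : k `^ p = 1 + eps by rewrite /k -powRrM mulVf ?gt_eqF// powRr1// addr_ge0// ltW.
have [f [G [fG f01 f1 GE]]] := @cutoff_C1_pair R N x0 r k r0 k1.
have r20 : 0 < r / 2 by rewrite divr_gt0.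
have z0 : C1_pair (fun _ : 'rV[R]_N => 0 : R) (fun=> 0).
  split; [by move=> x; exact: cst_continuous|by move=> x; exact: cst_continuous|].
  by move=> x v; rewrite dotvC dotv0; exact: is_derive_cst.
pose u (x : 'rV[R]_N) := d * f x + 0; pose Du (x : 'rV[R]_N) := d *: G x + 0.
have uD : C1_pair u Du := C1_pair_lincomb d fG z0.
have [cu cDu _] := uD.
have mu_ : measurable_fun setT u by exact: continuous_measurable_rV.
have mDu : measurable_fun setT Du.
  apply: measurable_fun_rV => i; apply: continuous_measurable_rV => x.
  by apply: (@cvg_comp _ _ _ Du (fun z : 'rV[R]_N => z 0 i)); [exact: cDu|exact: coord_continuous].
have ub : (pint mu p u <= (d `^ p * (r ^+ N * eball_volume N))%:E)%E.
  apply: (pint_le_bounded mu_ (measurable_eball x0 r) d0) => [x|x xr|].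
  - have [/andP[h1 h2] _] := f01 x; rewrite /u addr0 ger0_norm ?mulr_ge0//.
    by rewrite ler_piMr.
  - have [_ h] := f01 x; rewrite /u h ?mulr0 ?addr0// leNgt; exact/negP.
  - exact: lebesgue_eball.
pose C := d * (k * (2 / r)).
have C0 : 0 <= C by rewrite !mulr_ge0 ?invr_ge0 ?(ltW k0) ?(ltW r0).
have mS : measurable (eball x0 r `\` eball x0 (r / 2)).
  by apply: measurableD; exact: measurable_eball.
have meDu : measurable_fun setT (fun x => enorm (Du x)).
  by apply: measurableT_comp; [exact: measurable_enorm|exact: mDu].
have Dub : (gradient_pint p Du <= (C `^ p * ((r ^+ N - (r / 2) ^+ N) * eball_volume N))%:E)%E.
  apply: (pint_le_bounded meDu mS C0) => [x|x xr|].
  - rewrite ger0_norm ?enorm_ge0// /Du addr0 enormZ (ger0_norm d0) ler_wpM2l//.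
    by have [] := GE x.
  - have [_ h] := GE x; rewrite /Du h ?scaler0 ?addr0 ?enorm0//.
    have [|h1] := ltP (enorm (x - x0)) r; last by right.
    by move=> h1; left; have [//|h2] := ltP (enorm (x - x0)) (r / 2); exfalso; apply: xr;
      split => //; apply/negP; rewrite -leNgt.
  - exact: measure_annulus.
have fU : finite_energy p (mkpair u Du).
  by split; [exact: mu_|exact: mDu|apply: le_lt_trans ub (ltry _)|apply: le_lt_trans Dub (ltry _)].
exists (mkpair u Du); split.
- exact: sobolev_C1_pair p1 _ _ uD fU.
- move=> x; rewrite -[fct_of _ x]/(u x) /u addr0; have [/andP[h1 h2] _] := f01 x.
  by rewrite mulr_ge0//= ler_piMr.
- by move=> x /f1 h; rewrite -[fct_of _ x]/(u x) /u addr0 h mulr1.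
apply: le_trans (energy_le p1 ma al0 a_ge a_le fU ub Dub) _.
have A0 : 0 <= A by apply: le_trans (ltW al0) _; apply: le_trans (a_ge 0) (a_le 0).
have w0 : 0 <= eball_volume N :> R by exact: ltW (eball_volume_gt0 N).1.
have rN : r ^+ N = r `^ (N%:R - p) * r `^ p.
  by rewrite -powRD ?subrK ?powR_mulrn ?(ltW r0)// (gt_eqF r0) implybT.
have rN2 : (r / 2) ^+ N = r ^+ N / 2 ^+ N by rewrite expr_div_n.
have p2N : 2 `^ (p - N%:R) = 2 `^ p / 2 ^+ N :> R.
  by rewrite powRB ?powR_mulrn// pnatr_eq0 implybT.
have CE : C `^ p = d `^ p * (1 + eps) * (2 `^ p / r `^ p).
  rewrite /C !powRM ?mulr_ge0 ?invr_ge0 ?(ltW k0) ?(ltW r0)// kp -mulrA; congr (_ * (_ * (_ * _))).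
  by rewrite -powR_inv1 ?(ltW r0)// -powRrM mulN1r powRN.
have rp0 : 0 < r `^ p by exact: powR_gt0.
have two0 : 0 < 2 ^+ N :> R by exact: exprn_gt0.
rewrite CE rN2 p2N rN.
have -> : d `^ p * (1 + eps) * (2 `^ p / r `^ p) *
    ((r `^ (N%:R - p) * r `^ p - r `^ (N%:R - p) * r `^ p / 2 ^+ N) * eball_volume N) +
    A * (d `^ p * (r `^ (N%:R - p) * r `^ p * eball_volume N)) =
  (1 + eps) * (d `^ p * eball_volume N * r `^ (N%:R - p) * (2 `^ p - 2 `^ p / 2 ^+ N)) +
  d `^ p * eball_volume N * r `^ (N%:R - p) * (r `^ p * A).
  by field; rewrite !gt_eqF.
rewrite [_ * (_ - _ + _)]mulrDr [(1 + eps) * (_ + _)]mulrDr lerD2l.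
have h1 : 0 <= d `^ p * eball_volume N * r `^ (N%:R - p).
  by apply: mulr_ge0; [apply: mulr_ge0; [exact: powR_ge0|exact: w0]|exact: powR_ge0].
by apply: ler_peMl;
  [apply: mulr_ge0 h1 _; apply: mulr_ge0; [exact: powR_ge0|exact: A0]|rewrite lerDl ltW].
Qed.

End test_element.

(** * Critical points and weak solutions *)

Lemma C1_pair_comp {R : realType} {N : nat} (f : 'rV[R]_N -> R) (G : 'rV[R]_N -> 'rV[R]_N)
  (z dz : R -> R) :
  C1_pair f G -> (forall q : R, is_derive q (1 : R) z (dz q)) -> continuous dz ->
  C1_pair (fun x => z (f x)) (fun x => dz (f x) *: G x).
Proof.
move=> [cf cG df] hz cdz.
have cz : continuous z.
  by move=> q; apply: differentiable_continuous; apply/derivable1_diffP; have [] := hz q.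
split.
- by move=> x; apply: (@cvg_comp _ _ _ f z); [exact: cf|exact: cz].
- apply: continuous_rV_vec => i; under eq_fun do rewrite !mxE.
  have c1 : continuous (fun x => dz (f x)).
    by move=> x; apply: (@cvg_comp _ _ _ f dz); [exact: cf|exact: cdz].
  have c2 : continuous (fun x => G x 0 i).
    by move=> x; apply: (@cvg_comp _ _ _ G (fun y : 'rV[R]_N => y 0 i));
      [exact: cG|exact: coord_continuous].
  by move=> x; apply: (continuousM (c1 x) (c2 x)).
- move=> x v; have := @is_derive1_comp R z (fun t => f (x + t *: v)) 0 _ _ (hz _) (df x v).
  by rewrite scale0r addr0 dotvZl.
Qed.

Lemma ae_eq_Rintegral {d} {T : measurableType d} {R : realType}
  (mu : {measure set T -> \bar R}) (f g : T -> R) :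
  measurable_fun setT f -> measurable_fun setT g -> {ae mu, forall x, f x = g x} ->
  \int[mu]_x f x = \int[mu]_x g x.
Proof.
move=> mf mg fg; rewrite /Rintegral; congr fine; apply: ae_eq_integral => //.
- exact/measurable_EFinP.
- exact/measurable_EFinP.
- by apply: filterS fg => x -> _.
Qed.

Section critical_points.
Context {R : realType} {N : nat} (p : R) (a h : 'rV[R]_N -> R) (al A : R) (g : R -> R) (lam : R).
Local Notation mu := (@lebesgue_rV R N).
Hypotheses (N_ge1 : (0 < N)%N) (N_lt_p : N%:R < p).
Hypotheses (ma : measurable_fun setT a) (al0 : 0 < al).
Hypotheses (a_ge : forall x, al <= a x) (a_le : forall x, a x <= A).
Hypotheses (mh : measurable_fun setT h) (ih : mu.-integrable setT (EFin \o h)).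
Hypothesis h0 : forall x, 0 <= h x.
Hypotheses (cg : continuous g) (g_const : forall t, t <= 0 -> g t = g 0).
Hypothesis g_ge0 : forall t, 0 <= g t.
Hypothesis lam0 : 0 <= lam.
Implicit Types (U V W : @pairs R N).

Let p1 : 1 < p. Proof. exact: embedding_p_gt1 N_ge1 N_lt_p. Qed.
Let p0 : 0 < p. Proof. exact: lt_trans p1. Qed.
Let pN : 2 <= p \/ N = 1%N. Proof. exact: embedding_exponent N_ge1 N_lt_p. Qed.

Local Notation E := (energy p a).
Local Notation X := (@sobolev R N p).
Local Notation Gt := (antideriv g).
Local Notation H := (mass h).

Let X0 : X 0. Proof. exact: sobolev0 p1. Qed.
Let XP b U V : X U -> X V -> X (b *: U + V). Proof. exact: sobolevP p1 b U V. Qed.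
Let E0 U : 0 <= E U. Proof. exact: energy_ge0 p1 al0 a_ge U. Qed.
Let EZ b U : X U -> E (b *: U) = `|b| `^ p * E U.
Proof. by move=> sU; exact: energyZ ma al0 a_ge a_le b _ (sobolev_finite p1 sU). Qed.
Let Econv (s : R) U V :
  X U -> X V -> 0 <= s <= 1 -> E ((1 - s) *: U + s *: V) <= (1 - s) * E U + s * E V.
Proof.
by move=> sU sV;
  exact: energy_convex p1 ma al0 a_ge a_le _ _ _ (sobolev_finite p1 sU) (sobolev_finite p1 sV).
Qed.
Let Euconv (M e : R) : 0 < e -> exists2 d : R, 0 < d & forall U V,
  X U -> X V -> E U <= M -> E V <= M ->
    E U + E V - 2 * E (2^-1 *: (U + V)) <= d -> E (U - V) <= e.
Proof.
move=> e0; have [d d0 Hd] := energy_uconvex p1 pN ma al0 a_ge a_le M e0.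
by exists d => // U V sU sV; exact: Hd (sobolev_finite p1 sU) (sobolev_finite p1 sV).
Qed.

Lemma weighted_ae_eq (k1 k2 : 'rV[R]_N -> R) : bounded_measurable k1 -> bounded_measurable k2 ->
  {ae mu, forall x, k1 x = k2 x} -> \int[mu]_x (h x * k1 x) = \int[mu]_x (h x * k2 x).
Proof.
move=> [m1 _] [m2 _] k12; apply: ae_eq_Rintegral; [exact: measurable_funM|exact: measurable_funM|].
by apply: filterS k12 => x ->.
Qed.

(** [U] may fail to be C^1, so a C^1 approximant is modified instead. The result [w] is nonnegative
    and nearly minimizes the same tilted functional, hence is close to [U] in energy and, by the sup
    bound, uniformly. *)
Lemma critical_ge0 U (k : 'rV[R]_N -> R) : bounded_measurable k -> (forall x, 0 <= k x) ->
  minimizes X E (pairing h lam k) U -> forall x, 0 <= fct_of U x.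
Proof.
have near_arith (z1 z2 z3 z4 z5 z6 z7 t : R) : z1 <= z2 -> z2 <= z3 + t / 2 ->
  z6 - z7 <= z5 -> z5 - z7 <= z4 -> z7 <= t / 4 -> z1 - z4 <= z3 - z6 + t by move=> *; lra.
move=> bk k0 [sU minU] x; apply/ler_addgt0Pl => e e0; rewrite addrC.
have bl := pairing_bounded N_ge1 N_lt_p ma al0 a_ge a_le mh ih h0 lam0 bk.
have [_ [C lC]] := bl; have [mk [B HB]] := bk.
have B0 : 0 <= B by apply: le_trans (HB 0).
have [d1 d10 Hd1] := sobolev_sup_small N_ge1 N_lt_p ma al0 a_ge a_le e0.
have [d2 d20 Hd2] := near_minimizers_close p1 X0 XP E0 EZ Euconv C d10.
have d220 : 0 < d2 / 2 by rewrite divr_gt0.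
have [d3 d30 Hd3] := energy_continuous p1 ma al0 a_ge a_le (E U) d220.
have K0 : 0 <= lam * (B * H) by rewrite !mulr_ge0// (mass_ge0 h0).
pose del := Num.min d3 (d2 / 4 / (lam * (B * H) + 1)).
have K1 : 0 < lam * (B * H) + 1 by rewrite ltr_wpDl.
have del0 : 0 < del by rewrite lt_min d30 !divr_gt0.
have Kdel : lam * (B * del * H) <= d2 / 4.
  have -> : lam * (B * del * H) = del * (lam * (B * H)) by ring.
  apply: (@le_trans _ _ (d2 / 4 / (lam * (B * H) + 1) * (lam * (B * H)))).
    by rewrite ler_wpM2r// /del ge_min lexx orbT.
  by rewrite mulrAC ler_pdivrMr// ler_wpM2l ?lerDl// divr_ge0// ltW.
have [f [G [fG fF EF sF]]] := sobolev_approx N_ge1 N_lt_p ma al0 a_ge a_le sU del0.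
have sFF : X (mkpair f G) := sobolev_C1_pair p1 fG fF.
(* A C^1 substitute for |q|: as 0 <= z q <= |q| and |z'| <= 1 the energy does not rise, and as q -
   del <= z q the pairing with the nonnegative [k] loses at most a multiple of [del]. *)
pose z (q : R) := Num.sqrt (q * q + del ^+ 2) - del.
pose dz (q : R) := q / Num.sqrt (q * q + del ^+ 2).
have q0 q : 0 < q * q + del ^+ 2 by rewrite ltr_wpDl ?exprn_gt0// -expr2 sqr_ge0.
have s0 q : 0 < Num.sqrt (q * q + del ^+ 2) by rewrite sqrtr_gt0.
have sle q : `|q| <= Num.sqrt (q * q + del ^+ 2).
  by rewrite -sqrtr_sqr ler_sqrt// ?expr2 ?lerDl ?sqr_ge0//; exact: ltW.
have sle2 q : Num.sqrt (q * q + del ^+ 2) <= `|q| + del.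
  have h1 : 0 <= `|q| + del by rewrite addr_ge0// ltW.
  rewrite -[leRHS]ger0_norm// -sqrtr_sqr ler_sqrt ?sqr_ge0// sqrrD -normrX ger0_norm ?sqr_ge0//.
  by rewrite expr2 lerD2r lerDl mulrn_wge0// mulr_ge0// ltW.
have sle3 q : del <= Num.sqrt (q * q + del ^+ 2).
  rewrite -[leLHS]ger0_norm ?(ltW del0)// -sqrtr_sqr ler_sqrt ?(ltW (q0 _))//.
  by rewrite lerDr -expr2 sqr_ge0.
have hz q : is_derive q (1 : R) z (dz q).
  have d1' : is_derive q (1 : R) (fun t : R => t * t + del ^+ 2) (2 * q).
    have := is_deriveD (is_deriveM (is_derive_id q (1 : R)) (is_derive_id q (1 : R)))
      (is_derive_cst (del ^+ 2) q (1 : R)).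
    rewrite addr0 /GRing.scale/= mulr1; congr (is_derive _ _ _ _); ring.
  have := is_deriveB
    (@is_derive1_comp R Num.sqrt (fun t : R => t * t + del ^+ 2) q _ _
    (is_derive1_sqrt (q0 q)) d1') (is_derive_cst del q (1 : R)).
  rewrite subr0; congr (is_derive _ _ _ _); rewrite /dz; field; by rewrite gt_eqF.
have cdz : continuous dz.
  move=> q; rewrite /continuous_at; apply: cvgM; first exact: cvg_id.
  apply: cvgV; first by rewrite gt_eqF.
  apply: (@cvg_comp _ _ _ (fun t : R => t * t + del ^+ 2) Num.sqrt); last exact: sqrt_continuous.
  by apply: cvgD; [apply: cvgM; exact: cvg_id|exact: cvg_cst].
have zG := C1_pair_comp fG hz cdz.
pose w := mkpair (fun x => z (f x)) (fun x => dz (f x) *: G x).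
have [mf mG foo Goo] := fF; have [cz cdG _] := zG.
have wle y : `|fct_of w y| <= `|f y|.
  rewrite -[fct_of w y]/(z (f y)) /z ger0_norm ?subr_ge0//.
  by rewrite lerBlDr.
have dwle y : enorm (grad_of w y) <= enorm (G y).
  rewrite -[grad_of w y]/(dz (f y) *: G y) enormZ ler_piMl ?enorm_ge0//.
  by rewrite /dz normrM normfV ler_pdivrMr ?normr_gt0 ?gt_eqF// mul1r [leRHS]ger0_norm// ltW.
have mdG : measurable_fun setT (fun x => dz (f x) *: G x).
  apply: measurable_fun_rV => i; apply: continuous_measurable_rV => y.
  by apply: (@cvg_comp _ _ _ (fun x => dz (f x) *: G x) (fun t : 'rV[R]_N => t 0 i));
    [exact: cdG|exact: coord_continuous].
have fw : finite_energy p w.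
  split; [exact: continuous_measurable_rV|exact: mdG| |].
  - by apply: le_lt_trans foo; apply: (le_pint _ p0) => //; exact: continuous_measurable_rV.
  - apply: le_lt_trans Goo; apply: (le_pint _ p0).
    + by apply: measurableT_comp; [exact: measurable_enorm|exact: mdG].
    + by apply: measurableT_comp; [exact: measurable_enorm|exact: mG].
    + by move=> y; rewrite !ger0_norm ?enorm_ge0.
have sw : X w := sobolev_C1_pair p1 zG fw.
have a0 y : 0 <= a y by apply: le_trans (a_ge y); exact: ltW.
have Ew : E w <= E (mkpair f G).
  apply: (energy_le_density p1 ma al0 a_ge a_le fw
    (energy_density_integrable ma al0 a_ge a_le fF)) => y.
  rewrite /energy_density; apply: lerD.
    by apply: ge0_ler_powR; rewrite ?nnegrE ?enorm_ge0 ?(ltW p0).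
  by rewrite ler_wpM2l//; apply: ge0_ler_powR; rewrite ?nnegrE ?(ltW p0).
have EFU : E (mkpair f G) <= E U + d2 / 2.
  have : `|E U - E (mkpair f G)| <= d2 / 2.
    apply: (Hd3 _ _ (sobolev_finite p1 sU) fF (lexx _)); apply: le_trans EF _.
    by rewrite /del ge_min lexx.
  by rewrite ler_distlC => /andP[_].
have bm V : X V -> bounded_measurable (fct_of V).
  exact: sobolev_bounded_measurable N_ge1 N_lt_p ma al0 a_ge a_le V.
have low V W : X V -> X W -> (forall y, fct_of V y - del <= fct_of W y) ->
    pairing h lam k V - lam * (B * del * H) <= pairing h lam k W.
  move=> sV sW VW; rewrite /pairing -mulrBr ler_wpM2l//.
  have bc := bounded_measurable_cst (N := N) (- (B * del)).
  have bkV := bounded_measurableM bk (bm _ sV).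
  have := weighted_le mh ih h0
    (bounded_measurableD (bounded_measurableZ 1 bkV) (bounded_measurableZ 1 bc))
    (bounded_measurableM bk (bm _ sW)).
  rewrite (weighted_lin2 mh ih h0 1 1 bkV bc) weighted_cst// !mul1r mulNr; apply => y.
  rewrite !mul1r; have h1 := ler_wpM2l (k0 y) (VW y); rewrite mulrBr in h1.
  apply: le_trans h1; rewrite lerD2l lerN2 ler_wpM2r ?(ltW del0)//.
  by apply: le_trans (HB y); exact: ler_norm.
have l1 : pairing h lam k U - lam * (B * del * H) <= pairing h lam k (mkpair f G).
  apply: low => // y; rewrite lerBlDr -lerBlDl; apply: le_trans (ler_norm _) _; exact: sF.
have l2 : pairing h lam k (mkpair f G) - lam * (B * del * H) <= pairing h lam k w.
  apply: low => // y; rewrite lerB//; apply: le_trans (sle _); exact: ler_norm.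
have near : E w - pairing h lam k w <= E U - pairing h lam k U + d2.
  move: Ew EFU l1 l2 Kdel;
    move: (E w) (E (mkpair f G)) (E U) (pairing h lam k w) (pairing h lam k (mkpair f G))
    (pairing h lam k U) (lam * (B * del * H)).
  move=> z1 z2 z3 z4 z5 z6 z7; move: (d2) d20 => dd dd0; exact: near_arith.
have close : E (U - w) <= d1.
  apply: (Hd2 _ _ _ _ bl lC minU sU sw _ near); by rewrite lerDl ltW.
have sUw : X (U - w) by rewrite addrC -scaleN1r; exact: XP.
have := Hd1 _ x sUw close; rewrite fct_ofB ler_distlC => /andP[h1 h2].
have w0 : 0 <= fct_of w x by rewrite -[fct_of w x]/(z (f x)) subr_ge0.
exact: le_trans w0 h2.
Qed.

Local Notation crit := (critical X E (dPsi h g lam)).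

Let bU U : X U -> bounded_measurable (fct_of U).
Proof. exact: sobolev_bounded_measurable N_ge1 N_lt_p ma al0 a_ge a_le U. Qed.
Let bg U : X U -> bounded_measurable (fun x => g (fct_of U x)).
Proof. by move=> sU; exact: bounded_measurable_comp cg (bU sU). Qed.
Let bG U : X U -> bounded_measurable (fun x => Gt (fct_of U x)).
Proof. by move=> sU; exact: bounded_measurable_comp (continuous_antideriv cg g_const) (bU sU). Qed.

Lemma critical_sup_ge0 U : crit U -> forall x, 0 <= fct_of U x.
Proof. by move=> cU; exact: critical_ge0 (bg cU.1) (fun x => g_ge0 _) cU. Qed.

(** The gradients are not compared. Each of the two minimizes its tilted functional, whose linear
    part takes equal values at [U] and [V], so each energy is at most the other. Critical points
    with different energies or levels are therefore distinct as classes. *)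
Lemma critical_energy_eq U V : crit U -> crit V -> {ae mu, forall x, fct_of U x = fct_of V x} ->
  E U = E V /\ Psi h g lam U = Psi h g lam V.
Proof.
have half U1 V1 :
  crit U1 -> crit V1 -> {ae mu, forall x, fct_of U1 x = fct_of V1 x} -> E U1 <= E V1.
  move=> [sU minU] [sV _] UV; have := minU _ sV.
  have -> : dPsi h g lam U1 V1 = dPsi h g lam U1 U1; last by rewrite lerD2r.
  rewrite /dPsi /pairing; congr (_ * _); apply: weighted_ae_eq.
  - exact: bounded_measurableM (bg sU) (bU sV).
  - exact: bounded_measurableM (bg sU) (bU sU).
  - by apply: filterS UV => x ->.
move=> cU cV UV; split.
  have VU : {ae mu, forall x, fct_of V x = fct_of U x} by apply: filterS UV => x ->.
  by apply/eqP; rewrite eq_le; apply/andP; split;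
    [exact: (half _ _ cU cV UV)|exact: (half _ _ cV cU VU)].
rewrite /Psi; congr (_ * _); apply: weighted_ae_eq; [exact: bG cU.1|exact: bG cV.1|].
by apply: filterS UV => x ->.
Qed.

Lemma measurable_first_variation (b : 'rV[R]_N -> R) (u v : 'rV[R]_N -> R)
  (Y Z : 'rV[R]_N -> 'rV[R]_N) :
  measurable_fun setT b -> measurable_fun setT u -> measurable_fun setT v ->
  (forall i, measurable_fun setT (fun x => Y x 0 i)) ->
    (forall i, measurable_fun setT (fun x => Z x 0 i)) ->
  measurable_fun setT
    (fun x => enorm (Y x) `^ (p - 2) * dotv (Y x) (Z x) + b x * `|u x| `^ (p - 2) * u x * v x).
Proof.
move=> mb mu_ mv mY mZ.
have mYv : measurable_fun setT Y by apply: measurable_fun_rV => i; exact: mY.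
apply: measurable_funD.
  apply: measurable_funM.
    apply: (measurableT_comp (measurable_powR (p - 2))).
    by apply: measurableT_comp; [exact: measurable_enorm|exact: mYv].
  by apply: measurable_sum => i; apply: measurable_funM; [exact: mY|exact: mZ].
apply: measurable_funM => //; apply: measurable_funM => //; apply: measurable_funM => //.
by apply: (measurableT_comp (measurable_powR (p - 2))); exact: measurableT_comp.
Qed.

(** Nonnegativity of [U] makes the given and the redefined nonlinearity agree along it. A test pair
    is exchanged for its representative in [sobolev], and all replacements concern null sets
    only. *)
Lemma critical_weak_solution (a' h' : 'rV[R]_N -> R) (g' : R -> R) U :
  measurable_fun setT a' -> {ae mu, forall x, a' x = a x} ->
  measurable_fun setT h' -> {ae mu, forall x, h' x = h x} ->
  continuous g' -> (forall t, 0 <= t -> g' t = g t) ->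
  crit U -> weak_solution p a' h' g' lam (fct_of U).
Proof.
move=> ma' aa mh' hh cg' gg cU; have U0 := critical_sup_ge0 cU; have [sU minU] := cU.
have wU : W1p p (fct_of U) (grad_of U) := sU.1.
split; first exact: aeW.
exists (grad_of U) => // v Dv vW.
have [V [sV vV DvV]] := W1p_representative N_ge1 N_lt_p ma al0 a_ge a_le vW.
have coords (u : 'rV[R]_N -> R) (Y : 'rV[R]_N -> 'rV[R]_N) : W1p p u Y ->
    measurable_fun setT u /\ forall i, measurable_fun setT (fun x => Y x 0 i).
  move=> [/(Lfun_pint _ p0)[m1 _] m2 _]; split => // i.
  by have /(Lfun_pint _ p0)[] := m2 i.
have [mu_ mDu] := coords _ _ wU; have [mv mDv] := coords _ _ vW; have [mV mDV] := coords _ _ sV.1.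
have bl : bounded_linear X E (dPsi h g lam U).
  exact: pairing_bounded N_ge1 N_lt_p ma al0 a_ge a_le mh ih h0 lam0 _ (bg sU).
have EL := euler_lagrange p1 ma al0 a_ge a_le bl (conj sU minU) sV.
transitivity (\int[mu]_x first_variation p a U V x).
  apply: ae_eq_Rintegral; [exact: measurable_first_variation|exact: measurable_first_variation|].
  apply: filterS (filterI (filterI aa vV) DvV) => x [[-> ->] ->].
  by [].
rewrite EL /dPsi /pairing; congr (_ * _); apply: ae_eq_Rintegral.
- apply: measurable_funM; first exact: mh.
  by apply: measurable_funM; [have [] := bg sU|exact: mV].
- apply: measurable_funM; last exact: mv.
  apply: measurable_funM; first exact: mh'.
  by apply: (measurableT_comp _ mu_); exact: continuous_measurable_fun.
apply: filterS (filterI hh vV) => x [-> ->].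
by rewrite (gg _ (U0 x)) mulrA.
Qed.

Lemma sup_cst_gt0 : 0 < sup_cst (N := N) p al.
Proof.
have m0 : 0 < (p - 1) / (p - N%:R) by rewrite divr_gt0// subr_gt0.
have [w0 _] := @eball_volume_gt0 R N.
have N0 : 0 < N%:R :> R by rewrite ltr0n.
apply: mulr_gt0; last exact: powR_gt0.
apply: mulr_gt0; last by rewrite divr_gt0// powR_gt0.
apply: mulr_gt0; last by rewrite powR_gt0// invr_gt0.
by apply: mulr_gt0; rewrite powR_gt0// divr_gt0.
Qed.

Lemma weighted_indicator (S : set 'rV[R]_N) : measurable S ->
  \int[mu]_x (h x * \1_S x) = \int[mu]_(x in S) h x.
Proof.
move=> mS; rewrite [RHS]Rintegral_mkcond; apply: eq_Rintegral => x _.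
by rewrite patchE indicE; case: (x \in S); rewrite ?mulr1 ?mulr0.
Qed.

Lemma antideriv_mono s t : s <= t -> Gt s <= Gt t.
Proof.
move=> st; have [B _ HB] := bounded_on_segment (`|s| + `|t|) cg.
have H1 x : s <= x <= t -> 0 <= g x <= B.
  move=> /andP[sx xt]; rewrite g_ge0/=; apply: le_trans (ler_norm _) _; apply: HB.
  rewrite ler_norml; apply/andP; split.
    apply: le_trans sx; rewrite opprD lerBlDr; apply: le_trans (_ : s <= _); last by rewrite lerDl.
    by rewrite lerNl -normrN ler_norm.
  by apply: le_trans xt _; apply: le_trans (ler_norm t) _; rewrite lerDr.
have /andP[h1 _] := antideriv_bounds cg g_const st H1.
by rewrite -subr_ge0; apply: le_trans h1; rewrite mul0r.
Qed.

Theorem three_critical (x0 : 'rV[R]_N) (r c d : R) :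
  primitive g t / t `^ p @[t --> +oo] --> (0 : R) -> 0 < r -> 0 < c -> c < d ->
  lam * (Gt c * H) < c `^ p / (p * sup_cst (N := N) p al `^ p) ->
  p^-1 * (d `^ p * eball_volume N * r `^ (N%:R - p) * (2 `^ p - 2 `^ (p - N%:R) + r `^ p * A)) <
    lam * (Gt d * \int[mu]_(x in eball x0 (r / 2)) h x) ->
  exists U V W, [/\ crit U, crit V & crit W] /\
    [/\ ~ ae_eq mu setT (fct_of U) (fct_of V), ~ ae_eq mu setT (fct_of U) (fct_of W) &
        ~ ae_eq mu setT (fct_of V) (fct_of W)].
Proof.
move=> lim r0 c0 cd small large.
have d0 : 0 < d by exact: lt_trans cd.
set k := sup_cst p al in small; have kp0 : 0 < k `^ p by apply: powR_gt0; exact: sup_cst_gt0.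
pose rho := c `^ p / (p * k `^ p).
have pk0 : 0 < p * k `^ p by rewrite mulr_gt0.
have rho0 : 0 < rho by rewrite divr_gt0// powR_gt0.
pose delta := rho - lam * (Gt c * H).
have delta0 : 0 < delta by rewrite subr_gt0.
set Q := d `^ p * _ * _ * _ in large; set L := lam * (Gt d * _) in large.
(* The strict inequality [large] leaves room for the factor 1 + eps of [test_element]; half of the
   margin is spent on it. *)
have [eps eps0 Heps] : exists2 eps : R, 0 < eps & p^-1 * ((1 + eps) * Q) < L.
  have K1 : 0 < `|p^-1 * Q| + 1 by rewrite ltr_wpDl.
  have LQ : 0 < L - p^-1 * Q by rewrite subr_gt0.
  exists ((L - p^-1 * Q) / 2 / (`|p^-1 * Q| + 1)); first by rewrite !divr_gt0.
  have h1 : (L - p^-1 * Q) / 2 / (`|p^-1 * Q| + 1) * (p^-1 * Q) <= (L - p^-1 * Q) / 2.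
    rewrite mulrAC ler_pdivrMr// ler_wpM2l ?divr_ge0 ?(ltW LQ)//.
    by apply: le_trans (ler_norm _) _; rewrite lerDl.
  rewrite mulrCA mulrDl mul1r; apply: le_lt_trans (_ : p^-1 * Q + (L - p^-1 * Q) / 2 < L).
    by rewrite lerD2l.
  by rewrite -ltrBrDl ltr_pdivrMr// ltr_pMr// ltr1n.
have [V [sV V01 Vd EV]] := test_element N_ge1 N_lt_p ma al0 a_ge a_le x0 r0 (ltW d0) eps0.
have sphere U : X U -> E U = rho -> delta <= E U - Psi h g lam U.
  move=> sU EU; rewrite EU /delta lerD2l lerN2 /Psi ler_wpM2l// -weighted_cst//.
  apply: (weighted_le mh ih h0 (bG sU) (bounded_measurable_cst _)) => x; apply: antideriv_mono.
  apply: le_trans (ler_norm _) _.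
  have := sobolev_sup N_ge1 N_lt_p ma al0 a_ge a_le x sU; rewrite EU -/k.
  have -> : k `^ p * (p * rho) = c `^ p by rewrite /rho; field; rewrite !gt_eqF.
  by apply: contraTT; rewrite -!ltNge => h1; rewrite gt0_ltr_powR ?nnegrE ?(ltW c0).
(* [V] takes the value [d > c] at [x0], which the sup bound forbids when the energy is at most
   [rho]. *)
have Vrho : rho < E V.
  have Vx0 : fct_of V x0 = d by apply: Vd; rewrite subrr enorm0 divr_ge0// ltW.
  have := sobolev_sup N_ge1 N_lt_p ma al0 a_ge a_le x0 sV.
  rewrite Vx0 ger0_norm ?(ltW d0)// -/k => h1.
  rewrite ltr_pdivrMr//; apply: lt_le_trans (_ : d `^ p <= _); last first.
    by apply: le_trans h1 _; rewrite mulrA mulrC (mulrC p).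
  by rewrite gt0_ltr_powR ?nnegrE ?(ltW c0) ?(ltW d0).
have JV : E V - Psi h g lam V < delta.
  apply: lt_trans delta0; rewrite subr_lt0.
  have h1 : E V <= p^-1 * ((1 + eps) * Q) by rewrite mulrC ler_pdivlMr// mulrC.
  apply: le_lt_trans h1 _; apply: lt_le_trans Heps _.
  rewrite /L /Psi ler_wpM2l//.
  have mB := measurable_eball x0 (r / 2).
  have bi : bounded_measurable (\1_(eball x0 (r / 2)) : 'rV[R]_N -> R).
    split; first exact: measurable_indic.
    by exists 1 => x; rewrite indicE; case: (_ \in _); rewrite ?normr1 ?normr0.
  have -> : Gt d * \int[mu]_(x in eball x0 (r / 2)) h x =
      \int[mu]_x (h x * (Gt d * \1_(eball x0 (r / 2)) x + 0 * \1_(eball x0 (r / 2)) x)).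
    by rewrite (weighted_lin2 mh ih h0 (Gt d) 0 bi bi) weighted_indicator// mul0r addr0.
  have bb := bounded_measurableD (bounded_measurableZ (Gt d) bi) (bounded_measurableZ 0 bi).
  apply: (weighted_le mh ih h0 bb (bG sV)) => x; rewrite mul0r addr0 indicE.
  case: (boolP (x \in _)) => [/set_mem xB|_].
    by rewrite mulr1 Vd// ltW.
  rewrite mulr0 -(antideriv0 g); apply: antideriv_mono.
  by have /andP[] := V01 x.
have Psi0 : Psi h g lam 0 = 0.
  rewrite /Psi (_ : \int[mu]_x _ = 0) ?mulr0//.
  transitivity (\int[mu]_x (h x * 0)); last by rewrite weighted_cst// mul0r.
  by apply: eq_Rintegral => x _; rewrite fct_of0 antideriv0.
have E00 : E 0 = 0.
  have := EZ 0 X0; rewrite scale0r normr0 powR0 ?gt_eqF//.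
  by rewrite mul0r.
have [U1 [U2 [U3 [[c1 c2 c3] [l1 l2 l3 l4 l5]]]]] :=
  three_critical_points p1 X0 XP E0 EZ Econv Euconv
    (sobolev_complete N_ge1 N_lt_p ma al0 a_ge a_le)
    (fun U b V W sU sV sW => dPsi_linear lam N_ge1 N_lt_p ma al0 a_ge a_le mh ih h0 cg b sU sV sW)
    (dPsi_bounded N_ge1 N_lt_p ma al0 a_ge a_le mh ih h0 cg lam0)
    (dPsi_continuous N_ge1 N_lt_p ma al0 a_ge a_le mh ih h0 cg lam0)
    (fun M u su Eu => dPsi_compact N_ge1 N_lt_p ma al0 a_ge a_le mh ih h0 cg lam0 su Eu)
    (Psi_bounded N_ge1 N_lt_p ma al0 a_ge a_le mh ih h0 cg g_const lam0)
    (Psi_continuous N_ge1 N_lt_p ma al0 a_ge a_le mh ih h0 cg g_const lam0)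
    (Psi_first_order N_ge1 N_lt_p ma al0 a_ge a_le mh ih h0 cg g_const lam0)
    (J_coercive N_ge1 N_lt_p ma al0 a_ge a_le mh ih h0 cg g_const lam0 (g_ge0 0) lim)
    sphere X0 sV
    (eq_ind_r (fun z => z < rho) rho0 E00) Vrho
    (eq_ind_r (fun z => z - Psi h g lam 0 < delta)
      (eq_ind_r (fun z => 0 - z < delta) (eq_ind_r (fun z => z < delta) delta0 (subr0 0)) Psi0) E00)
    JV.
exists U1, U2, U3; split => //.
have ae U' V' : ae_eq mu setT (fct_of U') (fct_of V') ->
  {ae mu, forall x, fct_of U' x = fct_of V' x}.
  by apply: filterS => x; apply.
split => /ae.
- by move=> /(critical_energy_eq c1 c2)[EE _]; move: l1; rewrite EE => /(lt_trans l2); rewrite ltxx.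
- move=> /(critical_energy_eq c1 c3)[EE PP]; move: l3; rewrite EE PP => /lt_le_trans/(_ l5).
  by rewrite ltxx.
- move=> /(critical_energy_eq c2 c3)[EE PP]; move: l4; rewrite EE PP => /lt_le_trans/(_ l5).
  by rewrite ltxx.
Qed.

End critical_points.

(** * Return to the given data *)

Lemma k_sup_cst (R : realType) (N : nat) (p : R) (a : 'rV[R]_N -> R) :
  k_ p a = sup_cst (N := N) p (ess_lower a).
Proof. by rewrite /k_ /sup_cst /eball_volume invf_div. Qed.

Lemma Linfty_ae_bounds (R : realType) (N : nat) (a : 'rV[R]_N -> R) :
  a \in Lfun (lebesgue_rV N) +oo%E -> (0 < ess_inf (lebesgue_rV N) (EFin \o a))%E ->
  [/\ 0 < ess_lower a, ess_lower a <= infnorm a, measurable_fun setT a &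
      {ae lebesgue_rV N, forall x, ess_lower a <= a x <= infnorm a}].
Proof.
set mu := lebesgue_rV N => /andP[/set_mem/= ma /set_mem/= afin] apos.
have [w0 wE] := @eball_volume_gt0 R N.
have mu0 : (0 < mu setT)%E.
  apply: (@lt_le_trans _ _ (mu (eball 0 1))); first by rewrite wE lte_fin.
  by apply: le_measure; rewrite ?inE//; exact: measurable_eball.
have nE : 'N[mu]_+oo[EFin \o a]%E = ess_sup mu (abse \o (EFin \o a)) by rewrite unlock mu0.
have fi : 'N[mu]_+oo[EFin \o a]%E \is a fin_num.
  by rewrite ge0_fin_numE//; exact: Lnorm_ge0.
have up : {ae mu, forall x, a x <= infnorm a}.
  have := ess_sup_ge mu (abse \o (EFin \o a)); apply: filterS => x.
  rewrite -nE -(fineK fi) -/(infnorm a) /= lee_fin; apply: le_trans; exact: ler_norm.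
(* The whole space has positive measure, so a property true almost everywhere holds somewhere; one
   good point shows that the essential infimum is finite and at most the sup norm. *)
have ex (P : set 'rV[R]_N) : {ae mu, forall x, P x} -> exists x, P x.
  move=> aP; apply: contrapT => nP.
  have : {ae mu, forall x, False} by apply: filterS aP => x Px; apply: nP; exists x.
  move=> [S [mS S0 sub]]; have : mu setT = 0%E.
    by apply/eqP; rewrite eq_le measure_ge0 andbT -S0 le_measure ?inE// => x _; apply: sub.
  by move=> z; rewrite z ltxx in mu0.
have lo := ess_inf_le mu (EFin \o a).
have [x [xu xl]] := ex _ (filterI up lo).
have fl : ess_inf mu (EFin \o a) \is a fin_num.
  by rewrite ge0_fin_numE ?(ltW apos)//; apply: le_lt_trans xl _; exact: ltry.
have lo' : {ae mu, forall x, ess_lower a <= a x}.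
  by apply: filterS lo => y; rewrite -(fineK fl) lee_fin.
split; [by rewrite -lte_fin fineK| |exact: ma|].
- by rewrite (le_trans _ xu)// -lee_fin fineK.
- by apply: filterS (filterI lo' up) => y [-> ->].
Qed.

Lemma primitive_eq (R : realType) (g1 g2 : R -> R) (t : R) :
  (forall x, 0 <= x -> g1 x = g2 x) -> primitive g1 t = primitive g2 t.
Proof.
move=> E; apply: eq_Rintegral => x; rewrite inE/= in_itv/= => /andP[x0 _]; exact: E.
Qed.

Theorem corollary3p2 (R : realType) (N : nat) (p : R)
    (a h : 'rV[R]_N -> R) (g : R -> R) (x0 : 'rV[R]_N) (r c d : R)
    (N_ge1 : (1 <= N)%N) (N_lt_p : N%:R < p)
    (a_Linfty : a \in Lfun (lebesgue_rV N) +oo%E)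
    (a_pos : (0 < ess_inf (lebesgue_rV N) (EFin \o a))%E)
    (h_L1 : h \in Lfun (lebesgue_rV N) 1%E)
    (h_ge0 : {ae lebesgue_rV N, forall x, 0 <= h x})
    (h_neq0 : ~ {ae lebesgue_rV N, forall x, h x = 0})
    (g_cont : continuous g)
    (g_ge0 : forall t, 0 <= t -> 0 <= g t)
    (g_neq0 : exists2 t, 0 <= t & g t != 0)
    (r_gt0 : 0 < r)
    (h_ball : 0 < \int[lebesgue_rV N]_(x in eball x0 (r / 2)) h x)
    (c_gt0 : 0 < c) (c_lt_d : c < d)
    (Gc_lt_Gd : primitive g c / c `^ p <
                Ktilde p a h x0 r * (primitive g d / d `^ p))
    (G_lim : primitive g t / t `^ p @[t --> +oo] --> (0 : R))
    (lambda : R)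
    (lambda_gt : lambda1 p a h g x0 r d < lambda)
    (lambda_lt : (lambda%:E < lambda2 p a h g c)%E) :
  exists u1 u2 u3 : 'rV[R]_N -> R,
    [/\ weak_solution p a h g lambda u1,
        weak_solution p a h g lambda u2 &
        weak_solution p a h g lambda u3] /\
    [/\ ~ ae_eq (lebesgue_rV N) setT u1 u2,
        ~ ae_eq (lebesgue_rV N) setT u1 u3 &
        ~ ae_eq (lebesgue_rV N) setT u2 u3].
Proof.
pose mu := @lebesgue_rV R N.
have p0 : 0 < p by apply: le_lt_trans N_lt_p.
have [al0 alA ma ab] := Linfty_ae_bounds a_Linfty a_pos.
pose al := ess_lower a; pose A := infnorm a.
have A0 : 0 < A by exact: lt_le_trans alA.
pose a' x := Num.max al (Num.min A (a x)).
have ma' : measurable_fun setT a'.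
  by apply: measurable_maxr => //; apply: measurable_minr.
have a_ge x : al <= a' x by rewrite /a' le_max lexx.
have a_le x : a' x <= A by rewrite /a' ge_max alA ge_min lexx.
have aa : {ae mu, forall x, a x = a' x}.
  by apply: filterS ab => x /andP[h1 h2]; rewrite /a' min_r// max_r.
have /andP[/set_mem/= mh /set_mem/= hfin] := h_L1.
(* Nonnegative at every point and almost everywhere equal to [h]; its mass is the L^1 norm of [h] by
   definition. *)
pose h' x := `|h x|.
have mh' : measurable_fun setT h' by exact: measurableT_comp.
have n1 : 'N[mu]_1[EFin \o h]%E = (\int[mu]_x (h' x)%:E)%E by rewrite Lnorm1.
have ih' : mu.-integrable setT (EFin \o h').
  apply/integrableP; split; first exact/measurable_EFinP.
  have -> : (\int[mu]_x `|(EFin \o h') x| = \int[mu]_x (h' x)%:E)%E.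
    by apply: eq_integral => x _; rewrite /= /h' normr_id.
  by rewrite -n1.
have h'0 x : 0 <= h' x by exact: normr_ge0.
have hh : {ae mu, forall x, h x = h' x}.
  by apply: filterS h_ge0 => x hx; rewrite /h' ger0_norm.
have HE : norm1 h = mass h' by rewrite /norm1 n1.
pose g' t := g (Num.max t 0).
have cg' : continuous g'.
  move=> t; apply: (@cvg_comp _ _ _ (fun t => Num.max t 0) g); last exact: g_cont.
  exact: (@continuous_max R R id (fun=> 0) t (cvg_id) (@cst_continuous _ _ _ _)).
have g'E t : 0 <= t -> g t = g' t by move=> t0; rewrite /g' max_l.
have g'0 t : 0 <= g' t by rewrite /g' g_ge0// le_max lexx orbT.
have g'const t : t <= 0 -> g' t = g' 0 by move=> t0; rewrite /g' max_r// maxxx.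
have GE t : primitive g t = primitive g' t by apply: primitive_eq; exact: g'E.
have GtE t : 0 <= t -> antideriv g' t = primitive g t by move=> t0; rewrite /antideriv t0 GE.
have d0 : 0 < d by exact: lt_trans c_lt_d.
have lim' : primitive g' t / t `^ p @[t --> +oo] --> (0 : R).
  by under eq_fun do rewrite -GE.
have G0 t : 0 <= t -> 0 <= primitive g t.
  move=> t0; rewrite -GtE// -(antideriv0 g'); exact: (antideriv_mono cg' g'const g'0 t0).
pose I := \int[mu]_(x in eball x0 (r / 2)) h' x.
have IE : \int[mu]_(x in eball x0 (r / 2)) h x = I.
  rewrite /I /Rintegral; congr fine; apply: ae_eq_integral.
  - exact: measurable_eball.
  - by apply/measurable_EFinP; apply: measurable_funTS.
  - by apply/measurable_EFinP; apply: measurable_funTS.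
  - by apply: filterS hh => x -> _.
have I0 : 0 < I by rewrite -IE.
have H0 : 0 < mass h'.
  apply: lt_le_trans I0 _; have bi : bounded_measurable (\1_(eball x0 (r / 2)) : 'rV[R]_N -> R).
    split; first by apply: measurable_indic; exact: measurable_eball.
    by exists 1 => x; rewrite indicE; case: (_ \in _); rewrite ?normr1 ?normr0.
  rewrite /I -(weighted_indicator h' (measurable_eball _ _)) -[leRHS]mul1r -(weighted_cst ih').
  apply: (weighted_le mh' ih' h'0 bi (bounded_measurable_cst 1)) => x.
  by rewrite indicE; case: (_ \in _).
pose k := k_ p a.
have k0 : 0 < k by rewrite /k k_sup_cst; exact: sup_cst_gt0.
have kp0 : 0 < k `^ p by exact: powR_gt0.
pose w : R := eball_volume N; have w0 : 0 < w by exact: (eball_volume_gt0 N).1.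
have wE : Gamma (1 + N%:R / 2) / pi `^ (N%:R / 2) = w^-1 :> R by rewrite /w /eball_volume invf_div.
pose S := 2 `^ p - 2 `^ (p - N%:R) + r `^ p * A.
have S0 : 0 < S.
  rewrite ltr_wpDl ?mulr_gt0 ?powR_gt0// subr_ge0 ler_powR ?ler1n//.
  by rewrite gerBl.
pose q := r `^ (p - N%:R); have q0 : 0 < q by exact: powR_gt0.
have KE : Ktilde p a h x0 r = 1 / k `^ p * w^-1 * (q / S) * (I / mass h').
  by rewrite /Ktilde /K_ wE IE HE.
have K0 : 0 < Ktilde p a h x0 r by rewrite KE !mulr_gt0 ?divr_gt0 ?invr_gt0.
have dp0 : 0 < d `^ p by exact: powR_gt0.
(* The left side of (ii) is nonnegative, so (ii) forces G(d) > 0 and [lambda1] is a genuine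
   quotient. *)
have Gd0 : 0 < primitive g d.
  have : 0 < Ktilde p a h x0 r * (primitive g d / d `^ p).
    by apply: le_lt_trans Gc_lt_Gd; rewrite divr_ge0 ?powR_ge0// G0// ltW.
  by rewrite pmulr_rgt0// pmulr_lgt0// invr_gt0.
(* The factors k_a^p and the L^1 norm cancel against those in the definition of [Ktilde]. What
   remains is the energy bound of the profile over G(d) times the mass of [h] in the half ball, so
   that [lambda1 < lambda] becomes [large]. *)
have L1E : lambda1 p a h g x0 r d = (w * S * d `^ p) / (p * q * I * primitive g d).
  by rewrite /lambda1 -/k HE KE; field; rewrite !gt_eqF.
have lam_gt0 : 0 < lambda.
  apply: lt_trans lambda_gt; rewrite L1E.
  by apply: divr_gt0; apply: mulr_gt0 => //; apply: mulr_gt0 => //; exact: mulr_gt0.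
have large : p^-1 * (d `^ p * w * r `^ (N%:R - p) * S) < lambda * (antideriv g' d * I).
  rewrite GtE ?(ltW d0)//.
  have D0 : 0 < primitive g d * I by exact: mulr_gt0.
  rewrite -ltr_pdivrMr//; apply: le_lt_trans lambda_gt; rewrite L1E.
  have -> : r `^ (N%:R - p) = q^-1 by rewrite /q -powRN opprB.
  rewrite le_eqVlt; apply/orP; left; apply/eqP.
  by field; rewrite !gt_eqF.
have small : lambda * (antideriv g' c * mass h') < c `^ p / (p * sup_cst (N := N) p al `^ p).
  rewrite GtE ?(ltW c_gt0)// /al -k_sup_cst -/k.
  have cp0 : 0 < c `^ p by exact: powR_gt0.
  (* When G(c) = 0 the threshold is infinite and the left side of the claim is 0; otherwise the
     claim is [lambda < lambda2] rearranged. *)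
  move: lambda_lt; rewrite /lambda2; case: eqVneq => [-> _|Gc].
    by rewrite mul0r mulr0 divr_gt0// mulr_gt0.
  have Gc0 : 0 < primitive g c by rewrite lt0r Gc G0// ltW.
  rewrite lte_fin -/k HE => hl.
  have D0 : 0 < primitive g c * mass h' by exact: mulr_gt0.
  rewrite -ltr_pdivlMr//; apply: lt_le_trans hl _.
  rewrite le_eqVlt; apply/orP; left; apply/eqP.
  by field; rewrite !gt_eqF.
have [U [V [W [[cU cV cW] dist]]]] := three_critical N_ge1 N_lt_p ma' al0 a_ge a_le mh' ih'
  h'0 cg' g'const g'0 (ltW lam_gt0) lim' r_gt0 c_gt0 c_lt_d small large.
exists (fct_of U), (fct_of V), (fct_of W); split; last exact: dist.
have sol Z : critical (sobolev p) (energy p a') (dPsi h' g' lambda) Z -> weak_solution p a h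
  g lambda (fct_of Z).
  move=> cZ; exact:
    (critical_weak_solution N_ge1 N_lt_p ma' al0 a_ge a_le mh' ih' h'0 cg' g'0 (ltW lam_gt0)
    ma aa mh hh g_cont g'E cZ).
by split; exact: sol.
Qed.
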